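(* Let $m>2$, $n=2m$. The space $$\mathfrak C=\{C_{abcd}\in\otimes^4\mathfrak V:C_{abcd}=C_{[ab][cd]},\ C_{[abc]d}=0,\ C^a{}_{bad}=0\}$$ of tensors with Weyl symmetries admits a filtration $$\{0\}=:\mathfrak C^3\subset\mathfrak C^2\subset\mathfrak C^1\subset\mathfrak C^0\subset\mathfrak C^{-1}\subset\mathfrak C^{-2}:=\mathfrak C$$ of $\mathfrak p$-modules $\mathfrak C^i=\{C\in\mathfrak C:{}^{\mathfrak C}_\xi\Pi^k_{i-1}(C)=0\text{ for all }k\}$, $i=-1,0,1,2$, where $${}^{\mathfrak C}_\xi\Pi^0_{-2}(C):=\xi^{aA}\xi^{bB}\xi^{cC}\xi^{dD}C_{abcd},\qquad {}^{\mathfrak C}_\xi\Pi^0_{-1}(C):=\xi^{aA}\xi^{bB}\xi^{cdC'}C_{abcd},$$ $${}^{\mathfrak C}_\xi\Pi^1_{-1}(C):=\xi^{aA}\xi^{bB}\xi^{cC}C_{abce}+\tfrac1{n+2}\big(\xi^{aA}\xi^{bB}\xi^{cdD'}C_{abcd}\gamma_{eD'}{}^{C}-\xi^{aC}\xi^{b[A|}\xi^{cdD'}C_{abcd}\gamma_{eD'}{}^{|B]}\big),$$ $${}^{\mathfrak C}_\xi\Pi^0_0(C):=\xi^{abB'}\xi^{cdD'}C_{abcd},\qquad {}^{\mathfrak C}_\xi\Pi^1_0(C):=\xi^{abB'}\xi^{cD}C_{abcd}+\tfrac1n\xi^{abB'}\xi^{ceD'}C_{abce}\gamma_{dD'}{}^{D},$$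 $${}^{\mathfrak C}_\xi\Pi^2_0(C):=\xi^{aA}C_{a[bc]d}\xi^{dD}+\tfrac1{n-4}\xi^{aeC'}C_{aed[b}\gamma_{c]C'}{}^{[A}\xi^{dD]}-\tfrac1{2(n-2)(n-4)}\xi^{aeC'}C_{aedf}\xi^{dfF'}\gamma_{[b|C'}{}^{A}\gamma_{|c]F'}{}^{D},$$ $${}^{\mathfrak C}_\xi\Pi^3_0(C):=\xi^{aA}C_{a(bc)d}\xi^{dD}-\tfrac3{n+4}\xi^{aeC'}C_{aed(b}\gamma_{c)C'}{}^{(A}\xi^{dD)}-\tfrac3{2(n+2)(n+4)}\xi^{aeC'}C_{aedf}\xi^{dfF'}\gamma_{(b|C'}{}^{A}\gamma_{|c)F'}{}^{D},$$ $${}^{\mathfrak C}_\xi\Pi^0_1(C):=\xi^{abB'}C_{abcd},\qquad {}^{\mathfrak C}_\xi\Pi^1_1(C):=\xi^{aB}C_{abcd}+\tfrac1{n+2}\big(\xi^{aeC'}\gamma_{bC'}{}^{B}C_{aecd}-\xi^{aeC'}C_{aeb[c}\gamma_{d]C'}{}^{B}\big),$$ with the proviso that ${}^{\mathfrak C}_\xi\Pi^2_0$ does not occur when $m=3$. The associated graded $\mathfrak p$-module $\mathrm{gr}(\mathfrak C)=\bigoplus_{i=-2}^2\mathrm{gr}_i(\mathfrak C)$, $\mathrm{gr}_i(\mathfrak C):=\mathfrak C^i/\mathfrak C^{i+1}$, splits into a direct sum $$\mathrm{gr}_{\pm2}(\mathfrak C)\cong\mathfrak C^0_{\pm2},\quad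 \mathrm{gr}_{\pm1}(\mathfrak C)\cong\mathfrak C^0_{\pm1}\oplus\mathfrak C^1_{\pm1},\quad \mathrm{gr}_0(\mathfrak C)\cong\mathfrak C^0_0\oplus\mathfrak C^1_0\oplus\mathfrak C^2_0\oplus\mathfrak C^3_0$$ of irreducible $\mathfrak p$-modules isomorphic to the following $\mathfrak g_0$-modules, of the stated dimensions: - $\mathfrak C^0_{\pm2}\cong\mathfrak g_{\pm1}\circledcirc\mathfrak g_{\pm1}$, dimension $\frac1{12}m^2(m^2-1)$; - $\mathfrak C^0_{\pm1}\cong\mathfrak g_{\pm1}\circledcirc\mathfrak z_0$, dimension $\frac12m(m-1)$; - $\mathfrak C^1_{\pm1}\cong\mathfrak g_{\pm1}\circledcirc\mathfrak{sl}_0$, dimension $\frac13m^2(m^2-4)$; - $\mathfrak C^0_0\cong\mathfrak z_0\circledcirc\mathfrak z_0$, dimension $1$; - $\mathfrak C^1_0\cong\mathfrak{sl}_0\circledcirc\mathfrak z_0$, dimension $m^2-1$; - $\mathfrak C^2_0\cong\mathfrak g_1\circledcirc\mathfrak g_{-1}$, dimension $\frac14m^2(m+1)(m-3)$; - $\mathfrak C^3_0\cong\mathfrak{sl}_0\circledcirc\mathfrak{sl}_0$, dimension $\frac14m^2(m-1)(m+3)$; with the proviso that $\mathfrak C^2_0$ does not occur when $m=3$. Further, for $|i|\le1$, $$\mathfrak C_i^j=\{C\in\mathfrak C^i:{}^{\mathfrak C}_\xi\Pi_i^k(C)=0\text{ for all }k\neq j\}/\mathfrak C^{i+1}.$$ Finally,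 the $\mathfrak p$-module $\mathrm{gr}(\mathfrak C)$ can be expressed by means of the directed graph with arrows $$\mathfrak C^0_2\to\mathfrak C^1_1,\ \mathfrak C^0_1;\qquad \mathfrak C^1_1\to\mathfrak C^3_0,\ \mathfrak C^2_0,\ \mathfrak C^1_0;\qquad \mathfrak C^0_1\to\mathfrak C^2_0,\ \mathfrak C^1_0,\ \mathfrak C^0_0;$$ $$\mathfrak C^3_0\to\mathfrak C^1_{-1};\quad \mathfrak C^2_0\to\mathfrak C^1_{-1},\ \mathfrak C^0_{-1};\quad \mathfrak C^1_0\to\mathfrak C^1_{-1},\ \mathfrak C^0_{-1};\quad \mathfrak C^0_0\to\mathfrak C^0_{-1};\quad \mathfrak C^1_{-1},\ \mathfrak C^0_{-1}\to\mathfrak C^0_{-2},$$ (arrows involving $\mathfrak C_0^2$ being absent when $m=3$), where an arrow from $\mathfrak C_i^j$ to $\mathfrak C_{i-1}^k$ implies that $\breve{\mathfrak C}_i^j\subset\mathfrak g_1\cdot\breve{\mathfrak C}_{i-1}^k$ for any choice of irreducible $\mathfrak g_0$-modules $\breve{\mathfrak C}_i^j$, $\breve{\mathfrak C}_{i-1}^k$ isomorphic to $\mathfrak C_i^j$, $\mathfrak C_{i-1}^k$ respectively, or equivalently (when both maps involved are among the nine maps ${}^{\mathfrak C}_\xi\Pi^0_{-2}$, ${}^{\mathfrak C}_\xi\Pi^0_{-1}$, ${}^{\mathfrak C}_\xi\Pi^1_{-1}$, ${}^{\mathfrak C}_\xi\Pi^0_0$, ${}^{\mathfrak C}_\xi\Pi^1_0$,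 ${}^{\mathfrak C}_\xi\Pi^2_0$, ${}^{\mathfrak C}_\xi\Pi^3_0$, ${}^{\mathfrak C}_\xi\Pi^0_1$, ${}^{\mathfrak C}_\xi\Pi^1_1$) that $\ker{}^{\mathfrak C}_\xi\Pi_i^j\subset\ker{}^{\mathfrak C}_\xi\Pi_{i-1}^k$.
   Context: Let $\mathfrak V$ be a $2m$-dimensional oriented complex vector space ($m>2$) with non-degenerate symmetric bilinear form $g_{ab}$, used to raise and lower indices (and to identify $\mathfrak V\cong\mathfrak V^*$). Round/square brackets denote normalised (skew-)symmetrisation; vertical bars enclose indices excluded from it. $\mathfrak S^\pm$ are the chiral spinor spaces; elements of $\mathfrak S^+$ have primed upper indices, elements of $\mathfrak S^-$ unprimed upper indices. Clifford multiplication is given by $\gamma_{aA'}{}^B$, $\gamma_{aA}{}^{B'}$ with $\gamma_{(a|A'}{}^{C}\gamma_{|b)C}{}^{B'}=-g_{ab}\delta_{A'}^{B'}$, $\gamma_{(a|A}{}^{C'}\gamma_{|b)C'}{}^{B}=-g_{ab}\delta_A^B$; set $\gamma_{abA'}{}^{B'}:=\gamma_{[a|A'}{}^{C}\gamma_{|b]C}{}^{B'}$. Fix a pure spinor $\xi^{A'}\in\mathfrak S^+$, i.e. a non-zero spinor for which the kernel of $\xi_a{}^A:=\xi^{B'}\gamma_{aB'}{}^A:\mathfrak V\to\mathfrak S^-$ has dimension $m$ (it is then totally null), and put $\xi_{ab}{}^{A'}:=\xi^{B'}\gamma_{abB'}{}^{A'}$. Identify $\mathfrak g:=\mathfrak{so}(2m,\mathbb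 C)$ with $\wedge^2\mathfrak V^*$. $\mathfrak p:=\{\phi_{ab}\in\mathfrak g:\xi^{aA}\xi^{bB}\phi_{ab}=0\}$ is the stabiliser of the line spanned by $\xi^{A'}$. Put $\mathfrak V_{\frac12}:=\ker(\xi_a{}^A:\mathfrak V\to\mathfrak S^-)$ and choose a totally null complement $\mathfrak V_{-\frac12}$ of it in $\mathfrak V$; this induces a grading $\mathfrak g=\mathfrak g_{-1}\oplus\mathfrak g_0\oplus\mathfrak g_1$ with $\mathfrak g_{\pm1}\cong\wedge^2\mathfrak V_{\pm\frac12}$, $\mathfrak g_0\cong\mathfrak V_{-\frac12}\otimes\mathfrak V_{\frac12}\cong\mathfrak{gl}(m,\mathbb C)$, $\mathfrak p=\mathfrak g_0\oplus\mathfrak g_1$, $\mathfrak g_1$ nilpotent; $\mathfrak g_0=\mathfrak z_0\oplus\mathfrak{sl}_0$ with $\mathfrak z_0$ the one-dimensional centre and $\mathfrak{sl}_0\cong\mathfrak{sl}(m,\mathbb C)$. ''Isomorphic to the $\mathfrak g_0$-module'' means isomorphic as a $\mathfrak g_0$-module. The splitting of $\mathfrak V$ induces a splitting of $\mathfrak C$ into graded $\mathfrak g_0$-submodules, in which the $\breve{\mathfrak C}_i^j$ live; $\mathfrak g_1\cdot$ denotes the algebraic action (linear span). $\mathfrak M\circledcirc\mathfrak M'$ denotes the Cartan product, the unique irreducible component of highest dimension in $\mathfrak M\otimes\mathfrak M'$.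
   Formalization: The Cartan product is taken as the irreducible component containing the product of highest weight vectors, not the component of highest dimension, because for m > 6 the latter contradicts the stated dimension of the Cartan square of 𝔤_{±1} (and is not unique for m = 6). *)

(* Defs.v *)
From HB Require Import structures.
From mathcomp Require Import all_boot all_order all_algebra.
From mathcomp Require Import complex reals.

Set Implicit Arguments.
Unset Strict Implicit.
Unset Printing Implicit Defensive.

Import GRing.Theory.
Local Open Scope ring_scope.

(* Abstract indices are read in a fixed but arbitrary basis of V, so that V is  *)
(* 'rV_n with the Gram matrix g.  A form phi_{ab} in (x)^2 V^* is a matrix, and *)
(* a tensor C_{abcd} in (x)^4 V^* is a finite function of (a, b, c, d).         *)
Notation tensor4 K n := {ffun 'I_n * 'I_n * 'I_n * 'I_n -> K^o}.

Section Symmetrisers.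
Variables (K : fieldType) (I : Type).

Definition sym2 (f : I -> I -> K) (x y : I) : K := (f x y + f y x) / 2.

Definition skew2 (f : I -> I -> K) (x y : I) : K := (f x y - f y x) / 2.

Definition skew3 (f : I -> I -> I -> K) (x y z : I) : K :=
  (f x y z - f y x z + f y z x - f z y x + f z x y - f x z y) / 6.

End Symmetrisers.

(* A small calculus showing that the tensorial formulas below are linear.       *)
Section Linearity.
Variables (K : fieldType) (E : lmodType K).

Definition is_linform (f : E -> K) : Prop :=
  forall k x y, f (k *: x + y) = k * f x + f y.

Lemma linform_add f h :
  is_linform f -> is_linform h -> is_linform (fun x => f x + h x).
Proof. by move=> lf lh k x y; rewrite lf lh mulrDr addrACA. Qed.

Lemma linform_opp f : is_linform f -> is_linform (fun x => - f x).
Proof. by move=> lf k x y; rewrite lf opprD mulrN. Qed.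

Lemma linform_mull c f : is_linform f -> is_linform (fun x => c * f x).
Proof. by move=> lf k x y; rewrite lf mulrDr mulrCA. Qed.

Lemma linform_mulr c f : is_linform f -> is_linform (fun x => f x * c).
Proof. by move=> lf k x y; rewrite lf mulrDl mulrA. Qed.

Lemma linform_sum (I : finType) (f : I -> E -> K) :
  (forall i, is_linform (f i)) -> is_linform (fun x => \sum_i f i x).
Proof.
move=> lf k x y; rewrite mulr_sumr -big_split /=.
by apply: eq_bigr => i _; rewrite lf.
Qed.

Lemma linear_ffun (J : finType) (h : E -> J -> K^o) :
  (forall j, is_linform (h^~ j)) -> linear (fun x => [ffun j => h x j]).
Proof. by move=> lh k x y; apply/ffunP=> j; rewrite !ffunE lh. Qed.

End Linearity.

Lemma linform_coef (K : fieldType) (J : finType) (j : J) :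
  is_linform (fun C : {ffun J -> K^o} => C j).
Proof. by move=> k x y; rewrite !ffunE. Qed.

Ltac linform :=
  cbv beta delta [sym2 skew2 skew3];
  repeat first
    [ apply: linform_coef
    | match goal with
      | |- is_linform (fun x => @?a x + @?b x) =>
             apply: (@linform_add _ _ a b)
      | |- is_linform (fun x => - @?a x) => apply: (@linform_opp _ _ a)
      | |- is_linform (fun x => _ * @?a x) => apply: (@linform_mull _ _ _ a)
      | |- is_linform (fun x => @?a x * _) => apply: (@linform_mulr _ _ _ a)
      end
    | apply: linform_sum => ? ].

Ltac linear_tensor :=
  apply: linear_ffun;
  let t := fresh in move=> t;
  repeat match goal with
         | |- context [match ?u with pair _ _ => _ end] => destruct u
         end;
  simpl; linform.

Section BilinearSpan.
Variables (K : fieldType) (E F G : vectType K).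

(* The span of all f a b with a in A and b in B, for a bilinear f (compare with *)
(* prodv for the product of an algebra).                                        *)
Definition bspan (f : E -> F -> G) (A : {vspace E}) (B : {vspace F}) :
  {vspace G} := <<[seq f a b | a <- vbasis A, b <- vbasis B]>>%VS.

Lemma bspan_subP (f : E -> F -> G) (A : {vspace E}) (B : {vspace F})
    (X : {vspace G}) :
    (forall b, linear (f^~ b)) -> (forall a, linear (f a)) ->
  reflect (forall a b, a \in A -> b \in B -> f a b \in X) (bspan f A B <= X)%VS.
Proof.
move=> lfl lfr; apply: (iffP span_subvP) => [sX a b Aa Bb | sX v].
  pose fl b' : {linear E -> G} :=
    HB.pack (f^~ b') (GRing.isLinear.Build _ _ _ _ _ (lfl b')).
  pose fr a' : {linear F -> G} :=
    HB.pack (f a') (GRing.isLinear.Build _ _ _ _ _ (lfr a')).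
  rewrite (coord_vbasis Aa).
  change (fl b (\sum_(i < \dim A) coord (vbasis A) i a *: (vbasis A)`_i) \in X).
  rewrite linear_sum; apply: memv_suml => i _; rewrite linearZ; apply: memvZ.
  rewrite (coord_vbasis Bb).
  change (fr (vbasis A)`_i
    (\sum_(j < \dim B) coord (vbasis B) j b *: (vbasis B)`_j) \in X).
  rewrite linear_sum; apply: memv_suml => j _; rewrite linearZ; apply: memvZ.
  by apply: sX; apply: allpairs_f; rewrite mem_nth ?size_tuple.
by case/allpairsP=> -[a b] /= [Aa Bb ->]; apply: sX; apply: vbasis_mem.
Qed.

End BilinearSpan.

Section Tensors.
Variables (K : fieldType) (n : nat) (g : 'M[K]_n).
Implicit Types (u v : 'rV[K]_n) (phi psi : 'M[K]_n) (C : tensor4 K n).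

(* u_a v_b and u_[a v_b] *)
Definition tens_vec u v : 'M[K]_n := (u *m g)^T *m (v *m g).

Definition wedge u v : 'M[K]_n := 2^-1 *: (tens_vec u v - tens_vec v u).

(* phi_{ab} psi_{cd} *)
Definition tens_form phi psi : tensor4 K n :=
  [ffun t => let: (a, b, c, d) := t in phi a b * psi c d].

(* phi_a^b *)
Definition endo phi : 'M[K]_n := phi *m invmx g.

(* The natural action of phi in so(V) = /\^2 V^* on the second and fourth       *)
(* tensor powers of V^*.  On /\^2 V^* it is the adjoint action, so that         *)
(* lie phi psi is also the Lie bracket of so(V).                                *)
Definition lie phi psi : 'M[K]_n := endo phi *m psi + psi *m (endo phi)^T.

Definition act4 phi C : tensor4 K n :=
  [ffun t => let: (a, b, c, d) := t in
   \sum_e (endo phi a e * C (e, b, c, d) + endo phi b e * C (a, e, c, d)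
         + endo phi c e * C (a, b, e, d) + endo phi d e * C (a, b, c, e))].

Fact lie_linear phi : linear (lie phi).
Proof.
move=> k x y; rewrite /lie mulmxDr mulmxDl -scalemxAr -scalemxAl.
by rewrite scalerDr addrACA.
Qed.
HB.instance Definition _ phi :=
  GRing.isLinear.Build K 'M[K]_n 'M[K]_n _ (lie phi) (lie_linear phi).

Fact act4_linear phi : linear (act4 phi).
Proof. by linear_tensor. Qed.
HB.instance Definition _ phi :=
  GRing.isLinear.Build K (tensor4 K n) (tensor4 K n) _ (act4 phi)
    (act4_linear phi).

Definition totally_null (U : {vspace 'rV[K]_n}) : Prop :=
  forall u v, u \in U -> v \in U -> u *m g *m v^T = 0.

Definition weyl_pairs C : tensor4 K n :=
  [ffun t => let: (a, b, c, d) := t in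
   C (a, b, c, d)
   - skew2 (fun a b => skew2 (fun c d => C (a, b, c, d)) c d) a b].

Definition weyl_bianchi C : tensor4 K n :=
  [ffun t => let: (a, b, c, d) := t in
   skew3 (fun a b c => C (a, b, c, d)) a b c].

Definition weyl_trace C : {ffun 'I_n * 'I_n -> K^o} :=
  [ffun t => let: (b, d) := t in
   \sum_a \sum_e invmx g a e * C (e, b, a, d)].

Fact weyl_pairs_linear : linear weyl_pairs.
Proof. by linear_tensor. Qed.
HB.instance Definition _ :=
  GRing.isLinear.Build K (tensor4 K n) _ _ weyl_pairs weyl_pairs_linear.

Fact weyl_bianchi_linear : linear weyl_bianchi.
Proof. by linear_tensor. Qed.
HB.instance Definition _ :=
  GRing.isLinear.Build K (tensor4 K n) _ _ weyl_bianchi weyl_bianchi_linear.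

Fact weyl_trace_linear : linear weyl_trace.
Proof. by linear_tensor. Qed.
HB.instance Definition _ :=
  GRing.isLinear.Build K (tensor4 K n) _ _ weyl_trace weyl_trace_linear.

Definition weyl : {vspace tensor4 K n} :=
  (lker (linfun weyl_pairs) :&: lker (linfun weyl_bianchi)
   :&: lker (linfun weyl_trace))%VS.

(* 2 phi_(ab) *)
Definition form_sym phi : 'M[K]_n := phi + phi^T.

Fact form_sym_linear : linear form_sym.
Proof. by move=> k x y; rewrite /form_sym linearP /= scalerDr addrACA. Qed.
HB.instance Definition _ :=
  GRing.isLinear.Build K 'M[K]_n 'M[K]_n _ form_sym form_sym_linear.

(* so(V), as /\^2 V^* *)
Definition so_form : {vspace 'M[K]_n} := lker (linfun form_sym).

(* Modules over a Lie subalgebra h of so(V).  A quotient module U / W is        *)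
(* represented by the pair of the submodules W <= U of (x)^4 V^*.               *)

Definition stable (h : {vspace 'M[K]_n}) (U : {vspace tensor4 K n}) : Prop :=
  forall phi, phi \in h -> (linfun (act4 phi) @: U <= U)%VS.

Definition quo_irreducible (h : {vspace 'M[K]_n})
    (U W : {vspace tensor4 K n}) : Prop :=
  [/\ (W <= U)%VS, stable h U, stable h W, W <> U
    & forall X, stable h X -> (W <= X)%VS -> (X <= U)%VS -> X = W \/ X = U].

Definition irreducible (h : {vspace 'M[K]_n}) (U : {vspace tensor4 K n}) :
  Prop := quo_irreducible h U 0%VS.

(* U / W is isomorphic to N as an h-module: an isomorphism is the same as an    *)
(* h-equivariant surjection U -> N with kernel W.                               *)
Definition quo_isomorphic (h : {vspace 'M[K]_n})
    (U W N : {vspace tensor4 K n}) : Prop :=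
  exists f : 'End(tensor4 K n),
    [/\ (f @: U)%VS = N, (U :&: lker f)%VS = W
      & forall phi C, phi \in h -> C \in U -> f (act4 phi C) = act4 phi (f C)].

Definition subalgebra (b : {vspace 'M[K]_n}) : Prop := (bspan lie b b <= b)%VS.

Definition solvable_algebra (b : {vspace 'M[K]_n}) : Prop :=
  exists k, iter k (fun U => bspan lie U U) b = 0%VS.

Definition borel (h b : {vspace 'M[K]_n}) : Prop :=
  [/\ (b <= h)%VS, subalgebra b, solvable_algebra b
    & forall b', (b' <= h)%VS -> subalgebra b' -> solvable_algebra b' ->
      (b <= b')%VS -> b' = b].

Definition highest_weight_vector (b : {vspace 'M[K]_n}) phi : Prop :=
  phi != 0 /\ forall beta, beta \in b -> lie beta phi \in <[phi]>%VS.

(* N is the Cartan product of the irreducible h-submodules M and M' of so(V):   *)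
(* the irreducible component of M (x) M' containing the tensor product of       *)
(* highest weight vectors.  It does not depend on the Borel subalgebra b, all   *)
(* of them being conjugate.  Note that it need not be the component of highest  *)
(* dimension: for gl(m) and M = M' = /\^2 K^m the component of shape (2,1,1) is *)
(* larger than the Cartan square, of shape (2,2), as soon as m > 6.             *)
Definition cartan_product (h M M' : {vspace 'M[K]_n})
    (N : {vspace tensor4 K n}) : Prop :=
  [/\ (N <= bspan tens_form M M')%VS, irreducible h N
    & exists b phi phi',
      [/\ borel h b, phi \in M /\ highest_weight_vector b phi,
          phi' \in M' /\ highest_weight_vector b phi'
        & tens_form phi phi' \in N]].

(* The splitting V = Vp (+) Vm, with Vp = V_{1/2} and Vm = V_{-1/2}.            *)
Variables Vp Vm : {vspace 'rV[K]_n}.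

Definition g_pos : {vspace 'M[K]_n} := bspan wedge Vp Vp.
Definition g_zero : {vspace 'M[K]_n} := bspan wedge Vm Vp.
Definition g_neg : {vspace 'M[K]_n} := bspan wedge Vm Vm.

Definition z_zero : {vspace 'M[K]_n} :=
  (g_zero :&: \bigcap_(phi <- vbasis g_zero) lker (linfun (lie phi)))%VS.

(* As g_zero is isomorphic to gl(m), its ideal sl(m) is the derived algebra.    *)
Definition sl_zero : {vspace 'M[K]_n} := bspan lie g_zero g_zero.

Definition V_half (s : bool) : {vspace 'rV[K]_n} := if s then Vp else Vm.

(* The part of degree i, vectors of V_{1/2} and V_{-1/2} having degrees 1/2 and *)
(* -1/2 (and V^* being identified with V).                                      *)
Definition weyl_graded (i : int) : {vspace tensor4 K n} :=
  (weyl :&: \sum_(s : bool * bool * bool * bool |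
                let: (s1, s2, s3, s4) := s in
                (s1 + s2 + s3 + s4)%N%:Z - 2 == i)
      let: (s1, s2, s3, s4) := s in
      bspan tens_form (bspan tens_vec (V_half s1) (V_half s2))
                      (bspan tens_vec (V_half s3) (V_half s4)))%VS.

End Tensors.

(* Clifford multiplication: gp a is the matrix of gamma_{aA'}^B and gm a that   *)
(* of gamma_{aA}^{B'}; spinors are row vectors, with upper index.               *)
Definition clifford_relations (K : fieldType) (n N : nat) (g : 'M[K]_n)
    (gp gm : 'I_n -> 'M[K]_N) : Prop :=
  forall a b,
    2^-1 *: (gp a *m gm b + gp b *m gm a) = - (g a b)%:M /\
    2^-1 *: (gm a *m gp b + gm b *m gp a) = - (g a b)%:M.

Section Spinors.
Variables (K : fieldType) (n N : nat) (g : 'M[K]_n).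
Variables (gp gm : 'I_n -> 'M[K]_N) (xi : 'rV[K]_N).
Implicit Types (W : tensor4 K n) (a b c d e f : 'I_n) (A B C D : 'I_N).

(* gamma_{abA'}^{B'} *)
Definition gamma2 a b : 'M[K]_N := 2^-1 *: (gp a *m gm b - gp b *m gm a).

(* xi_a^A *)
Definition xi_low : 'M[K]_(n, N) := \matrix_(a, A) (xi *m gp a) 0 A.

(* xi^{aA} *)
Definition xi1 : 'M[K]_(n, N) := invmx g *m xi_low.

(* xi^{abA'} *)
Definition xi2 a b A : K :=
  \sum_c \sum_d invmx g a c * invmx g b d * (xi *m gamma2 c d) 0 A.

(* V_{1/2} *)
Definition ker_xi : {vspace 'rV[K]_n} := lker (linfun (mulmxr xi_low)).

Definition pure_spinor : Prop := xi != 0 /\ (\dim ker_xi).*2 = n.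

(* xi^{aA} xi^{bB} phi_{ab} *)
Definition form_on_xi (phi : 'M[K]_n) : 'M[K]_N := xi1^T *m phi *m xi1.

Fact form_on_xi_linear : linear form_on_xi.
Proof.
move=> k x y.
by rewrite /form_on_xi mulmxDr mulmxDl -scalemxAr -scalemxAl.
Qed.
HB.instance Definition _ :=
  GRing.isLinear.Build K 'M[K]_n 'M[K]_N _ form_on_xi form_on_xi_linear.

Definition p_alg : {vspace 'M[K]_n} :=
  (so_form K n :&: lker (linfun form_on_xi))%VS.

(* The maps Pi_i^j, named Pi_<i>_<j> with m for a minus sign.                   *)

Definition Pi_m2_0 W : {ffun 'I_N * 'I_N * 'I_N * 'I_N -> K^o} :=
  [ffun t => let: (A, B, C, D) := t in
   \sum_a \sum_b \sum_c \sum_d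
     xi1 a A * xi1 b B * xi1 c C * xi1 d D * W (a, b, c, d)].

Definition Pi_m1_0 W : {ffun 'I_N * 'I_N * 'I_N -> K^o} :=
  [ffun t => let: (A, B, C) := t in
   \sum_a \sum_b \sum_c \sum_d
     xi1 a A * xi1 b B * xi2 c d C * W (a, b, c, d)].

Definition Pi_m1_1 W : {ffun 'I_N * 'I_N * 'I_N * 'I_n -> K^o} :=
  [ffun t => let: (A, B, C, e) := t in
   \sum_a \sum_b \sum_c xi1 a A * xi1 b B * xi1 c C * W (a, b, c, e)
   + (n%:R + 2)^-1 *
     (\sum_a \sum_b \sum_c \sum_d \sum_D
        xi1 a A * xi1 b B * xi2 c d D * W (a, b, c, d) * gp e D C
      - skew2 (fun A B => \sum_a \sum_b \sum_c \sum_d \sum_D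
          xi1 a C * xi1 b A * xi2 c d D * W (a, b, c, d) * gp e D B) A B)].

Definition Pi_0_0 W : {ffun 'I_N * 'I_N -> K^o} :=
  [ffun t => let: (B, D) := t in
   \sum_a \sum_b \sum_c \sum_d xi2 a b B * xi2 c d D * W (a, b, c, d)].

Definition Pi_0_1 W : {ffun 'I_N * 'I_N * 'I_n -> K^o} :=
  [ffun t => let: (B, D, d) := t in
   \sum_a \sum_b \sum_c xi2 a b B * xi1 c D * W (a, b, c, d)
   + n%:R^-1 *
     \sum_a \sum_b \sum_c \sum_e \sum_C
       xi2 a b B * xi2 c e C * W (a, b, c, e) * gp d C D].

Definition Pi_0_2 W : {ffun 'I_n * 'I_n * 'I_N * 'I_N -> K^o} :=
  [ffun t => let: (b, c, A, D) := t in
   skew2 (fun b c => \sum_a \sum_d xi1 a A * W (a, b, c, d) * xi1 d D) b c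
   + (n%:R - 4)^-1 *
     skew2 (fun b c => skew2 (fun A D => \sum_a \sum_e \sum_d \sum_C
       xi2 a e C * W (a, e, d, b) * gp c C A * xi1 d D) A D) b c
   - (2 * (n%:R - 2) * (n%:R - 4))^-1 *
     skew2 (fun b c => \sum_a \sum_e \sum_d \sum_f \sum_C \sum_F
       xi2 a e C * W (a, e, d, f) * xi2 d f F * gp b C A * gp c F D) b c].

Definition Pi_0_3 W : {ffun 'I_n * 'I_n * 'I_N * 'I_N -> K^o} :=
  [ffun t => let: (b, c, A, D) := t in
   sym2 (fun b c => \sum_a \sum_d xi1 a A * W (a, b, c, d) * xi1 d D) b c
   - 3 / (n%:R + 4) *
     sym2 (fun b c => sym2 (fun A D => \sum_a \sum_e \sum_d \sum_C
       xi2 a e C * W (a, e, d, b) * gp c C A * xi1 d D) A D) b c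
   - 3 / (2 * (n%:R + 2) * (n%:R + 4)) *
     sym2 (fun b c => \sum_a \sum_e \sum_d \sum_f \sum_C \sum_F
       xi2 a e C * W (a, e, d, f) * xi2 d f F * gp b C A * gp c F D) b c].

Definition Pi_1_0 W : {ffun 'I_n * 'I_n * 'I_N -> K^o} :=
  [ffun t => let: (c, d, B) := t in
   \sum_a \sum_b xi2 a b B * W (a, b, c, d)].

Definition Pi_1_1 W : {ffun 'I_n * 'I_n * 'I_n * 'I_N -> K^o} :=
  [ffun t => let: (b, c, d, B) := t in
   \sum_a xi1 a B * W (a, b, c, d)
   + (n%:R + 2)^-1 *
     (\sum_a \sum_e \sum_C xi2 a e C * gp b C B * W (a, e, c, d)
      - skew2 (fun c d => \sum_a \sum_e \sum_C
          xi2 a e C * W (a, e, b, c) * gp d C B) c d)].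

Fact Pi_m2_0_linear : linear Pi_m2_0.
Proof. by linear_tensor. Qed.
HB.instance Definition _ :=
  GRing.isLinear.Build K (tensor4 K n) _ _ Pi_m2_0 Pi_m2_0_linear.

Fact Pi_m1_0_linear : linear Pi_m1_0.
Proof. by linear_tensor. Qed.
HB.instance Definition _ :=
  GRing.isLinear.Build K (tensor4 K n) _ _ Pi_m1_0 Pi_m1_0_linear.

Fact Pi_m1_1_linear : linear Pi_m1_1.
Proof. by linear_tensor. Qed.
HB.instance Definition _ :=
  GRing.isLinear.Build K (tensor4 K n) _ _ Pi_m1_1 Pi_m1_1_linear.

Fact Pi_0_0_linear : linear Pi_0_0.
Proof. by linear_tensor. Qed.
HB.instance Definition _ :=
  GRing.isLinear.Build K (tensor4 K n) _ _ Pi_0_0 Pi_0_0_linear.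

Fact Pi_0_1_linear : linear Pi_0_1.
Proof. by linear_tensor. Qed.
HB.instance Definition _ :=
  GRing.isLinear.Build K (tensor4 K n) _ _ Pi_0_1 Pi_0_1_linear.

Fact Pi_0_2_linear : linear Pi_0_2.
Proof. by linear_tensor. Qed.
HB.instance Definition _ :=
  GRing.isLinear.Build K (tensor4 K n) _ _ Pi_0_2 Pi_0_2_linear.

Fact Pi_0_3_linear : linear Pi_0_3.
Proof. by linear_tensor. Qed.
HB.instance Definition _ :=
  GRing.isLinear.Build K (tensor4 K n) _ _ Pi_0_3 Pi_0_3_linear.

Fact Pi_1_0_linear : linear Pi_1_0.
Proof. by linear_tensor. Qed.
HB.instance Definition _ :=
  GRing.isLinear.Build K (tensor4 K n) _ _ Pi_1_0 Pi_1_0_linear.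

Fact Pi_1_1_linear : linear Pi_1_1.
Proof. by linear_tensor. Qed.
HB.instance Definition _ :=
  GRing.isLinear.Build K (tensor4 K n) _ _ Pi_1_1 Pi_1_1_linear.

(* The kernel in the space of Weyl tensors of Pi_i^j.                           *)
Definition ker_Pi (i : int) (j : nat) : {vspace tensor4 K n} :=
  (weyl g :&:
   match i, j with
   | (-2)%Z, 0 => lker (linfun Pi_m2_0)
   | (-1)%Z, 0 => lker (linfun Pi_m1_0)
   | (-1)%Z, 1 => lker (linfun Pi_m1_1)
   | 0%Z, 0 => lker (linfun Pi_0_0)
   | 0%Z, 1 => lker (linfun Pi_0_1)
   | 0%Z, 2 => lker (linfun Pi_0_2)
   | 0%Z, 3 => lker (linfun Pi_0_3)
   | 1%Z, 0 => lker (linfun Pi_1_0)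
   | 1%Z, 1 => lker (linfun Pi_1_1)
   | _, _ => fullv
   end)%VS.

(* The values of j for which C_i^j occurs; for i <= 1 they are also those for   *)
(* which Pi_i^j occurs.  The components C_0^2 and Pi_0^2 are missing for        *)
(* m = 3, that is n = 6.                                                        *)
Definition indices (i : int) : seq nat :=
  match i with
  | (-2)%Z => [:: 0]
  | (-1)%Z => [:: 0; 1]
  | 0%Z => if n == 6 then [:: 0; 1; 3] else [:: 0; 1; 2; 3]
  | 1%Z => [:: 0; 1]
  | 2%Z => [:: 0]
  | _ => [::]
  end%N.

(* The filtration; as indices (-3) is empty, its term of index -2 is weyl g.    *)
Definition weyl_filtration (i : int) : {vspace tensor4 K n} :=
  (if (3 <= i)%R then 0
   else weyl g :&: \bigcap_(k <- indices (i - 1)) ker_Pi (i - 1) k)%VS.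

(* C_i^j is weyl_component i j / weyl_filtration (i + 1).  For i = 2 and i = -2 *)
(* the only index is j = 0, and weyl_component i 0 is weyl_filtration i.        *)
Definition weyl_component (i : int) (j : nat) : {vspace tensor4 K n} :=
  (weyl_filtration i :&: \bigcap_(k <- indices i | k != j) ker_Pi i k)%VS.

Definition quo_dim (i : int) (j : nat) : rat :=
  (\dim (weyl_component i j))%:R - (\dim (weyl_filtration (i + 1)))%:R.

Variable Vm : {vspace 'rV[K]_n}.

(* C_i^j is an irreducible p-module of dimension dim, isomorphic as a           *)
(* g_0-module to the Cartan product of M and M'.                                *)
Definition component_type (i : int) (j : nat) (M M' : {vspace 'M[K]_n})
    (dim : rat) : Prop :=
  let U := weyl_component i j in
  let W := weyl_filtration (i + 1) in
  [/\ quo_irreducible g p_alg U W,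
      exists N, cartan_product g (g_zero g ker_xi Vm) M M' N /\
                quo_isomorphic g (g_zero g ker_xi Vm) U W N
    & quo_dim i j = dim].

(* X is an irreducible g_0-submodule of degree i isomorphic to C_i^j.           *)
Definition weyl_breve (i : int) (j : nat) (X : {vspace tensor4 K n}) : Prop :=
  [/\ (X <= weyl_graded g ker_xi Vm i)%VS,
      irreducible g (g_zero g ker_xi Vm) X
    & quo_isomorphic g (g_zero g ker_xi Vm)
        (weyl_component i j) (weyl_filtration (i + 1)) X].

Definition breve_inclusion (i : int) (j k : nat) : Prop :=
  forall X Y, weyl_breve i j X -> weyl_breve (i - 1) k Y ->
    (X <= bspan (act4 g) (g_pos g ker_xi) Y)%VS.

(* arrow i j k stands for an arrow from C_i^j to C_(i-1)^k.                     *)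
Definition arrow (i : int) (j k : nat) : int * nat * nat := (i, j, k).

Definition arrows : seq (int * nat * nat) :=
  [seq a <- [:: arrow 2 0 1; arrow 2 0 0;
                arrow 1 1 3; arrow 1 1 2; arrow 1 1 1;
                arrow 1 0 2; arrow 1 0 1; arrow 1 0 0;
                arrow 0 3 1;
                arrow 0 2 1; arrow 0 2 0;
                arrow 0 1 1; arrow 0 1 0;
                arrow 0 0 0;
                arrow (-1) 1 0; arrow (-1) 0 0]
     | let: (i, j, k) := a in (j \in indices i) && (k \in indices (i - 1))].

End Spinors.

(* Main.v *)
(* In a frame of V_{1/2} and V_{-1/2} a Weyl tensor is the collection of its components of degrees -2 to 2, each
   degree splitting under gl_m into pairwise non-isomorphic simple modules. Contracting with xi, the kernel of
   Pi_i^j is the set of tensors with no component in the modules below (i,j). The action of g_1 raises the degree,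
   and an arrow is a nonzero entry of its matrix. *)

From HB Require Import structures.
From mathcomp Require Import all_boot all_order all_algebra.
From mathcomp Require Import ring lra zify boolp.
Require Import Defs.

Set Implicit Arguments.
Unset Strict Implicit.
Unset Printing Implicit Defensive.

Import Order.TTheory GRing.Theory Num.Theory.
Local Open Scope ring_scope.

(** Simplicity comes from the unitary trick: for the standard Hermitian form the adjoint of a matrix
    unit of gl_m is the transposed unit, so an invariant subspace has an invariant complement, and a
    weight vector found in every non-zero invariant subspace cannot lie in two complementary ones.
    Weights also separate the modules of one degree: each is split off by a weight that the
    remaining ones lack. Hence an invariant subspace contains a given module or projects to zero on
    it, and questions of irreducibility, inclusion and arrows reduce to one non-zero coordinate.
    Dimensions are traces of projections; within a degree they differ, and this identifies a
    submodule isomorphic to C_i^j. Spinors are used only through xi e_i = 0 and the Clifford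
    relation: the products of xi with one, two or three vectors f_i are independent up to
    skew-symmetry, so a map Pi vanishes when explicit frame components do. The case m = 3 is an
    obstacle throughout: the module of C_0^2 has no four distinct indices to live on and its
    dimension drops to 0, while the frame values of Pi_0^2 that test degrees -2 and -1 carry the
    factor m - 3. *)

Section SubspaceOfPredicate.
Variables (K : fieldType) (E : vectType K).

Definition lin_closed (P : E -> Prop) : Prop :=
  P 0 /\ forall k x y, P x -> P y -> P (k *: x + y).

(** A subspace of largest dimension inside [P] contains every vector of [P], since otherwise a line
    could be added to it. The closure hypothesis stays under the existential so that [vsof] is
    defined for every predicate and only its membership lemma asks for closure. *)
Lemma ex_subspace (P : E -> Prop) :
  exists W : {vspace E}, lin_closed P -> forall x, x \in W <-> P x.
Proof.
have [cP|] := pselect (lin_closed P); last by exists 0%VS.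
case: (cP) => P0 PD.
pose Q d := `[< exists W : {vspace E}, (forall x, x \in W -> P x) /\ \dim W = d >].
have exQ : exists d, Q d.
  exists 0%N; apply/asboolP; exists 0%VS; split; last exact: dimv0.
  by move=> x; rewrite memv0 => /eqP ->.
have Qle d : Q d -> (d <= dim E)%N.
  by move=> /asboolP [W [_ <-]]; rewrite -dimvf dimvS ?subvf.
case: (ex_maxnP exQ Qle) => d /asboolP [W [WP dW]] dmax.
exists W => _ x; split=> [|Px]; first exact: WP.
apply: contraT => xW.
have : Q (\dim (<[x]> + W)).
  apply/asboolP; exists (<[x]> + W)%VS; split=> // y.
  by case/memv_addP => _ /vlineP [k ->] [w /WP Pw ->]; apply: PD.
move=> /dmax; rewrite -dW => le_d.
have /eqP eqW : (W == <[x]> + W)%VS by rewrite eqEdim addvSr le_d.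
by case/negP: xW; rewrite eqW (subvP (addvSl _ _)) ?memv_line.
Qed.

Definition vsof (P : E -> Prop) : {vspace E} := projT1 (cid (ex_subspace P)).

Lemma vsofP (P : E -> Prop) x : lin_closed P -> x \in vsof P <-> P x.
Proof. by move=> cP; rewrite /vsof; case: cid => W /= ->. Qed.

Lemma vs0P (U : {vspace E}) : (forall x, x \in U -> x \in 0%VS) -> U = 0%VS.
Proof. by move=> h; apply/eqP; rewrite -subv0; apply/subvP. Qed.

End SubspaceOfPredicate.

(** * Invariant subspaces and the unitary trick *)

Section Invariant.
Variables (K : fieldType) (E : vectType K) (T : Type) (op : T -> E -> E).
Implicit Types X Y N : {vspace E}.

Definition invar X : Prop := forall i x, x \in X -> op i x \in X.

(** The zero space counts as simple; that the modules are non-zero is settled apart, by their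
    dimensions. *)
Definition simple N : Prop :=
  forall X, (X <= N)%VS -> invar X -> X = 0%VS \/ X = N.

Hypothesis op_lin : forall i, linear (op i).

Lemma op_linD i k x y : op i (k *: x + y) = k *: op i x + op i y.
Proof. exact: op_lin. Qed.

Lemma opD i x y : op i (x + y) = op i x + op i y.
Proof. by rewrite -[x in LHS]scale1r op_linD scale1r. Qed.

Lemma invar_cap X Y : invar X -> invar Y -> invar (X :&: Y)%VS.
Proof.
by move=> iX iY i x; rewrite !memv_cap => /andP [xX xY]; rewrite iX ?iY.
Qed.

End Invariant.

Section Hermitian.
Variables (K : numClosedFieldType) (J : finType).
Local Notation A := {ffun J -> K^o}.
Implicit Types (x y : A) (X Y N : {vspace A}).

Definition herm x y : K := \sum_j x j * (y j)^*.

Lemma herm_is_linear y : linear (fun x => herm x y : K^o).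
Proof.
move=> k u v; rewrite /herm /GRing.scale /= mulr_sumr -big_split /=.
by apply: eq_bigr => j _; rewrite !ffunE mulrDl mulrA.
Qed.

Lemma herm_eq0 x : herm x x = 0 -> x = 0.
Proof.
move=> /eqP; rewrite /herm psumr_eq0 => [/allP h|j _]; last exact: mul_conjC_ge0.
apply/ffunP => j; rewrite ffunE; apply/eqP.
by have := h j (mem_index_enum j); rewrite mul_conjC_eq0.
Qed.

Variables (T : Type) (op : T -> A -> A) (adj : T -> T).
Hypothesis op_adj : forall i x y, herm (op i x) y = herm x (op (adj i) y).

(** The orthogonal complement is invariant because the adjoint of an operator of the family belongs
    to the family. It is cut out of [N] by dim X equations, so [X] and it fill [N]. *)
Lemma complement X N : (X <= N)%VS -> invar op X -> invar op N ->
  exists Y, [/\ (Y <= N)%VS, invar op Y, (X :&: Y = 0)%VS & (X + Y = N)%VS].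
Proof.
move=> sXN iX iN.
pose F (x : A) : {ffun 'I_(\dim X) -> K^o} := [ffun i : 'I_(\dim X) => herm x (vbasis X)`_i].
have linF : linear F.
  by move=> k u v; apply/ffunP=> i; rewrite !ffunE herm_is_linear.
pose FL : {linear A -> {ffun 'I_(\dim X) -> K^o}} :=
  HB.pack F (GRing.isLinear.Build _ _ _ _ _ linF).
pose Y := (N :&: lker (linfun FL))%VS.
have hY x : x \in Y <-> x \in N /\ forall y, y \in X -> herm x y = 0.
  rewrite memv_cap memv_ker lfunE /=; split.
    move=> /andP [xN /eqP /ffunP F0]; split=> // y yX.
    rewrite (coord_vbasis yX) /herm.
    under eq_bigr => j _.
      rewrite sum_ffunE raddf_sum mulr_sumr /=; over.
    rewrite exchange_big /= big1 // => i _.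
    have := F0 i; rewrite !ffunE /herm => F0i.
    under eq_bigr => j _.
      rewrite ffunE rmorphM mulrCA /=; over.
    by rewrite -mulr_sumr F0i mulr0.
  case=> xN h; rewrite xN /=; apply/eqP/ffunP => i; rewrite !ffunE.
  by apply: h; rewrite vbasis_mem // mem_nth ?size_tuple.
have capXY : (X :&: Y = 0)%VS.
  apply: vs0P => x; rewrite memv_cap => /andP [xX].
  by move=> /hY [_ /(_ x xX)/herm_eq0 ->]; rewrite mem0v.
exists Y; split=> //; first exact: capvSl.
  move=> i x /hY [xN h]; apply/hY; split; first exact: iN.
  by move=> y yX; rewrite op_adj h // iX.
apply/eqP; rewrite eqEdim subv_add sXN capvSl /=.
rewrite dimv_disjoint_sum // -(limg_ker_dim (linfun FL) N) -/Y addnC leq_add2r.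
by apply: leq_trans (dimvS (subvf _)) _; rewrite dimvf /dim /= muln1 card_ord.
Qed.

Definition diag (d : J -> int) x : A := [ffun t => (d t)%:~R * x t].
Definition eigenpart (d : J -> int) (l : int) x : A :=
  [ffun t => (d t == l)%:R * x t].

(* Lagrange interpolation: the eigenprojections of [diag d] are polynomials in [diag d]. *)
Lemma eigenpart_mem (d : J -> int) l X :
  (forall x, x \in X -> diag d x \in X) ->
  forall x, x \in X -> eigenpart d l x \in X.
Proof.
move=> dX x xX.
pose L (s : seq int) : A :=
  [ffun t => (\prod_(u <- s) ((d t)%:~R - u%:~R)) * x t].
have LX s : L s \in X.
  elim: s => [|u s IHs].
    by have -> : L [::] = x; [apply/ffunP=> t; rewrite ffunE big_nil mul1r|].
  have -> : L (u :: s) = diag d (L s) - u%:~R *: L s.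
    apply/ffunP => t; rewrite !ffunE big_cons /=.
    by rewrite /GRing.scale /=; ring.
  by rewrite memvB ?memvZ ?dX.
pose s := [seq u <- [seq d t | t <- enum J] | u != l].
pose c : K := \prod_(u <- s) (l%:~R - u%:~R).
have cn0 : c != 0.
  rewrite prodf_seq_neq0; apply/allP => u; rewrite mem_filter => /andP [ul _].
  by rewrite /= subr_eq0 eqr_int eq_sym.
have -> : eigenpart d l x = c^-1 *: L s.
  apply/ffunP => t; rewrite !ffunE /GRing.scale /=.
  have [->|ne] := eqVneq (d t) l; first by rewrite mul1r mulrA mulVf ?mul1r.
  have /perm_to_rem P : d t \in s by rewrite mem_filter ne map_f ?mem_enum.
  suff -> : \prod_(u <- s) ((d t)%:~R - u%:~R) = 0 :> K by rewrite !mul0r mulr0.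
  by rewrite (perm_big _ P) big_cons subrr; apply: mul0r.
by apply: memvZ; apply: LX.
Qed.

(* Two invariant subspaces of [N] cannot both contain an eigenvector seen by the *)
(* coordinate [t0], and one of them does as soon as it is non-zero.              *)
Variables (N : {vspace A}) (d : J -> int) (l : int) (t0 : J).
Hypotheses (iN : invar op N)
  (dN : forall X x, invar op X -> x \in X -> diag d x \in X)
  (d0 : d t0 = l)
  (N3 : forall X, (X <= N)%VS -> invar op X ->
          (forall x, x \in X -> x t0 = 0) -> X = 0%VS)
  (N2 : forall x, x \in N -> (forall t, d t != l -> x t = 0) ->
          x t0 = 0 -> x = 0).

Lemma eigenvector_mem X : (X <= N)%VS -> invar op X -> X <> 0%VS ->
  exists x, [/\ x \in X, forall t, d t != l -> x t = 0 & x t0 = 1].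
Proof.
move=> sX iX nX; have [x [xX x0]] : exists x, x \in X /\ x t0 != 0.
  apply: contrapT => h; apply: nX; apply: N3 => // x xX.
  by apply/eqP/negP => /negP x0; apply: h; exists x.
exists ((x t0)^-1 *: eigenpart d l x); split=> [|t /negPf dt|].
- by rewrite memvZ // (eigenpart_mem _ _ xX) // => y; apply: dN.
- by rewrite !ffunE dt mul0r /GRing.scale /= mulr0.
- by rewrite !ffunE d0 eqxx mul1r /GRing.scale /= mulVf.
Qed.

Lemma simple_of_eigenvector : simple op N.
Proof.
move=> X sX iX; have [->|nX] := pselect (X = 0%VS); [by left | right].
have [Y [sY iY XY0 XYN]] := complement sX iX iN.
have [Y0|nY] := pselect (Y = 0%VS); first by rewrite -XYN Y0 addv0.
have [x [xX xd x1]] := eigenvector_mem sX iX nX.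
have [y [yY yd y1]] := eigenvector_mem sY iY nY.
have /eqP : x - y = 0.
  apply: N2 => [|t dt|]; first by rewrite memvB ?(subvP sX x) ?(subvP sY y).
    by rewrite !ffunE xd ?yd ?subrr.
  by rewrite !ffunE x1 y1 subrr.
rewrite subr_eq0 => /eqP xy.
have : x \in (X :&: Y)%VS by rewrite memv_cap xX xy yY.
rewrite XY0 memv0 => /eqP x0; move: x1; rewrite x0 ffunE => /eqP.
by rewrite eq_sym oner_eq0.
Qed.

(** The part of weight [l] of an element of [Z] comes from [N] alone, as [W] has no such weight. So
    if [Z] meets [N] in 0, the [N]-components of elements of [Z] vanish at [t0]; they form an
    invariant subspace, which is then 0. *)
Lemma peel (W : {vspace A}) Z : (forall i, linear (op i)) ->
  invar op W -> invar op Z -> (Z <= N + W)%VS -> (N :&: W = 0)%VS ->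
  (forall x, x \in W -> forall t, d t == l -> x t = 0) ->
  (Z <= W)%VS \/ (Z = N + (Z :&: W))%VS.
Proof.
move=> lop iW iZ sZ NW0 dW.
have [sNZ|] := pselect ((Z :&: N)%VS <> 0%VS); [right | move=> /contrapT ZN0; left].
  have NZ : (N <= Z)%VS.
    by case: (simple_of_eigenvector (capvSr Z N) (invar_cap iZ iN)) => // <-; exact: capvSl.
  apply/eqP; rewrite eqEsubv subv_add NZ capvSl /= andbT.
  apply/subvP => z zZ; have /memv_addP [x xN [w wW zE]] := subvP sZ _ zZ.
  rewrite zE memv_add // memv_cap wW andbT.
  by rewrite -[w](addKr x) -zE memvD ?memvN ?(subvP NZ x).
(* The projection of [Z] to [N] along [W]. *)
pose P x := x \in N /\ exists2 w, w \in W & x + w \in Z.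
have cP : lin_closed P.
  split; first by split; rewrite ?mem0v //; exists 0; rewrite ?addr0 mem0v.
  move=> k x y [xN [w wW xwZ]] [yN [u uW yuZ]]; split; first by rewrite memvD ?memvZ.
  exists (k *: w + u); first by rewrite memvD ?memvZ.
  by rewrite addrACA -scalerDr memvD ?memvZ.
have V0 : vsof P = 0%VS.
  apply: N3 => [||x /vsofP-/(_ cP) [xN [w wW xwZ]]].
  - by apply/subvP => x /vsofP-/(_ cP) [].
  - move=> i x /vsofP-/(_ cP) [xN [w wW xwZ]]; apply/vsofP => //; split; first exact: iN.
    by exists (op i w); rewrite -?(opD lop); [apply: iW | apply: iZ].
  have eZ : eigenpart d l (x + w) \in Z by apply: (eigenpart_mem _ _ xwZ) => y; apply: dN.
  have eE : eigenpart d l (x + w) = eigenpart d l x.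
    apply/ffunP => t; rewrite !ffunE; have [dt|] := boolP (d t == l); last by rewrite !mul0r.
    by rewrite (dW w) ?addr0.
  have : eigenpart d l x \in (Z :&: N)%VS.
    by rewrite memv_cap -eE eZ eE (eigenpart_mem _ _ xN) // => y; apply: dN.
  by rewrite ZN0 memv0 => /eqP/ffunP/(_ t0); rewrite !ffunE d0 eqxx mul1r.
apply/subvP => z zZ; have /memv_addP [x xN [w wW zE]] := subvP sZ _ zZ.
have : x \in vsof P by apply/vsofP => //; split=> //; exists w => //; rewrite -zE.
by rewrite V0 memv0 => /eqP x0; rewrite zE x0 add0r.
Qed.

End Hermitian.

(** * Dimension as the trace of a projection *)

Section IdempotentTrace.
Variables (K : fieldType) (J : finType).
Local Notation A := {ffun J -> K^o}.

Definition unit_arr (t : J) : A := [ffun u => (u == t)%:R].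

Lemma arr_sum_unit (x : A) : x = \sum_t x t *: unit_arr t.
Proof.
apply/ffunP => u; rewrite sum_ffunE (bigD1 u) //= big1 => [|t tu].
  by rewrite addr0 !ffunE eqxx /GRing.scale /= mulr1.
by rewrite !ffunE eq_sym (negPf tu) scaler0.
Qed.

(** The trace is rewritten in a basis of [N], where each basis vector contributes its own
    coordinate, which is 1. The equality lives in [K]; it determines the dimension because [K] has
    characteristic 0 where it is applied. *)
Lemma dim_idempotent (p : 'End(A)) (N : {vspace A}) :
  (forall x, p x \in N) -> (forall x, x \in N -> p x = x) ->
  (\dim N)%:R = \sum_t p (unit_arr t) t :> K.
Proof.
move=> pN pid.
have pE x : p x = \sum_i coord (vbasis N) i (p x) *: (vbasis N)`_i.
  exact: coord_vbasis.
under eq_bigr => t _ do rewrite pE sum_ffunE.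
rewrite exchange_big /=.
transitivity (\sum_(i < \dim N) (1 : K)); first by rewrite sumr_const card_ord.
apply: eq_bigr => i _.
transitivity (coord (vbasis N) i (p (vbasis N)`_i)).
  rewrite pid ?vbasis_mem ?mem_nth ?size_tuple //.
  by rewrite coord_free ?eqxx ?(basis_free (vbasisP N)).
rewrite [X in p X]arr_sum_unit !linear_sum /=.
by apply: eq_bigr => t _; rewrite !linearZ /= !ffunE mulrC.
Qed.

End IdempotentTrace.

(** * Four-index arrays with the action of gl_m *)

Section Arrays.
Variables (K : numClosedFieldType) (m : nat).
Local Notation I := 'I_m.
Local Notation A := (tensor4 K m).
Implicit Types (F G : A) (a b c i j k l : I) (X Y N : {vspace A}).

Definition ev F i j k l : K := F (i, j, k, l).
Definition dl i j : K := (i == j)%:R.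
Definition mkA (f : I -> I -> I -> I -> K) : A :=
  [ffun t => let: (i, j, k, l) := t in f i j k l].

Lemma ev_mkA f i j k l : ev (mkA f) i j k l = f i j k l.
Proof. by rewrite /ev ffunE. Qed.

Lemma evP F G : (forall i j k l, ev F i j k l = ev G i j k l) <-> F = G.
Proof.
split=> [h|-> //]; apply/ffunP => -[[[i j] k] l]; exact: h.
Qed.

Lemma ev_lin (x : K) F G i j k l :
  ev (x *: F + G) i j k l = x * ev F i j k l + ev G i j k l.
Proof. by rewrite /ev !ffunE. Qed.

Lemma evZ (x : K) F i j k l : ev (x *: F) i j k l = x * ev F i j k l.
Proof. by rewrite /ev !ffunE. Qed.

Lemma evD F G i j k l : ev (F + G) i j k l = ev F i j k l + ev G i j k l.
Proof. by rewrite /ev !ffunE. Qed.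

Lemma evN F i j k l : ev (- F) i j k l = - ev F i j k l.
Proof. by rewrite /ev !ffunE. Qed.

Lemma ev0 i j k l : ev 0 i j k l = 0.
Proof. by rewrite /ev !ffunE. Qed.

Lemma dlii i : dl i i = 1.
Proof. by rewrite /dl eqxx. Qed.

Lemma dln i j : i != j -> dl i j = 0.
Proof. by rewrite /dl => /negPf ->. Qed.

Lemma dlC i j : dl i j = dl j i.
Proof. by rewrite /dl eq_sym. Qed.

Lemma sum_dl i (f : I -> K) : \sum_j dl i j * f j = f i.
Proof.
rewrite (bigD1 i) //= dlii mul1r big1 ?addr0 // => j ji.
by rewrite dln ?mul0r // eq_sym.
Qed.

Lemma sum_dlr i (f : I -> K) : \sum_j f j * dl i j = f i.
Proof. by rewrite -[RHS](sum_dl i); apply: eq_bigr => j _; rewrite mulrC. Qed.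

Lemma sum_dlC i (f : I -> K) : \sum_j dl j i * f j = f i.
Proof. by under eq_bigr => j _ do rewrite dlC; rewrite sum_dl. Qed.

Lemma sum_dlCr i (f : I -> K) : \sum_j f j * dl j i = f i.
Proof. by under eq_bigr => j _ do rewrite dlC; rewrite sum_dlr. Qed.

Lemma sum_const (x : K) : \sum_(j < m) x = m%:R * x.
Proof. by rewrite sumr_const card_ord mulr_natl. Qed.

(* The matrix unit mapping e_a to e_b, acting on one covariant ([up]) or         *)
(* contravariant index.                                                          *)
Definition slot (up : bool) a b (f : I -> K) i : K :=
  if up then dl i a * f b else - (dl b i * f a).

(** The first two indices always have the same type, [u3] and [u4] choose the type of the others:
    (true, true), (true, false) and (false, false) occur for degrees of absolute value 2, 1 and
    0. *)
Definition op (u3 u4 : bool) (ab : I * I) F : A :=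
  mkA (fun i j k l =>
    slot true ab.1 ab.2 (fun i => ev F i j k l) i
    + slot true ab.1 ab.2 (fun j => ev F i j k l) j
    + slot u3 ab.1 ab.2 (fun k => ev F i j k l) k
    + slot u4 ab.1 ab.2 (fun l => ev F i j k l) l).

Lemma op_linear u3 u4 ab : linear (op u3 u4 ab).
Proof.
move=> x F G; apply/evP => i j k l.
by rewrite ev_lin !ev_mkA /slot; case: u3; case: u4; rewrite !ev_lin; ring.
Qed.

Lemma sum4 (f : I * I * I * I -> K) :
  \sum_t f t = \sum_i \sum_j \sum_k \sum_l f (i, j, k, l).
Proof. by rewrite !pair_bigA; apply: eq_bigr => -[[[i j] k] l] _. Qed.

Lemma slot_adj up a b (f h : I -> K) :
  \sum_i slot up a b f i * (h i)^* = \sum_i f i * (slot up b a h i)^*.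
Proof.
rewrite /slot; case: up.
  transitivity (\sum_i dl i a * (f b * (h i)^*)); first by apply: eq_bigr => i _; ring.
  rewrite sum_dlC -[LHS](sum_dlC b (fun i => f i * (h a)^*)).
  apply: eq_bigr => i _; rewrite rmorphM /= /dl conjC_nat; ring.
transitivity (\sum_i dl b i * (- f a * (h i)^*)); first by apply: eq_bigr => i _; ring.
rewrite sum_dl -[LHS](sum_dl a (fun i => - f i * (h b)^*)).
by apply: eq_bigr => i _; rewrite rmorphN rmorphM /= /dl conjC_nat; ring.
Qed.

Definition flip (ab : I * I) := (ab.2, ab.1).

(** A matrix unit is real, so its adjoint is its transpose, in covariant and in contravariant slots
    alike; the four slots are treated independently after moving the relevant sum innermost. *)
Lemma op_adj u3 u4 ab F G :
  herm (op u3 u4 ab F) G = herm F (op u3 u4 (flip ab) G).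
Proof.
have E (B : A) (h : I -> I -> I -> I -> K) :
    \sum_t mkA h t * (B t)^* = \sum_i \sum_j \sum_k \sum_l h i j k l * (ev B i j k l)^*.
  by rewrite sum4; do 4!apply: eq_bigr => ? _; rewrite ffunE.
have E' (B : A) (h : I -> I -> I -> I -> K) :
    \sum_t B t * (mkA h t)^* = \sum_i \sum_j \sum_k \sum_l ev B i j k l * (h i j k l)^*.
  by rewrite sum4; do 4!apply: eq_bigr => ? _; rewrite ffunE.
rewrite /herm E E' /=.
pose S (f : I -> I -> I -> I -> K) := \sum_i \sum_j \sum_k \sum_l f i j k l.
have SD f g : S (fun i j k l => f i j k l + g i j k l) = S f + S g.
  rewrite /S -big_split; apply: eq_bigr => i _; rewrite -big_split.
  apply: eq_bigr => j _; rewrite -big_split.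
  by apply: eq_bigr => k _; rewrite -big_split.
have Seq f g : (forall i j k l, f i j k l = g i j k l) -> S f = S g.
  by move=> h; do 4!apply: eq_bigr => ? _.
have S1 f : S f = \sum_j \sum_k \sum_l \sum_i f i j k l.
  rewrite /S exchange_big; apply: eq_bigr => j _; rewrite exchange_big.
  by apply: eq_bigr => k _; rewrite exchange_big.
have S2 f : S f = \sum_i \sum_k \sum_l \sum_j f i j k l.
  by apply: eq_bigr => i _; rewrite exchange_big; apply: eq_bigr => k _; rewrite exchange_big.
have S3 f : S f = \sum_i \sum_j \sum_l \sum_k f i j k l.
  by do 2!apply: eq_bigr => ? _; rewrite exchange_big.
rewrite -/(S _) -[RHS]/(S _).
under Seq => i j k l do rewrite !mulrDl.
under [RHS]Seq => i j k l do rewrite !rmorphD !mulrDr.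
rewrite !SD; congr (_ + _ + _ + _).
- rewrite !S1; apply: eq_bigr => j _; apply: eq_bigr => k _; apply: eq_bigr => l _.
  exact: (slot_adj true _ _ (fun i => ev F i j k l) (fun i => ev G i j k l)).
- rewrite !S2; apply: eq_bigr => i _; apply: eq_bigr => k _; apply: eq_bigr => l _.
  exact: (slot_adj true _ _ (fun j => ev F i j k l) (fun j => ev G i j k l)).
- rewrite !S3; apply: eq_bigr => i _; apply: eq_bigr => j _; apply: eq_bigr => l _.
  exact: (slot_adj u3 _ _ (fun k => ev F i j k l) (fun k => ev G i j k l)).
- apply: eq_bigr => i _; apply: eq_bigr => j _; apply: eq_bigr => k _.
  exact: (slot_adj u4 _ _ (fun l => ev F i j k l) (fun l => ev G i j k l)).
Qed.

Definition wt (u3 u4 : bool) (d : I -> int) (t : I * I * I * I) : int :=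
  let: (i, j, k, l) := t in
  d i + d j + (if u3 then d k else - d k) + (if u4 then d l else - d l).

(** The weight operator is the combination of the diagonal matrix units with coefficients [d c]. *)
Lemma diag_wt_mem u3 u4 d X F : invar (op u3 u4) X -> F \in X ->
  diag (wt u3 u4 d) F \in X.
Proof.
move=> iX FX.
have -> : diag (wt u3 u4 d) F = \sum_c (d c)%:~R *: op u3 u4 (c, c) F.
  clear iX FX.
  apply/evP => i j k l; rewrite /ev ffunE sum_ffunE.
  transitivity (\sum_c (dl i c * ((d c)%:~R * ev F c j k l)
     + dl j c * ((d c)%:~R * ev F i c k l)
     + dl c k * ((if u3 then (d c)%:~R else - (d c)%:~R) * ev F i j c l)
     + dl c l * ((if u4 then (d c)%:~R else - (d c)%:~R) * ev F i j k c)) : K).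
    rewrite !big_split !sum_dl !sum_dlC /=.
    by case: u3; case: u4; rewrite /wt !rmorphD ?rmorphN /= -!/(ev F i j k l); ring.
  apply: eq_bigr => c _; rewrite !ffunE /= /slot /GRing.scale /=.
  by case: u3; case: u4; rewrite ?(dlC k c) ?(dlC l c); ring.
by apply: memv_suml => c _; apply: memvZ; apply: iX.
Qed.

Lemma invar_vsof u3 u4 (P : A -> Prop) : lin_closed P ->
  (forall ab F, P F -> P (op u3 u4 ab F)) -> invar (op u3 u4) (vsof P).
Proof. by move=> cP h ab F /vsofP-/(_ cP) /h Ph; apply/vsofP. Qed.

End Arrays.

(** * The gl_m-modules occurring in each degree *)

Section Modules.
Variables (K : numClosedFieldType) (m : nat).
Local Notation I := 'I_m.
Local Notation A := (tensor4 K m).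
Local Notation M := (m%:R : K).
Implicit Types (F G : A) (a b c i j k l : I) (X Y N : {vspace A}).

Definition sk12 F := forall i j k l, ev F j i k l = - ev F i j k l.
Definition sk34 F := forall i j k l, ev F i j l k = - ev F i j k l.
Definition sy12 F := forall i j k l, ev F j i k l = ev F i j k l.
Definition sy34 F := forall i j k l, ev F i j l k = ev F i j k l.
Definition bianchi F :=
  forall i j k l, ev F i j k l + ev F j k i l + ev F k i j l = 0.

Definition z1 F i j : K := \sum_k ev F i j k k.
Definition t1 F i j : K := \sum_k ev F k i j k.
Definition z0 F j l : K := \sum_i ev F i j i l.
Definition zz F : K := \sum_j z0 F j j.

(** The copy of the skew forms in degree 1: for skew [T] this is, up to a factor, the only
    combination of [T] with one delta that is skew in the first pair and satisfies the Bianchi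
    identity. *)
Definition iota1 (T : I -> I -> K) : A :=
  mkA (fun i j k l => 2 * T i j * dl K k l + T i k * dl K j l - T j k * dl K i l).

(** The trace condition of [riem0] forces the parts symmetric and skew in the last two indices to
    carry 3/4 and 1/4 of the trace [z0]. The constants [cS] and [cL] give [iotaS] and [iotaL]
    exactly these traces; the terms with [t] compensate for the trace of [z]. *)
Definition cS : K := 3 / (4 * (M + 2)).
Definition cL : K := (4 * (M - 2))^-1.
Definition iotaS (z : I -> I -> K) (t : K) i j k l : K :=
  cS * (z j l * dl K i k + z j k * dl K i l + z i l * dl K j k + z i k * dl K j l
        - (M + 1)^-1 * t * (dl K i k * dl K j l + dl K i l * dl K j k)).
Definition iotaL (z : I -> I -> K) (t : K) i j k l : K :=
  cL * (z i k * dl K j l - z i l * dl K j k + z j l * dl K i k - z j k * dl K i l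
        - (M - 1)^-1 * t * (dl K i k * dl K j l - dl K i l * dl K j k)).

Definition symB F i j k l : K := (ev F i j k l + ev F i j l k) / 2.
Definition altB F i j k l : K := (ev F i j k l - ev F i j l k) / 2.

(** Algebraic curvature tensors, the Schur functor of shape (2,2). *)
Definition curv F := [/\ sk12 F, sk34 F & bianchi F].
(** Here [F i j k l] stands for the component of a Weyl tensor on e_i, e_j, e_k, f_l; the last
    condition is the vanishing of its metric trace on two vectors of V_{1/2}. *)
Definition hookish F :=
  [/\ sk12 F, bianchi F & forall i j, t1 F i j + t1 F j i = 0].
Definition hook F := hookish F /\ forall i j, z1 F i j = 0.
Definition lam F := hookish F /\
  forall i j k l, ev F i j k l = (2 * (M + 1))^-1 * ev (iota1 (z1 F)) i j k l.
(** Here [F i j k l] stands for the component on e_i, f_k, e_j, f_l. The first condition is the pair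
    symmetry, the second the vanishing of the metric trace once the Bianchi identity has eliminated
    the components on e, e, f, f. *)
Definition riem0 F := (forall i j k l, ev F j i l k = ev F i j k l) /\
  forall j l, z0 F j l = 2 * \sum_k ev F j k k l.
(** Absence of a [sym0]-component: the symmetric part is the one that the trace dictates. [hasL] and
    [hasZ] play the same role for [alt0] and [sl0]. *)
Definition hasS F := forall i j k l, symB F i j k l = iotaS (z0 F) (zz F) i j k l.
Definition hasL F := forall i j k l, altB F i j k l = iotaL (z0 F) (zz F) i j k l.
Definition hasZ F := forall j l, z0 F j l = M^-1 * zz F * dl K j l.
Definition sym0 F := riem0 F /\ (sy34 F /\ forall i j, z0 F i j = 0).
Definition alt0 F := riem0 F /\ (sk34 F /\ forall i j, z0 F i j = 0).
Definition sl0 F := riem0 F /\ [/\ hasS F, hasL F & zz F = 0].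
Definition triv0 F := riem0 F /\ [/\ hasS F, hasL F & hasZ F].

Lemma sum_lin (x : K) (f g : I -> K) :
  \sum_i (x * f i + g i) = x * (\sum_i f i) + \sum_i g i.
Proof. by rewrite big_split mulr_sumr. Qed.

Lemma z1_lin x F G i j : z1 (x *: F + G) i j = x * z1 F i j + z1 G i j.
Proof. by rewrite /z1 -sum_lin; apply: eq_bigr => k _; rewrite ev_lin. Qed.

Lemma t1_lin x F G i j : t1 (x *: F + G) i j = x * t1 F i j + t1 G i j.
Proof. by rewrite /t1 -sum_lin; apply: eq_bigr => k _; rewrite ev_lin. Qed.

Lemma z0_lin x F G i j : z0 (x *: F + G) i j = x * z0 F i j + z0 G i j.
Proof. by rewrite /z0 -sum_lin; apply: eq_bigr => k _; rewrite ev_lin. Qed.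

Lemma zz_lin x F G : zz (x *: F + G) = x * zz F + zz G.
Proof. by rewrite /zz -sum_lin; apply: eq_bigr => k _; rewrite z0_lin. Qed.

Lemma z1_0 i j : z1 0 i j = 0.
Proof. by rewrite /z1 big1 // => k _; rewrite ev0. Qed.
Lemma t1_0 i j : t1 0 i j = 0.
Proof. by rewrite /t1 big1 // => k _; rewrite ev0. Qed.
Lemma z0_0 i j : z0 0 i j = 0.
Proof. by rewrite /z0 big1 // => k _; rewrite ev0. Qed.
Lemma zz_0 : zz 0 = 0.
Proof. by rewrite /zz big1 // => k _; rewrite z0_0. Qed.

Definition array_lin := (ev_lin, z1_lin, t1_lin, z0_lin, zz_lin).
Definition array_0 := (ev0, z1_0, t1_0, z0_0, zz_0).

Lemma lin_closedI (P Q : A -> Prop) : lin_closed P -> lin_closed Q ->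
  lin_closed (fun F => P F /\ Q F).
Proof.
move=> [P0 PD] [Q0 QD]; split=> // x F G [PF QF] [PG QG].
by split; [apply: PD | apply: QD].
Qed.

Lemma lin_closedI3 (P Q R : A -> Prop) : lin_closed P -> lin_closed Q ->
  lin_closed R -> lin_closed (fun F => [/\ P F, Q F & R F]).
Proof.
move=> [P0 PD] [Q0 QD] [R0 RD]; split=> // x F G [PF QF RF] [PG QG RG].
by split; [apply: PD | apply: QD | apply: RD].
Qed.

Lemma sk12_lin : lin_closed sk12.
Proof. by split=> [|x F G f g] i j k l; rewrite ?array_0 ?oppr0 // !ev_lin f g; ring. Qed.
Lemma sk34_lin : lin_closed sk34.
Proof. by split=> [|x F G f g] i j k l; rewrite ?array_0 ?oppr0 // !ev_lin f g; ring. Qed.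
Lemma sy12_lin : lin_closed sy12.
Proof. by split=> [|x F G f g] i j k l; rewrite ?array_0 // !ev_lin f g; ring. Qed.
Lemma sy34_lin : lin_closed sy34.
Proof. by split=> [|x F G f g] i j k l; rewrite ?array_0 // !ev_lin f g; ring. Qed.
Lemma bianchi_lin : lin_closed bianchi.
Proof.
split=> [|x F G f g] i j k l; rewrite ?array_0 ?addr0 //.
rewrite !ev_lin; transitivity (x * (ev F i j k l + ev F j k i l + ev F k i j l)
  + (ev G i j k l + ev G j k i l + ev G k i j l)); first by ring.
by rewrite f g mulr0 addr0.
Qed.

Lemma curv_lin : lin_closed curv.
Proof. exact: lin_closedI3 sk12_lin sk34_lin bianchi_lin. Qed.

Lemma hookish_lin : lin_closed hookish.
Proof.
apply: lin_closedI3 sk12_lin bianchi_lin _.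
split=> [|x F G f g] i j; rewrite ?array_0 ?addr0 // !t1_lin.
transitivity (x * (t1 F i j + t1 F j i) + (t1 G i j + t1 G j i)); first by ring.
by rewrite f g mulr0 addr0.
Qed.

Lemma z1_closed : lin_closed (fun F => forall i j, z1 F i j = 0).
Proof. by split=> [|x F G f g] i j; rewrite array_0 // || rewrite z1_lin f g mulr0 addr0. Qed.

Lemma z0_closed : lin_closed (fun F => forall i j, z0 F i j = 0).
Proof. by split=> [|x F G f g] i j; rewrite array_0 // || rewrite z0_lin f g mulr0 addr0. Qed.

Lemma zz_closed : lin_closed (fun F => zz F = 0).
Proof. by split=> [|x F G f g]; rewrite array_0 // || rewrite zz_lin f g mulr0 addr0. Qed.

Lemma hook_lin : lin_closed hook.
Proof. exact: lin_closedI hookish_lin z1_closed. Qed.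

Lemma lam_lin : lin_closed lam.
Proof.
apply: lin_closedI hookish_lin _; split=> [|x F G f g] i j k l.
  by rewrite ev_mkA !array_0; ring.
by rewrite ev_lin f g !ev_mkA !z1_lin; ring.
Qed.

Lemma riem0_lin : lin_closed riem0.
Proof.
apply: lin_closedI; first by split=> [|x F G f g] i j k l; rewrite ?array_0 // !ev_lin f g; ring.
split=> [|x F G f g] i j.
  by rewrite array_0 big1 ?mulr0 // => k _; rewrite ev0.
by rewrite z0_lin f g; under [in RHS]eq_bigr => k _ do rewrite ev_lin; rewrite sum_lin; ring.
Qed.

Lemma hasS_lin : lin_closed hasS.
Proof.
split=> [|x F G f g] i j k l; rewrite /symB /iotaS ?array_0; first by ring.
rewrite !ev_lin; transitivity (x * symB F i j k l + symB G i j k l).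
  by rewrite /symB; ring.
by rewrite f g /iotaS !array_lin; ring.
Qed.

Lemma hasL_lin : lin_closed hasL.
Proof.
split=> [|x F G f g] i j k l; rewrite /altB /iotaL ?array_0; first by ring.
rewrite !ev_lin; transitivity (x * altB F i j k l + altB G i j k l).
  by rewrite /altB; ring.
by rewrite f g /iotaL !array_lin; ring.
Qed.

Lemma hasZ_lin : lin_closed hasZ.
Proof.
split=> [|x F G f g] j l; first by rewrite !array_0; ring.
by rewrite z0_lin zz_lin f g; ring.
Qed.

Lemma sym0_lin : lin_closed sym0.
Proof. exact: lin_closedI riem0_lin (lin_closedI sy34_lin z0_closed). Qed.
Lemma alt0_lin : lin_closed alt0.
Proof. exact: lin_closedI riem0_lin (lin_closedI sk34_lin z0_closed). Qed.
Lemma sl0_lin : lin_closed sl0.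
Proof. exact: lin_closedI riem0_lin (lin_closedI3 hasS_lin hasL_lin zz_closed). Qed.
Lemma triv0_lin : lin_closed triv0.
Proof. exact: lin_closedI riem0_lin (lin_closedI3 hasS_lin hasL_lin hasZ_lin). Qed.

Lemma opE u3 u4 a b F i j k l : ev (op u3 u4 (a, b) F) i j k l =
  dl K i a * ev F b j k l + dl K j a * ev F i b k l
  + (if u3 then dl K k a * ev F i j b l else - (dl K b k * ev F i j a l))
  + (if u4 then dl K l a * ev F i j k b else - (dl K b l * ev F i j k a)).
Proof. by rewrite ev_mkA /slot; case: u3; case: u4. Qed.

Lemma sk12_op u3 u4 ab F : sk12 F -> sk12 (op u3 u4 ab F).
Proof.
case: ab => a b h i j k l; rewrite !opE.
rewrite (h i b) (h b j); case: u3; case: u4;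
 by rewrite ?(h i j b l) ?(h i j a l) ?(h i j k b) ?(h i j k a); ring.
Qed.

Lemma sk34_op u ab F : sk34 F -> sk34 (op u u ab F).
Proof.
case: ab => a b h i j k l; rewrite !opE (h b j k l) (h i b k l).
case: u; first by rewrite (h i j k b) (h i j b l); ring.
by rewrite (h i j k a) (h i j a l); ring.
Qed.

Lemma sy34_op u ab F : sy34 F -> sy34 (op u u ab F).
Proof.
case: ab => a b h i j k l; rewrite !opE (h b j k l) (h i b k l).
case: u; first by rewrite (h i j k b) (h i j b l); ring.
by rewrite (h i j k a) (h i j a l); ring.
Qed.

Lemma bianchi_op u ab F : bianchi F -> bianchi (op true u ab F).
Proof.
case: ab => a b h i j k l; rewrite !opE.
transitivity (dl K i a * (ev F b j k l + ev F j k b l + ev F k b j l)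
  + dl K j a * (ev F i b k l + ev F b k i l + ev F k i b l)
  + dl K k a * (ev F i j b l + ev F j b i l + ev F b i j l)
  + (if u then dl K l a * (ev F i j k b + ev F j k i b + ev F k i j b)
     else - (dl K b l * (ev F i j k a + ev F j k i a + ev F k i j a)))).
  by case: u; ring.
by rewrite !h; case: u; rewrite !mulr0 ?oppr0 !addr0.
Qed.

Lemma curv_op ab F : curv F -> curv (op true true ab F).
Proof. by case=> ? ? ?; split; [apply: sk12_op | apply: sk34_op | apply: bianchi_op]. Qed.

Lemma z1_op a b F i j :
  z1 (op true false (a, b) F) i j = dl K i a * z1 F b j + dl K j a * z1 F i b.
Proof.
rewrite /z1; under eq_bigr => k _ do rewrite opE.
rewrite !big_split /= sumrN sum_dlC sum_dl -!mulr_sumr; ring.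
Qed.

Lemma t1_op a b F i j :
  t1 (op true false (a, b) F) i j = dl K i a * t1 F b j + dl K j a * t1 F i b.
Proof.
rewrite /t1; under eq_bigr => k _ do rewrite opE.
rewrite !big_split /= sumrN sum_dlC sum_dl -!mulr_sumr; ring.
Qed.

Lemma z0_op a b F j l :
  z0 (op false false (a, b) F) j l = dl K j a * z0 F b l - dl K b l * z0 F j a.
Proof.
rewrite /z0; under eq_bigr => k _ do rewrite opE.
rewrite !big_split /= !sumrN sum_dlC sum_dl -!mulr_sumr; ring.
Qed.

Lemma zz_op ab F : zz (op false false ab F) = 0.
Proof.
case: ab => a b; rewrite /zz; under eq_bigr => k _ do rewrite z0_op.
by rewrite big_split /= sumrN sum_dlC sum_dl subrr.
Qed.

Lemma hookish_op ab F : hookish F -> hookish (op true false ab F).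
Proof.
case: ab => a b [h1 h2 h3]; split; [exact: sk12_op | exact: bianchi_op |].
move=> i j; rewrite !t1_op.
transitivity (dl K i a * (t1 F b j + t1 F j b) + dl K j a * (t1 F i b + t1 F b i)).
  by ring.
by rewrite !h3 !mulr0 addr0.
Qed.

Lemma hook_op ab F : hook F -> hook (op true false ab F).
Proof.
case=> hF h; split; first exact: hookish_op.
by case: ab => a b i j; rewrite z1_op !h !mulr0 addr0.
Qed.

Lemma lam_op ab F : lam F -> lam (op true false ab F).
Proof.
case=> hF h; split; first exact: hookish_op.
case: ab => a b i j k l; rewrite opE /= !h !ev_mkA !z1_op; ring.
Qed.

Lemma riem0_op ab F : riem0 F -> riem0 (op false false ab F).
Proof.
case: ab => a b [h1 h2]; split=> [i j k l|j l].
  by rewrite !opE (h1 b j) (h1 i b) (h1 i j k a) (h1 i j a l); ring.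
rewrite z0_op !h2; under [in RHS]eq_bigr => k _ do rewrite opE.
by rewrite !big_split /= !sumrN sum_dlC sum_dl -!mulr_sumr; ring.
Qed.

Lemma symB_op a b F i j k l : symB (op false false (a, b) F) i j k l =
  dl K i a * symB F b j k l + dl K j a * symB F i b k l
  - dl K b k * symB F i j a l - dl K b l * symB F i j k a.
Proof. by rewrite /symB !opE; ring. Qed.

Lemma altB_op a b F i j k l : altB (op false false (a, b) F) i j k l =
  dl K i a * altB F b j k l + dl K j a * altB F i b k l
  - dl K b k * altB F i j a l - dl K b l * altB F i j k a.
Proof. by rewrite /altB !opE; ring. Qed.

Lemma hasS_op ab F : hasS F -> hasS (op false false ab F).
Proof.
by case: ab => a b h i j k l; rewrite symB_op !h /iotaS zz_op !z0_op; ring.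
Qed.

Lemma hasL_op ab F : hasL F -> hasL (op false false ab F).
Proof.
by case: ab => a b h i j k l; rewrite altB_op !h /iotaL zz_op !z0_op; ring.
Qed.

Lemma hasZ_op ab F : hasZ F -> hasZ (op false false ab F).
Proof. by case: ab => a b h j l; rewrite z0_op zz_op !h; ring. Qed.

Lemma z00_op ab F : (forall i j, z0 F i j = 0) ->
  forall i j, z0 (op false false ab F) i j = 0.
Proof. by case: ab => a b h i j; rewrite z0_op !h; ring. Qed.

Lemma sym0_op ab F : sym0 F -> sym0 (op false false ab F).
Proof.
by case=> rF [h z]; split; [exact: riem0_op | split; [exact: sy34_op | exact: z00_op]].
Qed.

Lemma alt0_op ab F : alt0 F -> alt0 (op false false ab F).
Proof.
by case=> rF [h z]; split; [exact: riem0_op | split; [exact: sk34_op | exact: z00_op]].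
Qed.

Lemma sl0_op ab F : sl0 F -> sl0 (op false false ab F).
Proof.
case=> rF [hS hL _]; split; first exact: riem0_op.
by split; [exact: hasS_op | exact: hasL_op | exact: zz_op].
Qed.

Lemma triv0_op ab F : triv0 F -> triv0 (op false false ab F).
Proof.
case=> rF [hS hL hZ]; split; first exact: riem0_op.
by split; [exact: hasS_op | exact: hasL_op | exact: hasZ_op].
Qed.

End Modules.

(** * One coordinate detects every non-zero invariant subspace of a module *)

Section Vanishing.
Variables (K : numClosedFieldType) (m : nat).
Local Notation I := 'I_m.
Local Notation A := (tensor4 K m).
Local Notation M := (m%:R : K).
Hypothesis m_gt2 : (2 < m)%N.
Implicit Types (F G : A) (a b c d f i j k l : I) (X Y N : {vspace A}).

Lemma Mn (q : nat) : (q <= 2)%N -> M != q%:R.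
Proof. by move=> q2; rewrite eqr_nat neq_ltn (leq_ltn_trans q2) ?orbT. Qed.

Lemma Mp (q : nat) : M + q%:R != 0.
Proof. by rewrite -natrD pnatr_eq0 addn_eq0 negb_and -lt0n (leq_trans _ m_gt2). Qed.

Lemma M0n : M != 0. Proof. by have := Mp 0; rewrite addr0. Qed.
Lemma MB (q : nat) : (q <= 2)%N -> M - q%:R != 0.
Proof. by move=> q2; rewrite subr_eq0 Mn. Qed.
Lemma Mp1n : M + 1 != 0. Proof. exact: (Mp 1). Qed.
Lemma Mp2n : M + 2 != 0. Proof. exact: (Mp 2). Qed.
Lemma MB1n : M - 1 != 0. Proof. exact: (@MB 1). Qed.
Lemma MB2n : M - 2 != 0. Proof. exact: (@MB 2). Qed.

Lemma num_neq0 (q : nat) : q.+1%:R != 0 :> K.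
Proof. by rewrite pnatr_eq0. Qed.

Lemma cancel0 (x y : K) : x != 0 -> x * y = 0 -> y = 0.
Proof. by move=> /negPf x0 /eqP; rewrite mulf_eq0 x0 => /eqP. Qed.

Lemma lincomb0 (c1 c2 x y e1 e2 : K) :
  y = 0 -> e1 = 0 -> e2 = 0 -> x = y + c1 * e1 + c2 * e2 -> x = 0.
Proof. by move=> -> -> -> ->; rewrite !mulr0 !addr0. Qed.

Lemma neg_self (x : K) : x = - x -> x = 0.
Proof.
move=> h; apply: (@cancel0 2 x); first exact: num_neq0.
by rewrite mulr_natl mulr2n {2}h subrr.
Qed.

Lemma sk12_diag F i k l : sk12 F -> ev F i i k l = 0.
Proof. by move=> h; apply: neg_self. Qed.
Lemma sk34_diag F i k l : sk34 F -> ev F i k l l = 0.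
Proof. by move=> h; apply: neg_self. Qed.

(** The octahedron argument: four Bianchi sums add up, by skew-symmetry, to twice the difference. *)
Lemma curv_pair F i j k l : curv F -> ev F k l i j = ev F i j k l.
Proof.
case=> s12 s34 b.
apply: subr0_eq.
apply: (@cancel0 2); first exact: num_neq0.
transitivity ((ev F i k l j + ev F k l i j + ev F l i k j)
  + (ev F i k j l + ev F k j i l + ev F j i k l)
  - (ev F i l j k + ev F l j i k + ev F j i l k)
  - (ev F k l j i + ev F l j k i + ev F j k l i)); last by rewrite !b; ring.
rewrite (s34 i k j l) (s12 i j) (s12 i l k j) (s34 i l j k) (s12 i j l k) (s34 i j k l).
by rewrite (s34 k l i j) (s12 j k i l) (s34 l j i k) (s34 j k i l); ring.
Qed.

(** The vanishing coordinate is polarised: evaluated on images under matrix units it lets e0 and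
    then e1 be replaced by arbitrary indices. The result is skew-symmetry in the second and fourth
    index, hence in all four, and the Bianchi identity becomes 3 F = 0. *)
Lemma curv_vanish X e0 e1 : e0 != e1 -> (forall F, F \in X -> curv F) ->
  invar (op true true) X -> (forall F, F \in X -> ev F e0 e1 e0 e1 = 0) ->
  forall F, F \in X -> F = 0.
Proof.
move=> ne cX iX V0; have ne' : e1 != e0 by rewrite eq_sym.
have S1 F c : F \in X -> ev F c e1 e0 e1 = 0.
  move=> FX; have := V0 _ (iX (e0, c) F FX); rewrite opE !dlii !(dln _ ne').
  move=> h; apply: (@cancel0 2); first exact: num_neq0.
  by rewrite -[RHS]h -(curv_pair e0 e1 c e1 (cX F FX)); ring.
have S2 F c d : F \in X -> ev F c e1 d e1 = 0.
  move=> FX; have := S1 _ c (iX (e0, d) F FX); rewrite opE !dlii !(dln _ ne') S1 //.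
  by move=> h; rewrite -[RHS]h; ring.
have S3 F c d f : F \in X -> ev F c d f e1 + ev F c e1 f d = 0.
  move=> FX; have := S2 _ c f (iX (e1, d) F FX); rewrite opE !dlii !S2 //.
  by move=> h; rewrite -[RHS]h; ring.
have S4 F c d f g : F \in X -> ev F c d f g + ev F c g f d = 0.
  move=> FX; have := S3 _ c d f (iX (e1, g) F FX); rewrite !opE !dlii.
  move=> h; rewrite -[RHS]h.
  transitivity (dl K c e1 * (ev F g d f e1 + ev F g e1 f d)
    + dl K d e1 * (ev F c g f e1 + ev F c e1 f g)
    + dl K f e1 * (ev F c d g e1 + ev F c e1 g d)
    + ev F c d f g + ev F c g f d); first by rewrite !S3 //; ring.
  ring.
move=> F FX; apply/evP => i j k l; rewrite ev0.
have [s12 s34 b] := cX F FX.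
have sw c d f g : ev F c d f g = - ev F c g f d.
  by apply/eqP; rewrite -subr_eq0 opprK S4.
apply: (@cancel0 3); first exact: num_neq0.
have s23 c d f g : ev F c d f g = - ev F c f d g.
  by rewrite sw (s34 c g d f) (sw c g d f); ring.
by rewrite -(b i j k l) (s23 j k) (s12 i j) (s12 i k j) (s23 i k); ring.
Qed.

(** The Bianchi identity traced over its third and last index. *)
Lemma hookish_z1 F i j : hookish F -> z1 F i j = - 2 * t1 F i j.
Proof.
case=> s12 b ht; have : \sum_k (ev F i j k k + ev F j k i k + ev F k i j k) = 0.
  by rewrite big1.
rewrite !big_split /=; under [X in _ + X + _ = _ -> _]eq_bigr => k _ do rewrite s12.
rewrite sumrN -/(z1 F i j) -/(t1 F i j) -/(t1 F j i) => h.
have h' : t1 F j i = - t1 F i j by apply/eqP; rewrite -addr_eq0 ht.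
by apply: subr0_eq; rewrite -[RHS]h h'; ring.
Qed.

Lemma hook_t1 F i j : hook F -> t1 F i j = 0.
Proof.
case=> hF z; apply: (@cancel0 (-2)); first by rewrite oppr_eq0 num_neq0.
by rewrite -hookish_z1.
Qed.

Lemma hook_vanish X e0 e1 w : e0 != e1 -> e0 != w -> e1 != w ->
  (forall F, F \in X -> hook F) -> invar (op true false) X ->
  (forall F, F \in X -> ev F e0 e1 e0 w = 0) -> forall F, F \in X -> F = 0.
Proof.
move=> n01 n0w n1w hX iX V0; have n10 : e1 != e0 by rewrite eq_sym.
have sk F i j k l : F \in X -> ev F j i k l = - ev F i j k l.
  by move=> /hX [[]].
have bi F i j k l : F \in X -> ev F i j k l = - ev F j k i l - ev F k i j l.
  move=> /hX [[_ b _] _]; apply: subr0_eq.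
  by rewrite -[RHS](b i j k l); ring.
have dl10 := dln K n10.
have S1 F c : F \in X -> c != w -> ev F c e1 e0 w + ev F e0 e1 c w = 0.
  move=> FX cw; have := V0 _ (iX (e0, c) F FX).
  by rewrite opE !dlii dl10 (dln K cw) => h; rewrite -[RHS]h; ring.
have S2 F c d : F \in X -> c != w -> d != w -> ev F c e1 d w + ev F d e1 c w = 0.
  move=> FX cw dw; have := S1 _ c (iX (e0, d) F FX) cw.
  rewrite !opE !dlii dl10 (dln K dw) => h.
  apply: (lincomb0 (c1 := - dl K c e0) (c2 := 0) h (S1 F d FX dw) (erefl 0)); ring.
have S3 F c d f : F \in X -> c != w -> d != w -> f != w ->
    ev F c f d w + ev F d f c w = 0.
  move=> FX cw dw fw; have := S2 _ c d (iX (e1, f) F FX) cw dw.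
  rewrite !opE !dlii (dln K fw) => h.
  apply: (lincomb0 (c1 := - dl K c e1) (c2 := - dl K d e1) h
    (S2 F f d FX fw dw) (S2 F c f FX cw fw)); ring.
have S4 F c d f : F \in X -> c != w -> d != w -> f != w -> ev F c d f w = 0.
  move=> FX cw dw fw; apply: (@cancel0 3); first exact: num_neq0.
  have sw i j k : i != w -> j != w -> k != w -> ev F i j k w = - ev F k j i w.
    by move=> iw jw kw; apply/eqP; rewrite -subr_eq0 opprK S3.
  have := bi F c d f w FX.
  rewrite (sw d f c) // (sk F f c d w) // (sw f c d) // (sk F c d f w) // => h.
  by apply/eqP; rewrite -[3]/(1 + 2) mulrDl mul1r {1}h; apply/eqP; ring.
have S5 F a c d f : F \in X -> a != w -> c != w -> d != w -> f != w ->
    ev F c d f a = dl K c a * ev F w d f w + dl K d a * ev F c w f w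
                   + dl K f a * ev F c d w w.
  move=> FX aw cw dw fw; have := S4 _ c d f (iX (a, w) F FX) cw dw fw.
  rewrite opE dlii => h; apply: subr0_eq.
  by rewrite -[RHS]oppr0 -h; ring.
(* The trace conditions at (d, f) and (f, d) read M x = y and M y = x. *)
have S6 F d f : F \in X -> d != w -> f != w -> ev F w d f w = 0.
  have E F' d' f' : F' \in X -> d' != w -> f' != w ->
      M * ev F' w d' f' w = ev F' w f' d' w.
    move=> FX dw fw; have := hook_t1 d' f' (hX _ FX); rewrite /t1.
    under eq_bigr => c _.
      have -> : ev F' c d' f' c = ev F' w d' f' w + dl K d' c * ev F' c w f' w
          + dl K f' c * ev F' c d' w w.
        have [->|cw] := eqVneq c w; last by rewrite S5 // dlii mul1r.
        by rewrite !dln // !mul0r !addr0.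
      over.
    rewrite !big_split /= sum_const !sum_dl.
    rewrite (sk F' w d' f' w) // (bi F' f' d' w w) // (sk F' w d') // (sk F' f' w) //.
    by move=> h; apply: subr0_eq; rewrite -[RHS]h; ring.
  move=> FX dw fw; have e1' := E F d f FX dw fw; have e2' := E F f d FX fw dw.
  apply: (@cancel0 ((M - 1) * (M + 1))); first by rewrite mulf_neq0 ?MB1n ?Mp1n.
  transitivity (M * (M * ev F w d f w) - ev F w d f w); first by ring.
  by rewrite e1' e2' subrr.
have S6' F d f : F \in X -> d != w -> f != w -> ev F d f w w = 0.
  move=> FX dw fw; rewrite bi // (sk F w f) // !S6 //; ring.
have S7 F a c d f : F \in X -> c != w -> d != w -> f != w -> ev F c d f a = 0.
  move=> FX cw dw fw; have [->|aw] := eqVneq a w; first exact: S4.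
  by rewrite S5 // S6 // S6' // (sk F w c) // S6 //; ring.
have ex_g d : exists2 g, g != w & g != d.
  have [de|de] := eqVneq d e0; last by exists e0; rewrite // eq_sym.
  by exists e1; rewrite // de.
have S8 F a d f : F \in X -> a != w -> d != w -> f != w -> ev F w d f a = 0.
  have R F' d' f' : F' \in X -> a != w -> d' != w -> f' != w ->
      ev F' w d' f' a + ev F' f' d' w a = 0.
    move=> FX aw dw fw; have aw' : w != a by rewrite eq_sym.
    have [df|df] := eqVneq d' f'; last first.
      have := S7 _ a f' d' f' (iX (f', w) F' FX) fw dw fw.
      rewrite opE dlii (dln K df) (dln K aw') => h; rewrite -[RHS]h; ring.
    rewrite df; have [g gw gf] := ex_g f'.
    have := S7 _ a g f' f' (iX (g, w) F' FX) gw fw fw.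
    rewrite opE dlii (dln K aw') (@dln _ _ f' g) 1?eq_sym // => h.
    rewrite sk12_diag; last by case: (hX _ FX) => [[]].
    by rewrite -[RHS]h; ring.
  move=> FX aw dw fw; have r1 := R F d f FX aw dw fw; have r2 := R F f d FX aw fw dw.
  apply: (@cancel0 3); first exact: num_neq0.
  have b1 := bi F w d f a FX; rewrite (sk F w f d a) // in b1.
  transitivity (2 * (ev F w d f a + ev F f d w a) + (ev F w f d a + ev F d f w a)
     + (ev F w d f a - (- ev F d f w a - - ev F w f d a)) - 2 * (ev F f d w a + ev F d f w a)).
    ring.
  by rewrite r1 r2 b1 (sk F d f) // subrr; ring.
have S9 F a d f : F \in X -> d != w -> f != w -> ev F w d f a = 0.
  by move=> FX dw fw; have [->|aw] := eqVneq a w; [exact: S6 | exact: S8].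
have S10 F a d : F \in X -> d != w -> ev F w d w a = 0.
  move=> FX dw; have [g gw gd] := ex_g d.
  have := S9 _ a d g (iX (g, w) F FX) dw gw.
  rewrite opE dlii (@dln _ _ w g) 1?eq_sym // (@dln _ _ d g) 1?eq_sym //.
  by rewrite (S9 F g d g) // => h; rewrite -[RHS]h; ring.
move=> F FX; apply/evP => i j k l; rewrite ev0.
have s12 : sk12 F by case: (hX _ FX) => [[]].
have [->|iw] := eqVneq i w; have [->|jw] := eqVneq j w.
- exact: sk12_diag.
- by have [->|kw] := eqVneq k w; [exact: S10 | exact: S9].
- by rewrite s12; have [->|kw] := eqVneq k w; rewrite ?S10 ?S9 ?oppr0.
- have [->|kw] := eqVneq k w; last exact: S7.
  by rewrite bi // (s12 w j) !S9 //; ring.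
Qed.

Lemma lam_vanish X e0 e1 w : e0 != e1 -> e0 != w -> e1 != w ->
  (forall F, F \in X -> lam F) -> invar (op true false) X ->
  (forall F, F \in X -> ev F e0 e1 w w = 0) -> forall F, F \in X -> F = 0.
Proof.
move=> n01 n0w n1w hX iX V0; have n10 : e1 != e0 by rewrite eq_sym.
have S0 F : F \in X -> z1 F e0 e1 = 0.
  move=> FX; have := V0 F FX; case: (hX F FX) => _ ->; rewrite ev_mkA dlii !(dln K) //.
  rewrite !mulr0 addr0 subr0 mulr1 mulrA => h.
  apply: (cancel0 _ h).
  by rewrite mulf_neq0 ?invr_eq0 ?mulf_neq0 ?Mp1n ?(num_neq0 1).
have S1 F c : F \in X -> z1 F c e1 = 0.
  move=> FX; have := S0 _ (iX (e0, c) F FX).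
  by rewrite z1_op dlii (dln K n10) => h; rewrite -[RHS]h; ring.
have S2 F c d : F \in X -> z1 F c d = 0.
  move=> FX; have := S1 _ c (iX (e1, d) F FX).
  by rewrite z1_op dlii S1 // => h; rewrite -[RHS]h; ring.
move=> F FX; apply/evP => i j k l; rewrite ev0; case: (hX F FX) => _ ->.
by rewrite ev_mkA !S2 //; ring.
Qed.

Lemma riem0_sy12 F : riem0 F -> sy34 F -> sy12 F.
Proof. by move=> [p _] s i j k l; rewrite -p s. Qed.

Lemma riem0_sk12 F : riem0 F -> sk34 F -> sk12 F.
Proof. by move=> [p _] s i j k l; rewrite -p s p. Qed.

(** Same scheme with the repeated contravariant index [w]. The two uses of trace-freeness produce
    the invertible factors M + 2 and M + 1. *)
Lemma sym0_vanish X e0 w : e0 != w ->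
  (forall F, F \in X -> sym0 F) -> invar (op false false) X ->
  (forall F, F \in X -> ev F e0 e0 w w = 0) -> forall F, F \in X -> F = 0.
Proof.
move=> n0w hX iX V0; have dl0w := dln K n0w.
have s12 F i j k l : F \in X -> ev F j i k l = ev F i j k l.
  by move=> /hX [r [s _]]; exact: riem0_sy12.
have s34 F i j k l : F \in X -> ev F i j l k = ev F i j k l.
  by move=> /hX [_ []].
have tr F j l : F \in X -> \sum_i ev F i j i l = 0 by move=> /hX [_ [_ h]]; exact: h.
have S0 F a : F \in X -> a != w -> ev F a e0 w w = 0.
  move=> FX aw; have := V0 _ (iX (e0, a) F FX).
  rewrite opE !dlii (dln K aw) (s12 F a e0) // => h.
  by apply: (@cancel0 2); rewrite ?(num_neq0 1) // -[RHS]h; ring.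
have S1 F a b : F \in X -> a != w -> b != w -> ev F a b w w = 0.
  move=> FX aw bw; have := S0 _ a (iX (e0, b) F FX) aw.
  by rewrite opE !dlii (dln K bw) S0 // => h; rewrite -[RHS]h; ring.
have R2 F a b x : F \in X -> a != w -> b != w -> x != w ->
    2 * ev F a b x w = dl K a x * ev F w b w w + dl K b x * ev F a w w w.
  move=> FX aw bw xw; have := S1 _ a b (iX (x, w) F FX) aw bw.
  rewrite opE !dlii (s34 F a b w x) // => h.
  by apply: subr0_eq; rewrite -[RHS]oppr0 -h; ring.
have S2 F b : F \in X -> b != w -> ev F w b w w = 0.
  move=> FX bw; have h := tr F b w FX.
  have : \sum_x (ev F w b w w + dl K b x * ev F x w w w + dl K w x * ev F w b w w)
      = 2 * \sum_i ev F i b i w.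
    rewrite mulr_sumr; apply: eq_bigr => x _; have [->|xw] := eqVneq x w.
      by rewrite dlii (dln K bw); ring.
    by rewrite R2 // dlii (@dln _ _ w x) 1?eq_sym //; ring.
  rewrite h mulr0 !big_split /= sum_const !sum_dl (s12 F w b) // => h'.
  by apply: (@cancel0 (M + 2)); rewrite ?Mp2n // -[RHS]h'; ring.
have S2' F a b x : F \in X -> a != w -> b != w -> ev F a b x w = 0.
  move=> FX aw bw; have [->|xw] := eqVneq x w; first exact: S1.
  apply: (@cancel0 2); first exact: (num_neq0 1).
  by rewrite R2 // (s12 F w a) // !S2 //; ring.
have R3 F a b x y : F \in X -> a != w -> b != w -> x != w -> y != w ->
    ev F a b x y = dl K a y * ev F w b x w + dl K b y * ev F a w x w.
  move=> FX aw bw xw yw; have := S2' _ a b x (iX (y, w) F FX) aw bw.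
  rewrite opE !dlii (@dln _ _ w x) 1?eq_sym // => h.
  by apply: subr0_eq; rewrite -[RHS]oppr0 -h; ring.
have S3 F b x : F \in X -> b != w -> x != w -> ev F w b x w = 0.
  move=> FX bw xw; have h := tr F b x FX.
  have : \sum_y (ev F w b x w + dl K b y * ev F y w x w) = \sum_i ev F i b i x.
    apply: eq_bigr => y _; have [->|yw] := eqVneq y w.
      by rewrite (dln K bw) (s34 F w b x w) //; ring.
    by rewrite (s34 F y b x y) // (R3 F y b x y) // dlii; ring.
  rewrite h !big_split /= sum_const !sum_dl (s12 F w b) // => h'.
  by apply: (@cancel0 (M + 1)); rewrite ?Mp1n // -[RHS]h'; ring.
have S4 F a b x y : F \in X -> a != w -> b != w -> ev F a b x y = 0.
  move=> FX aw bw; have [->|yw] := eqVneq y w; first exact: S2'.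
  have [->|xw] := eqVneq x w; first by rewrite s34 // S2'.
  by rewrite R3 // (s12 F w a) // !S3 //; ring.
have S5 F b x y : F \in X -> b != w -> ev F w b x y = 0.
  move=> FX bw; have [->|yw] := eqVneq y w.
    by have [->|xw] := eqVneq x w; [exact: S2 | exact: S3].
  have [->|xw] := eqVneq x w; first by rewrite s34 // S3.
  have := S4 _ b b x y (iX (b, w) F FX) bw bw.
  rewrite opE !dlii (@dln _ _ w x) 1?eq_sym // (@dln _ _ w y) 1?eq_sym // (s12 F w b) // => h.
  by apply: (@cancel0 2); rewrite ?(num_neq0 1) // -[RHS]h; ring.
have S6 F x y : F \in X -> ev F w w x y = 0.
  move=> FX; have := S5 _ e0 x y (iX (e0, w) F FX) n0w.
  by rewrite opE !dlii !(S5 F e0) // => h; rewrite -[RHS]h; ring.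
move=> F FX; apply/evP => i j k l; rewrite ev0.
have [->|iw] := eqVneq i w; have [->|jw] := eqVneq j w.
- exact: S6.
- exact: S5.
- by rewrite s12 // S5.
- exact: S4.
Qed.

(** Skew counterpart, with the contravariant pair (w, v). Trace-freeness now leaves the factors M -
    2 and M - 1, non-zero because m > 2. *)
Lemma alt0_vanish X e0 e1 v w : uniq [:: e0; e1; v; w] ->
  (forall F, F \in X -> alt0 F) -> invar (op false false) X ->
  (forall F, F \in X -> ev F e0 e1 w v = 0) -> forall F, F \in X -> F = 0.
Proof.
rewrite /= !inE !negb_or => /and4P [/and3P [n01 n0v n0w] /andP [n1v n1w] nvw _].
move=> hX iX V0; have n10 : e1 != e0 by rewrite eq_sym.
have s12 F i j k l : F \in X -> ev F j i k l = - ev F i j k l.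
  by move=> /hX [r [s _]]; exact: riem0_sk12.
have s34 F i j k l : F \in X -> ev F i j l k = - ev F i j k l.
  by move=> /hX [_ []].
have d34 F i j k : F \in X -> ev F i j k k = 0.
  by move=> FX; apply: neg_self; exact: s34.
have d12 F i j k : F \in X -> ev F i i j k = 0.
  by move=> FX; apply: neg_self; exact: s12.
have tr F j l : F \in X -> \sum_i ev F i j i l = 0 by move=> /hX [_ [_ h]]; exact: h.
pose out a := (a != v) && (a != w).
have outv a : out a -> a != v by case/andP.
have outw a : out a -> a != w by case/andP.
have S0 F a : F \in X -> out a -> ev F a e1 w v = 0.
  move=> FX oa; have := V0 _ (iX (e0, a) F FX).
  by rewrite opE !dlii (dln K n10) (dln K (outv _ oa)) (dln K (outw _ oa)) => h; rewrite -[RHS]h; ring.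
have S1 F a b : F \in X -> out a -> out b -> ev F a b w v = 0.
  move=> FX oa ob; have := S0 _ a (iX (e1, b) F FX) oa.
  rewrite opE !dlii S0 // (dln K (outv _ ob)) (dln K (outw _ ob)) => h.
  by rewrite -[RHS]h; ring.
(* [p] and [q] stand for [w] and [v] in either order. *)
pose swap p q := (p == w) && (q == v) || (p == v) && (q == w).
have swapC p q : swap p q -> swap q p.
  by rewrite /swap => /orP [/andP [-> ->]|/andP [-> ->]]; rewrite ?orbT.
have swapn p q : swap p q -> p != q.
  by rewrite /swap => /orP [/andP [/eqP -> /eqP ->]|/andP [/eqP -> /eqP ->]]; rewrite // eq_sym.
have outp p q a : swap p q -> out a -> a != p /\ a != q.
  by rewrite /swap => /orP [/andP [/eqP -> /eqP ->]|/andP [/eqP -> /eqP ->]] /andP [].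
have outE p q a : swap p q -> a != p -> a != q -> out a.
  rewrite /swap /out => /orP [/andP [/eqP -> /eqP ->]|/andP [/eqP -> /eqP ->]] *;
  by apply/andP.
have swp p q : swap p q -> forall F a b, F \in X -> out a -> out b -> ev F a b p q = 0.
  rewrite /swap => /orP [/andP [/eqP -> /eqP ->]|/andP [/eqP -> /eqP ->]] F a b FX oa ob.
    exact: S1.
  by rewrite s34 // S1 // oppr0.
have R2 p q F a b x : swap p q -> F \in X -> out a -> out b -> out x ->
    ev F a b p x = dl K a x * ev F q b p q + dl K b x * ev F a q p q.
  move=> spq FX oa ob ox; have := swp p q spq _ a b (iX (x, q) F FX) oa ob.
  rewrite opE !dlii (@dln _ _ q p) 1?eq_sym ?swapn // => h.
  by apply: subr0_eq; rewrite -[RHS]oppr0 -h; ring.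
have S2 p q F b : swap p q -> F \in X -> out b -> ev F q b p q = 0.
  move=> spq FX ob; have h := tr F b p FX; have [bp bq] := outp p q b spq ob.
  have pq := swapn _ _ spq.
  have : \sum_x (ev F q b p q + dl K b x * ev F x q p q - dl K p x * ev F q b p q)
      = - \sum_i ev F i b i p.
    rewrite -sumrN; apply: eq_bigr => x _; have [->|xp] := eqVneq x p.
      by rewrite dlii (dln K bp) d34 //; ring.
    have [->|xq] := eqVneq x q.
      by rewrite (dln K bq) (dln K pq) (s34 F q b q p) //; ring.
    rewrite -(s34 F x b x p) // (R2 p q F x b x) // ?(outE p q x) // dlii (@dln _ _ p x) 1?eq_sym //.
    ring.
  rewrite h oppr0 sumrB !big_split /= sum_const !sum_dl (s12 F q b) // => h'.
  by apply: (@cancel0 (M - 2)); rewrite ?MB2n // -[RHS]h'; ring.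
have S2' p q F a b x : swap p q -> F \in X -> out a -> out b -> ev F a b p x = 0.
  move=> spq FX oa ob; have [->|xp] := eqVneq x p; first exact: d34.
  have [->|xq] := eqVneq x q; first exact: swp.
  rewrite (R2 p q) // ?(outE p q) // (s12 F q a) // !S2 //; ring.
have R3 p q F a b x y : swap p q -> F \in X -> out a -> out b -> out x -> out y ->
    ev F a b x y = dl K a y * ev F p b x p + dl K b y * ev F a p x p.
  move=> spq FX oa ob ox oy; have [yp yq] := outp p q y spq oy.
  have [xp xq] := outp p q x spq ox.
  have := S2' p q _ a b x spq (iX (y, p) F FX) oa ob.
  rewrite opE !dlii (@dln _ _ p x) 1?eq_sym // (s34 F a b x y) // => h.
  rewrite (s34 F p b p x) // (s34 F a p p x) //.
  by apply: subr0_eq; rewrite -[RHS]h; ring.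
have swv : swap w v by rewrite /swap !eqxx.
have svw := swapC _ _ swv.
have out0 : out e0 by rewrite /out n0v.
have out1 : out e1 by rewrite /out n1v.
have ex_g d : exists2 g, out g & g != d.
  have [->|de] := eqVneq d e0; first by exists e1.
  by exists e0; rewrite // eq_sym.
(* The coordinate (g, b, x, g) is evaluated through [R3] once with [w] and once with [v]. *)
have Uvw F b x : F \in X -> out b -> out x -> ev F v b x v = ev F w b x w.
  move=> FX ob ox; have [g og gb] := ex_g b.
  have := R3 w v F g b x g swv FX og ob ox og.
  rewrite (R3 v w F g b x g svw FX og ob ox og) dlii (@dln _ _ b g) 1?eq_sym //.
  by rewrite !mul1r !mul0r !addr0.
have S3 F b x : F \in X -> out b -> out x -> ev F w b x w = 0.
  move=> FX ob ox; have h := tr F b x FX.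
  have : \sum_y (ev F w b x w + dl K b y * ev F y w x w) = - \sum_i ev F i b i x.
    rewrite -sumrN; apply: eq_bigr => y _; rewrite -(s34 F y b y x) //.
    have [->|yw] := eqVneq y w; first by rewrite (dln K (outw _ ob)); ring.
    have [->|yv] := eqVneq y v.
      by rewrite (dln K (outv _ ob)) Uvw //; ring.
    by rewrite (R3 w v F y b x y) // ?(outE w v y) // dlii; ring.
  rewrite h oppr0 !big_split /= sum_const !sum_dl (s12 F w b) // => h'.
  by apply: (@cancel0 (M - 1)); rewrite ?MB1n // -[RHS]h'; ring.
have S3' p q F b x : swap p q -> F \in X -> out b -> ev F p b x p = 0.
  move=> spq FX ob; have [->|xp] := eqVneq x p; first exact: d34.
  have [->|xq] := eqVneq x q; first by apply: S2 => //; exact: swapC.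
  have ox : out x by apply: (outE p q).
  move: spq; rewrite /swap => /orP [/andP [/eqP -> _]|/andP [/eqP -> _]]; last rewrite Uvw //.
    exact: S3.
  exact: S3.
have S4 F a b x y : F \in X -> out a -> out b -> ev F a b x y = 0.
  move=> FX oa ob.
  have [->|yw] := eqVneq y w; first by rewrite s34 // (S2' w v) ?oppr0.
  have [->|xw] := eqVneq x w; first by rewrite (S2' w v).
  have [->|yv] := eqVneq y v; first by rewrite s34 // (S2' v w) ?oppr0.
  have [->|xv] := eqVneq x v; first by rewrite (S2' v w).
  have ox : out x by apply: (outE w v).
  have oy : out y by apply: (outE w v).
  by rewrite (R3 w v F a b x y) // (s12 F w a) // !S3 //; ring.
have S5 p q F b x y : swap p q -> F \in X -> out b -> ev F p b x y = 0.
  move=> spq FX ob; have [->|yp] := eqVneq y p; first exact: (S3' p q).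
  have [->|xp] := eqVneq x p; first by rewrite s34 // (S3' p q) ?oppr0.
  have [g og gb] := ex_g b; have := S4 _ g b x y (iX (g, p) F FX) og ob.
  rewrite opE !dlii (@dln _ _ b g) 1?eq_sym // (@dln _ _ p x) 1?eq_sym //.
  by rewrite (@dln _ _ p y) 1?eq_sym // => h; rewrite -[RHS]h; ring.
have S6 F x y : F \in X -> ev F w v x y = 0.
  move=> FX; have := S5 w v _ e0 x y swv (iX (e0, v) F FX) out0.
  rewrite opE !dlii (@dln _ _ w e0) 1?eq_sym // !(S5 w v F e0) // => h.
  by rewrite -[RHS]h; ring.
move=> F FX; apply/evP => i j k l; rewrite ev0.
have [->|iw] := eqVneq i w; have [->|jw] := eqVneq j w.
- exact: d12.
- have [->|jv] := eqVneq j v; first exact: S6.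
  by rewrite (S5 w v) // ?(outE w v).
- rewrite s12 //; have [->|iv] := eqVneq i v; first by rewrite S6 ?oppr0.
  by rewrite (S5 w v) ?oppr0 // (outE w v).
- have [->|iv] := eqVneq i v; have [->|jv] := eqVneq j v.
  + exact: d12.
  + by rewrite (S5 v w) // (outE w v).
  + by rewrite s12 // (S5 v w) ?oppr0 // (outE w v).
  + by rewrite S4 // (outE w v).
Qed.

Lemma cS_neq0 : cS K m != 0.
Proof. by rewrite mulf_neq0 ?invr_eq0 ?mulf_neq0 ?Mp2n ?(num_neq0 2) ?(num_neq0 3). Qed.

Lemma sl0_ev F a b : sl0 F -> a != b -> ev F a a a b = 2 * cS K m * z0 F a b.
Proof.
move=> [_ [hS hL zF]] ab.
have -> : ev F a a a b = symB F a a a b + altB F a a a b.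
  by rewrite /symB /altB; field.
by rewrite hS hL /iotaS /iotaL zF dlii (dln K ab); ring.
Qed.

Lemma iota_eq0 F : hasS F -> hasL F -> (forall j l, z0 F j l = 0) -> F = 0.
Proof.
move=> hS hL z; have zF : zz F = 0 by rewrite /zz big1.
apply/evP => i j k l; have -> : ev F i j k l = symB F i j k l + altB F i j k l.
  by rewrite /symB /altB; field.
by rewrite hS hL /iotaS /iotaL zF !z ev0; ring.
Qed.

(** An array of this kind is determined by its trace [z0], which [sl0_ev] reads off one coordinate;
    what remains is the simplicity of sl_m. *)
Lemma sl0_vanish X e0 e1 w : e0 != e1 -> e0 != w -> e1 != w ->
  (forall F, F \in X -> sl0 F) -> invar (op false false) X ->
  (forall F, F \in X -> ev F e0 e0 e0 w = 0) -> forall F, F \in X -> F = 0.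
Proof.
move=> n01 n0w n1w hX iX V0.
have S0 F : F \in X -> z0 F e0 w = 0.
  move=> FX; have := V0 F FX; rewrite sl0_ev //; last exact: hX.
  by apply: cancel0; rewrite mulf_neq0 ?cS_neq0 ?(num_neq0 1).
have S1 F b : F \in X -> b != w -> z0 F b w = 0.
  move=> FX bw; have := S0 _ (iX (e0, b) F FX).
  by rewrite z0_op dlii (dln K bw) => h; rewrite -[RHS]h; ring.
have S2 F a b : F \in X -> b != w -> z0 F b a = dl K b a * z0 F w w.
  move=> FX bw; have [->|aw] := eqVneq a w; first by rewrite S1 // (dln K bw) mul0r.
  have := S1 _ b (iX (a, w) F FX) bw; rewrite z0_op dlii => h.
  by apply: subr0_eq; rewrite -[RHS]oppr0 -h; ring.
have S3 F : F \in X -> z0 F w w = 0.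
  move=> FX; have [_ [_ _]] := hX F FX; rewrite /zz.
  under eq_bigr => j _.
    have -> : z0 F j j = z0 F w w.
      by have [->|jw] := eqVneq j w; rewrite // S2 // dlii mul1r.
    over.
  by rewrite sum_const; apply: cancel0; exact: M0n.
have S4 F a b : F \in X -> z0 F b a = 0.
  move=> FX; have [->|bw] := eqVneq b w; last by rewrite S2 // S3 // mulr0.
  have [->|aw] := eqVneq a w; first exact: S3.
  have Z G c d : G \in X -> c != w -> z0 G c d = 0.
    by move=> GX cw; rewrite S2 // S3 // mulr0.
  have := Z _ e0 a (iX (e0, w) F FX) n0w.
  by rewrite z0_op dlii (@dln _ _ w a) 1?eq_sym // => h; rewrite -[RHS]h; ring.
move=> F FX; have [_ [hS hL _]] := hX F FX.
by apply: iota_eq0 => // j l; exact: S4.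
Qed.

Lemma triv0_ev F a b : triv0 F -> a != b -> ev F a b a b = 0 -> F = 0.
Proof.
move=> [_ [hS hL hZ]] ab; have ba : b != a by rewrite eq_sym.
have -> : ev F a b a b = symB F a b a b + altB F a b a b.
  by rewrite /symB /altB; field.
rewrite hS hL /iotaS /iotaL !hZ !dlii (dln K ab) (dln K ba) /cS /cL => h.
have zF : zz F = 0.
  (* The coordinate (a, b, a, b) when the trace is scalar: 3 / (4 M (M + 1)) from the symmetric part
     plus 1 / (4 M (M - 1)) from the skew one. *)
  apply: (@cancel0 ((2 * M - 1) / (2 * M * (M - 1) * (M + 1)))).
    rewrite mulf_neq0 ?invr_eq0 ?mulf_neq0 ?M0n ?MB1n ?Mp1n ?(num_neq0 1) //.
    rewrite -natrM subr_eq0 (eqr_nat _ _ 1); case: (m) m_gt2 => // q _.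
    by rewrite mul2n doubleS.
  rewrite -[RHS]h; field.
  by rewrite M0n MB1n MB2n Mp1n Mp2n.
by apply: iota_eq0 => // j l; rewrite hZ zF mulr0 mul0r.
Qed.

End Vanishing.

(** * Highest weight data and simplicity of the modules *)

Section Simplicity.
Variables (K : numClosedFieldType) (m : nat).
Local Notation I := 'I_m.
Local Notation A := (tensor4 K m).
Local Notation M := (m%:R : K).
Hypothesis m_gt2 : (2 < m)%N.
Implicit Types (F G : A) (i j k l : I) (X Y N W Z : {vspace A}).

(** The input of the criterion for simplicity: the coordinate [t0], of weight [q], detects non-zero
    invariant subspaces, and inside [P] a vector of weight [q] is determined by its value at
    [t0]. *)
Definition hw_data (u3 u4 : bool) (P : A -> Prop) (d : I -> int) (q : int)
    (t0 : I * I * I * I) : Prop :=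
  [/\ lin_closed P, forall ab F, P F -> P (op u3 u4 ab F), wt u3 u4 d t0 = q,
      forall X, (forall F, F \in X -> P F) -> invar (op u3 u4) X ->
        (forall F, F \in X -> F t0 = 0) -> forall F, F \in X -> F = 0
    & forall F, P F ->
        (forall i j k l, wt u3 u4 d (i, j, k, l) != q -> ev F i j k l = 0) ->
        F t0 = 0 -> F = 0].

Section OneModule.
Variables (u3 u4 : bool) (P : A -> Prop) (d : I -> int) (q : int).
Variable (t0 : I * I * I * I).
Hypothesis hP : hw_data u3 u4 P d q t0.

Let cP : lin_closed P. Proof. by case: hP. Qed.

Lemma hw_invar : invar (op u3 u4) (vsof P).
Proof. by case: hP => _ iP _ _ _; exact: invar_vsof. Qed.

Let dN X F : invar (op u3 u4) X -> F \in X -> diag (wt u3 u4 d) F \in X.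
Proof. exact: diag_wt_mem. Qed.

Let N3 X : (X <= vsof P)%VS -> invar (op u3 u4) X ->
  (forall F, F \in X -> F t0 = 0) -> X = 0%VS.
Proof.
case: hP => _ _ _ h _ sX iX X0; apply: vs0P => F FX.
rewrite memv0; apply/eqP; apply: (h X) => // G GX.
by apply/(vsofP _ cP)/(subvP sX).
Qed.

Let N2 F : F \in vsof P -> (forall t, wt u3 u4 d t != q -> F t = 0) ->
  F t0 = 0 -> F = 0.
Proof.
case: hP => _ _ _ _ h /(vsofP _ cP) PF F0; apply: h => // i j k l; exact: F0.
Qed.

Let d0 : wt u3 u4 d t0 = q. Proof. by case: hP. Qed.

Lemma hw_simple : simple (op u3 u4) (vsof P).
Proof. exact: (simple_of_eigenvector (@op_adj _ _ u3 u4) hw_invar dN d0 N3 N2). Qed.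

Lemma hw_peel W Z : invar (op u3 u4) W -> invar (op u3 u4) Z ->
  (Z <= vsof P + W)%VS -> (vsof P :&: W = 0)%VS ->
  (forall F, F \in W -> forall t, wt u3 u4 d t == q -> F t = 0) ->
  (Z <= W)%VS \/ (Z = vsof P + (Z :&: W))%VS.
Proof.
move=> iW iZ sZ c0 dW.
exact: (peel (@op_adj _ _ u3 u4) hw_invar dN d0 N3 N2 (@op_linear _ _ u3 u4)).
Qed.

End OneModule.

Variables (e0 e1 w : I).
Hypotheses (n01 : e0 != e1) (n0w : e0 != w) (n1w : e1 != w).
Let n10 : e1 != e0. Proof. by rewrite eq_sym. Qed.
Let nw0 : w != e0. Proof. by rewrite eq_sym. Qed.
Let nw1 : w != e1. Proof. by rewrite eq_sym. Qed.

(** Integer diagonal matrices for which the weight of the chosen coordinate occurs only once in the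
    module. For hooks the unequal values 2 and 1 are needed to tell e0 from e1. *)
Definition dCurv (c : I) : int := if (c == e0) || (c == e1) then 1 else 0.
Definition dHook (c : I) : int :=
  if c == e0 then 2 else if c == e1 then 1 else if c == w then -1 else 0.
Definition dSym (c : I) : int :=
  if c == e0 then 1 else if c == w then -1 else 0.

Lemma dCurv_le c : dCurv c <= 1. Proof. by rewrite /dCurv; case: ifP. Qed.
Lemma dCurv1 c : dCurv c = 1 -> c = e0 \/ c = e1.
Proof. by rewrite /dCurv; case: eqP; [left | case: eqP => //; right]. Qed.
Lemma dSym_bound c : -1 <= dSym c <= 1.
Proof. by rewrite /dSym; do !case: ifP. Qed.
Lemma dSym1 c : dSym c = 1 -> c = e0.
Proof. by rewrite /dSym; case: eqP => // _; case: ifP. Qed.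
Lemma dSymw c : dSym c = -1 -> c = w.
Proof. by rewrite /dSym; case: eqP => // _; case: eqP. Qed.
Lemma dHook_bound c : -1 <= dHook c <= 2.
Proof. by rewrite /dHook; do !case: ifP. Qed.
Lemma dHook2 c : dHook c = 2 -> c = e0.
Proof. by rewrite /dHook; case: eqP => // _; do !case: ifP. Qed.
Lemma dHook1 c : dHook c = 1 -> c = e1.
Proof. by rewrite /dHook; case: eqP => // _; case: eqP => // _; case: ifP. Qed.
Lemma dHookw c : dHook c = -1 -> c = w.
Proof. by rewrite /dHook; case: eqP => // _; case: eqP => // _; case: eqP. Qed.

Lemma dHook_pair a b : a != b -> dHook a + dHook b <= 3.
Proof.
move=> ab; rewrite leNgt; apply/negP => h.
have [ha hb] : dHook a = 2 /\ dHook b = 2.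
  by move: h (dHook_bound a) (dHook_bound b) => ? /andP [? ?] /andP [? ?]; split; lia.
by case/eqP: ab; rewrite (dHook2 ha) (dHook2 hb).
Qed.

Lemma hw_curv : hw_data true true (@curv K m) dCurv 4 (e0, e1, e0, e1).
Proof.
split; [exact: curv_lin | exact: curv_op | by rewrite /wt /dCurv !eqxx orbT | |].
  by move=> X cX iX X0; apply: (curv_vanish n01 cX iX).
move=> F [s12 s34 _] F0 F1; apply/evP => i j k l; rewrite ev0.
have [h|/F0 //] := boolP (wt true true dCurv (i, j, k, l) == 4).
have [/dCurv1 hi /dCurv1 hj /dCurv1 hk /dCurv1 hl] :
    [/\ dCurv i = 1, dCurv j = 1, dCurv k = 1 & dCurv l = 1].
  move/eqP: h (dCurv_le i) (dCurv_le j) (dCurv_le k) (dCurv_le l); rewrite /wt.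
  by split; lia.
have Z i' k' l' : ev F i' i' k' l' = 0 by apply: sk12_diag.
have Z' i' j' k' : ev F i' j' k' k' = 0 by apply: sk34_diag.
have F1' : ev F e0 e1 e0 e1 = 0 by [].
by case: hi => ->; case: hj => -> //; case: hk => ->; case: hl => -> //;
  rewrite ?(s12 e0 e1) ?(s34 _ _ e0 e1) F1' ?oppr0.
Qed.

Lemma hw_hook : hw_data true false (@hook K m) dHook 6 (e0, e1, e0, w).
Proof.
split; [exact: hook_lin | exact: hook_op | | |].
- by rewrite /wt /dHook !eqxx (negPf n10) (negPf nw0) (negPf nw1).
- by move=> X cX iX X0; apply: (hook_vanish m_gt2 n01 n0w n1w cX iX).
move=> F [[s12 _ _] _] F0 F1; apply/evP => i j k l; rewrite ev0.
have [h|/F0 //] := boolP (wt true false dHook (i, j, k, l) == 6).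
have [->|ij] := eqVneq i j; first exact: sk12_diag.
have F1' : ev F e0 e1 e0 w = 0 by [].
have hij : dHook i + dHook j <= 3.
  exact: dHook_pair.
move/eqP: h (dHook_bound i) (dHook_bound j) (dHook_bound k) (dHook_bound l); rewrite /wt.
move=> h /andP [i1 i2] /andP [j1 j2] /andP [k1 k2] /andP [l1 l2].
have /dHook2 -> : dHook k = 2 by lia.
have /dHookw -> : dHook l = -1 by lia.
have [/dHook2 -> | /dHook1 ->] : dHook i = 2 \/ dHook i = 1 by lia.
  have [/dHook1 -> // | /dHook2 ->] : dHook j = 1 \/ dHook j = 2 by lia.
  exact: sk12_diag.
have [/dHook2 -> | /dHook1 ->] : dHook j = 2 \/ dHook j = 1 by lia.
  by rewrite s12 F1' oppr0.
exact: sk12_diag.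
Qed.

Lemma hw_lam : hw_data true false (@lam K m) dCurv 2 (e0, e1, w, w).
Proof.
split; [exact: lam_lin | exact: lam_op | | |].
- by rewrite /wt /dCurv !eqxx (negPf nw0) (negPf nw1) orbT.
- by move=> X cX iX X0; apply: (lam_vanish m_gt2 n01 n0w n1w cX iX).
move=> F [[s12 _ _] h] F0 F1; have F1' : ev F e0 e1 w w = 0 by [].
have sz i j : z1 F i j = - z1 F j i.
  by rewrite /z1 -sumrN; apply: eq_bigr => k _; exact: s12.
have z01 : z1 F e0 e1 = 0.
  move: F1'; rewrite h ev_mkA dlii !(dln K) // !mulr0 addr0 subr0 mulr1 mulrA.
  by apply: cancel0; rewrite mulf_neq0 ?invr_eq0 ?mulf_neq0 ?Mp1n ?(num_neq0 K 1).
suff z i j : z1 F i j = 0.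
  by apply/evP => i j k l; rewrite h ev_mkA !z ev0; ring.
have [d2|d2] := boolP (dCurv i + dCurv j == 2); last first.
  rewrite /z1 big1 // => k _; apply: F0; rewrite /wt /=; apply: contraNneq d2 => <-.
  by rewrite addrK.
have [/dCurv1 hi /dCurv1 hj] : dCurv i = 1 /\ dCurv j = 1.
  by move/eqP: d2 (dCurv_le i) (dCurv_le j); split; lia.
have zd a : z1 F a a = 0 by apply: neg_self.
by case: hi => ->; case: hj => -> //; rewrite sz z01 oppr0.
Qed.

(** Each term of [iota1] has a delta between the contravariant index and another one; the remaining
    two indices have total weight at most 4. This gap lets the hooks be split off first. *)
Lemma lam_weight F i j k l : lam F ->
  wt true false dHook (i, j, k, l) = 6 -> ev F i j k l = 0.
Proof.
move=> [[s12 _ _] h] hw; have [->|ij] := eqVneq i j; first exact: sk12_diag.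
have hij a b : a != b -> dHook a + dHook b <= 3.
  exact: dHook_pair.
move: hw (hij _ _ ij) (dHook_bound i) (dHook_bound j) (dHook_bound k); rewrite /wt.
move=> hw b /andP [i1 i2] /andP [j1 j2] /andP [k1 k2].
rewrite h ev_mkA !dln; first by ring.
- by apply/negP => /eqP il; rewrite il in hw i1 i2 b; lia.
- by apply/negP => /eqP jl; rewrite jl in hw j1 j2 b; lia.
- by apply/negP => /eqP kl; rewrite kl in hw k1 k2; lia.
Qed.

Lemma hw_sym0 : hw_data false false (@sym0 K m) dSym 4 (e0, e0, w, w).
Proof.
split; [exact: sym0_lin | exact: sym0_op | | |].
- by rewrite /wt /dSym !eqxx (negPf nw0).
- by move=> X cX iX X0; apply: (sym0_vanish m_gt2 n0w cX iX).
move=> F _ F0 F1; apply/evP => i j k l; rewrite ev0.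
have [h|/F0 //] := boolP (wt false false dSym (i, j, k, l) == 4).
move/eqP: h (dSym_bound i) (dSym_bound j) (dSym_bound k) (dSym_bound l); rewrite /wt.
move=> h /andP [i1 i2] /andP [j1 j2] /andP [k1 k2] /andP [l1 l2].
have /dSym1 -> : dSym i = 1 by lia.
have /dSym1 -> : dSym j = 1 by lia.
have /dSymw -> : dSym k = -1 by lia.
have /dSymw -> : dSym l = -1 by lia.
exact: F1.
Qed.

(** At weight 4 every delta of [iotaS] joins e0 to [w]. *)
Lemma hasS_weight F i j k l : hasS F ->
  wt false false dSym (i, j, k, l) = 4 -> ev F i j k l = 0.
Proof.
move=> hS h.
move: h (dSym_bound i) (dSym_bound j) (dSym_bound k) (dSym_bound l); rewrite /wt.
move=> h /andP [i1 i2] /andP [j1 j2] /andP [k1 k2] /andP [l1 l2].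
have /dSym1 -> : dSym i = 1 by lia.
have /dSym1 -> : dSym j = 1 by lia.
have /dSymw -> : dSym k = -1 by lia.
have /dSymw -> : dSym l = -1 by lia.
have -> : ev F e0 e0 w w = symB F e0 e0 w w by rewrite /symB; field.
by rewrite hS /iotaS (dln K n0w); ring.
Qed.

Lemma hw_sl0 : hw_data false false (@sl0 K m) dSym 2 (e0, e0, e0, w).
Proof.
split; [exact: sl0_lin | exact: sl0_op | | |].
- by rewrite /wt /dSym !eqxx (negPf nw0).
- by move=> X cX iX X0; apply: (sl0_vanish m_gt2 n01 n0w n1w cX iX).
move=> F hF F0 F1; have [_ [hS hL _]] := hF.
have F1' : ev F e0 e0 e0 w = 0 by [].
apply: iota_eq0 => // j l; have [h|h] := boolP (dSym j - dSym l == 2); last first.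
  rewrite /z0 big1 // => i _; apply: F0; rewrite /wt /=; apply: contraNneq h => <-.
  by rewrite [dSym i + _]addrC addrK.
move/eqP: h (dSym_bound j) (dSym_bound l).
move=> h /andP [j1 j2] /andP [l1 l2].
have /dSym1 -> : dSym j = 1 by lia.
have /dSymw -> : dSym l = -1 by lia.
move: F1'; rewrite sl0_ev //; apply: cancel0.
by rewrite mulf_neq0 ?cS_neq0 ?(num_neq0 K 1).
Qed.

(** Scalar trace leaves only products of two deltas, all of weight 0. *)
Lemma triv0_weight F i j k l : triv0 F ->
  wt false false dSym (i, j, k, l) = 2 -> ev F i j k l = 0.
Proof.
move=> [_ [hS hL hZ]]; rewrite /wt => h.
have -> : ev F i j k l = symB F i j k l + altB F i j k l by rewrite /symB /altB; field.
have p1 : dl K i k * dl K j l = 0.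
  have [ik|ik] := eqVneq i k; last by rewrite (dln K ik) mul0r.
  have [jl|jl] := eqVneq j l; last by rewrite (dln K jl) mulr0.
  by rewrite ik jl in h; lia.
have p2 : dl K i l * dl K j k = 0.
  have [ik|ik] := eqVneq i l; last by rewrite (dln K ik) mul0r.
  have [jl|jl] := eqVneq j k; last by rewrite (dln K jl) mulr0.
  by rewrite ik jl in h; lia.
rewrite hS hL /iotaS /iotaL !hZ.
transitivity ((dl K i k * dl K j l) * (2 * cS K m * M^-1 * zz F - cS K m * (M + 1)^-1 * zz F
    + 2 * cL K m * M^-1 * zz F - cL K m * (M - 1)^-1 * zz F)
  + (dl K i l * dl K j k) * (2 * cS K m * M^-1 * zz F - cS K m * (M + 1)^-1 * zz F
    - 2 * cL K m * M^-1 * zz F + cL K m * (M - 1)^-1 * zz F)); first by ring.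
by rewrite p1 p2 !mul0r addr0.
Qed.

Lemma hw_triv0 : hw_data false false (@triv0 K m) (fun=> 0) 0 (e0, e1, e0, e1).
Proof.
split; [exact: triv0_lin | exact: triv0_op | by rewrite /wt | |].
  by move=> X cX iX X0 F FX; apply: (triv0_ev m_gt2 (cX _ FX) n01); exact: X0.
by move=> F tF _; exact: triv0_ev.
Qed.

Section Alternating.
Variable v : I.
Hypotheses (n0v : e0 != v) (n1v : e1 != v) (nvw : v != w).

Definition dAlt (c : I) : int :=
  if (c == e0) || (c == e1) then 1 else if (c == v) || (c == w) then -1 else 0.

Lemma dAlt_bound c : -1 <= dAlt c <= 1.
Proof. by rewrite /dAlt; do !case: ifP. Qed.
Lemma dAlt1 c : dAlt c = 1 -> c = e0 \/ c = e1.
Proof.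
by rewrite /dAlt; case: eqP; [left | case: eqP; [right | case: ifP]].
Qed.
Lemma dAltw c : dAlt c = -1 -> c = v \/ c = w.
Proof.
rewrite /dAlt; case: ifP => // _; case: eqP; first by left.
by case: eqP => //; right.
Qed.

Lemma dAlt4 i j k l : wt false false dAlt (i, j, k, l) = 4 ->
  [/\ i = e0 \/ i = e1, j = e0 \/ j = e1, k = v \/ k = w & l = v \/ l = w].
Proof.
move=> h.
move: h (dAlt_bound i) (dAlt_bound j) (dAlt_bound k) (dAlt_bound l); rewrite /wt.
move=> h /andP [i1 i2] /andP [j1 j2] /andP [k1 k2] /andP [l1 l2].
by split; [apply: dAlt1 | apply: dAlt1 | apply: dAltw | apply: dAltw]; lia.
Qed.

Lemma hw_alt0 : hw_data false false (@alt0 K m) dAlt 4 (e0, e1, w, v).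
Proof.
split; [exact: alt0_lin | exact: alt0_op | | |].
- by rewrite /wt /dAlt !eqxx (negPf nw0) (negPf nw1) !orbT ?(eq_sym v) (negPf n0v) (negPf n1v).
- move=> X cX iX X0; apply: (alt0_vanish m_gt2 _ cX iX) X0.
  by rewrite /= !inE !negb_or n01 n0v n0w n1v n1w nvw.
move=> F [r [s34 _]] F0 F1; have s12 := riem0_sk12 r s34.
apply/evP => i j k l; rewrite ev0.
have [h|/F0 //] := boolP (wt false false dAlt (i, j, k, l) == 4).
have Z i' k' l' : ev F i' i' k' l' = 0 by apply: sk12_diag.
have Z' i' j' k' : ev F i' j' k' k' = 0 by apply: sk34_diag.
have F1' : ev F e0 e1 w v = 0 by [].
by case: (dAlt4 (eqP h)) => -[] -> [] -> [] -> [] -> //;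
  rewrite ?(s12 e0 e1) ?(s34 _ _ w v) F1' ?oppr0.
Qed.

Lemma iota_weight F i j k l : hasS F -> hasL F ->
  wt false false dAlt (i, j, k, l) = 4 -> ev F i j k l = 0.
Proof.
move=> hS hL h.
have -> : ev F i j k l = symB F i j k l + altB F i j k l by rewrite /symB /altB; field.
by rewrite hS hL /iotaS /iotaL; case: (dAlt4 h) => -[] -> [] -> [] -> [] ->;
  rewrite ?(dln K n0w) ?(dln K n1w) ?(dln K n0v) ?(dln K n1v); ring.
Qed.

End Alternating.

End Simplicity.

Section LinearOf.
Variables (K : fieldType) (E F : vectType K) (f : E -> F).

Definition lin_of (H : linear f) : 'Hom(E, F) :=
  linfun (HB.pack_for {linear E -> F} f (GRing.isLinear.Build _ _ _ _ _ H)).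

Lemma lin_ofE H x : lin_of H x = f x.
Proof. by rewrite lfunE. Qed.

End LinearOf.

(** * Dimensions of the modules *)

Section Dimensions.
Variables (K : numClosedFieldType) (m : nat).
Local Notation I := 'I_m.
Local Notation A := (tensor4 K m).
Local Notation A2 := {ffun I * I -> K^o}.
Local Notation M := (m%:R : K).
Hypothesis m_gt2 : (2 < m)%N.
Implicit Types (F G : A) (i j k l : I).

Definition tr4 (f : I -> I -> I -> I -> K) := \sum_i \sum_j \sum_k \sum_l f i j k l.

Lemma tr4D f g : tr4 (fun i j k l => f i j k l + g i j k l) = tr4 f + tr4 g.
Proof.
rewrite /tr4 -big_split; apply: eq_bigr => i _; rewrite -big_split.
apply: eq_bigr => j _; rewrite -big_split; apply: eq_bigr => k _.
exact: big_split.
Qed.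

Lemma tr4Z c f : tr4 (fun i j k l => c * f i j k l) = c * tr4 f.
Proof.
rewrite /tr4 mulr_sumr; apply: eq_bigr => i _; rewrite mulr_sumr.
apply: eq_bigr => j _; rewrite mulr_sumr; apply: eq_bigr => k _.
by rewrite mulr_sumr.
Qed.

Lemma tr4N f : tr4 (fun i j k l => - f i j k l) = - tr4 f.
Proof.
rewrite -mulN1r -tr4Z; do 4!apply: eq_bigr => ? _; by rewrite mulN1r.
Qed.

Lemma eq_tr4 f g : (forall i j k l, f i j k l = g i j k l) -> tr4 f = tr4 g.
Proof. by move=> h; do 4!apply: eq_bigr => ? _. Qed.

Definition d4 (a b c d i j k l : I) : K := dl K a i * dl K b j * dl K c k * dl K d l.

Lemma ev_unit i j k l a b c d : ev (unit_arr K (i, j, k, l)) a b c d = d4 a b c d i j k l.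
Proof. by rewrite /ev ffunE /d4 /dl -!natrM !mulnb !xpair_eqE. Qed.

Lemma dim_of_projection (P : A -> Prop) (p : A -> A) (H : linear p) : lin_closed P ->
  (forall F, P (p F)) -> (forall F, P F -> p F = F) ->
  (\dim (vsof P))%:R = tr4 (fun i j k l => ev (p (unit_arr K (i, j, k, l))) i j k l).
Proof.
move=> cP pP pid; rewrite (dim_idempotent (p := lin_of H)) => [|F|F /(vsofP _ cP)].
- by rewrite sum4; apply: eq_tr4 => i j k l; rewrite lin_ofE.
- by rewrite lin_ofE; apply/vsofP.
- by rewrite lin_ofE; exact: pid.
Qed.

Lemma sum_constr (x : K) : \sum_(j < m) x = x * M.
Proof. by rewrite sum_const mulrC. Qed.

Ltac trace4 :=
  rewrite /tr4 /d4;
  under eq_bigr => i _ do (under eq_bigr => j _ do (under eq_bigr => k _ do (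
    under eq_bigr => l _ do rewrite ?dlii ?mulr1 ?mul1r)));
  under eq_bigr => i _ do (under eq_bigr => j _ do (under eq_bigr => k _ do
    rewrite -?mulr_suml ?sum_constr ?sum_dlr ?dlii ?mulr1 ?mul1r));
  under eq_bigr => i _ do (under eq_bigr => j _ do
    rewrite -?mulr_suml ?sum_constr ?sum_dlr ?dlii ?mulr1 ?mul1r);
  under eq_bigr => i _ do
    rewrite -?mulr_suml ?sum_constr ?sum_dlr ?dlii ?mulr1 ?mul1r;
  rewrite -?mulr_suml ?sum_constr; ring.

(** The trace of a permutation of the four tensor slots is M to the number of its cycles. *)
Lemma tr_perm : (
  (tr4 (fun i j k l => d4 i j k l i j k l) = M ^+ 4) *
  (tr4 (fun i j k l => d4 j i k l i j k l) = M ^+ 3) *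
  (tr4 (fun i j k l => d4 i j l k i j k l) = M ^+ 3) *
  (tr4 (fun i j k l => d4 i k j l i j k l) = M ^+ 3) *
  (tr4 (fun i j k l => d4 k j i l i j k l) = M ^+ 3) *
  (tr4 (fun i j k l => d4 i l k j i j k l) = M ^+ 3) *
  (tr4 (fun i j k l => d4 l j k i i j k l) = M ^+ 3) *
  (tr4 (fun i j k l => d4 j i l k i j k l) = M ^+ 2) *
  (tr4 (fun i j k l => d4 k l i j i j k l) = M ^+ 2) *
  (tr4 (fun i j k l => d4 l k j i i j k l) = M ^+ 2) *
  (tr4 (fun i j k l => d4 j k i l i j k l) = M ^+ 2) *
  (tr4 (fun i j k l => d4 k i j l i j k l) = M ^+ 2) *
  (tr4 (fun i j k l => d4 j l k i i j k l) = M ^+ 2) *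
  (tr4 (fun i j k l => d4 l i k j i j k l) = M ^+ 2) *
  (tr4 (fun i j k l => d4 k j l i i j k l) = M ^+ 2) *
  (tr4 (fun i j k l => d4 l j i k i j k l) = M ^+ 2) *
  (tr4 (fun i j k l => d4 i k l j i j k l) = M ^+ 2) *
  (tr4 (fun i j k l => d4 i l j k i j k l) = M ^+ 2) *
  (tr4 (fun i j k l => d4 j k l i i j k l) = M) *
  (tr4 (fun i j k l => d4 l i j k i j k l) = M) *
  (tr4 (fun i j k l => d4 j l i k i j k l) = M) *
  (tr4 (fun i j k l => d4 k i l j i j k l) = M) *
  (tr4 (fun i j k l => d4 k l j i i j k l) = M) *
  (tr4 (fun i j k l => d4 l k i j i j k l) = M))%type.
Proof. by do !split; trace4. Qed.

Definition pair_sym F i j k l : K :=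
  ev F i j k l - ev F j i k l - ev F i j l k + ev F j i l k
  + ev F k l i j - ev F k l j i - ev F l k i j + ev F l k j i.

(** A Young projection of shape (2,2). On [curv] the operator [pair_sym] is multiplication by 8, and
    the Bianchi identity turns the bracket into (16 + 8) F, whence 24. *)
Definition curv_proj F : A := mkA (fun i j k l =>
  24^-1 * (2 * pair_sym F i j k l - pair_sym F j k i l - pair_sym F k i j l)).

Lemma curv_proj_linear : linear curv_proj.
Proof.
move=> x F G; apply/evP => i j k l; rewrite ev_lin !ev_mkA /pair_sym !ev_lin.
by ring.
Qed.

Lemma dim_curv : (12 * \dim (vsof (@curv K m)) + m ^ 2 = m ^ 4)%N.
Proof.
apply/eqP; rewrite -(eqr_nat K) natrD natrM !natrX.
rewrite (dim_of_projection curv_proj_linear (@curv_lin K m)).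
- under eq_tr4 => i j k l do rewrite ev_mkA /pair_sym !ev_unit.
  rewrite tr4Z !tr4D !tr4N tr4Z !tr4D !tr4N !tr_perm.
  by apply/eqP; field.
- move=> F; split=> i j k l; rewrite !ev_mkA /pair_sym; by ring.
- move=> F cF; have [s12 s34 b] := cF; apply/evP => i j k l.
  have E i' j' k' l' : pair_sym F i' j' k' l' = 8 * ev F i' j' k' l'.
    rewrite /pair_sym (curv_pair i' j' k' l' cF) (curv_pair i' j' l' k' cF).
    rewrite (curv_pair j' i' k' l' cF) (curv_pair j' i' l' k' cF).
    by rewrite (s12 i' j' l' k') (s12 i' j' k' l') (s34 i' j' k' l'); ring.
  rewrite ev_mkA !E.
  transitivity (ev F i j k l - 3^-1 * (ev F i j k l + ev F j k i l + ev F k i j l)).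
    by field.
  by rewrite b mulr0 subr0.
Qed.

(** Rank-nullity for a trace [t] that maps [P] onto the space of all matrices, of dimension m ^
    2. *)
Lemma dim_kernel (P Q : A -> Prop) (t : A -> I -> I -> K) :
  lin_closed P -> lin_closed Q ->
  (forall x F G i j, t (x *: F + G) i j = x * t F i j + t G i j) ->
  (forall F, Q F <-> P F /\ forall i j, t F i j = 0) ->
  (forall T : I -> I -> K, exists2 F, P F & forall i j, t F i j = T i j) ->
  (\dim (vsof Q) + m ^ 2 = \dim (vsof P))%N.
Proof.
move=> cP cQ lt QP surj.
pose f F : A2 := [ffun u => t F u.1 u.2].
have lf : linear f by move=> x F G; apply/ffunP => u; rewrite !ffunE lt.
pose h := lin_of lf; rewrite -(limg_ker_dim h (vsof P)).
have -> : (vsof P :&: lker h)%VS = vsof Q.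
  apply/vspaceP => F; apply/idP/idP.
    rewrite memv_cap memv_ker lin_ofE => /andP [/(vsofP _ cP) PF /eqP/ffunP f0].
    apply/vsofP => //; apply/QP; split=> // i j; by have := f0 (i, j); rewrite !ffunE.
  move=> /(vsofP _ cQ)/QP [PF f0]; rewrite memv_cap memv_ker lin_ofE.
  apply/andP; split; first by apply/vsofP.
  by apply/eqP/ffunP => u; rewrite !ffunE f0.
have -> : (h @: vsof P)%VS = fullv.
  apply/vspaceP => T; rewrite memvf; have [F PF tF] := surj (fun i j => T (i, j)).
  apply/memv_imgP; exists F; first by apply/vsofP.
  by rewrite lin_ofE; apply/ffunP => -[i j]; rewrite ffunE tF.
by rewrite dimvf /dim /= muln1 card_prod card_ord mulnn.
Qed.

Definition hook_proj F : A := mkA (fun i j k l => 2^-1 * (ev F i j k l - ev F j i k l)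
  - 6^-1 * (ev F i j k l + ev F j k i l + ev F k i j l
            - ev F j i k l - ev F i k j l - ev F k j i l)).

Lemma hook_proj_linear : linear hook_proj.
Proof.
by move=> x F G; apply/evP => i j k l; rewrite ev_lin !ev_mkA !ev_lin; ring.
Qed.

(** Without trace conditions the space is the shape (2,1) tensored with the dual, of dimension (m^4
    - m^2) / 3; the trace [t1] takes away m^2. *)
Lemma dim_hook : (3 * \dim (vsof (@hook K m)) + 4 * m ^ 2 = m ^ 4)%N.
Proof.
pose P F := sk12 F /\ bianchi F.
have cP : lin_closed P := lin_closedI (@sk12_lin K m) (@bianchi_lin K m).
have h1 : (\dim (vsof (@hook K m)) + m ^ 2 = \dim (vsof P))%N.
  apply: (dim_kernel (t := @t1 K m)) => //; first exact: hook_lin.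
  - by move=> *; rewrite t1_lin.
  - move=> F; split=> [hF|[[s b] t0]].
      by split=> [|i j]; [case: hF => [[]] | exact: hook_t1].
    have hF : hookish F by split=> // i j; rewrite !t0 addr0.
    by split=> // i j; rewrite hookish_z1 // t0 mulr0.
  (* A preimage of [T]: its symmetric and skew halves enter through two equivariant arrays on which
     [t1] is multiplication by M - 1 and by - (M + 1). *)
  - move=> T; pose S i j := (M - 1)^-1 * ((T i j + T j i) / 2).
    pose R i j := - (M + 1)^-1 * ((T i j - T j i) / 2).
    exists (mkA (fun i j k l => S j k * dl K i l - S i k * dl K j l
       + ev (iota1 R) i j k l)).
      by split=> i j k l; rewrite !ev_mkA /S /R; ring.
    move=> i j; rewrite /t1.
    transitivity (\sum_k ((S i j - R i j) + dl K i k * (R k j - S k j)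
        + dl K j k * (2 * R k i))).
      by apply: eq_bigr => k _; rewrite !ev_mkA dlii; ring.
    rewrite !big_split /= !sum_const !sum_dl /S /R; field.
    by rewrite MB1n ?Mp1n.
have h2 : (\dim (vsof P))%:R = 3^-1 * (M ^+ 4 - M ^+ 2) :> K.
  rewrite (dim_of_projection hook_proj_linear cP).
  - under eq_tr4 => i j k l do rewrite ev_mkA !ev_unit.
    by rewrite tr4D tr4N !tr4Z !tr4D !tr4N !tr_perm; field.
  - by move=> F; split=> i j k l; rewrite !ev_mkA; field.
  - move=> F [s b]; apply/evP => i j k l; rewrite ev_mkA (s i j k l) (s k i j l) (s j k i l).
    transitivity (ev F i j k l - 3^-1 * (ev F i j k l + ev F j k i l + ev F k i j l)).
      by field.
    by rewrite b mulr0 subr0.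
apply/eqP; rewrite -(eqr_nat K) !natrD !(natrX, natrM); apply/eqP.
have := congr1 (fun x : nat => x%:R : K) h1; rewrite /= natrD natrX h2 => h3.
by transitivity (3 * ((\dim (vsof (@hook K m)))%:R + M ^+ 2) + M ^+ 2); [ring | rewrite h3; field].
Qed.

Definition tr2 (T : I -> I -> K) : K := \sum_i T i i.

Lemma sum_iotaS (T : I -> I -> K) j l :
  \sum_i iotaS T (tr2 T) i j i l = 3 / 4 * T j l.
Proof.
pose c := cS K m; pose t := tr2 T.
transitivity (\sum_i (c * (T j l - (M + 1)^-1 * t * dl K j l)
  + dl K j i * (c * (T i l - (M + 1)^-1 * t * dl K i l)) + dl K l i * (c * T j i)
  + T i i * (c * dl K j l))).
  apply: eq_bigr => i _; rewrite /iotaS -/c -/t dlii (dlC K i l); ring.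
rewrite !big_split /= !sum_const !sum_dl -mulr_suml -/(tr2 T) -/t /c /cS; field.
by rewrite Mp1n ?Mp2n.
Qed.

Lemma sum_iotaL (T : I -> I -> K) j l :
  \sum_i iotaL T (tr2 T) i j i l = 1 / 4 * T j l.
Proof.
pose c := cL K m; pose t := tr2 T.
transitivity (\sum_i (c * (T j l - (M - 1)^-1 * t * dl K j l)
  + dl K j i * (- c * (T i l - (M - 1)^-1 * t * dl K i l)) + dl K l i * (- c * T j i)
  + T i i * (c * dl K j l))).
  apply: eq_bigr => i _; rewrite /iotaL -/c -/t dlii (dlC K i l); ring.
rewrite !big_split /= !sum_const !sum_dl -mulr_suml -/(tr2 T) -/t /c /cL; field.
by rewrite MB1n ?MB2n.
Qed.

(** For s = 1 and s = -1 this projects onto arrays symmetric, respectively skew, in both pairs. *)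
Definition sq_proj (s : K) F : A := mkA (fun i j k l =>
  4^-1 * (ev F i j k l + s * ev F j i k l + s * ev F i j l k + s ^+ 2 * ev F j i l k)).

Lemma sq_proj_linear s : linear (sq_proj s).
Proof.
by move=> x F G; apply/evP => i j k l; rewrite ev_lin !ev_mkA !ev_lin; ring.
Qed.

Lemma tr_sq_proj s : tr4 (fun i j k l => ev (sq_proj s (unit_arr K (i, j, k, l))) i j k l)
  = 4^-1 * (M ^+ 2 + s * M) ^+ 2.
Proof.
under eq_tr4 => i j k l do rewrite ev_mkA !ev_unit.
by rewrite !tr4Z !tr4D !tr4Z !tr_perm; ring.
Qed.

Lemma dim_sym0 : (4 * \dim (vsof (@sym0 K m)) + 3 * m ^ 2 = m ^ 4 + 2 * m ^ 3)%N.
Proof.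
pose P F := sy12 F /\ sy34 F.
have cP : lin_closed P := lin_closedI (@sy12_lin K m) (@sy34_lin K m).
have h1 : (\dim (vsof (@sym0 K m)) + m ^ 2 = \dim (vsof P))%N.
  apply: (dim_kernel (t := @z0 K m)) => //; first exact: sym0_lin.
  - by move=> *; rewrite z0_lin.
  - move=> F; split=> [[r [s z]]|[[s s'] z]]; first by split=> //; split=> //; exact: riem0_sy12.
    split=> //; split=> [i j k l|j l]; first by rewrite s s'.
    by under eq_bigr => k _ do rewrite s; rewrite -/(z0 F j l) z mulr0.
  - move=> T; exists (mkA (fun i j k l => 4 / 3 * iotaS T (tr2 T) i j k l)).
      by split=> i j k l; rewrite !ev_mkA /iotaS; ring.
    move=> j l; rewrite /z0; under eq_bigr => k _ do rewrite ev_mkA.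
    by rewrite -mulr_sumr sum_iotaS; field.
have h2 : (\dim (vsof P))%:R = 4^-1 * (M ^+ 2 + 1 * M) ^+ 2 :> K.
  rewrite (dim_of_projection (sq_proj_linear 1) cP) ?tr_sq_proj //.
  - by move=> F; split=> i j k l; rewrite !ev_mkA; field.
  - move=> F [s s']; apply/evP => i j k l.
    by rewrite ev_mkA (s i j l k) (s i j k l) (s' i j k l); field.
apply/eqP; rewrite -(eqr_nat K) !natrD !(natrX, natrM); apply/eqP.
have := congr1 (fun x : nat => x%:R : K) h1; rewrite /= natrD natrX h2 => h3.
by transitivity (4 * ((\dim (vsof (@sym0 K m)))%:R + M ^+ 2) - M ^+ 2); [ring | rewrite h3; field].
Qed.

Lemma dim_alt0 : (4 * \dim (vsof (@alt0 K m)) + 2 * m ^ 3 + 3 * m ^ 2 = m ^ 4)%N.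
Proof.
pose P F := sk12 F /\ sk34 F.
have cP : lin_closed P := lin_closedI (@sk12_lin K m) (@sk34_lin K m).
have h1 : (\dim (vsof (@alt0 K m)) + m ^ 2 = \dim (vsof P))%N.
  apply: (dim_kernel (t := @z0 K m)) => //; first exact: alt0_lin.
  - by move=> *; rewrite z0_lin.
  - move=> F; split=> [[r [s z]]|[[s s'] z]]; first by split=> //; split=> //; exact: riem0_sk12.
    split=> //; split=> [i j k l|j l]; first by rewrite s s' opprK.
    by under eq_bigr => k _ do rewrite s; rewrite sumrN -/(z0 F j l) z oppr0 mulr0.
  - move=> T; exists (mkA (fun i j k l => 4 * iotaL T (tr2 T) i j k l)).
      by split=> i j k l; rewrite !ev_mkA /iotaL; ring.
    move=> j l; rewrite /z0; under eq_bigr => k _ do rewrite ev_mkA.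
    by rewrite -mulr_sumr sum_iotaL; field.
have h2 : (\dim (vsof P))%:R = 4^-1 * (M ^+ 2 + (-1) * M) ^+ 2 :> K.
  rewrite (dim_of_projection (sq_proj_linear (-1)) cP) ?tr_sq_proj //.
  - by move=> F; split=> i j k l; rewrite !ev_mkA; field.
  - move=> F [s s']; apply/evP => i j k l.
    by rewrite ev_mkA (s i j l k) (s i j k l) (s' i j k l); field.
apply/eqP; rewrite -(eqr_nat K) !natrD !(natrX, natrM); apply/eqP.
have := congr1 (fun x : nat => x%:R : K) h1; rewrite /= natrD natrX h2 => h3.
by transitivity (4 * ((\dim (vsof (@alt0 K m)))%:R + M ^+ 2) + 2 * M ^+ 3 - M ^+ 2); [ring | rewrite h3; field].
Qed.

(** An equivariant section of the trace [z0] with values in [riem0]; [sl0] and [triv0] are the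
    images of the trace-free and of the scalar matrices. *)
Definition iota0 (T : I -> I -> K) : A :=
  mkA (fun i j k l => iotaS T (tr2 T) i j k l + iotaL T (tr2 T) i j k l).

Lemma z0_iota0 T j l : z0 (iota0 T) j l = T j l.
Proof.
rewrite /z0; under eq_bigr => i _ do rewrite ev_mkA.
by rewrite big_split /= sum_iotaS sum_iotaL; field.
Qed.

Lemma zz_iota0 T : zz (iota0 T) = tr2 T.
Proof. by apply: eq_bigr => i _; rewrite z0_iota0. Qed.

Lemma iotaS_ext (T T' : I -> I -> K) t i j k l : (forall i j, T i j = T' i j) ->
  iotaS T t i j k l = iotaS T' t i j k l.
Proof. by move=> h; rewrite /iotaS !h. Qed.

Lemma iotaL_ext (T T' : I -> I -> K) t i j k l : (forall i j, T i j = T' i j) ->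
  iotaL T t i j k l = iotaL T' t i j k l.
Proof. by move=> h; rewrite /iotaL !h. Qed.

Lemma hasS_iota0 T : hasS (iota0 T).
Proof.
move=> i j k l; rewrite (iotaS_ext _ _ _ _ _ (z0_iota0 T)) zz_iota0 /symB !ev_mkA.
by rewrite /iotaS /iotaL; field; rewrite ?Mp1n ?MB1n.
Qed.

Lemma hasL_iota0 T : hasL (iota0 T).
Proof.
move=> i j k l; rewrite (iotaL_ext _ _ _ _ _ (z0_iota0 T)) zz_iota0 /altB !ev_mkA.
by rewrite /iotaS /iotaL; field; rewrite ?Mp1n ?MB1n.
Qed.

Lemma riem0_iota0 T : riem0 (iota0 T).
Proof.
split=> [i j k l|j l]; first by rewrite !ev_mkA /iotaS /iotaL; ring.
rewrite z0_iota0.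
transitivity (2 * (\sum_i iotaS T (tr2 T) i j i l - \sum_i iotaL T (tr2 T) i j i l)).
  by rewrite sum_iotaS sum_iotaL; field.
by rewrite -sumrB; congr (_ * _); apply: eq_bigr => i _; rewrite ev_mkA /iotaS /iotaL; ring.
Qed.

Lemma iota0E F : hasS F -> hasL F -> F = iota0 (z0 F).
Proof.
by move=> hS hL; apply/evP => i j k l; rewrite ev_mkA -hS -hL /symB /altB; field.
Qed.

Lemma z1_iota1 (T : I -> I -> K) i j : (forall i j, T i j = - T j i) ->
  z1 (iota1 T) i j = 2 * (M + 1) * T i j.
Proof.
move=> sT; rewrite /z1.
transitivity (\sum_k (2 * T i j + dl K j k * T i k + dl K i k * (- T j k))).
  by apply: eq_bigr => k _; rewrite ev_mkA dlii; ring.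
by rewrite !big_split /= !sum_const !sum_dl (sT j i); ring.
Qed.

Lemma hookish_iota1 (T : I -> I -> K) : (forall i j, T i j = - T j i) -> hookish (iota1 T).
Proof.
move=> sT; split=> [i j k l|i j k l|i j].
- by rewrite !ev_mkA (sT j i); ring.
- by rewrite !ev_mkA (sT j i) (sT k i) (sT k j); ring.
- have E a b : t1 (iota1 T) a b = - (M + 1) * T a b.
    rewrite /t1; transitivity (\sum_k (- T a b + dl K b k * (2 * T k a) + dl K a k * T k b)).
      by apply: eq_bigr => k _; rewrite ev_mkA dlii; ring.
    by rewrite !big_split /= !sum_const !sum_dl (sT b a); ring.
  by rewrite !E (sT j i); ring.
Qed.

Lemma lam_iota1 (T : I -> I -> K) : (forall i j, T i j = - T j i) -> lam (iota1 T).
Proof.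
move=> sT; split; first exact: hookish_iota1.
move=> i j k l; rewrite [in RHS]/iota1 !ev_mkA !z1_iota1 //; field.
by rewrite Mp1n.
Qed.

Definition skew_arr (T : A2) := forall i j, T (i, j) = - T (j, i).

Lemma iota1_linear : linear (fun T : A2 => iota1 (fun i j => T (i, j))).
Proof.
move=> x T S; apply/evP => i j k l; rewrite ev_lin !ev_mkA !ffunE /GRing.scale /=; ring.
Qed.

Lemma iota0_linear : linear (fun T : A2 => iota0 (fun i j => T (i, j))).
Proof.
move=> x T S; apply/evP => i j k l; rewrite ev_lin !ev_mkA /iotaS /iotaL.
have -> : tr2 (fun i j => (x *: T + S) (i, j))
    = x * tr2 (fun i j => T (i, j)) + tr2 (fun i j => S (i, j)).
  by rewrite /tr2 -sum_lin; apply: eq_bigr => a _; rewrite !ffunE.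
by rewrite !ffunE /GRing.scale /=; ring.
Qed.

Lemma z1_skew F i j : sk12 F -> z1 F i j = - z1 F j i.
Proof. by move=> s; rewrite /z1 -sumrN; apply: eq_bigr => k _; exact: s. Qed.

Lemma dim_lam : (2 * \dim (vsof (@lam K m)) + m = m ^ 2)%N.
Proof.
have cS : lin_closed skew_arr.
  split=> [|x T S hT hS] i j; rewrite !ffunE ?oppr0 // hT hS /GRing.scale /=; ring.
pose h := lin_of iota1_linear; pose p (T : A2) : A2 := [ffun u => (T u - T (u.2, u.1)) / 2].
have lp : linear p.
  by move=> x T S; apply/ffunP => u; rewrite !ffunE /GRing.scale /=; ring.
have -> : vsof (@lam K m) = (h @: vsof skew_arr)%VS.
  apply/vspaceP => F; apply/idP/idP => [/(vsofP _ (@lam_lin K m)) [[s b t] hF]|].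
    apply/memv_imgP; exists [ffun u => (2 * (M + 1))^-1 * z1 F u.1 u.2].
      by apply/vsofP => // i j; rewrite !ffunE /= z1_skew // mulrN.
    rewrite lin_ofE; apply/evP => i j k l; rewrite hF !ev_mkA !ffunE /=; ring.
  case/memv_imgP => T /(vsofP _ cS) sT ->; apply/vsofP; first exact: lam_lin.
  by rewrite lin_ofE; exact: lam_iota1.
rewrite limg_dim_eq; last first.
  apply: vs0P => T; rewrite memv_cap memv_ker lin_ofE.
  move=> /andP [/(vsofP _ cS) sT /eqP h0]; rewrite memv0; apply/eqP/ffunP => -[i j].
  have := z1_iota1 i j sT; rewrite h0 z1_0 ffunE => /esym; apply: cancel0.
  by rewrite mulf_neq0 ?Mp1n ?(num_neq0 K 1).
apply/eqP; rewrite -(eqr_nat K) natrD natrM natrX; apply/eqP.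
rewrite (dim_idempotent (p := lin_of lp)) => [|T|T /(vsofP _ cS) sT].
- have E : \sum_t lin_of lp (unit_arr K t) t = \sum_(u : I * I) 2^-1 * (1 - dl K u.2 u.1 * dl K u.1 u.2) :> K.
    apply: eq_bigr => -[i j] _; rewrite lin_ofE !ffunE /= eqxx.
    by rewrite xpair_eqE /dl -natrM mulnb mulrC.
  rewrite [X in 2 * X]E -(pair_bigA _ (fun i j => 2^-1 * (1 - dl K j i * dl K i j))) /=.
  under eq_bigr => i _ do (rewrite -mulr_sumr sumrB sum_const sum_dlr dlii).
  by rewrite sum_const; field.
- rewrite lin_ofE; apply/vsofP => // i j; rewrite !ffunE /=; ring.
- by rewrite lin_ofE; apply/ffunP => -[i j]; rewrite !ffunE /= (sT j i); field.
Qed.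

Lemma dim_sl0 : (\dim (vsof (@sl0 K m)) + 1 = m ^ 2)%N.
Proof.
pose h := lin_of iota0_linear; pose f (T : A2) : K^o := tr2 (fun i j => T (i, j)).
have lf : linear f.
  by move=> x T S; rewrite /f /tr2 /GRing.scale /= -sum_lin; apply: eq_bigr => i _; rewrite !ffunE.
have -> : vsof (@sl0 K m) = (h @: lker (lin_of lf))%VS.
  apply/vspaceP => F; apply/idP/idP => [/(vsofP _ (@sl0_lin K m)) [r [hS hL zF]]|].
    apply/memv_imgP; exists [ffun u => z0 F u.1 u.2].
      rewrite memv_ker lin_ofE; apply/eqP; rewrite -[RHS]zF.
      by apply: eq_bigr => i _; rewrite ffunE.
    rewrite lin_ofE {1}(iota0E hS hL); apply/evP => i j k l; rewrite !ev_mkA.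
    by congr (_ + _); rewrite ?/iotaS ?/iotaL /tr2; under [in RHS]eq_bigr => a _ do rewrite ffunE; rewrite !ffunE.
  case/memv_imgP => T; rewrite memv_ker lin_ofE => /eqP T0 ->.
  apply/vsofP; first exact: sl0_lin.
  rewrite lin_ofE; split; first exact: riem0_iota0.
  by split; [exact: hasS_iota0 | exact: hasL_iota0 | rewrite zz_iota0].
rewrite limg_dim_eq; last first.
  apply: vs0P => T; rewrite memv_cap memv_ker lin_ofE.
  move=> /andP [_]; rewrite memv_ker lin_ofE => /eqP h0; rewrite memv0; apply/eqP/ffunP => -[i j].
  by rewrite -[LHS](z0_iota0 (fun i j => T (i, j))) h0 z0_0 ffunE.
have <- : \dim (fullv : {vspace A2}) = (m ^ 2)%N.
  by rewrite dimvf /dim /= muln1 card_prod card_ord mulnn.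
rewrite -(limg_ker_dim (lin_of lf) fullv) capfv; congr (_ + _)%N.
have -> : (lin_of lf @: fullv)%VS = fullv.
  apply/vspaceP => x; rewrite memvf; apply/memv_imgP.
  exists [ffun u => (u.1 == u.2)%:R * (x / M)]; first exact: memvf.
  rewrite lin_ofE /f /tr2; under eq_bigr => i _ do rewrite ffunE eqxx mul1r.
  by rewrite sum_const mulrCA mulfV ?M0n ?mulr1.
by rewrite dimvf.
Qed.

Lemma dim_triv0 : \dim (vsof (@triv0 K m)) = 1%N.
Proof.
pose v : A := iota0 (fun i j => dl K i j).
have trd : tr2 (fun i j => dl K i j) = M.
  by rewrite /tr2; under eq_bigr => i _ do rewrite dlii; rewrite sum_const mulr1.
have tv : triv0 v.
  split; first exact: riem0_iota0.
  split; [exact: hasS_iota0 | exact: hasL_iota0 |].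
  by move=> j l; rewrite z0_iota0 zz_iota0 trd mulVf ?M0n ?mul1r.
have -> : vsof (@triv0 K m) = <[v]>%VS.
  apply/vspaceP => F; apply/idP/vlineP => [/(vsofP _ (@triv0_lin K m)) [r [hS hL hZ]]|[x ->]].
    exists (M^-1 * zz F); rewrite {1}(iota0E hS hL); apply/evP => i j k l.
    rewrite evZ !ev_mkA trd /iotaS /iotaL !hZ.
    have -> : tr2 (z0 F) = zz F by [].
    have mM := mulVf (M0n K m_gt2).
    (* The relation M^-1 M = 1 is isolated as an explicit factor, so that the rest is a polynomial
       identity. *)
    transitivity (M^-1 * zz F * (iotaS (fun i j => dl K i j) M i j k l
       + iotaL (fun i j => dl K i j) M i j k l) + (1 - M^-1 * M) * (zz F * (
     - cS K m * (M + 1)^-1 * (dl K i k * dl K j l + dl K i l * dl K j k)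
     - cL K m * (M - 1)^-1 * (dl K i k * dl K j l - dl K i l * dl K j k)))).
      by rewrite /iotaS /iotaL; ring.
    by rewrite mM subrr mul0r addr0.
  by apply: memvZ; apply/vsofP; first exact: triv0_lin.
rewrite dim_vline; suff -> : v != 0 by [].
apply/eqP => v0; have := M0n K m_gt2; rewrite -trd -zz_iota0 -/v v0 zz_0.
by rewrite eqxx.
Qed.

End Dimensions.

(** * Projections onto the modules of one degree *)

Section Decomposition.
Variables (K : numClosedFieldType) (m : nat).
Local Notation I := 'I_m.
Local Notation A := (tensor4 K m).
Local Notation M := (m%:R : K).
Hypothesis m_gt2 : (2 < m)%N.
Implicit Types (F G : A) (i j k l : I) (X Y N W Z : {vspace A}).

(* The irreducible modules of tensors of degree [q] in absolute value, numbered   *)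
(* as the components of the graded module.                                       *)
Definition lvl (q : nat) : A -> Prop :=
  match q with 2 => @curv K m | 1 => @hookish K m | 0 => @riem0 K m | _ => fun F => F = 0 end.

Definition mods (q s : nat) : A -> Prop :=
  match q, s with
  | 2, 0 => @curv K m
  | 1, 0 => @lam K m
  | 1, 1 => @hook K m
  | 0, 0 => @triv0 K m
  | 0, 1 => @sl0 K m
  | 0, 2 => @alt0 K m
  | 0, 3 => @sym0 K m
  | _, _ => fun F => F = 0
  end.

Definition opq (q : nat) := @op K m (q != 0)%N (q == 2)%N.

Definition trace_part F (i j : I) : K := M^-1 * zz F * dl K i j.

(** Each trace is lifted back by its equivariant section; the trace-free components are what is left
    after subtracting the lifts. *)
Definition pr (q s : nat) F : A :=
  match q, s with
  | 2, 0 => F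
  | 1, 0 => (2 * (M + 1))^-1 *: iota1 (z1 F)
  | 1, 1 => F - (2 * (M + 1))^-1 *: iota1 (z1 F)
  | 0, 0 => iota0 (trace_part F)
  | 0, 1 => iota0 (fun i j => z0 F i j - trace_part F i j)
  | 0, 2 => mkA (fun i j k l => altB F i j k l - iotaL (z0 F) (zz F) i j k l)
  | 0, 3 => mkA (fun i j k l => symB F i j k l - iotaS (z0 F) (zz F) i j k l)
  | _, _ => 0
  end.

Definition valid (q s : nat) : bool := (q, s) \in
  [:: (2, 0); (1, 0); (1, 1); (0, 0); (0, 1); (0, 2); (0, 3)]%N.

Lemma validP (P : nat -> nat -> Prop) :
  P 2 0 -> P 1 0 -> P 1 1 -> P 0 0 -> P 0 1 -> P 0 2 -> P 0 3 ->
  forall q s, valid q s -> P q s.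
Proof.
by move=> ? ? ? ? ? ? ? q s; rewrite /valid !inE;
  do !(case/orP => [/eqP [-> ->] //|]); move=> /eqP [-> ->].
Qed.

Lemma zero_lin : lin_closed (fun F : A => F = 0).
Proof. by split=> // x F G -> ->; rewrite scaler0 addr0. Qed.

Lemma mods_lin q s : lin_closed (mods q s).
Proof.
case: q => [|[|[|q]]] /=; [|case: s => [|[|s]]|case: s|exact: zero_lin].
- case: s => [|[|[|[|s]]]]; [exact: triv0_lin | exact: sl0_lin | exact: alt0_lin
   | exact: sym0_lin | exact: zero_lin].
- exact: lam_lin.
- exact: hook_lin.
- exact: zero_lin.
- exact: curv_lin.
- by move=> _; exact: zero_lin.
Qed.

Lemma lvl_lin q : lin_closed (lvl q).
Proof.
case: q => [|[|[|q]]] /=; [exact: riem0_lin | exact: hookish_lin | exact: curv_lin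
 | exact: zero_lin].
Qed.

Lemma mods_lvl q s F : mods q s F -> lvl q F.
Proof.
have z : lvl q 0 by case: (lvl_lin q).
case: q z => [|[|[|q]]] z /=; [|case: s => [|[|s]]|case: s|] => /=; rewrite ?/lam ?/hook;
  try (by case); try (by move=> ->); try (by move=> ? ->); try by [].
by case: s => [|[|[|[|s]]]]; rewrite ?/triv0 ?/sl0 ?/alt0 ?/sym0; try (by case); move=> ->.
Qed.

Lemma lvl_op q ab F : lvl q F -> lvl q (opq q ab F).
Proof.
case: q => [|[|[|q]]]; [exact: riem0_op | exact: hookish_op | exact: curv_op |].
move=> ->; apply/evP => i j k l; rewrite !ev_mkA /slot /= !ev0; ring.
Qed.

Lemma tr2_trace_part F : tr2 (trace_part F) = zz F.
Proof.
rewrite /tr2 /trace_part; under eq_bigr => i _ do rewrite dlii mulr1.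
by rewrite sum_const mulrA mulfV ?mul1r ?M0n.
Qed.

Lemma iota0_lin (x : K) T S i j k l :
  ev (@iota0 K m (fun i j => x * T i j + S i j)) i j k l
  = x * ev (iota0 T) i j k l + ev (iota0 S) i j k l.
Proof.
have E : tr2 (fun i j => x * T i j + S i j) = x * tr2 T + tr2 S.
  by rewrite /tr2 -sum_lin.
by rewrite !ev_mkA /iotaS /iotaL E; ring.
Qed.

Lemma iota0_ext (T S : I -> I -> K) : (forall i j, T i j = S i j) -> iota0 T = iota0 S.
Proof.
move=> h; have E : tr2 T = tr2 S by apply: eq_bigr => i _; rewrite h.
by apply/evP => i j k l; rewrite !ev_mkA /iotaS /iotaL !h E.
Qed.

Lemma iota0_0 : @iota0 K m (fun _ _ => 0) = 0.
Proof.
have E : @tr2 K m (fun _ _ => 0) = 0 by rewrite /tr2 big1.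
by apply/evP => i j k l; rewrite !ev_mkA /iotaS /iotaL E ev0; ring.
Qed.

Lemma trace_part_lin x F G i j :
  trace_part (x *: F + G) i j = x * trace_part F i j + trace_part G i j.
Proof. by rewrite /trace_part zz_lin; ring. Qed.

Lemma pr_linear q s : linear (pr q s).
Proof.
move=> x F G; have Z : (0 : A) = x *: 0 + 0 by rewrite scaler0 addr0.
case: q => [|[|[|q]]] //=; last by case: s.
  case: s => [|[|[|[|s]]]] //.
  - apply/evP => i j k l; rewrite ev_lin -iota0_lin; apply/evP: i j k l.
    by apply: iota0_ext => i j; exact: trace_part_lin.
  - apply/evP => i j k l; rewrite ev_lin -iota0_lin; apply/evP: i j k l.
    by apply: iota0_ext => i j; rewrite trace_part_lin z0_lin; ring.
  - apply/evP => i j k l; rewrite ev_lin !ev_mkA /altB /iotaL !array_lin; ring.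
  - apply/evP => i j k l; rewrite ev_lin !ev_mkA /symB /iotaS !array_lin; ring.
have E : iota1 (z1 (x *: F + G)) = x *: iota1 (z1 F) + iota1 (z1 G).
  by apply/evP => i j k l; rewrite ev_lin !ev_mkA !array_lin; ring.
case: s => [|[|s]] //; rewrite E; apply/evP => i j k l; rewrite !(ev_lin, evN, evD, evZ); ring.
Qed.

Lemma sum_symB F j l : riem0 F -> \sum_i symB F i j i l = 3 / 4 * z0 F j l.
Proof.
move=> [h1 h2]; rewrite /symB -mulr_suml big_split /= -/(z0 F j l).
have -> : \sum_i ev F i j l i = \sum_i ev F j i i l by apply: eq_bigr => i _; rewrite h1.
by rewrite {1}h2; rewrite h2; field.
Qed.

Lemma sum_altB F j l : riem0 F -> \sum_i altB F i j i l = 1 / 4 * z0 F j l.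
Proof.
move=> rF; have -> : \sum_i altB F i j i l = z0 F j l - \sum_i symB F i j i l.
  by rewrite -sumrB; apply: eq_bigr => i _; rewrite /symB /altB; field.
by rewrite sum_symB //; field.
Qed.

Lemma pr_mods q s F : lvl q F -> mods q s (pr q s F).
Proof.
case: q => [|[|[|q]]] //=; last by case: s.
  move=> rF; have [h1 h2] := rF; case: s => [|[|[|[|s]]]] //=.
  - split; first exact: riem0_iota0.
    split; [exact: hasS_iota0 | exact: hasL_iota0 |].
    by move=> j l; rewrite z0_iota0 // zz_iota0 // tr2_trace_part.
  - split; first exact: riem0_iota0.
    split; [exact: hasS_iota0 | exact: hasL_iota0 |].
    by rewrite zz_iota0 // /tr2 sumrB -/(tr2 (trace_part F)) tr2_trace_part subrr.
  - set G := mkA _.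
    have s34 : sk34 G by move=> i j k l; rewrite !ev_mkA /altB /iotaL; ring.
    have s12 : sk12 G.
      by move=> i j k l; rewrite !ev_mkA /altB /iotaL (h1 i j l k) (h1 i j k l); ring.
    have z i j : z0 G i j = 0.
      rewrite /z0; under eq_bigr => k _ do rewrite ev_mkA.
      by rewrite sumrB sum_altB // (sum_iotaL m_gt2) subrr.
    split=> //; split=> [i j k l|j l]; first by rewrite s34 s12 opprK.
    under [in RHS]eq_bigr => k _ do rewrite s12.
    by rewrite sumrN -/(z0 G j l) z oppr0 mulr0.
  - set G := mkA _.
    have s34 : sy34 G by move=> i j k l; rewrite !ev_mkA /symB /iotaS; ring.
    have s12 : sy12 G.
      by move=> i j k l; rewrite !ev_mkA /symB /iotaS (h1 i j l k) (h1 i j k l); ring.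
    have z i j : z0 G i j = 0.
      rewrite /z0; under eq_bigr => k _ do rewrite ev_mkA.
      by rewrite sumrB sum_symB // (sum_iotaS m_gt2) subrr.
    split=> //; split=> [i j k l|j l]; first by rewrite s34 s12.
    under [in RHS]eq_bigr => k _ do rewrite s12.
    by rewrite -/(z0 G j l) z mulr0.
move=> hF; have [s12 b t] := hF.
have lF : lam ((2 * (M + 1))^-1 *: iota1 (z1 F)).
  have := lam_iota1 m_gt2 (fun i j => z1_skew i j s12).
  by move=> h; rewrite -[X in lam X]addr0; case: (@lam_lin K m) => h0 hD; apply: hD.
have zH i j : z1 ((2 * (M + 1))^-1 *: iota1 (z1 F)) i j = z1 F i j.
  rewrite -[X in z1 X]addr0 z1_lin z1_0 z1_iota1 // => [|i' j']; last exact: z1_skew.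
  by field; rewrite Mp1n.
case: s => [|[|s]] //=; set H := (_ *: _) in lF zH *.
have -> : F - H = (-1) *: H + F by rewrite scaleN1r addrC.
case: (@hookish_lin K m) => h0 hD; split; first by apply: hD => //; case: lF.
by move=> i j; rewrite z1_lin zH mulN1r addNr.
Qed.

Lemma hasS_of0 F : (forall i j, z0 F i j = 0) -> sk34 F -> hasS F.
Proof.
move=> z s i j k l; have zF : zz F = 0 by rewrite /zz big1.
by rewrite /symB s /iotaS zF !z; ring.
Qed.

Lemma hasL_of0 F : (forall i j, z0 F i j = 0) -> sy34 F -> hasL F.
Proof.
move=> z s i j k l; have zF : zz F = 0 by rewrite /zz big1.
by rewrite /altB s /iotaL zF !z; ring.
Qed.

Lemma hasSP F : hasS F <-> pr 0 3 F = 0.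
Proof.
split=> [h|/evP h i j k l]; last by have := h i j k l; rewrite ev_mkA ev0 => /eqP; rewrite subr_eq0 => /eqP.
by apply/evP => i j k l; rewrite ev_mkA h subrr ev0.
Qed.

Lemma hasLP F : hasL F <-> pr 0 2 F = 0.
Proof.
split=> [h|/evP h i j k l]; last by have := h i j k l; rewrite ev_mkA ev0 => /eqP; rewrite subr_eq0 => /eqP.
by apply/evP => i j k l; rewrite ev_mkA h subrr ev0.
Qed.

Lemma hasZP F : hasZ F <-> pr 0 1 F = 0.
Proof.
split=> [h|h j l].
  rewrite /pr -[RHS]iota0_0; apply: iota0_ext => i j; rewrite h /trace_part; ring.
apply: subr0_eq.
by rewrite -[LHS](z0_iota0 m_gt2 (fun i j => z0 F i j - trace_part F i j)) -/(pr 0 1 F) h z0_0.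
Qed.

Lemma zzP F : zz F = 0 <-> pr 0 0 F = 0.
Proof.
split=> [h|h].
  by rewrite /pr -[RHS]iota0_0; apply: iota0_ext => i j; rewrite /trace_part h mulr0 mul0r.
by rewrite -tr2_trace_part -(zz_iota0 m_gt2) -/(pr 0 0 F) h zz_0.
Qed.

Lemma z1P F : hookish F -> (forall i j, z1 F i j = 0) <-> pr 1 0 F = 0.
Proof.
move=> [s _ _]; split=> [h|h i j].
  by apply/evP => i j k l; rewrite evZ ev_mkA !h ev0; ring.
apply: (@cancel0 _ 1); first exact: (num_neq0 K 0).
have := z1_iota1 i j (fun i j => z1_skew i j s).
have -> : iota1 (z1 F) = 0.
  move/eqP: h; rewrite scaler_eq0 invr_eq0 mulf_eq0 (negPf (Mp1n K m_gt2)).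
  by rewrite (negPf (num_neq0 K 1)) /= => /eqP.
rewrite z1_0 => /esym; rewrite mul1r; apply: cancel0.
by rewrite mulf_neq0 ?Mp1n ?(num_neq0 K 1).
Qed.

Lemma pr_mods0 q s r F : valid q s -> mods q r F -> r != s -> pr q s F = 0.
Proof.
have pr0 q' s' : pr q' s' 0 = 0.
  by have := @pr_linear q' s' (-1) 0 0; rewrite scaler0 add0r scaleN1r addNr.
move: q s; apply: validP.
- by case: r.
- case: r => [|[|r]] //=; [by case=> hF z _; exact: (proj1 (z1P hF) z) | by move=> -> _; exact: (pr0 1 0)%N].
- case: r => [|[|r]] //= hF _; last by rewrite hF; exact: (pr0 1 1)%N.
  by case: hF => _ h; apply/evP => i j k l; rewrite evD evN evZ -h subrr ev0.
- case: r => [|[|[|[|r]]]] //= h _; apply/zzP; last by rewrite h zz_0.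
  + by case: h => _ [].
  + by case: h => _ [_ z]; rewrite /zz big1.
  + by case: h => _ [_ z]; rewrite /zz big1.
- case: r => [|[|[|[|r]]]] //= h _; apply/hasZP; last by rewrite h; case: (@hasZ_lin K m).
  + by case: h => _ [].
  + by case: h => _ [_ z] j l; rewrite z /zz big1 ?mulr0 ?mul0r.
  + by case: h => _ [_ z] j l; rewrite z /zz big1 ?mulr0 ?mul0r.
- case: r => [|[|[|[|r]]]] //= h _; apply/hasLP; last by rewrite h; case: (@hasL_lin K m).
  + by case: h => _ [].
  + by case: h => _ [].
  + by case: h => _ [s z]; apply: hasL_of0.
- case: r => [|[|[|[|r]]]] //= h _; apply/hasSP; last by rewrite h; case: (@hasS_lin K m).
  + by case: h => _ [].
  + by case: h => _ [].
  + by case: h => _ [s z]; apply: hasS_of0.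
Qed.

Definition inds (q : nat) : seq nat :=
  match q with 0 => [:: 0; 1; 2; 3] | 1 => [:: 0; 1] | 2 => [:: 0] | _ => [::] end%N.

Lemma pr_sum q F : lvl q F -> F = \sum_(s <- inds q) pr q s F.
Proof.
case: q => [|[|[|q]]] //= h; rewrite ?big_cons ?big_nil ?addr0 //.
  have E : iota0 (fun i j => z0 F i j - trace_part F i j) + iota0 (trace_part F) = iota0 (z0 F).
    apply/evP => i j k l; rewrite evD -[X in X + _]mul1r -iota0_lin; apply/evP: i j k l.
    by apply: iota0_ext => i j; ring.
  rewrite addrA [pr 0 0 F + _]addrC E; apply/evP => i j k l.
  by rewrite !evD !ev_mkA /symB /altB -/(zz F) -[tr2 (z0 F)]/(zz F); field.
by rewrite addrC subrK.
Qed.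

End Decomposition.

(** * Invariant subspaces of a whole degree *)

Section Dichotomy.
Variables (K : numClosedFieldType) (m : nat).
Local Notation I := 'I_m.
Local Notation A := (tensor4 K m).
Hypothesis m_gt2 : (2 < m)%N.
Implicit Types (F G : A) (i j k l : I) (X Y N W Z : {vspace A}).
Local Notation lv q := (vsof (@lvl K m q)).
Local Notation md q s := (vsof (@mods K m q s)).

Lemma mem_lv q F : F \in lv q <-> lvl q F.
Proof. by apply: vsofP; exact: lvl_lin. Qed.

Lemma mem_md q s F : F \in md q s <-> mods q s F.
Proof. by apply: vsofP; exact: mods_lin. Qed.

Lemma ex_three : exists e0 e1 w : I, [/\ e0 != e1, e0 != w & e1 != w].
Proof.
have m0 : (0 < m)%N by exact: leq_trans m_gt2.
have m1 : (1 < m)%N by exact: leq_trans m_gt2.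
by exists (Ordinal m0), (Ordinal m1), (Ordinal m_gt2).
Qed.

Lemma ex_four : (3 < m)%N -> exists e0 e1 w v : I,
  [/\ e0 != e1, e0 != w & e1 != w] /\ [/\ e0 != v, e1 != v & v != w].
Proof.
move=> m3; have m0 : (0 < m)%N by exact: leq_trans m_gt2.
have m1 : (1 < m)%N by exact: leq_trans m_gt2.
by exists (Ordinal m0), (Ordinal m1), (Ordinal m_gt2), (Ordinal m3).
Qed.

(** At m = 3 the dimension formula reads 4 d + 54 + 27 = 81. *)
Lemma alt0_three F : m = 3%N -> alt0 F -> F = 0.
Proof.
move=> m3 hF; have := dim_alt0 K m_gt2; have FV : F \in vsof (@alt0 K m).
  by apply/vsofP; first exact: alt0_lin.
case: (eqVneq (vsof (@alt0 K m)) 0%VS) FV => [->|nF] FV; last first.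
  by move: nF; rewrite -dimv_eq0 -lt0n; lia.
by move: FV; rewrite memv0 => /eqP.
Qed.

Lemma vsof_alt0_three : m = 3%N -> vsof (@alt0 K m) = 0%VS.
Proof.
move=> m3; apply: vs0P => F /(vsofP _ (@alt0_lin K m)) h.
by rewrite (alt0_three m3 h) mem0v.
Qed.

Lemma md_simple q s : valid q s -> simple (opq q) (md q s).
Proof.
have [e0 [e1 [w [n01 n0w n1w]]]] := ex_three.
move: q s; apply: validP.
- exact: hw_simple (hw_curv K m_gt2 n01 n0w n1w).
- exact: hw_simple (hw_lam K m_gt2 n01 n0w n1w).
- exact: hw_simple (hw_hook K m_gt2 n01 n0w n1w).
- exact: hw_simple (hw_triv0 K m_gt2 n01).
- exact: hw_simple (hw_sl0 K m_gt2 n01 n0w n1w).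
- have [m3|m3] := ltnP 3 m; last first.
    rewrite /= vsof_alt0_three => [X|]; last by lia.
    by rewrite subv0 => /eqP -> _; left.
  have [f0 [f1 [x [v [[k01 k0w k1w] [k0v k1v kvw]]]]]] := ex_four m3.
  exact: hw_simple (hw_alt0 K m_gt2 k01 k0w k1w k0v k1v kvw).
- exact: hw_simple (hw_sym0 K m_gt2 n01 n0w n1w).
Qed.

Lemma md_op q s : invar (opq q) (md q s).
Proof.
have Z q' : invar (opq q') (0%VS : {vspace A}).
  move=> ab F; rewrite memv0 => /eqP ->; rewrite memv0; apply/eqP/evP => i j k l.
  by rewrite !ev_mkA /slot !ev0; do !case: ifP => _; ring.
have Z' (P : A -> Prop) q' : (forall F, P F <-> F = 0) -> invar (opq q') (vsof P).
  move=> h; suff -> : vsof P = 0%VS by exact: Z.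
  have cP : lin_closed P by split=> [|x F G /h -> /h ->]; apply/h; rewrite ?scaler0 ?addr0.
  by apply: vs0P => F /(vsofP _ cP)/h ->; rewrite mem0v.
case: q => [|[|[|q]]]; [|case: s => [|[|s]]|case: s => [|s]|];
  try (by apply: Z').
- case: s => [|[|[|[|s]]]]; try (by apply: Z').
  + by apply: invar_vsof; [exact: triv0_lin | exact: triv0_op].
  + by apply: invar_vsof; [exact: sl0_lin | exact: sl0_op].
  + by apply: invar_vsof; [exact: alt0_lin | exact: alt0_op].
  + by apply: invar_vsof; [exact: sym0_lin | exact: sym0_op].
- by apply: invar_vsof; [exact: lam_lin | exact: lam_op].
- by apply: invar_vsof; [exact: hook_lin | exact: hook_op].
- by apply: invar_vsof; [exact: curv_lin | exact: curv_op].
Qed.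

Definition riemS F := riem0 F /\ hasS F.
Definition riemL F := riem0 F /\ (hasS F /\ hasL F).
Lemma riemS_lin : lin_closed riemS.
Proof. exact: lin_closedI (@riem0_lin K m) (@hasS_lin K m). Qed.
Lemma riemL_lin : lin_closed riemL.
Proof. exact: lin_closedI (@riem0_lin K m) (lin_closedI (@hasS_lin K m) (@hasL_lin K m)). Qed.

Lemma invar_riemS : invar (opq 0) (vsof riemS).
Proof.
apply: invar_vsof => [|ab F [r h]]; first exact: riemS_lin.
by split; [exact: riem0_op | exact: hasS_op].
Qed.
Lemma invar_riemL : invar (opq 0) (vsof riemL).
Proof.
apply: invar_vsof => [|ab F [r [h h']]]; first exact: riemL_lin.
by split; [exact: riem0_op | split; [exact: hasS_op | exact: hasL_op]].
Qed.

Lemma pr_0 q s : pr q s (0 : A) = 0.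
Proof. by have := @pr_linear K m q s (-1) 0 0; rewrite scaler0 add0r scaleN1r addNr. Qed.

Lemma validE q s : valid q s = (s \in inds q).
Proof. by rewrite /valid; case: q => [|[|[|q]]]; rewrite !inE !xpair_eqE /= ?orbF. Qed.

Lemma uniq_inds q : uniq (inds q).
Proof. by case: q => [|[|[|q]]]. Qed.

Lemma pr_fix q s F : valid q s -> mods q s F -> pr q s F = F.
Proof.
move=> v hF; rewrite [RHS](pr_sum (mods_lvl hF)).
rewrite (bigD1_seq s) ?uniq_inds -?validE //= big1_seq ?addr0 // => r.
rewrite -validE => /andP [rs vr]; apply: (pr_mods0 m_gt2 vr hF).
by rewrite eq_sym.
Qed.

Lemma riem0_split F : riem0 F ->
  F = pr 0 3 F + (F - pr 0 3 F) /\ riemS (F - pr 0 3 F).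
Proof.
move=> rF; split; first by rewrite addrC subrK.
have h3 := @pr_mods K m m_gt2 0 3 F rF; split.
  rewrite -scaleN1r addrC; case: (@riem0_lin K m) => _ hD; apply: hD => //.
  exact: (@mods_lvl K m 0 3).
apply/(hasSP _); rewrite -scaleN1r addrC pr_linear scaleN1r.
by rewrite (@pr_fix 0 3 (pr 0 3 F)) // addNr.
Qed.

Lemma riemS_split F : riemS F ->
  F = pr 0 2 F + (F - pr 0 2 F) /\ riemL (F - pr 0 2 F).
Proof.
move=> [rF hS]; split; first by rewrite addrC subrK.
have h2 := @pr_mods K m m_gt2 0 2 F rF; split.
  rewrite -scaleN1r addrC; case: (@riem0_lin K m) => _ hD; apply: hD => //.
  exact: (@mods_lvl K m 0 2).
split; [apply/(hasSP _) | apply/(hasLP _)]; rewrite -scaleN1r addrC pr_linear scaleN1r.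
  by rewrite (pr_mods0 m_gt2 (r := 2) _ h2) // (proj1 (hasSP _) hS) oppr0 add0r.
by rewrite (@pr_fix 0 2 (pr 0 2 F)) // addNr.
Qed.

Lemma riemL_split F : riemL F ->
  F = pr 0 1 F + pr 0 0 F /\ triv0 (pr 0 0 F) /\ sl0 (pr 0 1 F).
Proof.
move=> [rF [hS hL]]; split; last first.
  by split; [exact: (@pr_mods K m m_gt2 0 0 F rF) | exact: (@pr_mods K m m_gt2 0 1 F rF)].
rewrite {1}(pr_sum (q := 0) rF) [inds 0]/= !big_cons big_nil.
by rewrite (proj1 (hasSP F) hS) (proj1 (hasLP F) hL) !addr0 addrC.
Qed.

(* An invariant subspace of a level contains each simple module or projects to 0 *)
(* on it: the simple modules are split off one by one.                           *)
Lemma dichotomy q s Z : valid q s -> invar (opq q) Z -> (Z <= lv q)%VS ->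
  (md q s <= Z)%VS \/ forall F, F \in Z -> pr q s F = 0.
Proof.
have [e0 [e1 [w [n01 n0w n1w]]]] := ex_three.
have prD q' s' F G : pr q' s' (F + G) = pr q' s' F + pr q' s' G.
  by rewrite -[F in LHS]scale1r pr_linear scale1r.
move=> vqs iZ sZ; have sl := @md_simple q s vqs.
have cap : (Z :&: md q s)%VS = 0%VS \/ (md q s <= Z)%VS.
  case: (sl (Z :&: md q s)%VS (capvSr _ _) (invar_cap iZ (@md_op q s))) => [|<-]; first by left.
  by right; exact: capvSl.
have split_of q' s' (Y W : {vspace A}) F : (Y <= W)%VS \/ (Y = md q' s' + (Y :&: W))%VS ->
    F \in Y -> exists2 G, mods q' s' G & exists2 H, H \in (Y :&: W)%VS & F = G + H.
  case=> [h|h] FY.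
    exists 0; first by case: (@mods_lin K m q' s').
    by exists F; [rewrite memv_cap FY; exact: (subvP h) | rewrite add0r].
  move: FY; rewrite {1}h; case/memv_addP => G /mem_md mG [H HY ->].
  by exists G => //; exists H.
have [q0|[q1|q2]] : q = 0%N \/ q = 1%N \/ q = 2%N.
  by move: q s vqs {sl cap iZ sZ}; apply: validP; auto.
- subst q; have lin0 : forall ab, linear (@op K m false false ab) := @op_linear K m false false.
  have Z0E F : F \in Z -> riem0 F by move=> /(subvP sZ)/mem_lv.
  (* The order of removal matters: [sym0] by weight 4 of [dSym], next [alt0] by weight 4 of [dAlt],
     next [sl0] by weight 2 of [dSym]; each weight is absent from what remains, and [triv0] is
     left. *)
  have p3 : (Z <= vsof riemS)%VS \/ (Z = md 0 3 + (Z :&: vsof riemS))%VS.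
    apply: (hw_peel (hw_sym0 K m_gt2 n01 n0w n1w) invar_riemS iZ).
    - apply/subvP => F /Z0E rF; have [E h] := riem0_split rF; rewrite E.
      apply: memv_add; last by apply/vsofP; first exact: riemS_lin.
      by apply/(@mem_md 0 3)/pr_mods.
    - apply: vs0P => F; rewrite memv_cap.
      move=> /andP [/(@mem_md 0 3) h /(vsofP _ riemS_lin) [_ /hasSP h']].
      by rewrite -(@pr_fix 0 3 F) // h' mem0v.
    - move=> F /(vsofP _ riemS_lin) [_ hS] [[[i j] k] l] /eqP; exact: (hasS_weight m_gt2 n01 n0w n1w).
  pose Z2 := (Z :&: vsof riemS)%VS.
  have i2 : invar (opq 0) Z2 by apply: invar_cap => //; exact: invar_riemS.
  have e2 F := split_of 0%N 3%N Z _ F p3.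
  have p2 : (Z2 <= vsof riemL)%VS \/ (Z2 = md 0 2 + (Z2 :&: vsof riemL))%VS.
    have sub : (Z2 <= vsof (@alt0 K m) + vsof riemL)%VS.
      apply/subvP => F; rewrite memv_cap => /andP [_ /(vsofP _ riemS_lin) rF].
      have [E h] := riemS_split rF; rewrite E.
      apply: memv_add; last by apply/vsofP; first exact: riemL_lin.
      by case: rF => rF _; apply/(@mem_md 0 2)/pr_mods.
    (* For m = 3 four distinct indices are missing, but then [alt0] is zero and there is nothing to
       split off. *)
    have [m3|m3] := ltnP 3 m; last first.
      by left; move: sub; rewrite vsof_alt0_three ?add0v //; lia.
    have [f0 [f1 [x [v [[k01 k0w k1w] [k0v k1v kvw]]]]]] := ex_four m3.
    apply: (hw_peel (hw_alt0 K m_gt2 k01 k0w k1w k0v k1v kvw) invar_riemL i2 sub).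
    - apply: vs0P => F; rewrite memv_cap.
      move=> /andP [/(@mem_md 0 2) h /(vsofP _ riemL_lin) [_ [_ /hasLP h']]].
      by rewrite -(@pr_fix 0 2 F) // h' mem0v.
    - move=> F /(vsofP _ riemL_lin) [_ [hS hL]] [[[i j] k] l] /eqP; exact: (iota_weight m_gt2 k01 k0w k1w k0v k1v kvw).
  pose Z1 := (Z2 :&: vsof riemL)%VS.
  have i1 : invar (opq 0) Z1 by apply: invar_cap => //; exact: invar_riemL.
  have e1' F := split_of 0%N 2%N Z2 _ F p2.
  have Z21 : (Z1 <= Z2)%VS := capvSl _ _.
  have Z2Z : (Z2 <= Z)%VS := capvSl _ _.
  have p1 : (Z1 <= md 0 0)%VS \/ (Z1 = md 0 1 + (Z1 :&: md 0 0))%VS.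
    apply: (hw_peel (hw_sl0 K m_gt2 n01 n0w n1w) (@md_op 0 0) i1).
    - apply/subvP => F; rewrite memv_cap => /andP [_ /(vsofP _ riemL_lin) rF].
      have [E [h0 h1]] := riemL_split rF; rewrite E.
      by apply: memv_add; [apply/(@mem_md 0 1) | apply/(@mem_md 0 0)].
    - apply: vs0P => F; rewrite memv_cap.
      move=> /andP [/(@mem_md 0 1) h /(@mem_md 0 0) h'].
      by rewrite -(@pr_fix 0 1 F) // (pr_mods0 m_gt2 (r := 0)) ?mem0v.
    - move=> F /(@mem_md 0 0) tF [[[i j] k] l] /eqP; exact: (triv0_weight m_gt2 n01 n0w n1w).
  have e0' F := split_of 0%N 1%N Z1 _ F p1.
  have prm r F : valid 0 r -> valid 0 s -> mods 0 r F -> r != s -> pr 0 s F = 0.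
    by move=> _ vs h ne; apply: (pr_mods0 m_gt2 vs h).
  have : s = 3%N \/ s = 2%N \/ s = 1%N \/ s = 0%N.
    by move: vqs; rewrite validE !inE => /or4P [] /eqP ->; auto.
  case=> [s3|[s2|[s1|s0]]].
  + subst s; case: p3 => [h|->]; [right=> F FZ | by left; exact: addvSl].
    by apply/hasSP; case: (proj1 (vsofP _ riemS_lin) (subvP h _ FZ)).
  + subst s; case: p2 => [h|h]; [right=> F FZ | left].
      have [G mG [H HZ ->]] := e2 F FZ; rewrite prD (prm 3 G) // add0r.
      by apply/hasLP; case: (proj1 (vsofP _ riemL_lin) (subvP h _ HZ)) => _ [].
    by apply: subv_trans Z2Z; rewrite h addvSl.
  + subst s; case: p1 => [h|h]; [right=> F FZ | left].
      have [G mG [H HZ ->]] := e2 F FZ; rewrite prD (prm 3 G) // add0r.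
      have [G' mG' [H' HZ' ->]] := e1' H HZ; rewrite prD (prm 2 G') // add0r.
      by apply: (prm 0) => //; apply/mem_md/(subvP h).
    by apply: subv_trans Z2Z; apply: subv_trans Z21; rewrite h addvSl.
  (* An element of [Z] is stripped of its other three components, all in [Z]; the rest lies in [Z]
     and in [triv0], hence is 0 in this case. *)
  + subst s; case: cap => [c0|]; [right=> F FZ | by left].
    have [G mG [H HZ ->]] := e2 F FZ; rewrite prD (prm 3 G) // add0r.
    have [G' mG' [H' HZ' ->]] := e1' H HZ; rewrite prD (prm 2 G') // add0r.
    have [G2 mG2 [H2 HZ2 ->]] := e0' H' HZ'; rewrite prD (prm 1 G2) // add0r.
    have : H2 \in (Z :&: md 0 0)%VS.
      apply: (subvP _ _ HZ2); apply: capvS; last exact: subvv.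
      exact: subv_trans Z21 Z2Z.
    by rewrite c0 memv0 => /eqP ->; exact: pr_0.
- subst q.
  have p1 : (Z <= md 1 0)%VS \/ (Z = md 1 1 + (Z :&: md 1 0))%VS.
    apply: (hw_peel (hw_hook K m_gt2 n01 n0w n1w) (@md_op 1 0) iZ).
    - apply/subvP => F /(subvP sZ)/mem_lv hF; rewrite (pr_sum hF) [inds 1]/=.
      rewrite !big_cons big_nil addr0 addrC.
      apply: memv_add; [apply/(@mem_md 1 1) | apply/(@mem_md 1 0)];
       exact: pr_mods.
    - apply: vs0P => F; rewrite memv_cap.
      move=> /andP [/(@mem_md 1 1) h /(@mem_md 1 0) h'].
      by rewrite -(@pr_fix 1 1 F) // (pr_mods0 m_gt2 (r := 0)) ?mem0v.
    - move=> F /(@mem_md 1 0) tF [[[i j] k] l] /eqP; exact: (lam_weight m_gt2 n01 n0w n1w).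
  have : s = 1%N \/ s = 0%N by move: vqs; rewrite validE !inE => /orP [] /eqP ->; auto.
  case=> ?; subst s.
    case: p1 => [h|->]; [right=> F FZ | by left; exact: addvSl].
    by apply: (pr_mods0 m_gt2 (r := 0)) => //; apply/mem_md/(subvP h).
  case: cap => [c0|]; [right=> F | by left].
  have h1 G : mods 1 1 G -> pr 1 0 G = 0 by move=> hG; apply: (pr_mods0 m_gt2 (r := 1)).
  case: p1 => [h FZ|->]; last first.
    case/memv_addP => G /mem_md mG [H]; rewrite c0 memv0 => /eqP -> ->.
    by rewrite addr0 h1.
  have : F \in (Z :&: md 1 0)%VS by rewrite memv_cap FZ (subvP h).
  by rewrite c0 memv0 => /eqP ->; apply: h1; case: (@mods_lin K m 1 1).
- subst q; have ? : s = 0%N by move: vqs; rewrite validE !inE => /eqP.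
  subst s; case: cap => [c0|]; [right=> F FZ | by left].
  have : F \in (Z :&: md 2 0)%VS.
    by rewrite memv_cap FZ; apply/(@mem_md 2 0)/(@mem_lv 2)/(subvP sZ).
  by rewrite c0 memv0 => /eqP ->.
Qed.

End Dichotomy.

(** * Tensors in a frame adapted to the splitting of V *)

Section Frame.
Variables (K : numClosedFieldType) (m n : nat) (g : 'M[K]_n)
  (fr : bool -> 'I_m -> 'rV[K]_n).
Local Notation I := 'I_m.
Local Notation P := (bool * I)%type.
Local Notation T := (tensor4 K n).
Implicit Types (C : T) (p q r s x y : P) (h : P -> P -> P -> P -> K).

Definition frm p : 'rV[K]_n := fr p.1 p.2.
Definition st p : P := (~~ p.1, p.2).
Definition dp p q : K := (p == q)%:R.

(** A hyperbolic basis: with e_i for [frm (true, i)] and f_i for [frm (false, i)], e_i pairs to 1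
    with f_i and to 0 with all others. The expansion formula stands in for the basis property. *)
Definition frame : Prop :=
  [/\ g^T = g, g \in unitmx,
      forall p q, (frm p *m g *m (frm q)^T) 0 0 = dp p (st q)
    & forall v : 'rV[K]_n, v = \sum_p (v *m g *m (frm (st p))^T) 0 0 *: frm p].

Hypothesis frameP : frame.

Lemma stK : involutive st. Proof. by case=> s i; rewrite /st /= negbK. Qed.

Lemma dpp p : dp p p = 1. Proof. by rewrite /dp eqxx. Qed.
Lemma dpC p q : dp p q = dp q p. Proof. by rewrite /dp eq_sym. Qed.
Lemma dp_st p q : dp (st p) q = dp p (st q).
Proof. by rewrite /dp (can2_eq stK stK). Qed.

Lemma sum_dp p (f : P -> K) : \sum_q dp p q * f q = f p.
Proof.
rewrite (bigD1 p) //= dpp mul1r big1 ?addr0 // => q qp.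
by rewrite /dp eq_sym (negPf qp) mul0r.
Qed.

Lemma sum_dpC p (f : P -> K) : \sum_q dp q p * f q = f p.
Proof. by under eq_bigr => q _ do rewrite dpC; rewrite sum_dp. Qed.

Definition vf p (a : 'I_n) : K := frm p 0 a.
(** The covector dual to [frm p]: its partner [frm (st p)] with the index lowered. *)
Definition cf p (a : 'I_n) : K := (frm (st p) *m g) 0 a.

Lemma vf_cf p q : \sum_a vf p a * cf q a = dp p q.
Proof.
have [gT _ G _] := frameP; have := G (st q) p; rewrite dp_st stK dpC => <-.
by rewrite mxE; apply: eq_bigr => a _; rewrite [X in _ = _ * X]mxE mulrC.
Qed.

Lemma cf_vf a b : \sum_p cf p a * vf p b = (a == b)%:R.
Proof.
have [_ _ _ /(_ (delta_mx 0 a))] := frameP; move/matrixP => /(_ 0 b).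
have [gT _ _ _] := frameP.
rewrite mxE eqxx /= eq_sym => ->; rewrite summxE; apply: eq_bigr => p _.
rewrite mxE; congr (_ * _); transitivity ((frm (st p) *m g)^T a 0); first by rewrite mxE.
by rewrite trmx_mul gT -mulmxA -rowE [RHS]mxE.
Qed.

(** [Sv] evaluates an abstract index on a frame vector and [Sc] passes back; iterated over the slots
    they convert tensors into frame components and conversely. *)
Definition Sv p (f : 'I_n -> K) : K := \sum_a vf p a * f a.
Definition Sc (a : 'I_n) (f : P -> K) : K := \sum_p cf p a * f p.

Lemma Sv_Sc p f : Sv p (fun a => Sc a f) = f p.
Proof.
rewrite /Sv /Sc -[RHS](sum_dp p f).
under eq_bigr => a _ do rewrite mulr_sumr.
rewrite exchange_big; apply: eq_bigr => q _; rewrite -vf_cf mulr_suml.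
by apply: eq_bigr => a _; rewrite mulrA.
Qed.

Lemma Sc_Sv a f : Sc a (fun p => Sv p f) = f a.
Proof.
rewrite /Sv /Sc; under eq_bigr => p _ do rewrite mulr_sumr.
rewrite exchange_big /=.
have e b : \sum_p cf p a * (vf p b * f b) = (a == b)%:R * f b.
  by under eq_bigr => p _ do rewrite mulrA; rewrite -mulr_suml cf_vf.
under eq_bigr => b _ do rewrite e.
by rewrite (bigD1 a) //= eqxx mul1r big1 ?addr0 // => b ba; rewrite eq_sym (negPf ba) mul0r.
Qed.

Lemma eq_Sv p f f' : (forall a, f a = f' a) -> Sv p f = Sv p f'.
Proof. by move=> e; apply: eq_bigr => a _; rewrite e. Qed.

Lemma eq_Sc a f f' : (forall p, f p = f' p) -> Sc a f = Sc a f'.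
Proof. by move=> e; apply: eq_bigr => p _; rewrite e. Qed.

Lemma SvD p f f' : Sv p (fun a => f a + f' a) = Sv p f + Sv p f'.
Proof. by rewrite /Sv -big_split; apply: eq_bigr => a _; rewrite mulrDr. Qed.

Lemma SvZ p c f : Sv p (fun a => c * f a) = c * Sv p f.
Proof. by rewrite /Sv mulr_sumr; apply: eq_bigr => a _; rewrite mulrCA. Qed.

Lemma Sv_sum (J : finType) p (f : J -> 'I_n -> K) :
  Sv p (fun a => \sum_j f j a) = \sum_j Sv p (f j).
Proof. by rewrite /Sv exchange_big; apply: eq_bigr => a _; rewrite mulr_sumr. Qed.

Lemma SvC p q (f : 'I_n -> 'I_n -> K) :
  Sv p (fun a => Sv q (f a)) = Sv q (fun b => Sv p (fun a => f a b)).
Proof.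
by rewrite {1}/Sv; under eq_bigr => a _ do rewrite -SvZ; rewrite -Sv_sum.
Qed.

Definition cm C p q r s : K :=
  Sv p (fun a => Sv q (fun b => Sv r (fun c => Sv s (fun d => C (a, b, c, d))))).

Definition mkT h : T := [ffun t => let: (a, b, c, d) := t in
  Sc d (fun s => Sc c (fun r => Sc b (fun q => Sc a (fun p => h p q r s))))].

Lemma cm_mkT h p q r s : cm (mkT h) p q r s = h p q r s.
Proof.
rewrite /cm; under eq_Sv => a do under eq_Sv => b do under eq_Sv => c do
  under eq_Sv => d do rewrite ffunE.
under eq_Sv => a do under eq_Sv => b do under eq_Sv => c do rewrite Sv_Sc.
under eq_Sv => a do under eq_Sv => b do rewrite Sv_Sc.
by under eq_Sv => a do rewrite Sv_Sc; rewrite Sv_Sc.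
Qed.

Lemma mkT_cm C : mkT (cm C) = C.
Proof.
apply/ffunP => -[[[a b] c] d]; rewrite ffunE /cm.
under eq_Sc => s do under eq_Sc => r do under eq_Sc => q do rewrite Sc_Sv.
under eq_Sc => s do under eq_Sc => r do rewrite Sc_Sv.
by under eq_Sc => s do rewrite Sc_Sv; rewrite Sc_Sv.
Qed.

Lemma cmP C C' : (forall p q r s, cm C p q r s = cm C' p q r s) <-> C = C'.
Proof.
split=> [e|-> //]; rewrite -(mkT_cm C) -(mkT_cm C').
apply/ffunP => -[[[a b] c] d]; rewrite !ffunE; do 4!apply: eq_Sc => ?; exact: e.
Qed.

Lemma cm_lin k C C' p q r s : cm (k *: C + C') p q r s = k * cm C p q r s + cm C' p q r s.
Proof.
rewrite /cm -SvZ -SvD; apply: eq_Sv => a; rewrite -SvZ -SvD; apply: eq_Sv => b.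
rewrite -SvZ -SvD; apply: eq_Sv => c; rewrite -SvZ -SvD; apply: eq_Sv => d.
by rewrite !ffunE.
Qed.

Lemma cmD C C' p q r s : cm (C + C') p q r s = cm C p q r s + cm C' p q r s.
Proof. by rewrite -[C]scale1r cm_lin mul1r scale1r. Qed.

Lemma cm0 p q r s : cm 0 p q r s = 0.
Proof. by have := cm_lin (-1) 0 0 p q r s; rewrite scaler0 addr0 mulN1r addNr. Qed.

Lemma cmZ k C p q r s : cm (k *: C) p q r s = k * cm C p q r s.
Proof. by rewrite -[k *: C]addr0 cm_lin cm0 addr0. Qed.

Lemma cmN C p q r s : cm (- C) p q r s = - cm C p q r s.
Proof. by rewrite -scaleN1r cmZ mulN1r. Qed.

Lemma cm_sum (J : finType) (F : J -> T) p q r s :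
  cm (\sum_j F j) p q r s = \sum_j cm (F j) p q r s.
Proof.
apply: (big_morph (fun C => cm C p q r s)); [by move=> *; exact: cmD | exact: cm0].
Qed.

(* [rot p q] maps [frm p] to [frm q] and [frm (st q)] to [- frm (st p)].         *)
Definition rot p q : 'M[K]_n := 2 *: wedge g (frm (st p)) (frm q).

Lemma frm_endo p q x b :
  Sv x (fun a => endo g (rot p q) a b) = dp x p * vf q b - dp x (st q) * vf (st p) b.
Proof.
have [gT gU G _] := frameP.
have e : frm x *m endo g (rot p q) = dp x p *: frm q - dp x (st q) *: frm (st p).
  rewrite /endo /rot /wedge scalerA mulfV ?(num_neq0 K 1) // scale1r.
  rewrite mulmxA mulmxBr mulmxBl.
  have t u v : frm x *m tens_vec g u v *m invmx g = (frm x *m g *m u^T) 0 0 *: v.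
    rewrite /tens_vec trmx_mul gT !mulmxA mulmxK //.
    by rewrite [frm x *m g *m u^T]mx11_scalar mul_scalar_mx !mxE eqxx mulr1n.
  by rewrite !t !G stK.
have := congr1 (fun v : 'rV_n => v 0 b) e; rewrite !mxE => <-.
by apply: eq_bigr => a _.
Qed.

Lemma Sv_endo p q x (f : 'I_n -> K) :
  Sv x (fun a => \sum_e endo g (rot p q) a e * f e)
  = dp x p * Sv q f - dp x (st q) * Sv (st p) f.
Proof.
rewrite Sv_sum; transitivity (\sum_e (dp x p * (vf q e * f e) - dp x (st q) * (vf (st p) e * f e))).
  apply: eq_bigr => e _; rewrite -[LHS]mulr1 -[1]divr1.
  transitivity (Sv x (fun a => endo g (rot p q) a e) * f e).
    rewrite /Sv divr1 mulr1 mulr_suml; apply: eq_bigr => a _; ring.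
  by rewrite frm_endo; ring.
by rewrite sumrB -!mulr_sumr.
Qed.

(** The effect of [rot p q] on one index of the frame components. *)
Definition rop p q (h : P -> K) x : K := dp x p * h q - dp x (st q) * h (st p).

Lemma Sv_rop p q y x (f : 'I_n -> P -> K) :
  Sv y (fun a => rop p q (f a) x) = rop p q (fun z => Sv y (fun a => f a z)) x.
Proof.
rewrite /rop -!SvZ -mulN1r -SvZ -SvD; apply: eq_Sv => a; ring.
Qed.

Lemma cm_rot p q C x1 x2 x3 x4 : cm (act4 g (rot p q) C) x1 x2 x3 x4 =
  rop p q (fun x => cm C x x2 x3 x4) x1 + rop p q (fun x => cm C x1 x x3 x4) x2
  + rop p q (fun x => cm C x1 x2 x x4) x3 + rop p q (fun x => cm C x1 x2 x3 x) x4.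
Proof.
pose E a (f : 'I_n -> K) := \sum_e endo g (rot p q) a e * f e.
have SE x (f : 'I_n -> 'I_n -> K) a : Sv x (fun b => E a (fun e => f e b)) = E a (fun e => Sv x (f e)).
  by rewrite Sv_sum; apply: eq_bigr => e _; rewrite SvZ.
have RE x f : Sv x (fun a => E a f) = rop p q (fun y => Sv y f) x by rewrite Sv_endo.
transitivity (Sv x1 (fun a => Sv x2 (fun b => Sv x3 (fun c => Sv x4 (fun d =>
   E a (fun e => C (e, b, c, d)) + E b (fun e => C (a, e, c, d))
   + E c (fun e => C (a, b, e, d)) + E d (fun e => C (a, b, c, e))))))).
  by do 4!apply: eq_Sv => ?; rewrite ffunE /E -!big_split.
under eq_Sv => a do under eq_Sv => b do under eq_Sv => c do rewrite !SvD.
under eq_Sv => a do under eq_Sv => b do rewrite !SvD.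
under eq_Sv => a do rewrite !SvD.
rewrite !SvD; congr (_ + _ + _ + _).
- rewrite /cm -RE; apply: eq_Sv => a.
  rewrite -(SE x2 (fun e b => _)); apply: eq_Sv => b.
  by rewrite -(SE x3 (fun e c => _)); apply: eq_Sv => c; rewrite -(SE x4 (fun e d => _)).
- rewrite /cm -Sv_rop; apply: eq_Sv => a; rewrite -RE; apply: eq_Sv => b.
  by rewrite -(SE x3 (fun e c => _)); apply: eq_Sv => c; rewrite -(SE x4 (fun e d => _)).
- rewrite /cm -Sv_rop; apply: eq_Sv => a; rewrite -Sv_rop; apply: eq_Sv => b.
  by rewrite -RE; apply: eq_Sv => c; rewrite -(SE x4 (fun e d => _)).
- rewrite /cm -Sv_rop; apply: eq_Sv => a; rewrite -Sv_rop; apply: eq_Sv => b.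
  by rewrite -Sv_rop; apply: eq_Sv => c; rewrite -RE.
Qed.

Definition weyl_comp h : Prop :=
  [/\ forall p q r s, h q p r s = - h p q r s,
      forall p q r s, h p q s r = - h p q r s,
      forall p q r s, h p q r s + h q r p s + h r p q s = 0
    & forall q s, \sum_p h (st p) q p s = 0].

Lemma invmxE a b : invmx g a b = \sum_p vf p a * vf (st p) b.
Proof.
have [gT gU _ _] := frameP.
pose V := \matrix_(a, b) \sum_p vf (st p) a * vf p b : 'M[K]_n.
have VE : V = invmx g.
  apply: (can_inj (mulKmx gU)); rewrite mulmxV //; apply/matrixP => c d.
  rewrite !mxE; under eq_bigr => e _ do rewrite mxE mulr_sumr.
  rewrite exchange_big /= -cf_vf; apply: eq_bigr => p _; rewrite /cf mxE mulr_suml.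
  by apply: eq_bigr => e _; rewrite -{1}gT mxE mulrA [g e c * _]mulrC.
rewrite -VE mxE (reindex_inj (can_inj stK)) /=.
by apply: eq_bigr => p _; rewrite stK.
Qed.

Lemma natr6_neq0 : (6 : K) != 0. Proof. exact: (num_neq0 K 5). Qed.

(** A tensor fixed by the skew-symmetriser of both pairs is skew in each pair; for such tensors the
    full skew-symmetrisation over three indices is 2/6 of the cyclic sum. *)
Lemma mem_weylE C : C \in weyl g <->
  [/\ forall a b c d, C (b, a, c, d) = - C (a, b, c, d),
      forall a b c d, C (a, b, d, c) = - C (a, b, c, d),
      forall a b c d, C (a, b, c, d) + C (b, c, a, d) + C (c, a, b, d) = 0
    & forall b d, \sum_a \sum_e invmx g a e * C (e, b, a, d) = 0].
Proof.
rewrite /weyl !memv_cap !memv_ker !lfunE /=; split.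
  move=> /andP [/andP [/eqP/ffunP pC /eqP/ffunP bC] /eqP/ffunP tC].
  have E a b c d : C (a, b, c, d) = 4^-1 *
      (C (a, b, c, d) - C (a, b, d, c) - C (b, a, c, d) + C (b, a, d, c)) :> K.
    have := pC (a, b, c, d); rewrite !ffunE /skew2 => e.
    by apply: subr0_eq; rewrite -[RHS]e; field.
  have s1 a b c d : C (b, a, c, d) = - C (a, b, c, d).
    by change ((C (b, a, c, d) : K) = - C (a, b, c, d)); rewrite E [in RHS]E; ring.
  have s2 a b c d : C (a, b, d, c) = - C (a, b, c, d).
    by change ((C (a, b, d, c) : K) = - C (a, b, c, d)); rewrite E [in RHS]E; ring.
  split=> // [a b c d|b d]; last by have := tC (b, d); rewrite !ffunE.
  have := bC (a, b, c, d); rewrite !ffunE /skew3 => e.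
  apply: (@cancel0 _ (2 / 6)); first by rewrite mulf_neq0 ?invr_eq0 ?natr6_neq0 ?(num_neq0 K 1).
  by rewrite -[RHS]e (s1 a b c d) (s1 b c a d) (s1 c a b d); ring.
move=> [s1 s2 b t]; apply/andP; split; first (apply/andP; split).
- apply/eqP/ffunP => -[[[a b'] c] d]; rewrite !ffunE /skew2.
  by rewrite (s1 a b') (s1 a b' d c) (s2 a b' c d); field.
- apply/eqP/ffunP => -[[[a b'] c] d]; rewrite !ffunE /skew3.
  rewrite (s1 a b' c d) (s1 b' c a d) (s1 c a b' d).
  transitivity (3^-1 * (C (a, b', c, d) + C (b', c, a, d) + C (c, a, b', d)) : K).
    by field.
  by rewrite b mulr0.
- by apply/eqP/ffunP => -[b' d]; rewrite !ffunE t.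
Qed.

Lemma Sv_eq0 (f : 'I_n -> K) : (forall p, Sv p f = 0) <-> forall a, f a = 0.
Proof.
split=> [e a|e p]; last by rewrite /Sv big1 // => a _; rewrite e mulr0.
by rewrite -Sc_Sv /Sc big1 // => p _; rewrite e mulr0.
Qed.

Definition perm4 (f : 'I_n * 'I_n * 'I_n * 'I_n -> 'I_n * 'I_n * 'I_n * 'I_n) C : T :=
  [ffun t => C (f t)].

(** Each condition is an identity between tensors with permuted slots, and [cm] is injective; the
    inverse Gram matrix becomes the pairing of [p] with [st p]. *)
Lemma weylE C : C \in weyl g <-> weyl_comp (cm C).
Proof.
pose s12 : T := perm4 (fun t => let: (a, b, c, d) := t in (b, a, c, d)) C.
pose s34 : T := perm4 (fun t => let: (a, b, c, d) := t in (a, b, d, c)) C.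
pose c1 : T := perm4 (fun t => let: (a, b, c, d) := t in (b, c, a, d)) C.
pose c2 : T := perm4 (fun t => let: (a, b, c, d) := t in (c, a, b, d)) C.
have E12 p q r s : cm s12 p q r s = cm C q p r s.
  rewrite /cm [RHS]SvC; do 4!apply: eq_Sv => ?; by rewrite ffunE.
have E34 p q r s : cm s34 p q r s = cm C p q s r.
  rewrite /cm; do 2!apply: eq_Sv => ?; rewrite [RHS]SvC; do 2!apply: eq_Sv => ?.
  by rewrite ffunE.
have Ec1 p q r s : cm c1 p q r s = cm C q r p s.
  rewrite /cm; under [RHS]eq_Sv => a do rewrite SvC.
  rewrite [RHS]SvC; do 4!apply: eq_Sv => ?; by rewrite ffunE.
have Ec2 p q r s : cm c2 p q r s = cm C r p q s.
  rewrite /cm [RHS]SvC; apply: eq_Sv => a; rewrite [RHS]SvC; do 3!apply: eq_Sv => ?.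
  by rewrite ffunE.
have EP (X Y : T) : (forall a b c d, X (a, b, c, d) = Y (a, b, c, d)) <->
    forall p q r s, cm X p q r s = cm Y p q r s.
  rewrite cmP; split=> [e|-> //]; apply/ffunP => -[[[a b] c] d]; exact: e.
have i1 : (forall a b c d, C (b, a, c, d) = - C (a, b, c, d)) <->
    forall p q r s, cm C q p r s = - cm C p q r s.
  split=> e.
    by have := proj1 (EP s12 (- C)); move=> h p q r s; rewrite -E12 h ?cmN // => *; rewrite !ffunE e.
  have h := proj2 (EP s12 (- C)); move=> a b c d.
  by rewrite -[LHS](ffunE (fun t => C (let: (a, b, c, d) := t in (b, a, c, d))) (a, b, c, d)) h ?ffunE // => *; rewrite E12 cmN e.
have i2 : (forall a b c d, C (a, b, d, c) = - C (a, b, c, d)) <->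
    forall p q r s, cm C p q s r = - cm C p q r s.
  split=> e.
    by have := proj1 (EP s34 (- C)); move=> h p q r s; rewrite -E34 h ?cmN // => *; rewrite !ffunE e.
  have h := proj2 (EP s34 (- C)); move=> a b c d.
  by rewrite -[LHS](ffunE (fun t => C (let: (a, b, c, d) := t in (a, b, d, c))) (a, b, c, d)) h ?ffunE // => *; rewrite E34 cmN e.
have i3 : (forall a b c d, C (a, b, c, d) + C (b, c, a, d) + C (c, a, b, d) = 0) <->
    forall p q r s, cm C p q r s + cm C q r p s + cm C r p q s = 0.
  split=> e.
    have h := proj1 (EP (C + c1 + c2) 0); move=> p q r s.
    by rewrite -(cm0 p q r s) -(Ec1 p q r s) -(Ec2 p q r s) -!cmD h // => *; rewrite !ffunE e.
  have h := proj2 (EP (C + c1 + c2) 0); move=> a b c d.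
  have := h _ a b c d; rewrite !ffunE; apply=> p q r s.
  by rewrite !cmD Ec1 Ec2 cm0 e.
have i4 : (forall b d, \sum_a \sum_e invmx g a e * C (e, b, a, d) = 0) <->
    forall q s, \sum_p cm C (st p) q p s = 0.
  have e0 q s : \sum_p cm C (st p) q p s
      = Sv q (fun b => Sv s (fun d => \sum_a \sum_e invmx g a e * C (e, b, a, d))).
    transitivity (\sum_p Sv q (fun b => Sv s (fun d => Sv p (fun a => Sv (st p) (fun e => C (e, b, a, d)))))).
      apply: eq_bigr => p _; rewrite /cm SvC; apply: eq_Sv => b.
      rewrite SvC; under eq_Sv => a do rewrite SvC.
      by rewrite SvC; apply: eq_Sv => d; apply: eq_Sv => a.
    rewrite -Sv_sum; apply: eq_Sv => b; rewrite -Sv_sum; apply: eq_Sv => d.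
    rewrite /Sv exchange_big; apply: eq_bigr => a _.
    under eq_bigr => p _ do rewrite mulr_sumr.
    rewrite exchange_big; apply: eq_bigr => e _; rewrite invmxE mulr_suml.
    by apply: eq_bigr => p _; rewrite mulrA.
  split=> e.
    by move=> q s; rewrite e0; apply/Sv_eq0: q => b; apply/Sv_eq0: s => d; exact: e.
  move=> b d; move: d; apply/Sv_eq0 => s; move: b; apply/Sv_eq0 => q.
  by rewrite -e0 e.
rewrite mem_weylE; split=> -[h1 h2 h3 h4]; split;
 by [apply: (proj1 i1) | apply: (proj1 i2) | apply: (proj1 i3) | apply: (proj1 i4)
    | apply: (proj2 i1) | apply: (proj2 i2) | apply: (proj2 i3) | apply: (proj2 i4)].
Qed.

End Frame.

(** * Components of one degree as arrays *)

Section Levels.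
Variables (K : numClosedFieldType) (m : nat).
Local Notation I := 'I_m.
Local Notation P := (bool * I)%type.
Local Notation A := (tensor4 K m).
Implicit Types (F : A) (i j k l : I) (p q r s : P) (h : P -> P -> P -> P -> K).
Local Notation weyl_comp := (@weyl_comp K m).

(* The components of a tensor of degree [- Q] (for [b]) or [Q] (for [~~ b]) given *)
(* by an array; the indices in V_{1/2} (for [b]) or V_{-1/2} are those of type b. *)
Definition emb (Q : nat) (b : bool) F p q r s : K :=
  let: (i, j, k, l) := (p.2, q.2, r.2, s.2) in
  match Q, p.1 == b, q.1 == b, r.1 == b, s.1 == b with
  | 2, true, true, true, true => ev F i j k l
  | 1, true, true, true, false => ev F i j k l
  | 1, true, true, false, true => - ev F i j l k
  | 1, true, false, true, true => ev F k l i j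
  | 1, false, true, true, true => - ev F k l j i
  | 0, true, true, false, false => ev F i j k l - ev F j i k l
  | 0, false, false, true, true => ev F k l i j - ev F l k i j
  | 0, true, false, true, false => ev F i k j l
  | 0, true, false, false, true => - ev F i l j k
  | 0, false, true, true, false => - ev F j k i l
  | 0, false, true, false, true => ev F j l i k
  | _, _, _, _, _ => 0
  end.

(** In each degree one pattern of e- and f-arguments determines all the others by the symmetries of
    a Weyl tensor; [rd] reads this pattern. *)
Definition rd (Q : nat) (b : bool) h : A := mkA (fun i j k l =>
  match Q with
  | 2 => h (b, i) (b, j) (b, k) (b, l)
  | 1 => h (b, i) (b, j) (b, k) (~~ b, l)
  | 0 => h (b, i) (~~ b, k) (b, j) (~~ b, l)
  | _ => 0
  end).

Lemma sum_P (f : P -> K) b : \sum_p f p = \sum_i f (b, i) + \sum_i f (~~ b, i).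
Proof.
have -> : \sum_p f p = \sum_s \sum_i f (s, i).
  by rewrite pair_bigA; apply: eq_bigr => -[s i] _.
by rewrite big_bool; case: b => //; rewrite addrC.
Qed.

Lemma weyl_comp_pair h p q r s : weyl_comp h -> h r s p q = h p q r s.
Proof.
move=> [s12 s34 b _].
apply: subr0_eq.
apply: (@cancel0 _ 2); first exact: (num_neq0 K 1).
transitivity ((h p r s q + h r s p q + h s p r q)
  + (h p r q s + h r q p s + h q p r s)
  - (h p s q r + h s q p r + h q p s r)
  - (h r s q p + h s q r p + h q r s p)); last by rewrite !b; ring.
rewrite (s34 p r q s) (s12 p q) (s12 p s r q) (s34 p s q r) (s12 p q s r) (s34 p q r s).
by rewrite (s34 r s p q) (s12 q r p s) (s34 s q p r) (s34 q r p s); ring.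
Qed.

Ltac four_cases b s1 s2 s3 s4 :=
  rewrite /emb /=; case: (s1 == b); case: (s2 == b); case: (s3 == b); case: (s4 == b).

Lemma emb0_weyl b F : riem0 F -> weyl_comp (emb 0 b F).
Proof.
move=> [E0 T0]; split.
- by move=> [s1 i] [s2 j] [s3 k] [s4 l]; four_cases b s1 s2 s3 s4;
   rewrite ?(E0 k l i j) ?(E0 l k i j); ring.
- move=> [s1 i] [s2 j] [s3 k] [s4 l]; four_cases b s1 s2 s3 s4;
   by rewrite ?(E0 i j k l) ?(E0 j i k l); ring.
- move=> [s1 i] [s2 j] [s3 k] [s4 l]; four_cases b s1 s2 s3 s4;
   rewrite ?(E0 i j k l) ?(E0 j i k l) ?(E0 i k j l) ?(E0 k i j l) ?(E0 i l j k)
    ?(E0 l i j k) ?(E0 j k i l) ?(E0 k j i l) ?(E0 j l i k) ?(E0 l j i k)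
    ?(E0 k l i j) ?(E0 l k i j); by ring.
- move=> [s2 j] [s4 l]; rewrite (sum_P _ b) /emb /st /= !negbK eqxx.
  rewrite (_ : (~~ b == b) = false); last by case: b.
  case: (s2 == b); case: (s4 == b); rewrite ?big1_eq ?addr0 //.
  + by rewrite sumrB sumrN -/(z0 F j l) T0; ring.
  + under [X in _ + X]eq_bigr => i _ do rewrite E0.
    by rewrite sumrB sumrN -/(z0 F l j) T0; ring.
Qed.

Lemma emb1_weyl b F : hookish F -> weyl_comp (emb 1 b F).
Proof.
move=> [s12 bi t]; split.
- by move=> [s1 i] [s2 j] [s3 k] [s4 l]; four_cases b s1 s2 s3 s4;
   rewrite ?(s12 i j); ring.
- by move=> [s1 i] [s2 j] [s3 k] [s4 l]; four_cases b s1 s2 s3 s4;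
   rewrite ?(s12 k l); ring.
- move=> [s1 i] [s2 j] [s3 k] [s4 l]; four_cases b s1 s2 s3 s4; rewrite ?addr0 //.
  + by rewrite -[RHS]oppr0 -(bi i j l k) (s12 i l j k); ring.
  + by rewrite -[RHS](bi i k l j) (s12 i l k j) (s12 i k l j); ring.
  + by rewrite -[RHS]oppr0 -(bi j k l i) (s12 j l k i); ring.
- move=> [s2 j] [s4 l]; rewrite (sum_P _ b) /emb /st /= !negbK eqxx.
  rewrite (_ : (~~ b == b) = false); last by case: b.
  case: (s2 == b); case: (s4 == b); rewrite ?big1_eq ?addr0 //.
  by rewrite !sumrN -/(t1 F l j) -/(t1 F j l) -opprD t oppr0.
Qed.

Lemma emb2_weyl b F : curv F -> weyl_comp (emb 2 b F).
Proof.
move=> [s12 s34 bi]; split.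
- by move=> [s1 i] [s2 j] [s3 k] [s4 l]; four_cases b s1 s2 s3 s4;
   rewrite ?(s12 i j) ?oppr0.
- by move=> [s1 i] [s2 j] [s3 k] [s4 l]; four_cases b s1 s2 s3 s4;
   rewrite ?(s34 i j k l) ?oppr0.
- by move=> [s1 i] [s2 j] [s3 k] [s4 l]; four_cases b s1 s2 s3 s4; rewrite ?addr0.
- move=> [s2 j] [s4 l]; rewrite (sum_P _ b) /emb /st /= !negbK eqxx.
  rewrite (_ : (~~ b == b) = false); last by case: b.
  by case: (s2 == b); case: (s4 == b); rewrite ?big1_eq ?addr0.
Qed.

Lemma emb_weyl Q b F : lvl Q F -> weyl_comp (emb Q b F).
Proof.
case: Q => [|[|[|Q]]]; [exact: emb0_weyl | exact: emb1_weyl | exact: emb2_weyl |].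
move=> _; split=> *; rewrite /emb ?oppr0 ?addr0 //.
by rewrite big1.
Qed.

(* The degree of a component, shifted by 2: the number of indices in V_{-1/2}.    *)
Definition deg p q r s : nat := (~~ p.1 + ~~ q.1 + ~~ r.1 + ~~ s.1)%N.

Definition deg_of (Q : nat) (b : bool) : nat := (if b then 2 - Q else 2 + Q)%N.

Lemma emb_deg Q b F p q r s : (Q <= 2)%N -> deg p q r s != deg_of Q b -> emb Q b F p q r s = 0.
Proof.
move: p q r s => [s1 i] [s2 j] [s3 k] [s4 l].
by case: Q => [|[|[|Q]]] //; case: b; case: s1; case: s2; case: s3; case: s4.
Qed.

(** The delicate point is degree 0: the metric trace on e_j, f_l contains components whose first
    pair has equal types, and rewriting them by the Bianchi identity creates the factor 2 of
    [riem0]. *)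
Lemma rd_lvl Q b h : weyl_comp h -> lvl Q (rd Q b h).
Proof.
move=> hW; have [s12 s34 bi t] := hW.
have pair := weyl_comp_pair _ _ _ _ hW.
rewrite /rd; case: Q => [|[|[|Q]]] /=; last by apply/evP => i j k l; rewrite ev_mkA ev0.
- split=> [i j k l|j l]; first by rewrite !ev_mkA pair.
  have := t (b, j) (~~ b, l); rewrite (sum_P _ b) /st /= negbK => e.
  pose f1 i := h (b, i) (~~ b, i) (b, j) (~~ b, l).
  pose f2 i := h (b, j) (~~ b, i) (b, i) (~~ b, l).
  transitivity (\sum_i f1 i); first by apply: eq_bigr => i _; rewrite ev_mkA.
  transitivity (2 * \sum_i f2 i); last first.
    by congr (_ * _); apply: eq_bigr => i _; rewrite ev_mkA.
  have e1 i : h (b, i) (b, j) (~~ b, i) (~~ b, l)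
      = h (b, i) (~~ b, i) (b, j) (~~ b, l) - h (b, j) (~~ b, i) (b, i) (~~ b, l).
    have := bi (b, i) (b, j) (~~ b, i) (~~ b, l); rewrite (s12 (b, i) (~~ b, i)).
    by move=> e'; apply: subr0_eq; rewrite -[RHS]e'; ring.
  have : \sum_i (- f2 i + (f1 i - f2 i)) = 0.
    rewrite -[RHS]e big_split; congr (_ + _); apply: eq_bigr => i _; last by rewrite e1.
    by rewrite [RHS]s12.
  rewrite big_split /= sumrB sumrN => e'.
  by apply: subr0_eq; rewrite -[RHS]e'; ring.
- split=> [i j k l|i j k l|i j]; first by rewrite !ev_mkA s12.
    by rewrite !ev_mkA bi.
  have := t (b, i) (b, j); rewrite (sum_P _ b) /st /= negbK => e.
  rewrite -[RHS]oppr0 -e opprD addrC -!sumrN; congr (_ + _); apply: eq_bigr => k _.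
    by rewrite ev_mkA [in RHS]pair [in RHS]s34 opprK.
  by rewrite ev_mkA [in RHS]s34 opprK.
- by split=> [i j k l|i j k l|i j k l]; rewrite !ev_mkA; [exact: s12 | exact: s34 | exact: bi].
Qed.

Lemma rd_emb Q b F : (Q <= 2)%N -> lvl Q F -> rd Q b (emb Q b F) = F.
Proof.
move=> Q2 hF; apply/evP => i j k l; rewrite ev_mkA; case: Q Q2 {hF} => [|[|[|Q]]] //.
- by rewrite /emb /= eqxx (_ : (~~ b == b) = false) //; case: b.
- by rewrite /emb /= eqxx (_ : (~~ b == b) = false) //; case: b.
- by rewrite /emb /= eqxx.
Qed.

Lemma emb_rd Q b h p q r s : (Q <= 2)%N -> weyl_comp h -> deg p q r s = deg_of Q b ->
  emb Q b (rd Q b h) p q r s = h p q r s.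
Proof.
move=> Q2 hW; have [s12 s34 bi t] := hW.
have pair := weyl_comp_pair _ _ _ _ hW.
(* This recovers the components on e, e, f, f from the alternating ones. *)
have key x y u v : h x u y v - h y u x v = h x y u v.
  by apply: subr0_eq; rewrite -[RHS]oppr0 -(bi x y u v) (s12 x u y v); ring.
move: p q r s => [s1 i] [s2 j] [s3 k] [s4 l].
case: Q Q2 => [|[|[|Q]]] // _; case: b; case: s1; case: s2; case: s3; case: s4 => //= _;
 rewrite /emb /= ?ev_mkA //=.
all: try (by rewrite [RHS]s34).
all: try (by rewrite [RHS]s12).
all: try (by rewrite [RHS]pair).
all: try (by rewrite [RHS]s12 [in RHS]pair).
all: try (by rewrite [RHS]s12 [in RHS]s34 opprK).
all: by rewrite key // pair.
Qed.

(* In degree 0 there are two embeddings, and only the one with [b = true] is used. *)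
Definition okb (Q : nat) (b : bool) : bool := (Q <= 2)%N && ((Q != 0)%N || b).

Lemma deg_ok p q r s : exists Q b, okb Q b /\ deg p q r s = deg_of Q b.
Proof.
have : (deg p q r s <= 4)%N.
  by rewrite /deg; do !case: (_.1).
case: deg => [|[|[|[|[|d]]]]] // _; [exists 2%N, true | exists 1%N, true | exists 0%N, true
 | exists 1%N, false | exists 2%N, false]; by [].
Qed.

Lemma deg_of_inj Q b Q' b' : okb Q b -> okb Q' b' -> deg_of Q b = deg_of Q' b' ->
  Q = Q' /\ b = b'.
Proof.
by case: Q => [|[|[|Q]]]; case: b => //; case: Q' => [|[|[|Q']]]; case: b'.
Qed.

Lemma rd_emb0 Q b Q' b' F : okb Q b -> okb Q' b' -> (Q, b) != (Q', b') ->
  rd Q' b' (emb Q b F) = 0.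
Proof.
move=> o o' ne; have Q2 : (Q <= 2)%N by case/andP: o.
have [e|ne'] := eqVneq (deg_of Q b) (deg_of Q' b').
  by have [E1 E2] := deg_of_inj o o' e; rewrite E1 E2 eqxx in ne.
apply/evP => i j k l; rewrite ev_mkA ev0.
case: Q' => [|[|[|Q']]] in o' ne ne' *; case: b' o' ne ne' => // _ _ ne';
 by apply: emb_deg => //=; rewrite eq_sym.
Qed.

End Levels.

(** * The graded pieces inside the space of Weyl tensors *)

Section Graded.
Variables (K : numClosedFieldType) (m n : nat) (g : 'M[K]_n)
  (fr : bool -> 'I_m -> 'rV[K]_n).
Hypotheses (m_gt2 : (2 < m)%N) (frameP : frame g fr).
Local Notation I := 'I_m.
Local Notation P := (bool * I)%type.
Local Notation A := (tensor4 K m).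
Local Notation T := (tensor4 K n).
Local Notation cm := (cm fr).
Implicit Types (C : T) (F : A) (p q r x y : P) (h : P -> P -> P -> P -> K).

Definition mk Q b F : T := mkT g fr (emb Q b F).
Definition rdC Q b C : A := rd Q b (cm C).

Lemma emb_lin Q b k F G p q r s :
  emb Q b (k *: F + G) p q r s = k * emb Q b F p q r s + emb Q b G p q r s.
Proof.
rewrite /emb; case: Q => [|[|[|Q]]]; case: (p.1 == b); case: (q.1 == b);
 case: (r.1 == b); case: (s.1 == b); rewrite ?ev_lin; ring.
Qed.

Lemma cm_mk Q b F p q r s : cm (mk Q b F) p q r s = emb Q b F p q r s.
Proof. exact: cm_mkT. Qed.

Lemma mk_linear Q b : linear (mk Q b).
Proof.
move=> k F G; apply/(cmP frameP) => p q r s.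
by rewrite cm_lin !cm_mk emb_lin.
Qed.

Lemma rdC_linear Q b : linear (rdC Q b).
Proof.
move=> k C C'; apply/evP => i j k' l; rewrite ev_lin !ev_mkA.
by case: Q => [|[|[|Q]]]; rewrite ?cm_lin //; ring.
Qed.

Lemma mk_weyl Q b F : lvl Q F -> mk Q b F \in weyl g.
Proof.
move=> hF; apply/(weylE frameP); have [h1 h2 h3 h4] := emb_weyl b hF.
split=> [p q r s|p q r s|p q r s|q s]; rewrite ?cm_mk //.
by under eq_bigr => p _ do rewrite cm_mk.
Qed.

Lemma rdC_lvl Q b C : C \in weyl g -> lvl Q (rdC Q b C).
Proof. by move=> /(weylE frameP) /(rd_lvl Q b). Qed.

Lemma rdC_mk Q b F : (Q <= 2)%N -> lvl Q F -> rdC Q b (mk Q b F) = F.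
Proof.
move=> Q2 hF; rewrite -[RHS](rd_emb b Q2 hF); apply/evP => i j k l.
by rewrite !ev_mkA; case: Q {Q2 hF} => [|[|[|Q]]]; rewrite ?cm_mk.
Qed.

Lemma rdC_mk0 Q b Q' b' F : okb Q b -> okb Q' b' -> (Q, b) != (Q', b') ->
  rdC Q' b' (mk Q b F) = 0.
Proof.
move=> o o' ne; rewrite -[RHS](rd_emb0 F o o' ne); apply/evP => i j k l.
by rewrite !ev_mkA; case: Q' {o' ne} => [|[|[|Q']]]; rewrite ?cm_mk.
Qed.

Lemma cm_weyl C Q b p q r s : C \in weyl g -> okb Q b -> deg p q r s = deg_of Q b ->
  cm C p q r s = emb Q b (rdC Q b C) p q r s.
Proof.
by move=> /(weylE frameP) CW /andP [Q2 _] e; rewrite emb_rd.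
Qed.

Definition grades : seq (nat * bool) :=
  [:: (2, true); (1, true); (0, true); (1, false); (2, false)]%N.

Lemma mem_grades Q b : ((Q, b) \in grades) = okb Q b.
Proof. by case: Q => [|[|[|Q]]]; case: b. Qed.

Lemma weyl_sum C : C \in weyl g -> C = \sum_(u <- grades) mk u.1 u.2 (rdC u.1 u.2 C).
Proof.
move=> CW; apply/(cmP frameP) => p q r s.
have -> : cm (\sum_(u <- grades) mk u.1 u.2 (rdC u.1 u.2 C)) p q r s
    = \sum_(u <- grades) emb u.1 u.2 (rdC u.1 u.2 C) p q r s.
  rewrite (big_morph (fun C => cm C p q r s) (fun C C' => cmD fr C C' p q r s) (cm0 fr p q r s)).
  by apply: eq_bigr => u _; rewrite cm_mk.
have [Q [b [o e]]] := deg_ok p q r s.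
rewrite (bigD1_seq (Q, b)) ?mem_grades //= big1_seq ?addr0 -?cm_weyl //.
move=> [Q' b'] /andP [ne]; rewrite mem_grades => o'.
apply: emb_deg; first by case/andP: o'.
rewrite e; apply/negP => /eqP /(deg_of_inj o o') [E1 E2].
by case/negP: ne; rewrite E1 E2.
Qed.

Lemma weyl_grade_eq0 C Q b : C \in weyl g -> okb Q b ->
  rdC Q b C = 0 <-> forall p q r s, deg p q r s = deg_of Q b -> cm C p q r s = 0.
Proof.
move=> CW o; split=> [e p q r s dE|e].
  rewrite (cm_weyl CW o dE) e /emb; case: (Q) => [|[|[|Q']]]; case: (p.1 == b);
  case: (q.1 == b); case: (r.1 == b); case: (s.1 == b); by rewrite ?ev0 ?oppr0 ?addr0.
apply/evP => i j k l; rewrite ev_mkA ev0.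
case: Q o e => [|[|[|Q']]] o e //; apply: e; by case: b o.
Qed.

Lemma weyl_ext C C' : C \in weyl g -> C' \in weyl g ->
  (forall Q b, okb Q b -> rdC Q b C = rdC Q b C') -> C = C'.
Proof.
move=> CW CW' e; rewrite (weyl_sum CW) (weyl_sum CW'); apply: eq_big_seq => -[Q b].
by rewrite mem_grades => /e /= ->.
Qed.

(** A rotation between two vectors of V_{1/2} is a matrix unit of g_0, identified with gl_m. *)
Definition Oab (ab : I * I) C : T := act4 g (rot g fr (true, ab.1) (true, ab.2)) C.
(** The f-indices transform by the dual representation, whence the transposition and the sign when
    [b] is false. *)
Definition opb Q b (ab : I * I) F : A :=
  if b then opq Q ab F else - opq Q (flip ab) F.

Lemma rdC_Oab Q b ab C : okb Q b -> rdC Q b (Oab ab C) = opb Q b ab (rdC Q b C).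
Proof.
case: ab => a c o; apply/evP => i j k l.
have dpE (s s' : bool) (x y : I) : dp K (s, x) (s', y) = (s == s')%:R * dl K x y.
  by rewrite /dp /dl xpair_eqE -natrM mulnb.
rewrite /opb /Oab /opq /rdC /rd; case: Q o => [|[|[|Q]]] //; case: b => // _;
 rewrite ?evN !ev_mkA !(cm_rot frameP) /rop /slot /= !dpE /= ?eqxx /= ?mul1r ?mul0r ?subr0 ?sub0r;
 rewrite /st /= ?ev_mkA ?(dlC K c) ?(dlC K a); ring.
Qed.

Lemma weyl_rot p q C : C \in weyl g -> act4 g (rot g fr p q) C \in weyl g.
Proof.
move=> /(weylE frameP) [s12 s34 bi t]; apply/(weylE frameP); split.
- move=> x y z u; rewrite !(cm_rot frameP) /rop.
  rewrite (s12 x q z u) (s12 x (st p) z u) (s12 q y z u) (s12 (st p) y z u).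
  by rewrite (s12 x y q u) (s12 x y (st p) u) (s12 x y z q) (s12 x y z (st p)); ring.
- move=> x y z u; rewrite !(cm_rot frameP) /rop.
  rewrite (s34 q y z u) (s34 (st p) y z u) (s34 x q z u) (s34 x (st p) z u).
  by rewrite (s34 x y q u) (s34 x y (st p) u) (s34 x y z q) (s34 x y z (st p)); ring.
- move=> x y z u; rewrite !(cm_rot frameP) /rop.
  transitivity (dp K x p * (cm C q y z u + cm C y z q u + cm C z q y u)
   - dp K x (st q) * (cm C (st p) y z u + cm C y z (st p) u + cm C z (st p) y u)
   + dp K y p * (cm C x q z u + cm C q z x u + cm C z x q u)
   - dp K y (st q) * (cm C x (st p) z u + cm C (st p) z x u + cm C z x (st p) u)
   + dp K z p * (cm C x y q u + cm C y q x u + cm C q x y u)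
   - dp K z (st q) * (cm C x y (st p) u + cm C y (st p) x u + cm C (st p) x y u)
   + dp K u p * (cm C x y z q + cm C y z x q + cm C z x y q)
   - dp K u (st q) * (cm C x y z (st p) + cm C y z x (st p) + cm C z x y (st p))).
    by ring.
  by rewrite !bi; ring.
- move=> y u; under eq_bigr => x _ do rewrite (cm_rot frameP).
  have S1 (h : P -> K) v : \sum_x dp K (st x) v * h x = h (st v).
    by under eq_bigr => x _ do rewrite dp_st; rewrite sum_dpC.
  rewrite /rop !big_split /= !sumrN -!mulr_sumr !t.
  by rewrite !S1 !sum_dpC !stK; ring.
Qed.

Definition mkL Q b : 'Hom(A, T) := lin_of (mk_linear Q b).
Definition rdL Q b : 'Hom(T, A) := lin_of (rdC_linear Q b).
Local Notation lv q := (vsof (@lvl K m q)).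
Local Notation md q s := (vsof (@mods K m q s)).

Definition Ninvar (X : {vspace T}) : Prop := invar Oab X.

Definition part Q b s : {vspace T} := (mkL Q b @: md Q s)%VS.

Lemma mem_part Q b s C : okb Q b -> C \in part Q b s <->
  [/\ C \in weyl g, mods Q s (rdC Q b C) & C = mk Q b (rdC Q b C)].
Proof.
move=> /andP [Q2 _]; split.
  case/memv_imgP => F /mem_md hF ->; rewrite lin_ofE.
  have lF := mods_lvl hF; rewrite rdC_mk //; split=> //; exact: mk_weyl.
case=> _ hF e; apply/memv_imgP; exists (rdC Q b C); first exact/mem_md.
by rewrite lin_ofE.
Qed.

Lemma dim_part Q b s : okb Q b -> \dim (part Q b s) = \dim (md Q s).
Proof.
move=> /andP [Q2 _]; apply: limg_dim_eq; apply/eqP; rewrite -subv0.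
apply/subvP => F; rewrite memv_cap memv_ker lin_ofE => /andP [/mem_md hF /eqP F0].
rewrite memv0 -(rdC_mk b Q2 (mods_lvl hF)) F0.
by rewrite -(lin_ofE (rdC_linear Q b)) linear0.
Qed.

Lemma invar_opb Q b (X : {vspace A}) : invar (opb Q b) X <-> invar (opq Q) X.
Proof.
case: b => //; split=> iX ab F FX; last by rewrite /opb memvN iX.
by have := iX (flip ab) F FX; rewrite /opb /flip memvN; case: ab.
Qed.

Lemma Oab_mk Q b ab F : okb Q b -> lvl Q F -> Oab ab (mk Q b F) = mk Q b (opb Q b ab F).
Proof.
move=> o hF; have Q2 : (Q <= 2)%N by case/andP: o.
have lO : lvl Q (opb Q b ab F).
  rewrite /opb; case: (b); first exact: lvl_op.
  case: (@lvl_lin K m Q) => l0 lD.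
  by rewrite -[- _]addr0 -scaleN1r; apply: lD => //; exact: lvl_op.
apply: weyl_ext => [||Q' b' o'].
- by apply: weyl_rot; exact: mk_weyl.
- exact: mk_weyl.
rewrite rdC_Oab //; have [[E1 E2]|ne] := eqVneq (Q, b) (Q', b').
  by rewrite -E1 -E2 !rdC_mk.
rewrite !rdC_mk0 // /opb; case: (b') => {o' ne}; last apply/eqP; rewrite ?oppr_eq0 ?evP.
  by apply/evP => i j k l; rewrite ev_mkA /slot !ev0; do !case: ifP => _; ring.
by apply/eqP/evP => i j k l; rewrite ev_mkA /slot !ev0; do !case: ifP => _; ring.
Qed.

Lemma part_invar Q b s : okb Q b -> Ninvar (part Q b s).
Proof.
move=> o ab _ /memv_imgP [F hF ->]; rewrite lin_ofE; have lF := mods_lvl (proj1 (mem_md _ _ _) hF).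
rewrite Oab_mk //; apply/memv_imgP; exists (opb Q b ab F); last by rewrite lin_ofE.
by have := @md_op K m Q s; move=> /(invar_opb Q b _) h; exact: h.
Qed.

Lemma part_simple Q b s : okb Q b -> valid Q s -> simple Oab (part Q b s).
Proof.
move=> o v X sX iX; pose Y := (rdL Q b @: X)%VS.
have Q2 : (Q <= 2)%N by case/andP: o.
have XE C : C \in X -> C = mk Q b (rdC Q b C) /\ mods Q s (rdC Q b C).
  by move=> /(subvP sX) /(mem_part s _ o) [].
have sY : (Y <= md Q s)%VS.
  by apply/subvP => _ /memv_imgP [C CX ->]; rewrite lin_ofE; apply/mem_md; case: (XE C CX).
have iY : invar (opq Q) Y.
  apply/(invar_opb Q b) => ab _ /memv_imgP [C CX ->]; rewrite lin_ofE -rdC_Oab //.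
  by rewrite -(lin_ofE (rdC_linear Q b)); apply: memv_img; exact: iX.
have [Y0|YN] := md_simple m_gt2 v sY iY; [left | right].
  apply: vs0P => C CX; have [E _] := XE C CX.
  have rY : rdL Q b C \in Y by exact: memv_img.
  have e : rdL Q b C = 0 by apply/eqP; rewrite -memv0; move: rY; rewrite Y0.
  rewrite lin_ofE in e; rewrite E e.
  by rewrite -(lin_ofE (mk_linear Q b)) linear0 mem0v.
apply/eqP; rewrite eqEsubv sX; apply/subvP => C0 /memv_imgP [F].
rewrite -YN => /memv_imgP [C CX ->] ->; rewrite !lin_ofE.
by have [<- _] := XE C CX.
Qed.

(** The dichotomy for arrays is transported by [mk] and [rdC], which are inverse to each other on
    tensors of one degree; sign and transposition do not affect which subspaces are invariant. *)
Lemma part_dichotomy Q b s (Z : {vspace T}) : okb Q b -> valid Q s -> Ninvar Z ->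
  (Z <= weyl g)%VS -> (forall C, C \in Z -> C = mk Q b (rdC Q b C)) ->
  (part Q b s <= Z)%VS \/ forall C, C \in Z -> pr Q s (rdC Q b C) = 0.
Proof.
move=> o v iZ sZ hZ; pose Y := (rdL Q b @: Z)%VS.
have iY : invar (opq Q) Y.
  apply/(invar_opb Q b) => ab _ /memv_imgP [C CX ->]; rewrite lin_ofE -rdC_Oab //.
  by rewrite -(lin_ofE (rdC_linear Q b)); apply: memv_img; exact: iZ.
have sY : (Y <= lv Q)%VS.
  apply/subvP => _ /memv_imgP [C CX ->]; rewrite lin_ofE; apply/mem_lv.
  exact/rdC_lvl/(subvP sZ).
have [h|h] := dichotomy m_gt2 v iY sY; [left | right=> C CZ].
  apply/subvP => _ /memv_imgP [F /(subvP h) /memv_imgP [C CZ ->] ->].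
  by rewrite !lin_ofE -hZ.
by apply: h; rewrite -(lin_ofE (rdC_linear Q b)); exact: memv_img.
Qed.

End Graded.

(** * Clifford products with the pure spinor *)

Section PureSpinor.
Variables (K : numClosedFieldType) (m n N : nat) (g : 'M[K]_n)
  (fr : bool -> 'I_m -> 'rV[K]_n) (gp gm : 'I_n -> 'M[K]_N) (xi : 'rV[K]_N).
Hypothesis frameP : frame g fr.
Hypothesis cliffP : clifford_relations g gp gm.
Local Notation I := 'I_m.
Local Notation P := (bool * I)%type.
Local Notation vf := (vf fr).
Local Notation Sv := (Sv fr).
Implicit Types (p q r : P) (i j k l : I) (A B : 'I_N) (a b : 'I_n).

(** Clifford multiplication by a frame vector, acting on row spinors from the right. *)
Definition Gp p : 'M[K]_N := \sum_a vf p a *: gp a.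
Definition Gm p : 'M[K]_N := \sum_a vf p a *: gm a.

Hypotheses (xi_e : forall i, xi *m Gp (true, i) = 0) (xi_neq0 : xi != 0).

Lemma sum_gram p q : \sum_a \sum_b vf p a * vf q b * g a b = dp K p (st q).
Proof.
have [_ _ G _] := frameP; rewrite -G !mxE exchange_big; apply: eq_bigr => b _.
rewrite !mxE mulr_suml; apply: eq_bigr => a _; rewrite /vf; ring.
Qed.

Lemma mul_Gp_Gm p q : Gp p *m Gm q = \sum_a \sum_b (vf p a * vf q b) *: (gp a *m gm b).
Proof.
rewrite mulmx_suml; apply: eq_bigr => a _; rewrite mulmx_sumr; apply: eq_bigr => b _.
by rewrite -scalemxAl -scalemxAr scalerA.
Qed.

Lemma mul_Gm_Gp p q : Gm p *m Gp q = \sum_a \sum_b (vf p a * vf q b) *: (gm a *m gp b).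
Proof.
rewrite mulmx_suml; apply: eq_bigr => a _; rewrite mulmx_sumr; apply: eq_bigr => b _.
by rewrite -scalemxAl -scalemxAr scalerA.
Qed.

Lemma half_eq (X Y : 'M[K]_N) : 2^-1 *: X = - Y -> X = - 2 *: Y.
Proof.
move=> e; rewrite scaleNr -scalerN -e scalerA mulfV ?scale1r //.
exact: (num_neq0 K 1).
Qed.

Lemma cliff_pm p q : Gp p *m Gm q = (- 2 * dp K p (st q))%:M - Gp q *m Gm p.
Proof.
apply/eqP; rewrite eq_sym subr_eq eq_sym; apply/eqP.
rewrite !mul_Gp_Gm [X in _ + X]exchange_big -big_split /=.
rewrite -sum_gram mulr_sumr raddf_sum /=; apply: eq_bigr => a _.
rewrite -big_split mulr_sumr raddf_sum; apply: eq_bigr => b _ /=.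
rewrite [vf q b * _]mulrC -scalerDr (half_eq (proj1 (cliffP a b))).
by rewrite scalerA scale_scalar_mx; congr _%:M; ring.
Qed.

Lemma cliff_mp p q : Gm p *m Gp q = (- 2 * dp K p (st q))%:M - Gm q *m Gp p.
Proof.
apply/eqP; rewrite eq_sym subr_eq eq_sym; apply/eqP.
rewrite !mul_Gm_Gp [X in _ + X]exchange_big -big_split /=.
rewrite -sum_gram mulr_sumr raddf_sum /=; apply: eq_bigr => a _.
rewrite -big_split mulr_sumr raddf_sum; apply: eq_bigr => b _ /=.
rewrite [vf q b * _]mulrC -scalerDr (half_eq (proj2 (cliffP a b))).
by rewrite scalerA scale_scalar_mx; congr _%:M; ring.
Qed.

(** The products of xi with one, two and three vectors f_i. Since the e_k annihilate xi,
    multiplication by e_k acts on them as a contraction, and this is how their independence is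
    tested. *)
Definition eta i : 'rV[K]_N := xi *m Gp (false, i).
Definition zeta i j : 'rV[K]_N := eta i *m Gm (false, j).
Definition omega i j k : 'rV[K]_N := zeta i j *m Gp (false, k).

Lemma dpE (s s' : bool) i j : dp K (s, i) (s', j) = (s == s')%:R * dl K i j.
Proof. by rewrite /dp /dl xpair_eqE -natrM mulnb. Qed.

Lemma eta_e i k : eta i *m Gm (true, k) = - (2 * dl K i k) *: xi.
Proof.
rewrite /eta -mulmxA cliff_pm mulmxBr mul_mx_scalar mulmxA xi_e mul0mx subr0.
by rewrite /st /= dpE eqxx mul1r mulNr.
Qed.

Lemma zeta_skew i j : zeta j i = - zeta i j.
Proof.
rewrite /zeta /eta -!mulmxA cliff_pm mulmxBr /st /= dpE /= mul0r mulr0.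
by rewrite mul_mx_scalar scale0r sub0r.
Qed.

Lemma zeta_e i j k : zeta i j *m Gp (true, k)
  = (2 * dl K i k) *: eta j - (2 * dl K j k) *: eta i.
Proof.
rewrite /zeta -mulmxA cliff_mp mulmxBr mul_mx_scalar mulmxA eta_e /st /= dpE /= mul1r.
by rewrite -scalemxAl !mulNr !scaleNr opprK addrC.
Qed.

Lemma omega_skew23 i j k : omega i k j = - omega i j k.
Proof.
rewrite /omega /zeta -!mulmxA cliff_mp /st /= dpE /= mul0r mulr0.
by rewrite raddf0 sub0r !mulmxN.
Qed.

Lemma omega_skew12 i j k : omega j i k = - omega i j k.
Proof. by rewrite /omega zeta_skew mulNmx. Qed.

Lemma omega_e i j l k : omega i j l *m Gm (true, k) =
  - (2 * dl K l k) *: zeta i j - (2 * dl K i k) *: zeta j l + (2 * dl K j k) *: zeta i l.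
Proof.
rewrite /omega -mulmxA cliff_pm mulmxBr mul_mx_scalar mulmxA zeta_e /st /= dpE /= mul1r.
by rewrite mulmxBl -!scalemxAl !mulNr !scaleNr opprB addrA addrAC.
Qed.

Lemma ind_xi (c : K) : c *: xi = 0 -> c = 0.
Proof. by move/eqP; rewrite scaler_eq0 (negPf xi_neq0) orbF => /eqP. Qed.

Lemma ind1 (c : I -> K) : \sum_i c i *: eta i = 0 -> forall i, c i = 0.
Proof.
move=> e i; have := congr1 (mulmx^~ (Gm (true, i))) e; rewrite /= mul0mx mulmx_suml.
under eq_bigr => j _ do rewrite -scalemxAl eta_e scalerA.
rewrite -scaler_suml => /ind_xi; under eq_bigr => j _ do
  rewrite mulrN mulrA mulrC -mulrN.
rewrite sum_dlC => /eqP; rewrite mulrC oppr_eq0 mulf_eq0 => /orP [/eqP|/eqP //].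
by move/eqP; rewrite (negPf (num_neq0 K 1)).
Qed.

(** Multiplication by e_k leaves a relation between the [eta], so the skew part of [c] vanishes; the
    symmetric part does not contribute since [zeta] is skew, and then [b] is 0. *)
Lemma ind0 (c : I -> I -> K) (b : K) : \sum_i \sum_j c i j *: zeta i j + b *: xi = 0 ->
  b = 0 /\ forall i j, c i j = c j i.
Proof.
move=> e.
have cs : forall i j, c i j = c j i.
  move=> k l; have := congr1 (mulmx^~ (Gp (true, k))) e; rewrite /= mul0mx mulmxDl.
  rewrite -scalemxAl xi_e scaler0 addr0 mulmx_suml.
  under eq_bigr => i _ do rewrite mulmx_suml.
  have E : \sum_i \sum_j c i j *: zeta i j *m Gp (true, k)
      = \sum_j (2 * (c k j - c j k)) *: eta j.
    transitivity (\sum_i \sum_j ((dl K i k * (2 * c i j)) *: eta j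
        - (dl K j k * (2 * c i j)) *: eta i)).
      do 2!apply: eq_bigr => ? _.
      by rewrite -scalemxAl zeta_e scalerBr !scalerA; congr (_ *: _ - _ *: _); ring.
    under eq_bigr => i _ do rewrite sumrB -[X in _ - X]scaler_suml sum_dlC.
    rewrite sumrB exchange_big -sumrB; apply: eq_bigr => j _.
    by rewrite -scaler_suml sum_dlC -scalerBl; congr (_ *: _); ring.
  rewrite E => /ind1 /(_ l); move=> h; apply: subr0_eq.
  by apply: cancel0 h; exact: (num_neq0 K 1).
split=> //; apply: ind_xi; rewrite -[RHS]e.
have S0 : \sum_i \sum_j c i j *: zeta i j = - \sum_i \sum_j c i j *: zeta i j.
  rewrite {1}exchange_big -sumrN; apply: eq_bigr => i _; rewrite -sumrN.
  by apply: eq_bigr => j _; rewrite zeta_skew scalerN cs.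
suff -> : \sum_i \sum_j c i j *: zeta i j = 0 by rewrite add0r.
apply/eqP; have : (2 : K) *: (\sum_i \sum_j c i j *: zeta i j) == 0.
  by rewrite scaler_nat mulr2n {2}S0 subrr.
by rewrite scaler_eq0 (negPf (num_neq0 K 1)).
Qed.

(** Multiplication by e_k reduces to [ind0]. Only the alternating part of [c] is determined, as the
    f_i anticommute. *)
Lemma ind3 (c : I -> I -> I -> K) (b : I -> K) :
  \sum_i \sum_j \sum_k c i j k *: omega i j k + \sum_i b i *: eta i = 0 ->
  (forall i, b i = 0) /\
  forall i j k, c i j k - c j i k + c k i j - c k j i - c i k j + c j k i = 0.
Proof.
move=> e; have H k : b k = 0 /\ forall i j,
    - c i j k - c k i j + c i k j = - c j i k - c k j i + c j k i.
  have := congr1 (mulmx^~ (Gm (true, k))) e; rewrite /= mul0mx mulmxDl !mulmx_suml.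
  have -> : \sum_i b i *: eta i *m Gm (true, k) = (- 2 * b k) *: xi.
    transitivity (\sum_i (dl K i k * (- 2 * b i)) *: xi).
      by apply: eq_bigr => i _; rewrite -scalemxAl eta_e scalerA; congr (_ *: _); ring.
    by rewrite -scaler_suml sum_dlC.
  have -> : \sum_i (\sum_j \sum_l c i j l *: omega i j l) *m Gm (true, k)
      = \sum_i \sum_j (2 * (- c i j k - c k i j + c i k j)) *: zeta i j.
    transitivity (\sum_i \sum_j \sum_l (- (dl K l k * (2 * c i j l)) *: zeta i j
       - (dl K i k * (2 * c i j l)) *: zeta j l + (dl K j k * (2 * c i j l)) *: zeta i l)).
      apply: eq_bigr => i _; rewrite mulmx_suml; apply: eq_bigr => j _; rewrite mulmx_suml.
      apply: eq_bigr => l _; rewrite -scalemxAl omega_e scalerDr scalerBr !scalerA.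
      by congr (_ *: _ - _ *: _ + _ *: _); ring.
    transitivity (\sum_i \sum_j - (2 * c i j k) *: zeta i j
       - \sum_j \sum_l (2 * c k j l) *: zeta j l + \sum_i \sum_l (2 * c i k l) *: zeta i l).
      under eq_bigr => i _ do under eq_bigr => j _ do rewrite !big_split /= sumrN.
      under eq_bigr => i _ do rewrite !big_split /= sumrN.
      rewrite !big_split /= sumrN; congr (_ - _ + _).
      - apply: eq_bigr => i _; apply: eq_bigr => j _; rewrite -scaler_suml sumrN.
        by rewrite sum_dlC.
      - rewrite exchange_big; apply: eq_bigr => j _; rewrite exchange_big.
        by apply: eq_bigr => l _; rewrite -scaler_suml sum_dlC.
      - apply: eq_bigr => i _; rewrite exchange_big; apply: eq_bigr => l _.
        by rewrite -scaler_suml sum_dlC.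
    rewrite -sumrB -big_split; apply: eq_bigr => i _; rewrite /= -sumrB -big_split.
    by apply: eq_bigr => j _; rewrite /= -scalerBl -scalerDl; congr (_ *: _); ring.
  move=> /ind0 [b0 cs]; split; first by apply: cancel0 b0; rewrite oppr_eq0 (num_neq0 K 1).
  by move=> i j; apply: (mulfI (num_neq0 K 1)); exact: cs.
split=> [i|i j k]; first by case: (H i).
have [_ /(_ i j) h] := H k.
transitivity ((- c j i k - c k j i + c j k i) - (- c i j k - c k i j + c i k j)).
  by ring.
by rewrite h subrr.
Qed.

(** Raising an index exchanges e_i and f_i, and xi e_i = 0: the tensor xi^{aA} is the sum of the e_i
    tensored with the products xi f_i. *)
Lemma contr1 A (f : 'I_n -> K) :
  \sum_a xi1 g gp xi a A * f a = \sum_i eta i 0 A * Sv (true, i) f.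
Proof.
have E a : xi1 g gp xi a A = \sum_p vf p a * (xi *m Gp (st p)) 0 A.
  rewrite /xi1 /xi_low mxE; under eq_bigr => b _ do rewrite !mxE (invmxE frameP) mulr_suml.
  rewrite exchange_big; apply: eq_bigr => p _.
  rewrite /Gp mulmx_sumr summxE mulr_sumr; apply: eq_bigr => b _.
  by rewrite -scalemxAr !mxE mulrA.
under eq_bigr => a _ do rewrite E mulr_suml.
rewrite exchange_big /= (sum_P _ true) [X in _ + X]big1 ?addr0 => [|i _].
  apply: eq_bigr => i _; rewrite /st /= -/(eta i) mulr_sumr.
  by apply: eq_bigr => a _; ring.
by apply: big1 => a _; rewrite /st /= xi_e mxE; ring.
Qed.

(** By the Clifford relation the coefficient of xi^{abA'} is [zeta] along two vectors e_i, e_j, a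
    multiple of xi along e_i and f_i, and 0 along two vectors f_i, f_j. *)
Lemma contr2 A (f : 'I_n -> 'I_n -> K) :
  \sum_a \sum_b xi2 g gp gm xi a b A * f a b =
  \sum_i \sum_j zeta i j 0 A * Sv (true, i) (fun a => Sv (true, j) (f a))
  - xi 0 A * \sum_i (Sv (true, i) (fun a => Sv (false, i) (f a))
    - Sv (false, i) (fun a => Sv (true, i) (f a))).
Proof.
pose x2 p q : 'rV[K]_N := 2^-1 *: (xi *m (Gp (st p) *m Gm (st q)) - xi *m (Gp (st q) *m Gm (st p))).
have E a b : xi2 g gp gm xi a b A = \sum_p \sum_q vf p a * vf q b * x2 p q 0 A.
  have Ex p q : x2 p q 0 A = \sum_c \sum_d vf (st p) c * vf (st q) d * (xi *m gamma2 gp gm c d) 0 A.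
    rewrite /x2 -mulmxBr mul_Gp_Gm [X in _ - X]mul_Gp_Gm [X in _ - X]exchange_big -sumrB.
    rewrite scalemxAr scaler_sumr mulmx_sumr summxE; apply: eq_bigr => c _.
    rewrite -sumrB scaler_sumr mulmx_sumr summxE; apply: eq_bigr => d _.
    rewrite [vf (st q) d * _]mulrC -scalerBr scalerA mulrC -scalerA -scalemxAr mxE.
    by rewrite /gamma2.
  rewrite /xi2; under [RHS]eq_bigr => p _ do under eq_bigr => q _ do rewrite Ex mulr_sumr.
  under [RHS]eq_bigr => p _ do under eq_bigr => q _ do under eq_bigr => c _ do rewrite mulr_sumr.
  transitivity (\sum_c \sum_d \sum_p \sum_q vf p a * vf q b *
     (vf (st p) c * vf (st q) d * (xi *m gamma2 gp gm c d) 0 A)).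
    apply: eq_bigr => c _; apply: eq_bigr => d _.
    rewrite !(invmxE frameP) mulr_suml mulr_suml; apply: eq_bigr => p _.
    rewrite mulr_sumr mulr_suml; apply: eq_bigr => q _; ring.
  under [LHS]eq_bigr => c _ do rewrite exchange_big /=.
  rewrite [LHS]exchange_big /=; apply: eq_bigr => p _.
  under [LHS]eq_bigr => c _ do rewrite exchange_big /=.
  by rewrite [LHS]exchange_big.
pose F p q := Sv p (fun a => Sv q (f a)).
have E2 : \sum_a \sum_b xi2 g gp gm xi a b A * f a b = \sum_p \sum_q x2 p q 0 A * F p q.
  transitivity (\sum_a \sum_b \sum_p \sum_q x2 p q 0 A * (vf p a * (vf q b * f a b))).
    apply: eq_bigr => a _; apply: eq_bigr => b _; rewrite E mulr_suml.
    apply: eq_bigr => p _; rewrite mulr_suml; apply: eq_bigr => q _; ring.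
  under eq_bigr => a _ do rewrite exchange_big.
  rewrite exchange_big; apply: eq_bigr => p _.
  under eq_bigr => a _ do rewrite exchange_big.
  rewrite exchange_big; apply: eq_bigr => q _.
  rewrite /F /Sv mulr_sumr; apply: eq_bigr => a _; rewrite !mulr_sumr.
  by apply: eq_bigr => b _.
have half : (2 : K)^-1 + 2^-1 = 1 by field.
have xee i j : x2 (true, i) (true, j) = zeta i j.
  rewrite /x2 /st /= !mulmxA -/(eta i) -/(eta j) -/(zeta i j) -/(zeta j i) [zeta j i]zeta_skew opprK.
  by rewrite scalerDr -scalerDl half scale1r.
have xef i j : x2 (true, i) (false, j) = - dl K i j *: xi.
  rewrite /x2 /st /= !mulmxA xi_e mul0mx subr0 -/(eta i) eta_e scalerA.
  by congr (_ *: _); field.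
have xfe i j : x2 (false, i) (true, j) = dl K i j *: xi.
  rewrite /x2 /st /= !mulmxA xi_e mul0mx sub0r -/(eta j) eta_e -scaleNr scalerA dlC.
  by congr (_ *: _); field.
have xff i j : x2 (false, i) (false, j) = 0.
  by rewrite /x2 /st /= !mulmxA !xi_e !mul0mx subrr scaler0.
rewrite E2 (sum_P _ true) /=.
under eq_bigr => i _ do rewrite (sum_P _ true).
under [X in _ + X]eq_bigr => i _ do rewrite (sum_P _ true).
rewrite !big_split /= -addrA; congr (_ + _).
  by apply: eq_bigr => i _; apply: eq_bigr => j _; rewrite xee.
rewrite -[X in - (_ * X)]big_split mulr_sumr -sumrN -!big_split; apply: eq_bigr => i _ /=.
under [X in X + _]eq_bigr => j _ do rewrite xef mxE mulNr mulNr -mulrA.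
under [X in _ + (X + _)]eq_bigr => j _ do rewrite xfe mxE -mulrA.
rewrite sumrN !sum_dl big1 => [|j _]; last by rewrite xff mxE mul0r.
rewrite /F; ring.
Qed.

End PureSpinor.

(** * The maps Pi in frame components *)

Section Components.
Variables (K : numClosedFieldType) (m n N : nat) (g : 'M[K]_n)
  (fr : bool -> 'I_m -> 'rV[K]_n) (gp gm : 'I_n -> 'M[K]_N) (xi : 'rV[K]_N).
Hypothesis frameP : frame g fr.
Hypothesis cliffP : clifford_relations g gp gm.
Local Notation I := 'I_m.
Local Notation P := (bool * I)%type.
Local Notation T := (tensor4 K n).
Local Notation Sv := (Sv fr).
Local Notation cm := (cm fr).
Local Notation Gp := (Gp fr gp).
Local Notation eta := (eta fr gp xi).
Local Notation zeta := (zeta fr gp gm xi).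
Hypothesis xi_e : forall i, xi *m Gp (true, i) = 0.
Implicit Types (p q r s : P) (i j k l : I) (A B D F : 'I_N) (C : T).
Implicit Types (a b c d e : 'I_n).

Definition L1 A (f : 'I_n -> K) : K := \sum_a xi1 g gp xi a A * f a.
Definition L2 A (f : 'I_n -> 'I_n -> K) : K :=
  \sum_a \sum_b xi2 g gp gm xi a b A * f a b.

(** A trace over half of the frame. The metric trace over the whole frame would vanish on a skew
    pair; this one does not, and it carries the trace components of every degree. *)
Definition zc C p q : K := \sum_i cm C (true, i) (false, i) p q.

(* The contraction of a Weyl tensor with xi^{abA'}.                               *)
Definition Xc C p q : 'rV[K]_N :=
  \sum_i \sum_j cm C (true, i) (true, j) p q *: zeta i j - (2 * zc C p q) *: xi.
(** Together [wc] and [Vc] contract the second pair as [Xc] contracts the first; [wc] collects the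
    coefficient of xi. *)
Definition wc C : 'rV[K]_N := \sum_k Xc C (true, k) (false, k).
Definition Vc C : 'M[K]_N :=
  \sum_k \sum_l (Xc C (true, k) (true, l))^T *m zeta k l - 2 *: ((wc C)^T *m xi).

Lemma rvZ (x : K) (v : 'rV[K]_N) A : (x *: v) 0 A = x * v 0 A.
Proof. exact: mxE. Qed.
Lemma rvD (v w : 'rV[K]_N) A : (v + w) 0 A = v 0 A + w 0 A.
Proof. exact: mxE. Qed.
Lemma rvN (v : 'rV[K]_N) A : (- v) 0 A = - v 0 A.
Proof. exact: mxE. Qed.
Lemma mxB (v w : 'M[K]_N) A B : (v - w) A B = v A B - w A B.
Proof. by rewrite !mxE. Qed.
Lemma mxZ (x : K) (v : 'M[K]_N) A B : (x *: v) A B = x * v A B.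
Proof. exact: mxE. Qed.
Lemma dyad (v w : 'rV[K]_N) A B : (v^T *m w) A B = v 0 A * w 0 B.
Proof. by rewrite [LHS]mxE big_ord1 [X in X * _]mxE. Qed.
Lemma rvM (v : 'rV[K]_N) (W : 'M[K]_N) D : (v *m W) 0 D = \sum_F v 0 F * W F D.
Proof. exact: mxE. Qed.

Lemma L1E A f : L1 A f = \sum_i eta i 0 A * Sv (true, i) f.
Proof. exact: contr1. Qed.

Lemma eq_L1 A f h : (forall a, f a = h a) -> L1 A f = L1 A h.
Proof. by move=> E; apply: eq_bigr => a _; rewrite E. Qed.

Lemma eq_L2 A f h : (forall a b, f a b = h a b) -> L2 A f = L2 A h.
Proof. by move=> E; apply: eq_bigr => a _; apply: eq_bigr => b _; rewrite E. Qed.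

Lemma Sv_L1 p A (f : 'I_n -> 'I_n -> K) :
  Sv p (fun e => L1 A (f e)) = L1 A (fun a => Sv p (fun e => f e a)).
Proof. by rewrite Sv_sum; apply: eq_bigr => a _; rewrite SvZ. Qed.

Lemma Sv_L2 p A (f : 'I_n -> 'I_n -> 'I_n -> K) :
  Sv p (fun e => L2 A (f e)) = L2 A (fun a b => Sv p (fun e => f e a b)).
Proof.
rewrite Sv_sum; apply: eq_bigr => a _; rewrite Sv_sum; apply: eq_bigr => b _.
by rewrite SvZ.
Qed.

Lemma Sv_gp p (v : 'rV[K]_N) D : Sv p (fun e => (v *m gp e) 0 D) = (v *m Gp p) 0 D.
Proof. by rewrite mulmx_sumr summxE; apply: eq_bigr => a _; rewrite -scalemxAr [RHS]mxE. Qed.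

Lemma Sv_suml p (f : 'I_n -> K) x : Sv p f * x = Sv p (fun a => f a * x).
Proof. by rewrite /Sv mulr_suml; apply: eq_bigr => a _; rewrite mulrA. Qed.

Lemma Sv_pair C p q r s :
  Sv r (fun c => Sv s (fun d => Sv p (fun a => Sv q (fun b => C (a, b, c, d))))) = cm C p q r s.
Proof.
under eq_Sv => c do rewrite SvC.
rewrite SvC; apply: eq_Sv => a; under eq_Sv => c do rewrite SvC.
by rewrite SvC.
Qed.

Lemma cm_rev C p q r s :
  cm C p q r s = Sv s (fun d => Sv r (fun c => Sv q (fun b => Sv p (fun a => C (a, b, c, d))))).
Proof.
rewrite -Sv_pair SvC; apply: eq_Sv => d; apply: eq_Sv => c; exact: SvC.
Qed.

Section OneTensor.
Variable C : T.
Hypothesis CW : C \in weyl g.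
Local Notation cc := (cm C).
Local Notation X := (Xc C).
Local Notation V := (Vc C).

Lemma cc12 p q r s : cc q p r s = - cc p q r s.
Proof. by have [h _ _ _] := proj1 (weylE frameP C) CW; exact: h. Qed.
Lemma cc34 p q r s : cc p q s r = - cc p q r s.
Proof. by have [_ h _ _] := proj1 (weylE frameP C) CW; exact: h. Qed.
Lemma cc_pair p q r s : cc r s p q = cc p q r s.
Proof. exact: (weyl_comp_pair _ _ _ _ (proj1 (weylE frameP C) CW)). Qed.
Lemma cc_bianchi p q r s : cc p q r s + cc q r p s + cc r p q s = 0.
Proof. by have [_ _ h _] := proj1 (weylE frameP C) CW; exact: h. Qed.

Lemma zc_skew p q : zc C q p = - zc C p q.
Proof. by rewrite /zc -sumrN; apply: eq_bigr => i _; rewrite cc34. Qed.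

Lemma Xc_skew p q : X q p = - X p q.
Proof.
rewrite /Xc zc_skew opprB addrC mulrN scaleNr opprK; congr (_ + _).
rewrite -sumrN; apply: eq_bigr => i _; rewrite -sumrN; apply: eq_bigr => j _.
by rewrite cc34 scaleNr.
Qed.

Lemma L2_pair p q A : L2 A (fun a b => Sv p (fun c => Sv q (fun d => C (a, b, c, d))))
  = X p q 0 A.
Proof.
rewrite /L2 (contr2 frameP cliffP xi_e) /Xc rvD summxE; congr (_ + _).
  apply: eq_bigr => i _; rewrite summxE; apply: eq_bigr => j _.
  by rewrite rvZ mulrC.
rewrite rvN rvZ /zc mulrC; congr (- (_ * _)); rewrite mulr_sumr; apply: eq_bigr => i _.
change (cc (true, i) (false, i) p q - cc (false, i) (true, i) p q
  = 2 * cc (true, i) (false, i) p q); rewrite (cc12 (true, i)); ring.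
Qed.

Lemma L2_pairC p q A : L2 A (fun c d => Sv p (fun a => Sv q (fun b => C (a, b, c, d))))
  = X p q 0 A.
Proof.
rewrite /L2 (contr2 frameP cliffP xi_e) /Xc rvD summxE; congr (_ + _).
  apply: eq_bigr => i _; rewrite summxE; apply: eq_bigr => j _.
  by rewrite rvZ mulrC Sv_pair cc_pair.
rewrite rvN rvZ /zc mulrC; congr (- (_ * _)); rewrite mulr_sumr; apply: eq_bigr => i _.
by rewrite !Sv_pair (cc34 p q (true, i)) cc_pair; ring.
Qed.

Lemma L2_pairE A a b : L2 A (fun c d => C (a, b, c, d))
  = \sum_i \sum_j zeta i j 0 A * Sv (true, i) (fun c => Sv (true, j) (fun d => C (a, b, c, d)))
  - xi 0 A * \sum_i (Sv (true, i) (fun c => Sv (false, i) (fun d => C (a, b, c, d)))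
    - Sv (false, i) (fun c => Sv (true, i) (fun d => C (a, b, c, d)))).
Proof. exact: contr2. Qed.

Lemma L2_sum (J : finType) A (f : J -> 'I_n -> 'I_n -> K) :
  L2 A (fun a b => \sum_j f j a b) = \sum_j L2 A (f j).
Proof.
rewrite /L2; under eq_bigr => a _ do under eq_bigr => b _ do rewrite mulr_sumr.
under eq_bigr => a _ do rewrite exchange_big.
by rewrite exchange_big.
Qed.

Lemma L2D A f h : L2 A (fun a b => f a b + h a b) = L2 A f + L2 A h.
Proof.
rewrite /L2 -big_split; apply: eq_bigr => a _; rewrite -big_split; apply: eq_bigr => b _.
exact: mulrDr.
Qed.

Lemma L2Z A x f : L2 A (fun a b => x * f a b) = x * L2 A f.
Proof.
rewrite /L2 mulr_sumr; apply: eq_bigr => a _; rewrite mulr_sumr; apply: eq_bigr => b _.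
exact: mulrCA.
Qed.

(** The factor 2 before [wc] appears because the mixed pairs (e, f) and (f, e) contribute equally,
    by skew-symmetry of [Xc]. *)
Lemma VE B D : L2 B (fun a b => L2 D (fun c d => C (a, b, c, d))) = V B D.
Proof.
under eq_L2 => a b do rewrite L2_pairE -mulNr.
rewrite L2D L2Z !L2_sum /Vc mxB summxE; congr (_ + _).
  apply: eq_bigr => i _; rewrite L2_sum summxE; apply: eq_bigr => j _.
  by rewrite L2Z L2_pair dyad mulrC.
rewrite mxZ dyad /wc summxE mulNr; congr (- _).
transitivity (xi 0 D * \sum_i 2 * X (true, i) (false, i) 0 B).
  congr (_ * _); apply: eq_bigr => i _.
  under eq_L2 => a b do rewrite -mulN1r.
  rewrite L2D L2Z !L2_pair Xc_skew rvN; ring.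
rewrite -mulr_sumr; ring.
Qed.

(** Spinor-valued expressions are brought to this form since the independence of the [eta] then
    allows the coefficients to be compared. *)
Definition EE A B (f : I -> I -> K) : K := \sum_i \sum_j eta i 0 A * eta j 0 B * f i j.
Definition EEE A B D (f : I -> I -> I -> K) : K :=
  \sum_i \sum_j \sum_k eta i 0 A * eta j 0 B * eta k 0 D * f i j k.

Lemma Pi_m2_0E A B D F : Pi_m2_0 g gp xi C (A, B, D, F) =
  \sum_i \sum_j \sum_k \sum_l eta i 0 A * eta j 0 B * eta k 0 D * eta l 0 F *
    cc (true, i) (true, j) (true, k) (true, l).
Proof.
rewrite ffunE.
transitivity (L1 A (fun a => L1 B (fun b => L1 D (fun c => L1 F (fun d => C (a, b, c, d)))))).
  apply: eq_bigr => a _; rewrite mulr_sumr; apply: eq_bigr => b _.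
  rewrite mulrA mulr_sumr; apply: eq_bigr => c _.
  rewrite mulrA mulr_sumr; apply: eq_bigr => d _; ring.
rewrite L1E; apply: eq_bigr => i _.
rewrite Sv_L1 L1E mulr_sumr; apply: eq_bigr => j _.
rewrite (eq_Sv _ _ (fun b => Sv_L1 _ _ _)) Sv_L1 L1E mulrA mulr_sumr; apply: eq_bigr => k _.
rewrite (eq_Sv _ _ (fun c => eq_Sv _ _ (fun b => Sv_L1 _ _ _))).
rewrite (eq_Sv _ _ (fun b => Sv_L1 _ _ _)) Sv_L1 L1E mulrA mulr_sumr; apply: eq_bigr => l _.
rewrite mulrA; congr (_ * _); apply: esym; exact: cm_rev.
Qed.

Lemma Pi_m1_0E A B D : Pi_m1_0 g gp gm xi C (A, B, D) =
  EE A B (fun i j => X (true, i) (true, j) 0 D).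
Proof.
rewrite ffunE.
transitivity (L1 A (fun a => L1 B (fun b => L2 D (fun c d => C (a, b, c, d))))).
  apply: eq_bigr => a _; rewrite mulr_sumr; apply: eq_bigr => b _.
  rewrite mulrA mulr_sumr; apply: eq_bigr => c _.
  rewrite mulr_sumr; apply: eq_bigr => d _; ring.
rewrite L1E; apply: eq_bigr => i _.
rewrite Sv_L1 L1E mulr_sumr; apply: eq_bigr => j _.
rewrite mulrA -L2_pairC -Sv_L2; congr (_ * _); rewrite SvC; apply: eq_Sv => b.
by rewrite -Sv_L2.
Qed.

Lemma m1_0_row A B (e : 'I_n) D :
  \sum_a \sum_b \sum_c \sum_d \sum_F
     xi1 g gp xi a A * xi1 g gp xi b B * xi2 g gp gm xi c d F * C (a, b, c, d) * gp e F D
  = EE A B (fun i j => (X (true, i) (true, j) *m gp e) 0 D).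
Proof.
transitivity (\sum_F Pi_m1_0 g gp gm xi C (A, B, F) * gp e F D).
  under [RHS]eq_bigr => F _ do rewrite ffunE mulr_suml.
  rewrite [RHS]exchange_big; apply: eq_bigr => a _.
  under [RHS]eq_bigr => F _ do rewrite mulr_suml.
  rewrite [RHS]exchange_big; apply: eq_bigr => b _.
  under [RHS]eq_bigr => F _ do rewrite mulr_suml.
  rewrite [RHS]exchange_big; apply: eq_bigr => c _.
  under [RHS]eq_bigr => F _ do rewrite mulr_suml.
  by rewrite [RHS]exchange_big; apply: eq_bigr => d _.
under eq_bigr => F _ do rewrite Pi_m1_0E mulr_suml.
rewrite exchange_big; apply: eq_bigr => i _.
under eq_bigr => F _ do rewrite mulr_suml.
rewrite exchange_big; apply: eq_bigr => j _.
by rewrite [in RHS]rvM mulr_sumr; apply: eq_bigr => F _; rewrite mulrA.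
Qed.

Lemma Sv_EE p A B (f : 'I_n -> I -> I -> K) :
  Sv p (fun e => EE A B (f e)) = EE A B (fun i j => Sv p (fun e => f e i j)).
Proof.
rewrite Sv_sum; apply: eq_bigr => i _; rewrite Sv_sum; apply: eq_bigr => j _.
by rewrite SvZ.
Qed.

Lemma SvB p (f h : 'I_n -> K) : Sv p (fun a => f a - h a) = Sv p f - Sv p h.
Proof. by rewrite /Sv -sumrB; apply: eq_bigr => a _; rewrite mulrBr. Qed.

Lemma Sv_div p (f : 'I_n -> K) x : Sv p (fun a => f a / x) = Sv p f / x.
Proof. by rewrite Sv_suml. Qed.

Definition Y1 A B D p : K := EE A B (fun i j => (X (true, i) (true, j) *m Gp p) 0 D).

(** The free tensor index is evaluated on a frame vector while spinor indices stay free; the other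
    maps with tensor indices are treated alike. *)
Lemma Pi_m1_1E A B D p : Sv p (fun e => Pi_m1_1 g gp gm xi C (A, B, D, e)) =
  EEE A B D (fun i j k => cc (true, i) (true, j) (true, k) p)
  + (n%:R + 2)^-1 * (Y1 A B D p - (Y1 D A B p - Y1 D B A p) / 2).
Proof.
under eq_Sv => e do rewrite ffunE /skew2 !m1_0_row //.
rewrite SvD SvZ SvB Sv_div SvB !Sv_EE; congr (_ + _); last first.
  by rewrite /Y1; do !congr (_ + _) || congr (_ * _) || congr (- _);
     do 2!apply: eq_bigr => ? _; rewrite Sv_gp.
transitivity (L1 A (fun a => L1 B (fun b => L1 D (fun c => Sv p (fun e => C (a, b, c, e)))))).
  transitivity (Sv p (fun e => L1 A (fun a => L1 B (fun b => L1 D (fun c => C (a, b, c, e)))))).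
    apply: eq_Sv => e.
    apply: eq_bigr => a _; rewrite mulr_sumr; apply: eq_bigr => b _.
    by rewrite mulrA mulr_sumr; apply: eq_bigr => c _; rewrite mulrA.
  rewrite Sv_L1; apply: eq_L1 => a; rewrite Sv_L1; apply: eq_L1 => b; exact: Sv_L1.
rewrite L1E; apply: eq_bigr => i _.
rewrite Sv_L1 L1E mulr_sumr; apply: eq_bigr => j _.
rewrite (eq_Sv _ _ (fun b => Sv_L1 _ _ _)) Sv_L1 L1E mulrA mulr_sumr; apply: eq_bigr => k _.
rewrite mulrA; congr (_ * _); rewrite cm_rev [RHS]SvC; apply: eq_Sv => c.
by rewrite [RHS]SvC; apply: eq_Sv => b; rewrite [RHS]SvC.
Qed.

Lemma Pi_0_0E B D : Pi_0_0 g gp gm xi C (B, D) = V B D.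
Proof.
rewrite ffunE -VE; apply: eq_bigr => a _; apply: eq_bigr => b _.
rewrite mulr_sumr; apply: eq_bigr => c _; rewrite mulr_sumr; apply: eq_bigr => d _.
by rewrite mulrA.
Qed.

Lemma Pi_0_1E B D p : Sv p (fun d => Pi_0_1 g gp gm xi C (B, D, d)) =
  \sum_k eta k 0 D * X (true, k) p 0 B + n%:R^-1 * (V *m Gp p) B D.
Proof.
under eq_Sv => d do rewrite ffunE.
rewrite SvD SvZ; congr (_ + _ * _).
  transitivity (L2 B (fun a b => L1 D (fun c => Sv p (fun d => C (a, b, c, d))))).
    transitivity (Sv p (fun d => L2 B (fun a b => L1 D (fun c => C (a, b, c, d))))).
      apply: eq_Sv => d; apply: eq_bigr => a _; apply: eq_bigr => b _.
      by rewrite mulr_sumr; apply: eq_bigr => c _; rewrite mulrA.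
    by rewrite Sv_L2; apply: eq_L2 => a b; exact: Sv_L1.
  rewrite (eq_L2 _ (fun a b => L1E _ _)) L2_sum; apply: eq_bigr => k _.
  by rewrite L2Z L2_pair.
transitivity (Sv p (fun d => (row B V *m gp d) 0 D)).
  apply: eq_Sv => d; rewrite rvM.
  under [RHS]eq_bigr => F _ do rewrite mxE -Pi_0_0E ffunE mulr_suml.
  rewrite [RHS]exchange_big; apply: eq_bigr => a _.
  under [RHS]eq_bigr => F _ do rewrite mulr_suml.
  rewrite [RHS]exchange_big; apply: eq_bigr => b _.
  under [RHS]eq_bigr => F _ do rewrite mulr_suml.
  rewrite [RHS]exchange_big; apply: eq_bigr => c _.
  under [RHS]eq_bigr => F _ do rewrite mulr_suml.
  by rewrite [RHS]exchange_big; apply: eq_bigr => d' _.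
by rewrite Sv_gp -row_mul mxE.
Qed.

(** [C2], [S2] and [Z2] are the terms of [Pi_0_2] and [Pi_0_3] that contain no, one and two factors
    [xi2]. *)
Definition S2 A D p q : K := \sum_k eta k 0 D * (X (true, k) p *m Gp q) 0 A.
Definition Z2 A D p q : K := ((Gp p)^T *m V *m Gp q) A D.
Definition C2 A D p q : K := EE A D (fun i l => cc (true, i) p q (true, l)).

Lemma term_C2 A D p q : Sv p (fun b => Sv q (fun c =>
   \sum_a \sum_d xi1 g gp xi a A * C (a, b, c, d) * xi1 g gp xi d D)) = C2 A D p q.
Proof.
transitivity (L1 A (fun a => L1 D (fun d => Sv p (fun b => Sv q (fun c => C (a, b, c, d)))))).
  transitivity (Sv p (fun b => Sv q (fun c => L1 A (fun a => L1 D (fun d => C (a, b, c, d)))))).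
    apply: eq_Sv => b; apply: eq_Sv => c; apply: eq_bigr => a _; rewrite mulr_sumr.
    apply: eq_bigr => d _; ring.
  rewrite (eq_Sv _ _ (fun b => Sv_L1 _ _ _)) Sv_L1; apply: eq_L1 => a.
  by rewrite (eq_Sv _ _ (fun b => Sv_L1 _ _ _)) Sv_L1.
rewrite L1E; apply: eq_bigr => i _; rewrite Sv_L1 L1E mulr_sumr; apply: eq_bigr => l _.
rewrite mulrA; congr (_ * _); rewrite SvC; apply: eq_Sv => a.
by rewrite SvC; apply: eq_Sv => b; rewrite SvC.
Qed.

Lemma term_S2 A D p q : Sv p (fun b => Sv q (fun c =>
   \sum_a \sum_e \sum_d \sum_F
     xi2 g gp gm xi a e F * C (a, e, d, b) * gp c F A * xi1 g gp xi d D)) = S2 A D p q.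
Proof.
pose u k b : 'rV[K]_N := \row_F L2 F (fun a e => Sv (true, k) (fun d => C (a, e, d, b))).
transitivity (Sv p (fun b => Sv q (fun c => \sum_k eta k 0 D * (u k b *m gp c) 0 A))).
  apply: eq_Sv => b; apply: eq_Sv => c.
  transitivity (\sum_F gp c F A * L2 F (fun a e => L1 D (fun d => C (a, e, d, b)))).
    rewrite /L2; under [RHS]eq_bigr => F _ do rewrite mulr_sumr.
    rewrite [RHS]exchange_big; apply: eq_bigr => a _.
    under [RHS]eq_bigr => F _ do rewrite mulr_sumr.
    rewrite [RHS]exchange_big; apply: eq_bigr => e _.
    under [RHS]eq_bigr => F _ do rewrite 2!mulr_sumr.
    rewrite [RHS]exchange_big; apply: eq_bigr => d _; apply: eq_bigr => F _; ring.
  under [RHS]eq_bigr => k _ do rewrite rvM mulr_sumr.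
  rewrite [RHS]exchange_big; apply: eq_bigr => F _.
  rewrite (eq_L2 _ (fun a b => L1E _ _)) L2_sum mulr_sumr; apply: eq_bigr => k _.
  rewrite L2Z /u [X in _ = _ * (X * _)]mxE; ring.
under eq_Sv => b do rewrite Sv_sum; rewrite Sv_sum; apply: eq_bigr => k _.
under eq_Sv => b do rewrite SvZ Sv_gp; rewrite SvZ; congr (_ * _).
under eq_Sv => b do rewrite rvM; rewrite Sv_sum rvM; apply: eq_bigr => F _.
rewrite -Sv_suml; congr (_ * _); rewrite -L2_pair.
under eq_Sv => b do rewrite mxE; rewrite Sv_L2; apply: eq_L2 => a b; exact: SvC.
Qed.

Lemma term_Z2 A D p q : Sv p (fun b => Sv q (fun c =>
   \sum_a \sum_e \sum_d \sum_f \sum_B \sum_F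
     xi2 g gp gm xi a e B * C (a, e, d, f) * xi2 g gp gm xi d f F * gp b B A * gp c F D))
  = Z2 A D p q.
Proof.
transitivity (Sv p (fun b => Sv q (fun c => ((gp b)^T *m V *m gp c) A D))).
  apply: eq_Sv => b; apply: eq_Sv => c.
  transitivity (\sum_B \sum_F gp b B A * gp c F D *
      (\sum_a \sum_e \sum_d \sum_f xi2 g gp gm xi a e B * xi2 g gp gm xi d f F * C (a, e, d, f))).
    under [RHS]eq_bigr => B _ do under eq_bigr => F _ do
      (rewrite mulr_sumr; under eq_bigr => a _ do (rewrite mulr_sumr;
       under eq_bigr => e _ do (rewrite mulr_sumr; under eq_bigr => d _ do rewrite mulr_sumr))).
    do 4!(under [RHS]eq_bigr => B _ do rewrite exchange_big;
      rewrite [RHS]exchange_big; apply: eq_bigr => ? _).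
    apply: eq_bigr => B _; apply: eq_bigr => F _; ring.
  rewrite -mulmxA [RHS]mxE; apply: eq_bigr => B _.
  rewrite [in RHS]mxE [X in _ = _ * X]mxE mulr_sumr; apply: eq_bigr => F _.
  by rewrite -Pi_0_0E ffunE; ring.
have SR (W : 'M[K]_N) x y : Sv q (fun c => (W *m gp c) x y) = (W *m Gp q) x y.
  by rewrite mulmx_sumr summxE; apply: eq_bigr => c _; rewrite -scalemxAr [RHS]mxE.
under eq_Sv => b do rewrite SR.
rewrite /Z2 /Gp -!mulmxA linear_sum mulmx_suml summxE; apply: eq_bigr => b _.
by rewrite linearZ -scalemxAl [RHS]mxE /= mulmxA.
Qed.

Lemma Sv2D p q (f h : 'I_n -> 'I_n -> K) : Sv p (fun b => Sv q (fun c => f b c + h b c)) =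
  Sv p (fun b => Sv q (f b)) + Sv p (fun b => Sv q (h b)).
Proof. by rewrite -SvD; apply: eq_Sv => b; rewrite SvD. Qed.

Lemma Sv2Z p q x (f : 'I_n -> 'I_n -> K) : Sv p (fun b => Sv q (fun c => x * f b c)) =
  x * Sv p (fun b => Sv q (f b)).
Proof. by rewrite -SvZ; apply: eq_Sv => b; rewrite SvZ. Qed.

Lemma Sv2B p q (f h : 'I_n -> 'I_n -> K) : Sv p (fun b => Sv q (fun c => f b c - h b c)) =
  Sv p (fun b => Sv q (f b)) - Sv p (fun b => Sv q (h b)).
Proof. by rewrite -SvB; apply: eq_Sv => b; rewrite SvB. Qed.

Lemma Sv_skew2 p q (f : 'I_n -> 'I_n -> K) : Sv p (fun b => Sv q (fun c => skew2 f b c)) =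
  skew2 (fun p q => Sv p (fun b => Sv q (f b))) p q.
Proof.
rewrite /skew2 [X in _ - X]SvC -Sv2B mulrC -Sv2Z.
by do 2!apply: eq_Sv => ?; rewrite mulrC.
Qed.

Lemma Sv_sym2 p q (f : 'I_n -> 'I_n -> K) : Sv p (fun b => Sv q (fun c => sym2 f b c)) =
  sym2 (fun p q => Sv p (fun b => Sv q (f b))) p q.
Proof.
rewrite /sym2 [X in _ + X]SvC -Sv2D mulrC -Sv2Z.
by do 2!apply: eq_Sv => ?; rewrite mulrC.
Qed.

Lemma Pi_0_2E A D p q : Sv p (fun b => Sv q (fun c => Pi_0_2 g gp gm xi C (b, c, A, D))) =
  skew2 (C2 A D) p q + (n%:R - 4)^-1 * skew2 (fun p q => skew2 (fun A D => S2 A D p q) A D) p q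
  - (2 * (n%:R - 2) * (n%:R - 4))^-1 * skew2 (Z2 A D) p q.
Proof.
under eq_Sv => b do under eq_Sv => c do rewrite ffunE.
rewrite Sv2B Sv2D !Sv2Z !Sv_skew2; congr (_ + _ * _ - _ * _).
- by rewrite /skew2 !term_C2.
- rewrite /skew2; congr ((_ - _) / _).
    rewrite -!term_S2 -Sv2B mulrC -Sv2Z.
    by do 2!apply: eq_Sv => ?; rewrite mulrC.
  rewrite -!term_S2 -Sv2B mulrC -Sv2Z.
  by do 2!apply: eq_Sv => ?; rewrite mulrC.
- by rewrite /skew2 !term_Z2.
Qed.

Lemma Pi_0_3E A D p q : Sv p (fun b => Sv q (fun c => Pi_0_3 g gp gm xi C (b, c, A, D))) =
  sym2 (C2 A D) p q - 3 / (n%:R + 4) * sym2 (fun p q => sym2 (fun A D => S2 A D p q) A D) p q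
  - 3 / (2 * (n%:R + 2) * (n%:R + 4)) * sym2 (Z2 A D) p q.
Proof.
under eq_Sv => b do under eq_Sv => c do rewrite ffunE.
rewrite !Sv2B !Sv2Z !Sv_sym2; congr (_ - _ * _ - _ * _).
- by rewrite /sym2 !term_C2.
- rewrite /sym2; congr ((_ + _) / _).
    rewrite -!term_S2 -Sv2D mulrC -Sv2Z.
    by do 2!apply: eq_Sv => ?; rewrite mulrC.
  rewrite -!term_S2 -Sv2D mulrC -Sv2Z.
  by do 2!apply: eq_Sv => ?; rewrite mulrC.
- by rewrite /sym2 !term_Z2.
Qed.

Lemma Pi_1_0E B p q : Sv p (fun c => Sv q (fun d => Pi_1_0 g gp gm xi C (c, d, B))) = X p q 0 B.
Proof.
rewrite -L2_pair -Sv_L2; under eq_Sv => c do under eq_Sv => d do rewrite ffunE.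
by apply: eq_Sv => c; rewrite -Sv_L2.
Qed.

Lemma Pi_1_1E B p q r :
  Sv p (fun b => Sv q (fun c => Sv r (fun d => Pi_1_1 g gp gm xi C (b, c, d, B)))) =
  \sum_i eta i 0 B * cc (true, i) p q r + (n%:R + 2)^-1 *
    ((X q r *m Gp p) 0 B - ((X p q *m Gp r) 0 B - (X p r *m Gp q) 0 B) / 2).
Proof.
pose h b c d := \sum_a \sum_e \sum_F xi2 g gp gm xi a e F * C (a, e, b, c) * gp d F B.
have h1 x y z : Sv x (fun b => Sv y (fun c => Sv z (fun d => h b c d))) = (X x y *m Gp z) 0 B.
  pose u b c : 'rV[K]_N := \row_F L2 F (fun a e => C (a, e, b, c)).
  transitivity (Sv x (fun b => Sv y (fun c => (u b c *m Gp z) 0 B))).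
    apply: eq_Sv => b; apply: eq_Sv => c; rewrite -Sv_gp; apply: eq_Sv => d.
    rewrite rvM; under [RHS]eq_bigr => F _ do rewrite mxE mulr_suml.
    rewrite [RHS]exchange_big; apply: eq_bigr => a _.
    under [RHS]eq_bigr => F _ do rewrite mulr_suml.
    by rewrite [RHS]exchange_big.
  rewrite rvM; under eq_Sv => b do (under eq_Sv => c do rewrite rvM; rewrite Sv_sum).
  rewrite Sv_sum; apply: eq_bigr => F _; under eq_Sv => b do rewrite -Sv_suml.
  rewrite -Sv_suml; congr (_ * _); rewrite -L2_pair -Sv_L2; apply: eq_Sv => b.
  by rewrite -Sv_L2; apply: eq_Sv => c; rewrite mxE.
have E b c d : Pi_1_1 g gp gm xi C (b, c, d, B) = L1 B (fun a => C (a, b, c, d))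
    + (n%:R + 2)^-1 * (h c d b - (h b c d - h b d c) / 2).
  rewrite ffunE /skew2; congr (_ + _ * (_ - _)).
  by do 3!apply: eq_bigr => ? _; rewrite -!mulrA; congr (_ * _); rewrite mulrC.
under eq_Sv => b do under eq_Sv => c do (under eq_Sv => d do rewrite E;
  rewrite SvD SvZ SvB Sv_div SvB Sv_L1 L1E).
rewrite Sv2D Sv2Z Sv2B; congr (_ + _ * (_ - _)).
- under eq_Sv => b do rewrite Sv_sum; rewrite Sv_sum; apply: eq_bigr => i _.
  rewrite Sv2Z; congr (_ * _); rewrite /cm [RHS]SvC; apply: eq_Sv => b.
  by rewrite [RHS]SvC.
- rewrite -h1 SvC; apply: eq_Sv => c; rewrite SvC //.
- under eq_Sv => b do rewrite Sv_div; rewrite Sv_div Sv2B; congr ((_ - _) / _).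
    exact: h1.
  by rewrite -h1; apply: eq_Sv => b; rewrite SvC.
Qed.

End OneTensor.
End Components.

(** * Kernels of the maps Pi as vanishing of frame components *)

Section Kernels.
Variables (K : numClosedFieldType) (m n N : nat) (g : 'M[K]_n)
  (fr : bool -> 'I_m -> 'rV[K]_n) (gp gm : 'I_n -> 'M[K]_N) (xi : 'rV[K]_N).
Hypotheses (m_gt2 : (2 < m)%N) (n_eq : n = m.*2) (frameP : frame g fr)
  (cliffP : clifford_relations g gp gm).
Local Notation I := 'I_m.
Local Notation P := (bool * I)%type.
Local Notation T := (tensor4 K n).
Local Notation M := (m%:R : K).
Local Notation Sv := (Sv fr).
Local Notation cm := (cm fr).
Local Notation Gp := (Gp fr gp).
Local Notation eta := (eta fr gp xi).
Local Notation zeta := (zeta fr gp gm xi).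
Local Notation omega := (omega fr gp gm xi).
Hypotheses (xi_e : forall i, xi *m Gp (true, i) = 0) (xi_neq0 : xi != 0).
Implicit Types (p q r s : P) (i j k l : I) (A B D F : 'I_N).
Local Notation e_ := (pair true).
Local Notation f_ := (pair false).
Local Notation EE := (EE fr gp xi).
Local Notation EEE := (EEE fr gp xi).
Local Notation dl := (dl K).

Lemma nE : n%:R = 2 * M :> K. Proof. by rewrite n_eq -muln2 natrM mulrC. Qed.

Lemma two_neq0 : (2 : K) != 0. Proof. exact: (num_neq0 K 1). Qed.
Lemma np2 : 2 * M + 2 != 0.
Proof. by rewrite (_ : _ + _ = 2 * (M + 1)) ?mulf_neq0 ?two_neq0 ?(Mp1n K m_gt2) //; ring. Qed.
Lemma np4 : 2 * M + 4 != 0.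
Proof. by rewrite (_ : _ + _ = 2 * (M + 2)) ?mulf_neq0 ?two_neq0 ?(Mp2n K m_gt2) //; ring. Qed.
Lemma nm2 : 2 * M - 2 != 0.
Proof. by rewrite (_ : _ - _ = 2 * (M - 1)) ?mulf_neq0 ?two_neq0 ?(MB1n K m_gt2) //; ring. Qed.
Lemma nm4 : 2 * M - 4 != 0.
Proof. by rewrite (_ : _ - _ = 2 * (M - 2)) ?mulf_neq0 ?two_neq0 ?(MB2n K m_gt2) //; ring. Qed.

Lemma eta_ind (h : I -> K) : (forall A, \sum_i eta i 0 A * h i = 0) <-> forall i, h i = 0.
Proof.
split=> [e|e A]; last by rewrite big1 // => i _; rewrite e mulr0.
apply: (ind1 frameP cliffP xi_e xi_neq0); apply/rowP => A; rewrite summxE mxE -[RHS](e A).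
by apply: eq_bigr => i _; rewrite rvZ mulrC.
Qed.

Lemma EE_ind (h : I -> I -> K) : (forall A B, EE A B h = 0) <-> forall i j, h i j = 0.
Proof.
split=> [e i j|e A B]; last by rewrite /EE big1 // => i _; rewrite big1 // => j _; rewrite e mulr0.
move: j; apply/eta_ind => B; move: i; apply/eta_ind => A; rewrite -[RHS](e A B).
apply: eq_bigr => i _; rewrite mulr_sumr; apply: eq_bigr => j _; ring.
Qed.

Lemma EEE_ind (h : I -> I -> I -> K) :
  (forall A B D, EEE A B D h = 0) <-> forall i j k, h i j k = 0.
Proof.
split=> [e i j k|e A B D]; last first.
  rewrite /EEE big1 // => i _; rewrite big1 // => j _; rewrite big1 // => k _.
  by rewrite e mulr0.
move: i j; apply/EE_ind => A B; move: k; apply/eta_ind => D; rewrite -[RHS](e A B D).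
under eq_bigr => k _ do rewrite mulr_sumr; rewrite exchange_big; apply: eq_bigr => i _.
under eq_bigr => k _ do rewrite mulr_sumr; rewrite exchange_big; apply: eq_bigr => j _.
by apply: eq_bigr => k _; ring.
Qed.

Lemma EE_0 A B h : (forall i j, h i j = 0) -> EE A B h = 0.
Proof. by move=> e; apply: (proj2 (EE_ind h)). Qed.

Lemma Sv_0 p (f : 'I_n -> K) : (forall a, f a = 0) -> Sv p f = 0.
Proof. by move=> e; apply: (proj2 (Sv_eq0 frameP f)). Qed.

Lemma EE_D A B f h : EE A B f + EE A B h = EE A B (fun i j => f i j + h i j).
Proof. by rewrite -big_split; apply: eq_bigr => i _; rewrite -big_split; apply: eq_bigr => j _ /=; ring. Qed.
Lemma EE_Z A B x f : x * EE A B f = EE A B (fun i j => x * f i j).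
Proof. by rewrite mulr_sumr; apply: eq_bigr => i _; rewrite mulr_sumr; apply: eq_bigr => j _; ring. Qed.
Lemma EE_V A B x f : EE A B f / x = EE A B (fun i j => f i j / x).
Proof. by rewrite mulrC EE_Z; do 2!apply: eq_bigr => ? _; rewrite [_^-1 * _]mulrC. Qed.
Lemma EE_N A B f : - EE A B f = EE A B (fun i j => - f i j).
Proof. by rewrite -mulN1r EE_Z; do 2!apply: eq_bigr => ? _; rewrite mulN1r. Qed.
Definition EE_comb := (EE_D, EE_N, EE_Z, EE_V).
Lemma EE_C A B f : EE B A f = EE A B (fun i j => f j i).
Proof. by rewrite /EE exchange_big; do 2!apply: eq_bigr => ? _; rewrite [_ * eta _ 0 A]mulrC. Qed.
Lemma eq_EE A B f h : (forall i j, f i j = h i j) -> EE A B f = EE A B h.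
Proof. by move=> e; do 2!apply: eq_bigr => ? _; rewrite e. Qed.

Lemma eta_dl k A : eta k 0 A = \sum_i eta i 0 A * dl i k.
Proof. by rewrite sum_dlCr. Qed.

Lemma other_index i j : exists l, (i != l) && (j != l).
Proof.
have [l] : exists l, l \notin [:: i; j].
  apply/existsP; apply: contraT; rewrite negb_exists => /forallP h.
  have : (#|'I_m| <= size [:: i; j])%N.
    apply: leq_trans (card_size _); apply/subset_leq_card/subsetP => x _.
    by have := h x; rewrite negbK.
  by rewrite card_ord leqNgt m_gt2.
by rewrite !inE negb_or ![l == _]eq_sym => h; exists l.
Qed.

(** For given [l], the alternating part of the coefficients at (i, j, l) with i, j different from
    [l] is a multiple of Y_ij. Every pair i, j leaves such an [l], because m > 2. *)
Lemma omega_ind (Y : I -> I -> K) (b : I -> I -> K) : (forall i j, Y j i = - Y i j) ->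
  (forall l, \sum_i \sum_j Y i j *: omega i j l + \sum_k b l k *: eta k = 0) ->
  (forall i j, Y i j = 0) /\ forall l k, b l k = 0.
Proof.
move=> sY e.
have h l : (forall i, b l i = 0) /\ forall i j, i != l -> j != l -> Y i j = 0.
  have H : \sum_i \sum_j \sum_k (Y i j * dl k l) *: omega i j k + \sum_k b l k *: eta k = 0.
    rewrite -[RHS](e l); congr (_ + _); apply: eq_bigr => i _; apply: eq_bigr => j _.
    under eq_bigr => k _ do rewrite mulrC -scalerA.
    rewrite (bigD1 l) //= dlii scale1r big1 ?addr0 // => k kl.
    by rewrite dln // scale0r.
  have [h1 h2] := ind3 frameP cliffP xi_e xi_neq0 H.
  split=> // i j il jl; have := h2 i j l; rewrite (sY i j) (sY i l) (sY j l).
  rewrite dlii (dln K il) (dln K jl) => h3.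
  by apply: (cancel0 two_neq0); rewrite -[RHS]h3; ring.
split=> [i j|l k]; last by case: (h l).
by have [l /andP [il jl]] := other_index i j; case: (h l) => _; apply.
Qed.

Section OneTensor.
Variable C : T.
Hypothesis CW : C \in weyl g.
Local Notation cc := (cm C).
Local Notation X := (Xc fr gp gm xi C).
Local Notation zc := (zc fr C).
Local Notation wv := (wc fr gp gm xi C).
Let c12 := cc12 frameP CW.
Let cpair := cc_pair frameP CW.

(** [kP] and [kQ] express that nothing of degree -2, respectively -1, is present; within degree -1,
    [kz] excludes the two-form component and [kQlam] the trace-free hook. *)
Definition kP := forall i j k l, cc (e_ i) (e_ j) (e_ k) (e_ l) = 0.
Definition kQ := forall i j k l, cc (e_ i) (e_ j) (e_ k) (f_ l) = 0.
Definition kz := forall i j, zc (e_ i) (e_ j) = 0.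
Definition kQlam := forall i j k l, cc (e_ i) (e_ j) (e_ k) (f_ l) = (2 * M + 2)^-1 *
  (2 * zc (e_ i) (e_ j) * dl k l + zc (e_ i) (e_ k) * dl j l - zc (e_ j) (e_ k) * dl i l).
Definition z2 : K := \sum_k zc (e_ k) (f_ k).

Lemma zcE p q : zc p q = \sum_k cc p q (e_ k) (f_ k).
Proof. by apply: eq_bigr => k _; rewrite cpair. Qed.

(** This is [ind0]: it leaves the components symmetric in i, j, and they are skew. *)
Lemma X0P p q : X p q = 0 <-> (forall i j, cc (e_ i) (e_ j) p q = 0) /\ zc p q = 0.
Proof.
split=> [|[h z]]; last first.
  by rewrite /Xc z mulr0 scale0r subr0; do 2!(rewrite big1 // => ? _); rewrite h scale0r.
rewrite /Xc -scaleNr => /(ind0 frameP cliffP xi_e xi_neq0) [z h]; split=> [i j|].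
  by apply: neg_self; rewrite -c12 -h.
by apply: (@cancel0 _ (- 2)); rewrite ?oppr_eq0 ?two_neq0 // mulNr.
Qed.

Lemma XGe p q k A : (X p q *m Gp (e_ k)) 0 A = \sum_j eta j 0 A * (4 * cc (e_ k) (e_ j) p q).
Proof.
rewrite /Xc mulmxBl -scalemxAl xi_e scaler0 subr0 mulmx_suml summxE.
transitivity (\sum_i \sum_j (dl i k * (2 * cc (e_ i) (e_ j) p q * eta j 0 A)
    - dl j k * (2 * cc (e_ i) (e_ j) p q * eta i 0 A))).
  apply: eq_bigr => i _; rewrite mulmx_suml summxE; apply: eq_bigr => j _.
  rewrite -scalemxAl (zeta_e frameP cliffP xi_e) rvZ rvD rvN !rvZ; ring.
under eq_bigr => i _ do rewrite sumrB sum_dlC.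
rewrite sumrB exchange_big /=; under eq_bigr => j _ do rewrite sum_dlC.
rewrite -sumrB; apply: eq_bigr => j _; rewrite (c12 (e_ k)); ring.
Qed.

Lemma X_xi p q : (forall i j, cc (e_ i) (e_ j) p q = 0) -> X p q = - (2 * zc p q) *: xi.
Proof.
move=> h; rewrite /Xc [X in X - _]big1 ?sub0r ?scaleNr // => i _.
by rewrite big1 // => j _; rewrite h scale0r.
Qed.

Lemma XGf p q k A : (forall i j, cc (e_ i) (e_ j) p q = 0) ->
  (X p q *m Gp (f_ k)) 0 A = - (2 * zc p q) * eta k 0 A.
Proof. by move=> h; rewrite X_xi // -scalemxAl rvZ. Qed.

Lemma wE : wv = \sum_r \sum_s zc (e_ r) (e_ s) *: zeta r s - (2 * z2) *: xi.
Proof.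
rewrite /wc /Xc sumrB -scaler_suml -mulr_sumr; congr (_ - _).
rewrite exchange_big; apply: eq_bigr => r _; rewrite exchange_big; apply: eq_bigr => s _.
by rewrite -scaler_suml zcE.
Qed.

Lemma ker_m2_0 : (forall A B D F, Pi_m2_0 g gp xi C (A, B, D, F) = 0) <-> kP.
Proof.
have E A B D F : Pi_m2_0 g gp xi C (A, B, D, F) = EE A B (fun i j => EE D F (fun k l =>
    cc (e_ i) (e_ j) (e_ k) (e_ l))).
  rewrite (Pi_m2_0E frameP xi_e); apply: eq_bigr => i _; apply: eq_bigr => j _.
  rewrite mulr_sumr; apply: eq_bigr => k _; rewrite mulr_sumr; apply: eq_bigr => l _; ring.
split=> [h i j|h A B D F]; last first.
  by rewrite E; apply: EE_0 => i j; apply: EE_0 => k l; exact: h.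
apply/EE_ind => D F; move: i j; apply/EE_ind => A B; by rewrite -E.
Qed.

Lemma ker_m1_0 : (forall A B D, Pi_m1_0 g gp gm xi C (A, B, D) = 0) <-> kP /\ kz.
Proof.
split=> [h|[h z] A B D]; last first.
  rewrite (Pi_m1_0E frameP cliffP xi_e CW); apply: EE_0 => i j.
  by rewrite (proj2 (X0P _ _)) ?mxE.
have X0 i j : X (e_ i) (e_ j) = 0.
  apply/rowP => D; rewrite [RHS]mxE.
  move: i j; apply: (proj1 (EE_ind (fun i j => X (e_ i) (e_ j) 0 D))) => A B.
  by rewrite -(Pi_m1_0E frameP cliffP xi_e CW).
by split=> [k l i j|i j]; have [h1 h2] := proj1 (X0P _ _) (X0 i j).
Qed.

(** Independence in the second spinor index separates the [X] on two vectors of V_{1/2} from [wc];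
    the former give [kP] and [kz], after which [wc] is - 2 z2 xi. *)
Lemma ker_0_0 : (forall B D, Pi_0_0 g gp gm xi C (B, D) = 0) <-> [/\ kP, kz & z2 = 0].
Proof.
have E B D : Pi_0_0 g gp gm xi C (B, D) = (\sum_k \sum_l X (e_ k) (e_ l) 0 B *: zeta k l
   + (- 2 * wv 0 B) *: xi) 0 D.
  rewrite (Pi_0_0E frameP cliffP xi_e CW) /Vc mxB rvD summxE; congr (_ + _).
    rewrite summxE; apply: eq_bigr => k _; rewrite !summxE; apply: eq_bigr => l _.
    by rewrite dyad rvZ.
  by rewrite mxZ dyad rvZ mulNr mulNr mulrA.
split=> [h|[h z zz] B D].
  have [w0 X0] : wv = 0 /\ forall i j, X (e_ i) (e_ j) = 0.
    have H B : \sum_k \sum_l X (e_ k) (e_ l) 0 B *: zeta k l + (- 2 * wv 0 B) *: xi = 0.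
      by apply/rowP => D; rewrite -E h mxE.
    split=> [|i j]; apply/rowP => B; rewrite [RHS]mxE.
      have [w _] := ind0 frameP cliffP xi_e xi_neq0 (H B).
      by apply: (cancel0 _ w); rewrite oppr_eq0 two_neq0.
    have [_ s] := ind0 frameP cliffP xi_e xi_neq0 (H B).
    by apply: neg_self; rewrite {1}s (Xc_skew gp gm xi frameP CW) rvN.
  have [kp kz0] : kP /\ kz.
    by split=> [k l i j|i j]; have [h1 h2] := proj1 (X0P _ _) (X0 i j).
  split=> //; move: w0; rewrite wE.
  under eq_bigr => r _ do (under eq_bigr => s _ do rewrite kz0 scale0r; rewrite big1_eq).
  rewrite big1_eq sub0r -scaleNr => /(ind_xi xi_neq0) w.
  by apply: (@cancel0 _ (- 2)); rewrite ?oppr_eq0 ?two_neq0 // mulNr.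
rewrite E rvD rvZ wE zz mulr0 scale0r subr0 !summxE.
rewrite [X in _ + _ * X * _]big1 => [|r _].
  rewrite mulr0 mul0r addr0 big1 // => r _; rewrite summxE big1 // => s _.
  by rewrite (proj2 (X0P _ _)) // rvZ mxE mul0r.
by rewrite summxE big1 // => s _; rewrite z scale0r mxE.
Qed.

Lemma ker_1_0 : (forall c d B, Pi_1_0 g gp gm xi C (c, d, B) = 0) <->
  forall p q, (forall i j, cc (e_ i) (e_ j) p q = 0) /\ zc p q = 0.
Proof.
split=> [h p q|h c d B].
  apply/X0P/rowP => B; rewrite -(Pi_1_0E frameP cliffP xi_e CW) mxE.
  apply: Sv_0 => c; apply: Sv_0 => d; exact: h.
move: c; apply/(Sv_eq0 frameP) => p; move: p d.
have : forall p q, Sv p (fun c => Sv q (fun d => Pi_1_0 g gp gm xi C (c, d, B))) = 0.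
  by move=> p q; rewrite (Pi_1_0E frameP cliffP xi_e CW) (proj2 (X0P _ _)) ?mxE.
move=> h0 p d; suff : forall d, Sv p (fun c => Pi_1_0 g gp gm xi C (c, d, B)) = 0 by [].
by apply/(Sv_eq0 frameP) => q; rewrite SvC.
Qed.

End OneTensor.
End Kernels.

Section Kernels2.
Variables (K : numClosedFieldType) (m n N : nat) (g : 'M[K]_n)
  (fr : bool -> 'I_m -> 'rV[K]_n) (gp gm : 'I_n -> 'M[K]_N) (xi : 'rV[K]_N).
Hypotheses (m_gt2 : (2 < m)%N) (n_eq : n = m.*2) (frameP : frame g fr)
  (cliffP : clifford_relations g gp gm).
Local Notation I := 'I_m.
Local Notation P := (bool * I)%type.
Local Notation T := (tensor4 K n).
Local Notation M := (m%:R : K).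
Local Notation Sv := (Sv fr).
Local Notation cm := (cm fr).
Local Notation Gp := (Gp fr gp).
Local Notation eta := (eta fr gp xi).
Local Notation zeta := (zeta fr gp gm xi).
Local Notation omega := (omega fr gp gm xi).
Hypotheses (xi_e : forall i, xi *m Gp (true, i) = 0) (xi_neq0 : xi != 0).
Implicit Types (p q : P) (i j k l r s : I) (A B D F : 'I_N).
Local Notation e_ := (pair true).
Local Notation f_ := (pair false).
Local Notation EE := (EE fr gp xi).
Local Notation EEE := (EEE fr gp xi).
Local Notation dl := (dl K).

Local Notation EE_ind := (EE_ind frameP cliffP xi_e xi_neq0).
Local Notation EE_0 := (EE_0 frameP cliffP xi_e xi_neq0).
Local Notation EEE_ind := (EEE_ind frameP cliffP xi_e xi_neq0).
Local Notation Sv_0 := (Sv_0 frameP).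
Local Notation kP := (kP fr).
Local Notation kQ := (kQ fr).
Local Notation kz := (kz fr).
Local Notation kQlam := (kQlam fr).
Local Notation z2 := (z2 fr).
Local Notation nE := (nE K n_eq).
Let h2 := two_neq0 K.
Let hp2 := np2 K m_gt2.

Section OneTensor.
Variable C : T.
Hypothesis CW : C \in weyl g.
Local Notation cc := (cm C).
Local Notation X := (Xc fr gp gm xi C).
Local Notation V := (Vc fr gp gm xi C).
Local Notation zc := (zc fr C).
Local Notation wv := (wc fr gp gm xi C).
Local Notation z2c := (z2 C).
Let c12 := cc12 frameP CW.
Local Notation X0P := (X0P frameP cliffP xi_e xi_neq0 CW).
Local Notation XGe := (XGe frameP cliffP xi_e CW).
Local Notation XGf := (XGf gp gm xi).

Lemma EEE_D A B D f h : EEE A B D f + EEE A B D h = EEE A B D (fun i j k => f i j k + h i j k).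
Proof.
rewrite /EEE -big_split; apply: eq_bigr => i _; rewrite -big_split; apply: eq_bigr => j _.
by rewrite -big_split; apply: eq_bigr => k _ /=; ring.
Qed.
Lemma EEE_Z A B D x f : x * EEE A B D f = EEE A B D (fun i j k => x * f i j k).
Proof.
rewrite mulr_sumr; apply: eq_bigr => i _; rewrite mulr_sumr; apply: eq_bigr => j _.
by rewrite mulr_sumr; apply: eq_bigr => k _; ring.
Qed.
Lemma EEE_V A B D x f : EEE A B D f / x = EEE A B D (fun i j k => f i j k / x).
Proof. by rewrite mulrC EEE_Z; do 3!apply: eq_bigr => ? _; rewrite [_^-1 * _]mulrC. Qed.
Lemma EEE_N A B D f : - EEE A B D f = EEE A B D (fun i j k => - f i j k).
Proof. by rewrite -mulN1r EEE_Z; do 3!apply: eq_bigr => ? _; rewrite mulN1r. Qed.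
Lemma EEE_cyc A B D f : EEE D A B f = EEE A B D (fun i j k => f k i j).
Proof.
rewrite /EEE exchange_big; apply: eq_bigr => i _; rewrite exchange_big.
by do 2!apply: eq_bigr => ? _; congr (_ * _); ring.
Qed.
Lemma EEE_rev A B D f : EEE D B A f = EEE A B D (fun i j k => f k j i).
Proof.
rewrite EEE_cyc /EEE exchange_big; apply: eq_bigr => i _.
by apply: eq_bigr => j _; apply: eq_bigr => k _; ring.
Qed.
Lemma EEE_0 A B D h : (forall i j k, h i j k = 0) -> EEE A B D h = 0.
Proof. by move=> e; apply: (proj2 (EEE_ind h)). Qed.

Lemma kz_of_kQ : kQ C -> kz C.
Proof. by move=> q i j; rewrite (zcE frameP CW) big1 // => k _; exact: q. Qed.

Lemma kQlam_of_kQ : kQ C -> kQlam C.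
Proof. move=> q i j k l; rewrite q !(kz_of_kQ q); ring. Qed.

Lemma kQ_of_kQlam : kQlam C -> kz C -> kQ C.
Proof. move=> q z i j k l; rewrite q !z; ring. Qed.

Lemma Y1f A B D l : kP C -> Y1 fr gp gm xi C A B D (f_ l) =
  EEE A B D (fun i j k => - (2 * zc (e_ i) (e_ j)) * dl k l).
Proof.
move=> kp; do 2!apply: eq_bigr => ? _; rewrite XGf ?eta_dl => [|? ?]; last exact: kp.
by rewrite !mulr_sumr; apply: eq_bigr => k _; ring.
Qed.

Lemma m1_1f A B D l : kP C -> Sv (f_ l) (fun e => Pi_m1_1 g gp gm xi C (A, B, D, e)) =
  EEE A B D (fun i j k => cc (e_ i) (e_ j) (e_ k) (f_ l) - (2 * M + 2)^-1 *
  (2 * zc (e_ i) (e_ j) * dl k l + zc (e_ i) (e_ k) * dl j l - zc (e_ j) (e_ k) * dl i l)).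
Proof.
move=> kp; rewrite (Pi_m1_1E frameP cliffP xi_e CW) !Y1f // nE.
rewrite [EEE D A B _]EEE_cyc [EEE D B A _]EEE_rev.
rewrite !(EEE_N, EEE_D, EEE_V, EEE_Z).
apply: eq_bigr => i _; apply: eq_bigr => j _; apply: eq_bigr => k _; congr (_ * _).
rewrite (zc_skew frameP CW (e_ i) (e_ k)) (zc_skew frameP CW (e_ j) (e_ k)).
by field; rewrite ?hp2.
Qed.

(** Evaluated at f_l with A and B kept, the map is a combination of [omega] and [eta] in the index
    D, and only the components of degree -2 multiply [omega]. Once these are gone every [X] involved
    is a multiple of xi, and [m1_1f] exhibits the trace-free hook. *)
Lemma ker_m1_1 : (forall A B D e, Pi_m1_1 g gp gm xi C (A, B, D, e) = 0) <-> kP C /\ kQlam C.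
Proof.
split=> [h|[kp q] A B D e].
  have kp : kP C.
    (* [Y] and [b] are the coefficients of [omega] and of [eta] in the value at f_l. *)
    pose Y A B r s := (2 * M + 2)^-1 * EE A B (fun i j => cc (e_ r) (e_ s) (e_ i) (e_ j)).
    pose b A B l k := \sum_i \sum_j eta i 0 A * eta j 0 B * cc (e_ i) (e_ j) (e_ k) (f_ l)
      + (2 * M + 2)^-1 * (- 2 * EE A B (fun i j => zc (e_ i) (e_ j)) * dl k l
         - (\sum_j eta j 0 A * (X (e_ k) (e_ j) *m Gp (f_ l)) 0 B
           - \sum_j eta j 0 B * (X (e_ k) (e_ j) *m Gp (f_ l)) 0 A) / 2).
    have H A B : (forall r s, Y A B r s = 0) /\ forall l k, b A B l k = 0.
      apply: (omega_ind m_gt2 frameP cliffP xi_e xi_neq0) => [r s|l].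
        by rewrite /Y -mulrN EE_N; congr (_ * _); apply: eq_EE => i j; rewrite c12.
      apply/rowP => D; rewrite [RHS]mxE -[RHS](Sv_0 (f_ l) (h A B D)).
      rewrite (Pi_m1_1E frameP cliffP xi_e CW) rvD !summxE nE.
      under eq_bigr => r _ do (rewrite summxE; under eq_bigr => s _ do rewrite rvZ).
      under [X in _ + X]eq_bigr => k _ do rewrite rvZ /b mulrDl.
      rewrite [X in _ + X]big_split /= addrCA; congr (_ + _).
        under eq_bigr => k _ do rewrite mulr_suml; rewrite exchange_big.
        apply: eq_bigr => i _; under eq_bigr => k _ do rewrite mulr_suml.
        rewrite exchange_big; apply: eq_bigr => j _; apply: eq_bigr => k _; ring.
      have E1 : Y1 fr gp gm xi C A B D (f_ l) =
          \sum_r \sum_s EE A B (fun i j => cc (e_ r) (e_ s) (e_ i) (e_ j)) * omega r s l 0 D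
          - 2 * EE A B (fun i j => zc (e_ i) (e_ j)) * eta l 0 D.
        rewrite [2 * EE _ _ _]EE_Z mulr_suml /EE.
        under [X in X - _]eq_bigr => r _ do (under eq_bigr => s _ do (rewrite mulr_suml;
          under eq_bigr => i _ do rewrite mulr_suml)).
        under [X in X - _]eq_bigr => r _ do rewrite exchange_big.
        rewrite [X in X - _]exchange_big -sumrB; apply: eq_bigr => i _ /=.
        under [X in X - _]eq_bigr => r _ do rewrite exchange_big.
        rewrite [X in X - _]exchange_big mulr_suml -sumrB; apply: eq_bigr => j _ /=.
        rewrite /Xc mulmxBl -scalemxAl rvD rvN rvZ mulmx_suml summxE mulrBr; congr (_ - _).
          rewrite mulr_sumr; apply: eq_bigr => r _; rewrite mulmx_suml summxE mulr_sumr.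
          by apply: eq_bigr => s _; rewrite -scalemxAl rvZ /omega; ring.
        rewrite /eta; ring.
      have E2 A' B' : \sum_k \sum_j eta j 0 A' * (X (e_ k) (e_ j) *m Gp (f_ l)) 0 B' * eta k 0 D
          = Y1 fr gp gm xi C D A' B' (f_ l).
        by apply: eq_bigr => k _; apply: eq_bigr => j _; ring.
      rewrite -!E2 E1 {E1}.
      transitivity ((2 * M + 2)^-1 * (\sum_r \sum_s EE A B (fun i j => cc (e_ r) (e_ s) (e_ i) (e_ j)) * omega r s l 0 D)
        + \sum_k (2 * M + 2)^-1 * (- 2 * EE A B (fun i j => zc (e_ i) (e_ j)) * dl k l
         - (\sum_j eta j 0 A * (X (e_ k) (e_ j) *m Gp (f_ l)) 0 B
           - \sum_j eta j 0 B * (X (e_ k) (e_ j) *m Gp (f_ l)) 0 A) / 2) * eta k 0 D).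
        congr (_ + _); rewrite mulr_sumr; apply: eq_bigr => r _; rewrite mulr_sumr.
        by apply: eq_bigr => s _; rewrite /Y mulrA.
      rewrite -addrA mulrDr; congr (_ + _).
      under [X in _ = _ * (_ - (X - _) / _)]eq_bigr => k _ do rewrite -mulr_suml.
      under [X in _ = _ * (_ - (_ - X) / _)]eq_bigr => k _ do rewrite -mulr_suml.
      move: (EE A B _) => z; set a := fun k => \sum_j eta j 0 A * (X (e_ k) (e_ j) *m Gp (f_ l)) 0 B.
      set a' := fun k => \sum_j eta j 0 B * (X (e_ k) (e_ j) *m Gp (f_ l)) 0 A.
      transitivity (\sum_k ((2 * M + 2)^-1 * (- 2 * z) * (eta k 0 D * dl k l)
        - (2 * M + 2)^-1 / 2 * (a k * eta k 0 D) + (2 * M + 2)^-1 / 2 * (a' k * eta k 0 D))).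
        by apply: eq_bigr => k _; rewrite /a /a'; ring.
      rewrite big_split /= sumrB -[X in X - _ + _]mulr_sumr sum_dlCr.
      rewrite -[X in _ - X + _]mulr_sumr -[X in _ + X]mulr_sumr /a /a' /=; ring.
    move=> r s; apply: (proj1 (EE_ind _)) => A B; have [HY _] := H A B.
    by apply: (cancel0 _ (HY r s)); rewrite invr_eq0 hp2.
  split=> // i j k l; apply: subr0_eq.
  move: i j k; apply: (proj1 (EEE_ind _)) => A B D; rewrite -m1_1f //.
  by apply: Sv_0 => e; exact: h.
move: e; apply/(Sv_eq0 frameP) => -[[] l]; last first.
  by rewrite m1_1f // EEE_0 // => i j k; rewrite q subrr.
have Y0 A' B' D' : Y1 fr gp gm xi C A' B' D' (e_ l) = 0.
  apply: EE_0 => i j; rewrite XGe big1 // => k _; rewrite kp; ring.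
rewrite (Pi_m1_1E frameP cliffP xi_e CW) !Y0 EEE_0 => [|i j k]; last exact: kp.
ring.
Qed.

Lemma VGf B l : row B V *m Gp (f_ l) = \sum_r \sum_s X (e_ r) (e_ s) 0 B *: omega r s l
  - (2 * wv 0 B) *: eta l.
Proof.
have -> : row B V = \sum_r \sum_s X (e_ r) (e_ s) 0 B *: zeta r s - (2 * wv 0 B) *: xi.
  apply/rowP => D; rewrite [LHS]mxE /Vc mxB rvD rvN summxE; congr (_ - _).
    rewrite summxE; apply: eq_bigr => k _; rewrite !summxE; apply: eq_bigr => j _.
    by rewrite dyad rvZ.
  by rewrite mxZ dyad rvZ mulrA.
rewrite mulmxBl -scalemxAl mulmx_suml; congr (_ - _); apply: eq_bigr => r _.
by rewrite mulmx_suml; apply: eq_bigr => s _; rewrite -scalemxAl.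
Qed.

Lemma VGe B l : kP C -> kz C -> row B V *m Gp (e_ l) = 0.
Proof.
move=> kp z; have X0 i j : X (e_ i) (e_ j) = 0 by apply/X0P; split=> // ? ?; exact: kp.
have -> : row B V = - (2 * wv 0 B) *: xi.
  apply/rowP => D; rewrite [LHS]mxE /Vc mxB rvZ summxE big1 => [|k _].
    by rewrite mxZ dyad sub0r mulNr mulrA.
  by rewrite summxE big1 // => j _; rewrite dyad X0 mxE mul0r.
by rewrite -scalemxAl xi_e scaler0.
Qed.

Lemma wE0 : kz C -> wv = - (2 * z2c) *: xi.
Proof.
move=> z; rewrite (wE gp gm xi frameP CW) [X in X - _]big1 ?sub0r ?scaleNr // => i _.
by rewrite big1 // => j _; rewrite z scale0r.
Qed.

(** At f_l, [omega_ind] gives X(e_r, e_s) = 0 and X(e_k, f_l) = M^-1 delta_kl w. As w is then a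
    multiple of xi, degree -1 vanishes and the half trace of degree 0 is scalar. *)
Lemma ker_0_1 : (forall B D d, Pi_0_1 g gp gm xi C (B, D, d) = 0) <->
  [/\ kP C, kQ C & forall k l, zc (e_ k) (f_ l) = M^-1 * z2c * dl k l].
Proof.
have hM := M0n K m_gt2.
have VGr B D p : (V *m Gp p) B D = (row B V *m Gp p) 0 D by rewrite -row_mul [RHS]mxE.
split=> [h|[kp q hz] B D d].
  have H B : (forall r s, (2 * M)^-1 * X (e_ r) (e_ s) 0 B = 0) /\
      forall l k, X (e_ k) (f_ l) 0 B - (2 * M)^-1 * (2 * wv 0 B) * dl k l = 0.
    apply: (omega_ind m_gt2 frameP cliffP xi_e xi_neq0) => [r s|l].
      by rewrite (Xc_skew gp gm xi frameP CW (e_ r)) rvN mulrN.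
    apply/rowP => D; rewrite [RHS]mxE -[RHS](Sv_0 (f_ l) (h B D)).
    rewrite (Pi_0_1E frameP cliffP xi_e CW) VGr VGf nE; move: (wv 0 B) => w.
    rewrite !rvD rvN rvZ !summxE addrC mulrBr addrCA addrC.
    congr (_ + _).
      rewrite mulr_sumr; apply: eq_bigr => r _; rewrite !summxE mulr_sumr; apply: eq_bigr => s _.
      by rewrite !rvZ mulrA.
    rewrite [eta l 0 D]eta_dl !mulr_sumr -sumrN -big_split; apply: eq_bigr => k _ /=.
    by rewrite rvZ; ring.
  have X0 r s : X (e_ r) (e_ s) = 0.
    apply/rowP => B; rewrite [RHS]mxE; have [h1 _] := H B.
    by apply: (cancel0 _ (h1 r s)); rewrite invr_eq0 mulf_neq0.
  have kp : kP C by move=> k l i j; have [h1 _] := proj1 (X0P _ _) (X0 i j).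
  have z : kz C by move=> i j; have [_] := proj1 (X0P _ _) (X0 i j).
  have XE k l : \sum_i \sum_j cc (e_ i) (e_ j) (e_ k) (f_ l) *: zeta i j
      + (- 2 * zc (e_ k) (f_ l) + 2 * M^-1 * z2c * dl k l) *: xi = 0.
    transitivity (X (e_ k) (f_ l) - ((2 * M)^-1 * 2 * dl k l) *: wv); last first.
      apply/rowP => B; have [_ h1] := H B; rewrite [RHS]mxE -(h1 l k) [LHS]rvD [in LHS]rvN [in LHS]rvZ.
      by congr (_ - _); ring.
    rewrite wE0 // scalerA /Xc -addrA -!scaleNr -scalerDl; congr (_ + _ *: _).
    by field; rewrite ?h2 ?hM.
  split=> //.
    move=> i j k l; apply: neg_self; have [_ s] := ind0 frameP cliffP xi_e xi_neq0 (XE k l).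
    by rewrite {1}s c12.
  move=> k l; have [s _] := ind0 frameP cliffP xi_e xi_neq0 (XE k l).
  apply: subr0_eq; apply: (cancel0 h2).
  by rewrite -[RHS]oppr0 -s; ring.
have z := kz_of_kQ q.
move: d; apply/(Sv_eq0 frameP) => -[[] l]; rewrite (Pi_0_1E frameP cliffP xi_e CW) VGr.
  rewrite VGe // mxE mulr0 addr0 big1 // => k _.
  by rewrite (proj2 (X0P _ _)) ?mxE ?mulr0 //; split=> // ? ?; exact: kp.
rewrite VGf nE wE0 // rvD rvN rvZ rvZ summxE [X in _ + _ * (X - _)]big1 => [|r _]; last first.
  rewrite summxE big1 // => s _; rewrite (proj2 (X0P _ _)) ?mxE ?mul0r //; split=> // ? ?; exact: kp.
have -> : \sum_k eta k 0 D * X (e_ k) (f_ l) 0 B = \sum_k - (2 * M^-1 * z2c) * xi 0 B * eta k 0 D * dl k l.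
  apply: eq_bigr => k _; rewrite (X_xi gp gm xi) => [|? ?]; last exact: q.
  by rewrite rvZ hz; ring.
by rewrite sum_dlCr; field; rewrite ?h2 ?hM.
Qed.

End OneTensor.
End Kernels2.

(** * Kernels of Pi_0^2, Pi_0^3 and Pi_1^1 *)

Section Kernels3.
Variables (K : numClosedFieldType) (m n N : nat) (g : 'M[K]_n)
  (fr : bool -> 'I_m -> 'rV[K]_n) (gp gm : 'I_n -> 'M[K]_N) (xi : 'rV[K]_N).
Hypotheses (m_gt2 : (2 < m)%N) (n_eq : n = m.*2) (frameP : frame g fr)
  (cliffP : clifford_relations g gp gm).
Local Notation I := 'I_m.
Local Notation P := (bool * I)%type.
Local Notation T := (tensor4 K n).
Local Notation M := (m%:R : K).
Local Notation Sv := (Sv fr).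
Local Notation cm := (cm fr).
Local Notation Gp := (Gp fr gp).
Local Notation eta := (eta fr gp xi).
Local Notation zeta := (zeta fr gp gm xi).
Local Notation omega := (omega fr gp gm xi).
Hypotheses (xi_e : forall i, xi *m Gp (true, i) = 0) (xi_neq0 : xi != 0).
Implicit Types (p q : P) (i j k l r s : I) (A B D F : 'I_N).
Local Notation e_ := (pair true).
Local Notation f_ := (pair false).
Local Notation EE := (EE fr gp xi).
Local Notation dl := (dl K).

Local Notation EE_ind := (EE_ind frameP cliffP xi_e xi_neq0).
Local Notation EE_0 := (EE_0 frameP cliffP xi_e xi_neq0).
Local Notation Sv_0 := (Sv_0 frameP).
Local Notation kP := (kP fr).
Local Notation kQ := (kQ fr).
Local Notation kz := (kz fr).
Local Notation kQlam := (kQlam fr).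
Local Notation z2 := (z2 fr).
Local Notation nE := (nE K n_eq).
Let h2 := two_neq0 K.
Let hp2 := np2 K m_gt2.
Let hp4 := np4 K m_gt2.
Let hm2 := nm2 K m_gt2.
Let hm4 := nm4 K m_gt2.

Section OneTensor.
Variable C : T.
Hypothesis CW : C \in weyl g.
Local Notation cc := (cm C).
Local Notation X := (Xc fr gp gm xi C).
Local Notation zc := (zc fr C).
Local Notation wv := (wc fr gp gm xi C).
Local Notation z2c := (z2 C).
Local Notation S2 := (S2 fr gp gm xi C).
Local Notation Z2 := (Z2 fr gp gm xi C).
Local Notation C2 := (C2 fr gp xi C).
Let c12 := cc12 frameP CW.
Let c34 := cc34 frameP CW.
Let cpair := cc_pair frameP CW.
Let cbian := cc_bianchi frameP CW.
Local Notation XGe := (XGe frameP cliffP xi_e CW).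
Local Notation XGf := (XGf gp gm xi).
Local Notation kz_of_kQ := (kz_of_kQ frameP CW).
Local Notation F0 := (rdC fr 0 true C).

Lemma F0E i j k l : cc (e_ i) (f_ k) (e_ j) (f_ l) = ev F0 i j k l.
Proof. by rewrite ev_mkA. Qed.

Lemma z0F j l : z0 F0 j l = zc (e_ j) (f_ l).
Proof. by apply: eq_bigr => i _; rewrite -F0E. Qed.

Lemma zzF : zz F0 = z2c.
Proof. by apply: eq_bigr => i _; rewrite z0F. Qed.

Lemma riemF : riem0 F0. Proof. exact: (rdC_lvl frameP 0 true CW). Qed.

Lemma A4E i j k l : cc (e_ i) (e_ j) (f_ k) (f_ l) = 2 * altB F0 i j k l.
Proof.
have := cbian (e_ i) (e_ j) (f_ k) (f_ l); have [hs _] := riemF.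
rewrite (c12 (e_ i) (f_ k) (e_ j)) !F0E (hs i j l k) => h.
rewrite /altB mulrC divfK //; apply: subr0_eq.
by rewrite -[RHS]h; ring.
Qed.

(** The cubic product through which the two-form of degree -1 enters the values of Pi on two
    f-vectors. *)
Definition Om (q : I) : 'rV[K]_N := \sum_r \sum_s zc (e_ r) (e_ s) *: omega r s q.

Lemma eqEE A D f h : (forall i l, f i l = h i l) -> EE A D f = EE A D h.
Proof. exact: eq_EE. Qed.

Lemma EE_prod A D (a b : I -> K) : (\sum_i eta i 0 A * a i) * (\sum_l eta l 0 D * b l)
  = EE A D (fun i l => a i * b l).
Proof.
rewrite mulr_suml; apply: eq_bigr => i _; rewrite mulr_sumr; apply: eq_bigr => l _; ring.
Qed.

Lemma S2e A D p (q : I) : S2 A D p (e_ q) =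
  EE A D (fun i l => 4 * cc (e_ q) (e_ i) (e_ l) p).
Proof.
rewrite /S2 /EE exchange_big; apply: eq_bigr => l _; rewrite XGe mulr_sumr.
by apply: eq_bigr => i _; ring.
Qed.

Lemma S2f A D p (q : I) : (forall i j k, cc (e_ i) (e_ j) (e_ k) p = 0) ->
  S2 A D p (f_ q) = EE A D (fun i l => - (2 * zc (e_ l) p) * dl i q).
Proof.
move=> h; rewrite /S2 /EE exchange_big; apply: eq_bigr => l _.
rewrite XGf // [eta q 0 A]eta_dl !mulr_sumr.
by apply: eq_bigr => i _; ring.
Qed.

Lemma Z2E A D p q : Z2 A D p q =
  \sum_k \sum_l (X (e_ k) (e_ l) *m Gp p) 0 A * (zeta k l *m Gp q) 0 D
  - 2 * (wv *m Gp p) 0 A * (xi *m Gp q) 0 D.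
Proof.
rewrite /Z2 /Vc mulmxBr mulmxBl mxB; congr (_ - _); last first.
  by rewrite -scalemxAr -scalemxAl mxZ mulmxA -trmx_mul -mulmxA dyad mulrA.
rewrite [(Gp p)^T *m _]mulmx_sumr mulmx_suml summxE; apply: eq_bigr => k _.
rewrite [(Gp p)^T *m _]mulmx_sumr mulmx_suml summxE; apply: eq_bigr => l _.
by rewrite mulmxA -trmx_mul -mulmxA dyad.
Qed.

Lemma Z2e A D p (q : I) : Z2 A D p (e_ q) =
  \sum_l eta l 0 D * (4 * (X (e_ q) (e_ l) *m Gp p) 0 A).
Proof.
rewrite Z2E xi_e [(0 : 'rV__) 0 D]mxE mulr0 subr0.
transitivity (\sum_k \sum_l (dl k q * (2 * (X (e_ k) (e_ l) *m Gp p) 0 A * eta l 0 D)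
    - dl l q * (2 * (X (e_ k) (e_ l) *m Gp p) 0 A * eta k 0 D))).
  apply: eq_bigr => k _; apply: eq_bigr => l _.
  rewrite (zeta_e frameP cliffP xi_e) rvD rvN !rvZ; ring.
under eq_bigr => k _ do rewrite sumrB sum_dlC.
rewrite sumrB exchange_big /=; under eq_bigr => l _ do rewrite sum_dlC.
rewrite -sumrB; apply: eq_bigr => l _; rewrite (Xc_skew gp gm xi frameP CW (e_ q)) mulNmx rvN; ring.
Qed.

Lemma Z2ee A D i0 j0 : Z2 A D (e_ i0) (e_ j0) =
  EE A D (fun i l => 16 * cc (e_ i0) (e_ i) (e_ j0) (e_ l)).
Proof.
rewrite Z2e /EE exchange_big; apply: eq_bigr => l _; rewrite XGe !mulr_sumr.
by apply: eq_bigr => i _; ring.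
Qed.

Lemma Z2fe A D i0 j0 : kP C -> Z2 A D (f_ i0) (e_ j0) =
  EE A D (fun i l => - (8 * zc (e_ j0) (e_ l)) * dl i i0).
Proof.
move=> kp; rewrite Z2e /EE exchange_big; apply: eq_bigr => l _.
rewrite XGf => [|? ?]; last exact: kp.
rewrite [eta i0 0 A]eta_dl; move: (zc _ _) => z.
by rewrite !mulr_sumr; apply: eq_bigr => i _; ring.
Qed.

Lemma wGe A k : (wv *m Gp (e_ k)) 0 A = \sum_j eta j 0 A * (4 * zc (e_ k) (e_ j)).
Proof.
rewrite /wc mulmx_suml summxE; under eq_bigr => i _ do rewrite XGe.
rewrite exchange_big; apply: eq_bigr => j _; rewrite (zcE frameP CW) !mulr_sumr.
by apply: eq_bigr => i _.
Qed.

Lemma wGf A k : (wv *m Gp (f_ k)) 0 A = Om k 0 A - 2 * z2c * eta k 0 A.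
Proof.
rewrite (wE gp gm xi frameP CW) mulmxBl -scalemxAl rvD rvN rvZ; congr (_ - _).
congr (fun_of_matrix _ _ _); rewrite mulmx_suml; apply: eq_bigr => r _.
by rewrite mulmx_suml; apply: eq_bigr => s _; rewrite -scalemxAl.
Qed.

Lemma Z2ef A D i0 j0 : kP C -> Z2 A D (e_ i0) (f_ j0) =
  EE A D (fun i l => - (8 * zc (e_ i0) (e_ i)) * dl l j0).
Proof.
move=> kp; rewrite Z2E big1 => [|k _]; last first.
  rewrite big1 // => l _; rewrite XGe big1 ?mul0r // => i _; rewrite kp; ring.
rewrite sub0r wGe -/(eta j0) [eta j0 0 D]eta_dl -mulrA EE_prod !EE_comb.
by apply: eqEE => i l; ring.
Qed.

Lemma Z2ff A D i0 j0 : kP C -> Z2 A D (f_ i0) (f_ j0) =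
  EE A D (fun i l => 4 * z2c * dl i i0 * dl l j0)
  - 2 * (eta i0 0 A * Om j0 0 D + Om i0 0 A * eta j0 0 D).
Proof.
move=> kp; rewrite Z2E wGf -/(eta j0).
have -> : EE A D (fun i l => 4 * z2c * dl i i0 * dl l j0) = 4 * z2c * eta i0 0 A * eta j0 0 D.
  rewrite -mulrA [eta i0 0 A]eta_dl [eta j0 0 D]eta_dl EE_prod EE_comb.
  by apply: eqEE => i l; ring.
have -> : \sum_k \sum_l (X (e_ k) (e_ l) *m Gp (f_ i0)) 0 A * (zeta k l *m Gp (f_ j0)) 0 D
    = - 2 * eta i0 0 A * Om j0 0 D.
  rewrite /Om summxE mulr_sumr; apply: eq_bigr => k _; rewrite summxE mulr_sumr.
  apply: eq_bigr => l _; rewrite XGf => [|? ?]; last exact: kp.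
  by rewrite rvZ /omega; ring.
ring.
Qed.

Lemma Om_kz (q : I) : kz C -> Om q = 0.
Proof. by move=> z; rewrite /Om big1 // => r _; rewrite big1 // => s _; rewrite z scale0r. Qed.

Lemma C2E A D p q : C2 A D p q = EE A D (fun i l => cc (e_ i) p q (e_ l)).
Proof. by []. Qed.

Definition tot2 A D p q : K := skew2 (C2 A D) p q
  + (n%:R - 4)^-1 * skew2 (fun p q => skew2 (fun A D => S2 A D p q) A D) p q
  - (2 * (n%:R - 2) * (n%:R - 4))^-1 * skew2 (Z2 A D) p q.

Definition tot3 A D p q : K := sym2 (C2 A D) p q
  - 3 / (n%:R + 4) * sym2 (fun p q => sym2 (fun A D => S2 A D p q) A D) p q
  - 3 / (2 * (n%:R + 2) * (n%:R + 4)) * sym2 (Z2 A D) p q.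

Section Combine.
Variables (p q : P) (c1 c2 s1 s2 z1 z2 : I -> I -> K).
Hypothesis hs1 : forall A D, S2 A D p q = EE A D s1.
Hypothesis hs2 : forall A D, S2 A D q p = EE A D s2.

Lemma tot2_comb A D :
  C2 A D p q = EE A D c1 -> C2 A D q p = EE A D c2 ->
  Z2 A D p q = EE A D z1 -> Z2 A D q p = EE A D z2 ->
  tot2 A D p q = EE A D (fun i l => (c1 i l - c2 i l) / 2
    + (2 * M - 4)^-1 * (((s1 i l - s1 l i) / 2 - (s2 i l - s2 l i) / 2) / 2)
    - (2 * (2 * M - 2) * (2 * M - 4))^-1 * ((z1 i l - z2 i l) / 2)).
Proof.
move=> e1 e2 e3 e4; rewrite /tot2 /skew2 e1 e2 e3 e4 !hs1 !hs2 nE.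
by rewrite ![EE D A _]EE_C !EE_comb.
Qed.

End Combine.

Lemma Rsw (i p q l : I) : cc (e_ q) (e_ i) (e_ l) (e_ p) = cc (e_ i) (e_ q) (e_ p) (e_ l).
Proof. by rewrite c12 c34 opprK. Qed.

(** The factor 2 M - 6, here and in [tot2_ef], is zero for m = 3, where Pi_0^2 therefore sees
    neither degree -2 nor, once that is zero, degree -1. *)
Lemma tot2_ee A D i0 j0 : tot2 A D (e_ i0) (e_ j0) = EE A D (fun i l =>
  (2 * M - 6) / (2 * (2 * M - 2)) *
   (cc (e_ i) (e_ i0) (e_ j0) (e_ l) - cc (e_ i) (e_ j0) (e_ i0) (e_ l))).
Proof.
rewrite (tot2_comb (fun A D => S2e A D _ _) (fun A D => S2e A D _ _)
  (C2E _ _ _ _) (C2E _ _ _ _) (Z2ee _ _ _ _) (Z2ee _ _ _ _)).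
apply: eqEE => i l.
rewrite (Rsw i i0 j0 l) (Rsw i j0 i0 l) (cpair (e_ i) (e_ i0) (e_ j0) (e_ l)).
rewrite (cpair (e_ i) (e_ j0) (e_ i0) (e_ l)) (c12 (e_ i) (e_ i0) (e_ j0)) (c12 (e_ i) (e_ j0) (e_ i0)).
field; rewrite ?h2 ?hm2 ?hm4 //.
Qed.

Lemma tot2_ef A D i0 j0 : kP C -> tot2 A D (e_ i0) (f_ j0) = EE A D (fun i l =>
  (2 * M - 6) / (2 * (2 * M - 4)) *
   (cc (e_ l) (e_ i) (e_ i0) (f_ j0) + (2 * M - 2)^-1 *
     (zc (e_ i) (e_ i0) * dl l j0 - zc (e_ l) (e_ i0) * dl i j0))).
Proof.
move=> kp; rewrite (tot2_comb (fun A D => @S2f A D (e_ i0) j0 (fun i j k => kp i j k i0))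
  (fun A D => S2e A D _ _) (C2E _ _ _ _) (C2E _ _ _ _) (Z2ef _ _ _ _ kp) (Z2fe _ _ _ _ kp)).
apply: eqEE => i l.
rewrite (cpair (e_ i0) (e_ l) (e_ i) (f_ j0)) (c34 (e_ i) (e_ i0) (e_ l) (f_ j0)).

have b := cbian (e_ l) (e_ i) (e_ i0) (f_ j0).
have -> : cc (e_ l) (e_ i) (e_ i0) (f_ j0)
    = - cc (e_ i) (e_ i0) (e_ l) (f_ j0) - cc (e_ i0) (e_ l) (e_ i) (f_ j0).
  by apply: subr0_eq; rewrite -[RHS]b; ring.
rewrite (c12 (e_ i) (e_ i0)) (zc_skew frameP CW (e_ i) (e_ i0)) (zc_skew frameP CW (e_ l) (e_ i0)).
field; rewrite ?h2 ?hm2 ?hm4 //.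
Qed.

(** The coefficients of Pi_0^2 are exactly those that remove the trace from an array skew in both
    pairs. *)
Lemma tot2_ff A D i0 j0 : kP C -> kQ C -> tot2 A D (f_ i0) (f_ j0) = EE A D (fun i l =>
  iotaL (z0 F0) (zz F0) i l i0 j0 - altB F0 i l i0 j0).
Proof.
move=> kp q; have Ok k : Om k = 0 := Om_kz k (kz_of_kQ q).
have Zf A' D' i' j' : Z2 A' D' (f_ i') (f_ j')
    = EE A' D' (fun i l => 4 * z2c * dl i i' * dl l j').
  by rewrite Z2ff // !Ok ![(0 : 'rV__) _ _]mxE mulr0 mul0r addr0 mulr0 subr0.
rewrite (tot2_comb (fun A D => @S2f A D (f_ i0) j0 (fun i j k => q i j k i0))
  (fun A D => @S2f A D (f_ j0) i0 (fun i j k => q i j k j0)) (C2E _ _ _ _) (C2E _ _ _ _)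
  (Zf _ _ _ _) (Zf _ _ _ _)).
apply: eqEE => i l; rewrite /iotaL /altB zzF !z0F !(c34 (e_ i) (f_ _) (e_ l)) !F0E /cL.
field; rewrite ?h2 ?hm2 ?hm4 ?(MB1n K m_gt2) ?(MB2n K m_gt2) //.
Qed.

Lemma tot2_skew A D p q : tot2 A D q p = - tot2 A D p q.
Proof. by rewrite /tot2 /skew2; ring. Qed.

Lemma Sv2_ind (f : 'I_n -> 'I_n -> K) :
  (forall b c, f b c = 0) <-> forall p q, Sv p (fun b => Sv q (f b)) = 0.
Proof.
split=> [h p q|h b c]; first by apply: Sv_0 => b; apply: Sv_0.
move: b; apply/(Sv_eq0 frameP) => p; move: c.
suff : forall c, Sv p (fun a => f a c) = 0 by [].
by apply/(Sv_eq0 frameP) => q; rewrite SvC.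
Qed.

(** The types of the two frame arguments are exploited in turn: (e, e) with the Bianchi identity
    removes degree -2, (e, f) and its trace remove degree -1, and (f, f) is [hasL]. *)
Lemma ker_0_2 : m != 3%N -> (forall b c A D, Pi_0_2 g gp gm xi C (b, c, A, D) = 0) <->
  [/\ kP C, kQ C & hasL F0].
Proof.
move=> m3; have hm6 : 2 * M - 6 != 0.
  by rewrite (_ : _ - _ = 2 * (M - 3)) ?mulf_neq0 ?h2 ?subr_eq0 ?eqr_nat //; ring.
have tE A D : (forall b c, Pi_0_2 g gp gm xi C (b, c, A, D) = 0) <-> forall p q, tot2 A D p q = 0.
  rewrite Sv2_ind; split=> h p q; have := h p q; by rewrite (Pi_0_2E frameP cliffP xi_e CW).
split=> [h|[kp q hL] b c A D].
  have T p q A D : tot2 A D p q = 0 by apply: (proj1 (tE A D)).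
  have kp : kP C.
    have R i0 j0 i l : cc (e_ i) (e_ i0) (e_ j0) (e_ l) = cc (e_ i) (e_ j0) (e_ i0) (e_ l).
      apply: subr0_eq.
      apply: (@cancel0 _ ((2 * M - 6) / (2 * (2 * M - 2)))).
        by rewrite mulf_neq0 ?invr_eq0 ?mulf_neq0.
      by move: i l; apply: (proj1 (EE_ind _)) => A D; rewrite -tot2_ee.
    move=> i j k l; have := cbian (e_ i) (e_ j) (e_ k) (e_ l).
    by rewrite (c12 (e_ k) (e_ j)) (R i j k) subrK.
  have H l i (p q : I) : cc (e_ l) (e_ i) (e_ p) (f_ q) + (2 * M - 2)^-1 *
     (zc (e_ i) (e_ p) * dl l q - zc (e_ l) (e_ p) * dl i q) = 0.
    apply: (@cancel0 _ ((2 * M - 6) / (2 * (2 * M - 4)))).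
      by rewrite mulf_neq0 ?invr_eq0 ?mulf_neq0.
    move: i l; apply: (proj1 (EE_ind _)) => A D; rewrite -[RHS](T (e_ p) (f_ q) A D).
    by rewrite tot2_ef.
  (* Summing [H] over equal last two indices leaves a multiple of the two-form component. *)
  have z : kz C.
    move=> l i; have S : \sum_p (cc (e_ l) (e_ i) (e_ p) (f_ p) + (2 * M - 2)^-1 *
        (zc (e_ i) (e_ p) * dl l p - zc (e_ l) (e_ p) * dl i p)) = 0.
      by apply: big1 => p _; exact: H.
    move: S; rewrite big_split /= -mulr_sumr sumrB !sum_dlr -(zcE frameP CW).
    rewrite (zc_skew frameP CW (e_ l) (e_ i)) => S.
    apply: (@cancel0 _ ((2 * M - 4) / (2 * M - 2))); first by rewrite mulf_neq0 ?invr_eq0.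
    by rewrite -[RHS]S; field; rewrite hm2.
  have q : kQ C by move=> i j k l; have := H i j k l; rewrite !z !mul0r subrr mulr0 addr0.
  split=> // i j k l; apply/eqP; rewrite eq_sym -subr_eq0; apply/eqP.
  by move: i j; apply: (proj1 (EE_ind _)) => A D; rewrite -tot2_ff.
move: b c; apply/tE => -[[] i0] [[] j0].
- by rewrite tot2_ee EE_0 // => i l; rewrite !kp subrr mulr0.
- by rewrite tot2_ef // EE_0 // => i l; rewrite !(kz_of_kQ q) q !mul0r subrr mulr0 addr0 mulr0.
- rewrite tot2_skew tot2_ef // EE_0 ?oppr0 // => i l.
  by rewrite !(kz_of_kQ q) q !mul0r subrr mulr0 addr0 mulr0.
- by rewrite tot2_ff // EE_0 // => i l; rewrite hL subrr.
Qed.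

Lemma om23 i j k : omega i k j = - omega i j k.
Proof. exact: (omega_skew23 xi frameP cliffP). Qed.
Lemma om12 i j k : omega j i k = - omega i j k.
Proof. exact: (omega_skew12 xi frameP cliffP). Qed.

Lemma tot3_comb p q (c1 c2 s1 s2 z1 z2 : I -> I -> K) (x1 x2 : 'I_N -> 'I_N -> K) A D x y :
  (forall A D, S2 A D p q = EE A D s1 + x1 A D) ->
  (forall A D, S2 A D q p = EE A D s2 + x2 A D) ->
  C2 A D p q = EE A D c1 -> C2 A D q p = EE A D c2 ->
  Z2 A D p q = EE A D z1 + x -> Z2 A D q p = EE A D z2 + y ->
  tot3 A D p q = EE A D (fun i l => (c1 i l + c2 i l) / 2
    - 3 / (2 * M + 4) * (((s1 i l + s1 l i) / 2 + (s2 i l + s2 l i) / 2) / 2)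
    - 3 / (2 * (2 * M + 2) * (2 * M + 4)) * ((z1 i l + z2 i l) / 2))
   + (- (3 / (2 * M + 4) * (((x1 A D + x1 D A) / 2 + (x2 A D + x2 D A) / 2) / 2))
   - 3 / (2 * (2 * M + 2) * (2 * M + 4)) * ((x + y) / 2)).
Proof.
move=> hs1 hs2 e1 e2 e3 e4; rewrite /tot3 /sym2 e1 e2 e3 e4 !hs1 !hs2 nE ![EE D A _]EE_C.
transitivity (((EE A D c1 + EE A D c2) / 2 - 3 / (2 * M + 4) *
    (((EE A D s1 + EE A D (fun i l => s1 l i)) / 2
     + (EE A D s2 + EE A D (fun i l => s2 l i)) / 2) / 2)
    - 3 / (2 * (2 * M + 2) * (2 * M + 4)) * ((EE A D z1 + EE A D z2) / 2))
   + (- (3 / (2 * M + 4) * (((x1 A D + x1 D A) / 2 + (x2 A D + x2 D A) / 2) / 2))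
   - 3 / (2 * (2 * M + 2) * (2 * M + 4)) * ((x + y) / 2))); first by ring.
by rewrite !EE_comb.
Qed.

Lemma pad0 (x y : K) : x = y -> x = y + 0. Proof. by move=> ->; rewrite addr0. Qed.

Lemma tot3_ee A D i0 j0 : tot3 A D (e_ i0) (e_ j0) = EE A D (fun i l =>
  (2 * M - 2) * (2 * M - 4) / (2 * (2 * M + 2) * (2 * M + 4)) *
   (cc (e_ i) (e_ i0) (e_ j0) (e_ l) + cc (e_ i) (e_ j0) (e_ i0) (e_ l))).
Proof.
rewrite (@tot3_comb _ _ _ _ _ _ _ _ (fun _ _ => 0) (fun _ _ => 0) A D 0 0
  (fun A D => pad0 (S2e A D _ _)) (fun A D => pad0 (S2e A D _ _))
  (C2E _ _ _ _) (C2E _ _ _ _) (pad0 (Z2ee _ _ _ _)) (pad0 (Z2ee _ _ _ _))).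
rewrite [X in _ + X](_ : _ = 0) ?addr0; last by ring.
apply: eqEE => i l.
rewrite (Rsw i i0 j0 l) (Rsw i j0 i0 l) (cpair (e_ i) (e_ i0) (e_ j0) (e_ l)).
rewrite (cpair (e_ i) (e_ j0) (e_ i0) (e_ l)) (c12 (e_ i) (e_ i0) (e_ j0)) (c12 (e_ i) (e_ j0) (e_ i0)).
by field; rewrite ?h2 ?hp2 ?hp4.
Qed.

Lemma tot3_ef A D i0 j0 : kP C -> tot3 A D (e_ i0) (f_ j0) = EE A D (fun i l =>
  (2 * M - 2) / (2 * (2 * M + 4)) *
   (cc (e_ i0) (e_ i) (e_ l) (f_ j0) + cc (e_ i0) (e_ l) (e_ i) (f_ j0)
    - 3 / (2 * M + 2) * (zc (e_ i0) (e_ i) * dl l j0 + zc (e_ i0) (e_ l) * dl i j0))).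
Proof.
move=> kp; rewrite (@tot3_comb _ _ _ _ _ _ _ _ (fun _ _ => 0) (fun _ _ => 0) A D 0 0
  (fun A D => pad0 (@S2f A D (e_ i0) j0 (fun i j k => kp i j k i0)))
  (fun A D => pad0 (S2e A D _ _)) (C2E _ _ _ _) (C2E _ _ _ _)
  (pad0 (Z2ef _ _ _ _ kp)) (pad0 (Z2fe _ _ _ _ kp))).
rewrite [X in _ + X](_ : _ = 0) ?addr0; last by ring.
apply: eqEE => i l.
rewrite (cpair (e_ i0) (e_ l) (e_ i) (f_ j0)) (c34 (e_ i) (e_ i0) (e_ l) (f_ j0)).
rewrite (c12 (e_ i0) (e_ i)) (zc_skew frameP CW (e_ i0) (e_ i)) (zc_skew frameP CW (e_ i0) (e_ l)).
by field; rewrite ?h2 ?hp2 ?hp4.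
Qed.

(** The other cubic term produced by the two-form of degree -1; it is skew in p, q and so invisible
    to the symmetrised map Pi_0^3. *)
Definition Th (p q : I) A D : K :=
  \sum_k eta k 0 D * \sum_r zc (e_ r) (e_ k) * omega r p q 0 A.

Lemma Th_skew (p q : I) A D : Th q p A D = - Th p q A D.
Proof.
rewrite /Th -sumrN; apply: eq_bigr => k _; rewrite -mulrN; congr (_ * _).
rewrite -sumrN; apply: eq_bigr => r _.
by rewrite (om23 r p q) rvN mulrN.
Qed.

Lemma omega_lam (z : I -> I -> K) k (p q : I) A :
  \sum_i \sum_j (2 * z i j * dl k p + z i k * dl j p - z j k * dl i p) * omega i j q 0 A
  = 2 * dl k p * (\sum_i \sum_j z i j * omega i j q 0 A) + 2 * \sum_i z i k * omega i p q 0 A.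
Proof.
transitivity (\sum_i \sum_j (2 * dl k p * (z i j * omega i j q 0 A))
  + (\sum_i \sum_j (z i k * omega i j q 0 A) * dl j p
     - \sum_i \sum_j (z j k * omega i j q 0 A) * dl i p)).
  rewrite -sumrB -big_split; apply: eq_bigr => i _; rewrite -sumrB -big_split.
  by apply: eq_bigr => j _ /=; ring.
congr (_ + _).
  by rewrite mulr_sumr; apply: eq_bigr => i _; rewrite mulr_sumr.
under eq_bigr => i _ do rewrite sum_dlCr.
rewrite [X in _ - X]exchange_big /=; under [X in _ - X]eq_bigr => j _ do rewrite sum_dlCr.
rewrite -sumrB mulr_sumr; apply: eq_bigr => i _.
rewrite (om12 i p q) rvN; ring.
Qed.

Lemma S2ff A D (p q : I) : kQlam C -> S2 A D (f_ p) (f_ q) =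
  EE A D (fun i l => - (2 * zc (e_ l) (f_ p)) * dl i q)
  + (2 * M + 2)^-1 * (2 * eta p 0 D * Om q 0 A + 2 * Th p q A D).
Proof.
move=> ql; have XG k : (X (e_ k) (f_ p) *m Gp (f_ q)) 0 A
    = (2 * M + 2)^-1 * (2 * dl k p * Om q 0 A + 2 * \sum_i zc (e_ i) (e_ k) * omega i p q 0 A)
      - (2 * zc (e_ k) (f_ p)) * eta q 0 A.
  rewrite /Xc mulmxBl -scalemxAl rvD rvN rvZ; congr (_ - _).
  have -> : Om q 0 A = \sum_i \sum_j zc (e_ i) (e_ j) * omega i j q 0 A.
    rewrite /Om summxE; apply: eq_bigr => i _; rewrite summxE; apply: eq_bigr => j _.
    exact: rvZ.
  rewrite -(omega_lam (fun i j => zc (e_ i) (e_ j))) mulmx_suml summxE mulr_sumr.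
  apply: eq_bigr => i _; rewrite mulmx_suml summxE mulr_sumr; apply: eq_bigr => j _.
  by rewrite -scalemxAl rvZ -/(omega i j q) ql; ring.
rewrite /S2; under eq_bigr => k _ do rewrite XG mulrBr.
rewrite sumrB addrC; congr (_ + _).
  rewrite /EE exchange_big -sumrN; apply: eq_bigr => l _.
  rewrite [eta q 0 A]eta_dl; move: (zc _ _) => z; rewrite !mulr_sumr -sumrN.
  by apply: eq_bigr => i _; ring.
rewrite [eta p 0 D]eta_dl /Th; move: (Om q 0 A) => o.
transitivity (\sum_k (2 * M + 2)^-1 * (2 * o * (eta k 0 D * dl k p)
   + 2 * (eta k 0 D * \sum_i zc (e_ i) (e_ k) * omega i p q 0 A))).
  by apply: eq_bigr => k _; ring.
by rewrite -mulr_sumr big_split /= -!mulr_sumr; ring.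
Qed.

(** The two-form of degree -1 is allowed to be non-zero, so its cubic terms have to cancel: [Th] by
    symmetrisation, [Om] between the single and the double contraction, thanks to the coefficients
    of Pi_0^3. *)
Lemma tot3_ff A D i0 j0 : kP C -> kQlam C -> tot3 A D (f_ i0) (f_ j0) = EE A D (fun i l =>
  iotaS (z0 F0) (zz F0) i l i0 j0 - symB F0 i l i0 j0).
Proof.
move=> kp q; rewrite (@tot3_comb _ _ _ _ _ _ _ _ _ _ A D _ _
  (fun A D => S2ff A D i0 j0 q) (fun A D => S2ff A D j0 i0 q) (C2E _ _ _ _) (C2E _ _ _ _)
  (Z2ff _ _ _ _ kp) (Z2ff _ _ _ _ kp)).
rewrite (Th_skew i0 j0) (Th_skew i0 j0 D A) [X in _ + X](_ : _ = 0) ?addr0.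
  apply: eqEE => i l; rewrite /iotaS /symB zzF !z0F !(c34 (e_ i) (f_ _) (e_ l)) !F0E /cS.
  by field; rewrite ?h2 ?hp2 ?hp4 ?(Mp1n K m_gt2) ?(Mp2n K m_gt2).
by field; rewrite ?h2 ?hp2 ?hp4.
Qed.

Lemma tot3_sym A D p q : tot3 A D q p = tot3 A D p q.
Proof. by rewrite /tot3 /sym2; ring. Qed.

(** The equations at (e, f) restrict only a part symmetric in two indices; they hold for the
    two-form component, which is why [kQlam] and not [kQ] results. *)
Lemma ker_0_3 : (forall b c A D, Pi_0_3 g gp gm xi C (b, c, A, D) = 0) <->
  [/\ kP C, kQlam C & hasS F0].
Proof.
have tE A D : (forall b c, Pi_0_3 g gp gm xi C (b, c, A, D) = 0) <-> forall p q, tot3 A D p q = 0.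
  rewrite Sv2_ind; split=> h p q; have := h p q; by rewrite (Pi_0_3E frameP cliffP xi_e CW).
have h3 : (3 : K) != 0 := num_neq0 K 2.
split=> [h|[kp q hS] b c A D].
  have T p q A D : tot3 A D p q = 0 by apply: (proj1 (tE A D)).
  have kp : kP C.
    have R i0 j0 i l : cc (e_ i) (e_ j0) (e_ i0) (e_ l) = - cc (e_ i) (e_ i0) (e_ j0) (e_ l).
      apply/eqP; rewrite -addr_eq0 addrC; apply/eqP.
      apply: (@cancel0 _ ((2 * M - 2) * (2 * M - 4) / (2 * (2 * M + 2) * (2 * M + 4)))).
        by rewrite mulf_neq0 ?invr_eq0 ?mulf_neq0.
      by move: i l; apply: (proj1 (EE_ind _)) => A D; rewrite -tot3_ee.
    move=> i j k l; have := cbian (e_ i) (e_ j) (e_ k) (e_ l).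
    rewrite (c12 (e_ i) (e_ k)) (R j k i l) (R i k j l) (c12 (e_ i) (e_ j)) opprK => H.
    by apply: (cancel0 h3); rewrite -[RHS]H; ring.
  have H (p q : I) i l : cc (e_ p) (e_ i) (e_ l) (f_ q) + cc (e_ p) (e_ l) (e_ i) (f_ q)
      - 3 / (2 * M + 2) * (zc (e_ p) (e_ i) * dl l q + zc (e_ p) (e_ l) * dl i q) = 0.
    apply: (@cancel0 _ ((2 * M - 2) / (2 * (2 * M + 4)))).
      by rewrite mulf_neq0 ?invr_eq0 ?mulf_neq0.
    move: i l; apply: (proj1 (EE_ind _)) => A D; rewrite -[RHS](T (e_ p) (f_ q) A D).
    by rewrite tot3_ef.
  (* Two instances of [H] and one Bianchi identity are three linear equations for the three cyclic
     rearrangements. *)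
  have q : kQlam C.
    move=> i j k l; have b := cbian (e_ i) (e_ j) (e_ k) (f_ l).
    have H1 := H i l k j; have H2 := H j l k i.
    rewrite (c12 (e_ i) (e_ k)) in b; rewrite (c12 (e_ i) (e_ j)) in H2.
    rewrite (zc_skew frameP CW (e_ i) (e_ j)) in H2.
    apply: subr0_eq; apply: (cancel0 h3).
    transitivity ((cc (e_ i) (e_ k) (e_ j) (f_ l) + cc (e_ i) (e_ j) (e_ k) (f_ l) -
       3 / (2 * M + 2) * (zc (e_ i) (e_ k) * dl j l + zc (e_ i) (e_ j) * dl k l))
       - (cc (e_ j) (e_ k) (e_ i) (f_ l) - cc (e_ i) (e_ j) (e_ k) (f_ l) -
       3 / (2 * M + 2) * (zc (e_ j) (e_ k) * dl i l + - zc (e_ i) (e_ j) * dl k l))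
       + (cc (e_ i) (e_ j) (e_ k) (f_ l) + cc (e_ j) (e_ k) (e_ i) (f_ l) +
       - cc (e_ i) (e_ k) (e_ j) (f_ l))); last by rewrite H1 H2 b subrr addr0.
    by field; rewrite hp2.
  split=> // i j k l; apply/eqP; rewrite eq_sym -subr_eq0; apply/eqP.
  by move: i j; apply: (proj1 (EE_ind _)) => A D; rewrite -tot3_ff.
have ef A' D' i0 j0 : tot3 A' D' (e_ i0) (f_ j0) = 0.
  rewrite tot3_ef // EE_0 // => i l; rewrite !q (zc_skew frameP CW (e_ i) (e_ l)).
  by field; rewrite ?h2 ?hp2 ?hp4.
move: b c; apply/tE => -[[] i0] [[] j0].
- by rewrite tot3_ee EE_0 // => i l; rewrite !kp addr0 mulr0.
- exact: ef.
- by rewrite tot3_sym ef.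
- by rewrite tot3_ff // EE_0 // => i l; rewrite hS subrr.
Qed.

Definition tot1 B p q (r : P) : K := \sum_i eta i 0 B * cc (e_ i) p q r + (n%:R + 2)^-1 *
    ((X q r *m Gp p) 0 B - ((X p q *m Gp r) 0 B - (X p r *m Gp q) 0 B) / 2).

Lemma tot1_skew B p q (r : P) : tot1 B p r q = - tot1 B p q r.
Proof.
rewrite /tot1 (Xc_skew gp gm xi frameP CW q r) mulNmx rvN opprD -sumrN; congr (_ + _).
  by apply: eq_bigr => i _; rewrite c34 mulrN.
by ring.
Qed.

Lemma tot1_comb B p q (r : P) (b c d : I -> K) (x y z : K) :
  (X q r *m Gp p) 0 B = \sum_i eta i 0 B * b i + x ->
  (X p q *m Gp r) 0 B = \sum_i eta i 0 B * c i + y ->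
  (X p r *m Gp q) 0 B = \sum_i eta i 0 B * d i + z ->
  tot1 B p q r = \sum_i eta i 0 B * (cc (e_ i) p q r + (2 * M + 2)^-1 * (b i - (c i - d i) / 2))
   + (2 * M + 2)^-1 * (x - (y - z) / 2).
Proof.
move=> e1 e2 e3; rewrite /tot1 e1 e2 e3 nE.
transitivity (\sum_i eta i 0 B * cc (e_ i) p q r + (2 * M + 2)^-1 * (\sum_i eta i 0 B * b i
  - (\sum_i eta i 0 B * c i - \sum_i eta i 0 B * d i) / 2)
  + (2 * M + 2)^-1 * (x - (y - z) / 2)); first by ring.
congr (_ + _); rewrite -sumrB mulr_suml -sumrB mulr_sumr -big_split.
by apply: eq_bigr => i _ /=; ring.
Qed.

Lemma XGf_dl p q k A : (forall i j, cc (e_ i) (e_ j) p q = 0) ->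
  (X p q *m Gp (f_ k)) 0 A = \sum_i eta i 0 A * (- (2 * zc p q) * dl i k).
Proof.
move=> h; rewrite XGf // {1}eta_dl; move: (- _) => z.
by rewrite mulr_sumr; apply: eq_bigr => i _; ring.
Qed.

Lemma kQ34 : kQ C -> forall i j p q : I, cc (e_ i) (e_ j) (f_ q) (e_ p) = 0.
Proof. by move=> q i j p' q'; rewrite c34 q oppr0. Qed.

(** In degree -1, once a trace has given [kz], the equations say that a cyclic shift of the first
    three indices multiplies a component by - (M - 1). The Bianchi identity then becomes (M^2 - 3 M
    + 3) x = 0. *)
Lemma ker_1_1_P : (forall B p q (r : P), tot1 B p q r = 0) -> kP C /\ kQ C.
Proof.
move=> T; have kp : kP C.
  move=> i0 p q r; apply: (@cancel0 _ ((2 * M - 4) / (2 * M + 2))).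
    by rewrite mulf_neq0 ?invr_eq0.
  move: i0; apply/(eta_ind frameP cliffP xi_e xi_neq0) => B; rewrite -[RHS](T B (e_ p) (e_ q) (e_ r)).
  rewrite (tot1_comb (pad0 (XGe _ _ _ _)) (pad0 (XGe _ _ _ _)) (pad0 (XGe _ _ _ _))).
  rewrite subrr mul0r subrr mulr0 addr0; apply: eq_bigr => i _; congr (_ * _).
  have b := cbian (e_ p) (e_ q) (e_ r) (e_ i).
  rewrite (cpair (e_ p) (e_ q) (e_ r) (e_ i)) (cpair (e_ p) (e_ r) (e_ q) (e_ i)).
  rewrite (c12 (e_ r) (e_ p)) (c12 (e_ i) (e_ p)).
  have -> : cc (e_ p) (e_ q) (e_ r) (e_ i) =
      cc (e_ i) (e_ p) (e_ q) (e_ r) - cc (e_ r) (e_ p) (e_ q) (e_ i).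
    have e : cc (e_ q) (e_ r) (e_ p) (e_ i) = - cc (e_ i) (e_ p) (e_ q) (e_ r).
      by rewrite cpair c12.
    by apply: subr0_eq; rewrite -[RHS]b e; ring.
  by field; rewrite ?h2 ?hp2.
split=> //.
have H i (p q r : I) : (2 * M - 2) / (2 * M + 2) * cc (e_ i) (e_ p) (e_ q) (f_ r)
    + (2 * M + 2)^-1 * (zc (e_ p) (e_ q) * dl i r + 2 * cc (e_ q) (e_ i) (e_ p) (f_ r)) = 0.
  move: i; apply/(eta_ind frameP cliffP xi_e xi_neq0) => B; rewrite -[RHS](T B (e_ p) (e_ q) (f_ r)).
  rewrite (tot1_comb (pad0 (XGe _ _ _ _)) (pad0 (XGf_dl _ _ (fun i j => kp i j p q)))
    (pad0 (XGe _ _ _ _))).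
  rewrite subrr mul0r subrr mulr0 addr0; apply: eq_bigr => i _; congr (_ * _).
  by rewrite (c12 (e_ i) (e_ p)); field; rewrite ?h2 ?hp2.
have z : kz C.
  move=> i p; apply: (@cancel0 _ ((2 * M - 4) / (2 * M + 2))).
    by rewrite mulf_neq0 ?invr_eq0.
  have S : \sum_q ((2 * M - 2) / (2 * M + 2) * cc (e_ i) (e_ p) (e_ q) (f_ q)
    + (2 * M + 2)^-1 * (zc (e_ p) (e_ q) * dl i q + 2 * cc (e_ q) (e_ i) (e_ p) (f_ q))) = 0.
    by apply: big1 => q _; exact: H.
  have t : \sum_q cc (e_ q) (e_ i) (e_ p) (f_ q) = - 2^-1 * zc (e_ i) (e_ p).
    have hF := rdC_lvl frameP 1 true CW.
    have := hookish_z1 i p hF.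
    have -> : z1 (rdC fr 1 true C) i p = zc (e_ i) (e_ p).
      by rewrite (zcE frameP CW); apply: eq_bigr => k _; rewrite ev_mkA.
    move=> ->; rewrite mulrA mulNr mulrN mulVf // opprK mul1r.
    by apply: eq_bigr => q _; rewrite ev_mkA.
  rewrite -[RHS]S big_split /= -!mulr_sumr big_split /= sum_dlr -mulr_sumr t -(zcE frameP CW).
  by rewrite (zc_skew frameP CW (e_ i) (e_ p)); field; rewrite ?h2 ?hp2.
have H2 i (p q r : I) : (M - 1) * cc (e_ i) (e_ p) (e_ q) (f_ r) = - cc (e_ q) (e_ i) (e_ p) (f_ r).
  have := H i p q r; rewrite z mul0r add0r => E.
  apply: subr0_eq; apply: (@cancel0 _ (2 / (2 * M + 2))).
    by rewrite mulf_neq0 ?invr_eq0.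
  by rewrite -[RHS]E; field.
move=> i p q r; have b := cbian (e_ i) (e_ p) (e_ q) (f_ r).
have e1 := H2 i p q r; have e2 := H2 q i p r; have e3 := H2 p q i r.
(* With y = m - 3 the value is y^2 + 3 y + 3, a positive natural number. *)
have N0 : M ^+ 2 - 3 * M + 3 != 0.
  suff h x : (2 < x)%N -> x%:R ^+ 2 - 3 * x%:R + 3 != 0 :> K by exact: h.
  move=> /subnK <-; rewrite (_ : _ - _ + _ = ((x - 3) ^ 2 + 3 * (x - 3) + 3)%N%:R).
    by rewrite pnatr_eq0 addnS.
  by move: (x - 3)%N => y; rewrite !(natrD, natrX, natrM); ring.
apply: (cancel0 N0).
transitivity (cc (e_ i) (e_ p) (e_ q) (f_ r) + cc (e_ p) (e_ q) (e_ i) (f_ r)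
    + cc (e_ q) (e_ i) (e_ p) (f_ r)); last exact: b.
have -> : cc (e_ p) (e_ q) (e_ i) (f_ r) = (M - 1) ^+ 2 * cc (e_ i) (e_ p) (e_ q) (f_ r).
  by rewrite expr2 -mulrA e1 mulrN e2 opprK.
have -> : cc (e_ q) (e_ i) (e_ p) (f_ r) = - (M - 1) * cc (e_ i) (e_ p) (e_ q) (f_ r).
  by rewrite mulNr e1 opprK.
ring.
Qed.

(** Absence of the trace-free hook in degree 1: the mirror image of [kQlam]. *)
Definition kF1 := forall i (p q r : I), cc (e_ i) (f_ p) (f_ q) (f_ r) = - ((2 * M + 2)^-1 *
  (- 2 * zc (f_ q) (f_ r) * dl i p + zc (f_ p) (f_ q) * dl i r - zc (f_ p) (f_ r) * dl i q)).

Lemma tot1_eff B (p q r : I) : kQ C -> tot1 B (e_ p) (f_ q) (f_ r) = \sum_i eta i 0 B *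
  ((2 * M - 2) / (2 * M + 2) * (2 * altB F0 i p q r) + (2 * M + 2)^-1 *
   (z0 F0 p q * dl i r - z0 F0 p r * dl i q)).
Proof.
move=> hq; rewrite (tot1_comb (pad0 (XGe _ _ _ _)) (pad0 (XGf_dl _ _ (fun i j => hq i j p q)))
   (pad0 (XGf_dl _ _ (fun i j => hq i j p r)))).
rewrite subrr mul0r subrr mulr0 addr0; apply: eq_bigr => i _; congr (_ * _).
by rewrite (c12 (e_ i) (e_ p)) !A4E !z0F; field; rewrite ?h2 ?hp2.
Qed.

Lemma tot1_fef B (p q r : I) : kQ C -> tot1 B (f_ p) (e_ q) (f_ r) = \sum_i eta i 0 B *
  (ev F0 i q p r + (2 * M + 2)^-1 * (- 2 * z0 F0 q r * dl i p - z0 F0 q p * dl i r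
    - 4 * altB F0 i q p r)).
Proof.
move=> hq; rewrite (tot1_comb (pad0 (XGf_dl _ _ (fun i j => hq i j q r)))
  (pad0 (XGf_dl _ _ (fun i j => kQ34 hq i j q p))) (pad0 (XGe _ _ _ _))).
rewrite subrr mul0r subrr mulr0 addr0; apply: eq_bigr => i _; congr (_ * _).
rewrite (c12 (e_ i) (e_ q)) A4E F0E !z0F (zc_skew frameP CW (e_ q) (f_ p)).
by field; rewrite ?h2 ?hp2.
Qed.

(** With a scalar skew part in degree 0 the three contractions give multiples of one [omega], and
    total skew-symmetry makes them cancel. *)
Lemma tot1_fff B (p q r : I) (al : K) :
  (forall i j k l, 2 * altB F0 i j k l = al * (dl i k * dl j l - dl i l * dl j k)) ->
  tot1 B (f_ p) (f_ q) (f_ r) = \sum_i eta i 0 B * (cc (e_ i) (f_ p) (f_ q) (f_ r)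
   + (2 * M + 2)^-1 * (- 2 * zc (f_ q) (f_ r) * dl i p + zc (f_ p) (f_ q) * dl i r
      - zc (f_ p) (f_ r) * dl i q)).
Proof.
move=> hA; have XG (s t u : I) : (X (f_ s) (f_ t) *m Gp (f_ u)) 0 B =
    \sum_i eta i 0 B * (- (2 * zc (f_ s) (f_ t)) * dl i u) + 2 * al * omega s t u 0 B.
  rewrite /Xc mulmxBl -scalemxAl rvD rvN rvZ addrC; congr (_ + _).
    rewrite -/(eta u) [eta u 0 B]eta_dl; move: (zc _ _) => z.
    by rewrite mulr_sumr -sumrN; apply: eq_bigr => i _; ring.
  transitivity (\sum_i \sum_j ((al * dl j t * omega i j u 0 B) * dl i s
     - (al * dl j s * omega i j u 0 B) * dl i t)).
    rewrite mulmx_suml summxE; apply: eq_bigr => i _; rewrite mulmx_suml summxE.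
    by apply: eq_bigr => j _; rewrite -scalemxAl rvZ -/(omega i j u) A4E hA; ring.
  rewrite exchange_big /=; under eq_bigr => j _ do rewrite sumrB !sum_dlCr.
  rewrite sumrB; under eq_bigr => j _ do rewrite mulrAC.
  under [X in _ - X]eq_bigr => j _ do rewrite mulrAC.
  by rewrite !sum_dlCr (om12 s t u) rvN; ring.
rewrite (tot1_comb (XG _ _ _) (XG _ _ _) (XG _ _ _)) (om23 p q r).
rewrite (om23 q p r) (om12 p q r).
rewrite [X in _ + X](_ : _ = 0) ?addr0.
  by apply: eq_bigr => i _; congr (_ * (_ + _ * _)); field.
by rewrite !rvN; field; rewrite ?h2 ?hp2.
Qed.

Lemma tot1_eef B (p q r : I) : kP C -> kQ C -> tot1 B (e_ p) (e_ q) (f_ r) = 0.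
Proof.
move=> kp q'; rewrite (tot1_comb (pad0 (XGe _ _ _ _)) (pad0 (XGf_dl _ _ (fun i j => kp i j p q)))
    (pad0 (XGe _ _ _ _))).
rewrite subrr mul0r subrr mulr0 addr0 big1 // => i _.
by rewrite !q' (kz_of_kQ q'); ring.
Qed.

Lemma tot1_fee B (p q r : I) : kP C -> kQ C -> tot1 B (f_ p) (e_ q) (e_ r) = 0.
Proof.
move=> kp q'; rewrite (tot1_comb (pad0 (XGf_dl _ _ (fun i j => kp i j q r)))
  (pad0 (XGe _ _ _ _)) (pad0 (XGe _ _ _ _))).
rewrite subrr mul0r subrr mulr0 addr0 big1 // => i _.
rewrite -(cpair (e_ i) (f_ p)) !q' !(kQ34 q') (kz_of_kQ q'); ring.
Qed.

Lemma tot1_eee B (p q r : I) : kP C -> tot1 B (e_ p) (e_ q) (e_ r) = 0.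
Proof.
move=> kp; rewrite (tot1_comb (pad0 (XGe _ _ _ _)) (pad0 (XGe _ _ _ _)) (pad0 (XGe _ _ _ _))).
rewrite subrr mul0r subrr mulr0 addr0 big1 // => i _; rewrite !kp; ring.
Qed.

Lemma altB_triv i j k l : hasL F0 -> hasZ F0 -> 2 * altB F0 i j k l =
  zz F0 / (2 * M * (M - 1)) * (dl i k * dl j l - dl i l * dl j k).
Proof.
move=> hL hZ; rewrite hL /iotaL !hZ /cL.
by field; rewrite ?h2 ?(M0n K m_gt2) ?(MB1n K m_gt2) ?(MB2n K m_gt2).
Qed.

Lemma symB_triv i j k l : hasS F0 -> hasZ F0 -> 2 * symB F0 i j k l =
  3 * zz F0 / (2 * M * (M + 1)) * (dl i k * dl j l + dl i l * dl j k).
Proof.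
move=> hS hZ; rewrite hS /iotaS !hZ /cS.
by field; rewrite ?h2 ?(M0n K m_gt2) ?(Mp1n K m_gt2) ?(Mp2n K m_gt2).
Qed.

(** After [ker_1_1_P], the arguments (e, f, f) make the trace of degree 0 scalar and give [hasL],
    the arguments (f, e, f) give [hasS], and (f, f, f) leaves only the condition on the hook of
    degree 1. *)
Lemma ker_1_1 : (forall b c d B, Pi_1_1 g gp gm xi C (b, c, d, B) = 0) <->
  [/\ kP C, kQ C, [/\ hasS F0, hasL F0 & hasZ F0] & kF1].
Proof.
have hM := M0n K m_gt2; have hM1 := Mp1n K m_gt2; have hB1 := MB1n K m_gt2.
have hB2 := MB2n K m_gt2.
have tE B : (forall b c d, Pi_1_1 g gp gm xi C (b, c, d, B) = 0) <->
    forall p q (r : P), tot1 B p q r = 0.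
  have E p q (r : P) := Pi_1_1E frameP cliffP xi_e CW B p q r.
  split=> [h p q r|h b c d].
    rewrite /tot1 -E; apply: Sv_0 => b; apply: Sv_0 => c; apply: Sv_0 => d; exact: h.
  move: b c; suff : forall p q, Sv p (fun b => Sv q (fun c => Pi_1_1 g gp gm xi C (b, c, d, B))) = 0.
    by move/(proj2 (Sv2_ind _)).
  move=> p q; move: d; apply/(Sv_eq0 frameP) => r; rewrite -(h p q r) /tot1 -E.
  by rewrite SvC; apply: eq_Sv => b; rewrite SvC.
split=> [h|[kp q [hS hL hZ] h1] b c d B].
  have T B p q (r : P) : tot1 B p q r = 0 by apply: (proj1 (tE B)).
  have [kp hq] := ker_1_1_P T.
  have ind := eta_ind frameP cliffP xi_e xi_neq0.
  have HA i (p q r : I) : (2 * M - 2) / (2 * M + 2) * (2 * altB F0 i p q r) + (2 * M + 2)^-1 *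
      (z0 F0 p q * dl i r - z0 F0 p r * dl i q) = 0.
    by move: i; apply/ind => B; rewrite -tot1_eff.
  (* Obtained by contracting the second index of [HA] with the last one. *)
  have hZ : hasZ F0.
    move=> i q0; have [r1 r2] := riemF.
    have : (2 * M - 2) / (2 * M + 2) * (2 * \sum_p altB F0 i p q0 p)
        + (2 * M + 2)^-1 * (z0 F0 i q0 - zz F0 * dl i q0) = 0.
      transitivity (\sum_p ((2 * M - 2) / (2 * M + 2) * (2 * altB F0 i p q0 p)
        + (2 * M + 2)^-1 * (z0 F0 p q0 * dl i p - z0 F0 p p * dl i q0))).
        rewrite big_split /=; congr (_ + _); first by rewrite !mulr_sumr.
        by rewrite -mulr_sumr sumrB sum_dlr -mulr_suml.
      by apply: big1 => p _; exact: HA.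
    have -> : \sum_p altB F0 i p q0 p = 4^-1 * z0 F0 i q0.
      rewrite /altB -mulr_suml sumrB.
      have -> : \sum_p ev F0 i p q0 p = z0 F0 i q0 by apply: eq_bigr => p _; rewrite r1.
      have -> : \sum_p ev F0 i p p q0 = 2^-1 * z0 F0 i q0 by rewrite r2 mulKf.
      by field.
    move=> S; apply: subr0_eq; apply: (@cancel0 _ (M / (2 * M + 2))).
      by rewrite mulf_neq0 ?invr_eq0.
    by rewrite -[RHS]S; field; rewrite ?h2 ?hM ?hp2.
  have hA i j k l : 2 * altB F0 i j k l =
      zz F0 / (2 * M * (M - 1)) * (dl i k * dl j l - dl i l * dl j k).
    apply: subr0_eq; apply: (@cancel0 _ ((2 * M - 2) / (2 * M + 2))).
      by rewrite mulf_neq0 ?invr_eq0.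
    rewrite -[RHS](HA i j k l) !hZ; field; rewrite ?h2 ?hM ?hp2 ?hB1 //.
  have hL : hasL F0.
    move=> i j k l; apply: (mulfI h2); rewrite hA /iotaL !hZ /cL.
    by field; rewrite ?h2 ?hM ?hB1 ?hB2.
  have HF i (p q0 r : I) : ev F0 i q0 p r + (2 * M + 2)^-1 * (- 2 * z0 F0 q0 r * dl i p
      - z0 F0 q0 p * dl i r - 4 * altB F0 i q0 p r) = 0.
    by move: i; apply/ind => B; rewrite -tot1_fef.
  have hS : hasS F0.
    move=> i j k l; have e1 := HF i k j l; have e2 := HF i l j k.
    have e3 : 4 * altB F0 i j k l = 2 * (2 * altB F0 i j k l) by ring.
    have e4 : 4 * altB F0 i j l k = 2 * (2 * altB F0 i j l k) by ring.
    rewrite e3 hA !hZ in e1; rewrite e4 hA !hZ in e2.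
    rewrite /symB /iotaS !hZ /cS; apply: subr0_eq.
    apply: (cancel0 h2); rewrite -[RHS]addr0 -{1}e1 -{1}e2.
    by field; rewrite ?h2 ?hM ?hM1 ?hB1 ?hp2 ?(Mp2n K m_gt2).
  split=> // i p q0 r; apply/eqP; rewrite -subr_eq0 opprK; apply/eqP.
  by move: i; apply/ind => B; rewrite -(tot1_fff _ _ _ _ hA).
have hA i j k l := altB_triv i j k l hL hZ.
have fef B' (p0 q0 r0 : I) : tot1 B' (f_ p0) (e_ q0) (f_ r0) = 0.
  rewrite tot1_fef // big1 // => i _.
  have -> : ev F0 i q0 p0 r0 = symB F0 i q0 p0 r0 + altB F0 i q0 p0 r0.
    by rewrite /symB /altB; field.
  have es := mulKf h2 (symB F0 i q0 p0 r0); rewrite symB_triv // in es.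
  have ea := mulKf h2 (altB F0 i q0 p0 r0); rewrite hA in ea.
  rewrite -es -ea !hZ.
  by field; rewrite ?h2 ?hM ?hM1 ?hB1 ?hp2.
move: b c d; apply/tE => -[[] p] [[] q0] [[] r].
- exact: tot1_eee.
- exact: tot1_eef.
- by rewrite tot1_skew tot1_eef ?oppr0.
- rewrite tot1_eff // big1 // => i _; rewrite hA !hZ.
  by field; rewrite ?h2 ?hM ?hB1 ?hp2.
- exact: tot1_fee.
- exact: fef.
- by rewrite tot1_skew fef oppr0.
- by rewrite (tot1_fff _ _ _ _ hA) big1 // => i _; rewrite h1 addNr mulr0.
Qed.

End OneTensor.
End Kernels3.

(** * Kernels expressed by labels of components *)

Section Filtration.
Variables (K : numClosedFieldType) (m n N : nat) (g : 'M[K]_n)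
  (fr : bool -> 'I_m -> 'rV[K]_n) (gp gm : 'I_n -> 'M[K]_N) (xi : 'rV[K]_N).
Hypotheses (m_gt2 : (2 < m)%N) (n_eq : n = m.*2) (frameP : frame g fr)
  (cliffP : clifford_relations g gp gm).
Local Notation I := 'I_m.
Local Notation P := (bool * I)%type.
Local Notation T := (tensor4 K n).
Local Notation M := (m%:R : K).
Local Notation cm := (cm fr).
Local Notation Gp := (Gp fr gp).
Hypotheses (xi_e : forall i, xi *m Gp (true, i) = 0) (xi_neq0 : xi != 0).
Implicit Types (p q : P) (i j k l r s : I) (A B D F : 'I_N).
Local Notation e_ := (pair true).
Local Notation f_ := (pair false).
Local Notation dl := (dl K).

Local Notation kP := (kP fr).
Local Notation kQ := (kQ fr).
Local Notation kz := (kz fr).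
Local Notation kQlam := (kQlam fr).
Local Notation z2 := (z2 fr).
Let h2 := two_neq0 K.

Local Notation A4 := (tensor4 K m).
Implicit Types (C : T).

(* The degree [k] part of a Weyl tensor is read as the array [rk k C]; the pair
   [(k, j)] labels its component in the module numbered [j].                      *)
Definition lev (k : int) : nat * bool := match k with
  | Posz 0 => (0, true) | Posz q => (q, false) | Negz q => (q.+1, true) end%N.
Definition rk (k : int) C : A4 := rdC fr (lev k).1 (lev k).2 C.
Definition van (u : int * nat) C : Prop := pr (lev u.1).1 u.2 (rk u.1 C) = 0.

(* The components that vanish on the kernel of Pi_k^j: the label [(k, j)] and all
   those below it in the graph of arrows.                                         *)
Definition under (k : int) (j : nat) : seq (int * nat) := match k, j with
  | Negz 1, 0 => [:: (Negz 1, 0)]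
  | Negz 0, 0 => [:: (Negz 1, 0); (Negz 0, 0)]
  | Negz 0, 1 => [:: (Negz 1, 0); (Negz 0, 1)]
  | Posz 0, 0 => [:: (Negz 1, 0); (Negz 0, 0); (Posz 0, 0)]
  | Posz 0, 1 => [:: (Negz 1, 0); (Negz 0, 0); (Negz 0, 1); (Posz 0, 1)]
  | Posz 0, 2 => [:: (Negz 1, 0); (Negz 0, 0); (Negz 0, 1); (Posz 0, 2)]
  | Posz 0, 3 => [:: (Negz 1, 0); (Negz 0, 1); (Posz 0, 3)]
  | Posz 1, 0 => [:: (Negz 1, 0); (Negz 0, 0); (Negz 0, 1); (Posz 0, 0);
    (Posz 0, 1); (Posz 0, 2); (Posz 1, 0)]
  | Posz 1, 1 => [:: (Negz 1, 0); (Negz 0, 0); (Negz 0, 1); (Posz 0, 1);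
    (Posz 0, 2); (Posz 0, 3); (Posz 1, 1)]
  | _, _ => [::]
  end%N.

Lemma in_consP (Q : int * nat -> Prop) x (s : seq (int * nat)) :
  (forall u, u \in x :: s -> Q u) <-> Q x /\ (forall u, u \in s -> Q u).
Proof.
split=> [h|[h1 hs] u]; last by rewrite inE => /orP [/eqP ->|/hs].
by split=> [|u us]; apply: h; rewrite inE ?eqxx ?us ?orbT.
Qed.

Lemma in_nilP (Q : int * nat -> Prop) : (forall u, u \in [::] -> Q u) <-> True.
Proof. by split=> // _ u; rewrite in_nil. Qed.

Section OneTensor.
Variable C : T.
Hypothesis CW : C \in weyl g.
Local Notation cc := (cm C).
Local Notation zc := (zc fr C).
Let c34 := cc34 frameP CW.
Let cpair := cc_pair frameP CW.

Lemma kP_van : kP C <-> van (Negz 1, 0%N) C.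
Proof.
rewrite /van /rk /=; split=> [h|/evP h i j k l]; first by apply/evP => i j k l; rewrite ev_mkA h ev0.
by have := h i j k l; rewrite ev_mkA ev0.
Qed.

Let hook1 : hookish (rdC fr 1 true C) := rdC_lvl frameP 1 true CW.
Let hook1' : hookish (rdC fr 1 false C) := rdC_lvl frameP 1 false CW.

Lemma z1_rk i j : z1 (rdC fr 1 true C) i j = zc (e_ i) (e_ j).
Proof. by rewrite (zcE frameP CW); apply: eq_bigr => k _; rewrite ev_mkA. Qed.

Lemma z1_rk' i j : z1 (rdC fr 1 false C) i j = - zc (f_ i) (f_ j).
Proof.
rewrite (zcE frameP CW) -sumrN; apply: eq_bigr => k _; rewrite ev_mkA.
by rewrite -c34.
Qed.

Lemma kz_van : kz C <-> van (Negz 0, 0%N) C.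
Proof.
rewrite /van /rk /= -(z1P m_gt2 hook1); split=> h i j; last by rewrite -z1_rk.
by rewrite z1_rk.
Qed.

Lemma two_Mp1 : 2 * (M + 1) = 2 * M + 2 :> K. Proof. ring. Qed.

Lemma kQlam_van : kQlam C <-> van (Negz 0, 1%N) C.
Proof.
rewrite /van /rk /=; split=> h.
  apply/evP => i j k l; rewrite ev0 evD evN evZ [ev (iota1 _) _ _ _ _]ev_mkA.
  by rewrite ev_mkA h !z1_rk two_Mp1 subrr.
move=> i j k l; move/evP: h => /(_ i j k l).
rewrite ev0 evD evN evZ [ev (iota1 _) _ _ _ _]ev_mkA ev_mkA !z1_rk two_Mp1.
by move/eqP; rewrite subr_eq0 => /eqP.
Qed.

Lemma kQ_van : kQ C <-> van (Negz 0, 0%N) C /\ van (Negz 0, 1%N) C.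
Proof.
rewrite -kz_van -kQlam_van; split=> [h|[h h']].
  by split; [exact: (kz_of_kQ frameP CW) | exact: (kQlam_of_kQ frameP CW)].
exact: kQ_of_kQlam.
Qed.

Lemma kF1_van : kF1 fr C <-> van (Posz 1, 1%N) C.
Proof.
rewrite /van /rk /=.
have E i j k l : cc (e_ l) (f_ k) (f_ i) (f_ j) = - cc (f_ i) (f_ j) (f_ k) (e_ l).
  by rewrite -cpair c34.
split=> h.
  apply/evP => i j k l; rewrite ev0 evD evN evZ [ev (iota1 _) _ _ _ _]ev_mkA.
  rewrite ev_mkA -[cc _ _ _ _]opprK -E h !z1_rk' two_Mp1 (zc_skew frameP CW (f_ i) (f_ k)).
  by rewrite (dlC K k l) (dlC K j l) (dlC K i l) (zc_skew frameP CW (f_ j) (f_ k)); ring.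
move=> l k i j; move/evP: h => /(_ i j k l).
rewrite ev0 evD evN evZ [ev (iota1 _) _ _ _ _]ev_mkA ev_mkA !z1_rk' two_Mp1.
move/eqP; rewrite subr_eq0 => /eqP; rewrite E => ->.
rewrite (zc_skew frameP CW (f_ i) (f_ k)) (zc_skew frameP CW (f_ j) (f_ k)).
by rewrite (dlC K k l) (dlC K j l) (dlC K i l); ring.
Qed.

Lemma hasZ_van : (forall k l, zc (e_ k) (f_ l) = M^-1 * z2 C * dl k l) <-> van (Posz 0, 1%N) C.
Proof.
rewrite /van /rk /= -(hasZP m_gt2); split=> h j l; first by rewrite z0F zzF h.
by rewrite -z0F h zzF.
Qed.

(** The components on e, e, f, f see the skew part of degree 0, and the half trace sees the traces
    of degrees 0 and 1; what escapes is [sym0] in degree 0 and the trace-free hook in degree 1. *)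
Lemma ker_1_0_van : (forall p q, (forall i j, cc (e_ i) (e_ j) p q = 0) /\ zc p q = 0) <->
  forall u, u \in under (Posz 1) 0 -> van u C.
Proof.
have rF := riemF frameP CW.
split=> [h u|h].
  have kp : kP C by move=> i j k l; case: (h (e_ k) (e_ l)).
  have hq : kQ C by move=> i j k l; case: (h (e_ k) (f_ l)).
  have z00 j l : z0 (rdC fr 0 true C) j l = 0 by rewrite z0F; case: (h (e_ j) (f_ l)).
  have zz0 : zz (rdC fr 0 true C) = 0 by rewrite /zz big1.
  have [q1 q2] := proj1 kQ_van hq.
  move: u; apply/in_consP; split; first exact/kP_van.
  do 2![apply/in_consP; split; first by []].
  apply/in_consP; split; last (apply/in_consP; split; last (apply/in_consP; split; last
    (apply/in_consP; split; last exact/in_nilP))).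
  - by rewrite /van /rk /= -(zzP m_gt2).
  - by rewrite /van /rk /= -(hasZP m_gt2) => j l; rewrite z00 zz0 mulr0 mul0r.
  - rewrite /van /rk /= -hasLP => i j k l; rewrite /iotaL !z00 zz0.
    have := A4E frameP CW i j k l; have [-> _] := h (f_ k) (f_ l).
    by move/esym => a; rewrite (cancel0 h2 a); ring.
  - rewrite /van /rk /= -(z1P m_gt2 hook1') => i j; rewrite z1_rk'.
    by have [_ ->] := h (f_ i) (f_ j); rewrite oppr0.
have kp : kP C by apply/kP_van; apply: h.
have hq : kQ C by apply/kQ_van; split; apply: h.
have zz0 : zz (rdC fr 0 true C) = 0 by apply/(zzP m_gt2); apply: (h (Posz 0, 0%N)).
have hZ : hasZ (rdC fr 0 true C) by apply/(hasZP m_gt2); apply: (h (Posz 0, 1%N)).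
have z00 j l : z0 (rdC fr 0 true C) j l = 0 by rewrite hZ zz0 mulr0 mul0r.
have hL : hasL (rdC fr 0 true C) by apply/hasLP; apply: (h (Posz 0, 2%N)).
have z11 i j : zc (f_ i) (f_ j) = 0.
  apply/eqP; rewrite -oppr_eq0 -z1_rk'; apply/eqP; move: i j.
  by apply/(z1P m_gt2 hook1'); apply: (h (Posz 1, 0%N)).
have ff i j k l : cc (e_ i) (e_ j) (f_ k) (f_ l) = 0.
  by rewrite (A4E frameP CW) hL /iotaL !z00 zz0; ring.
move=> [[] k] [[] l]; split=> *.
- exact: kp.
- exact: (kz_of_kQ frameP CW hq).
- exact: hq.
- by rewrite -z0F z00.
- by rewrite c34 hq oppr0.
- by rewrite (zc_skew frameP CW (e_ l) (f_ k)) -z0F z00 oppr0.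
- exact: ff.
- exact: z11.
Qed.

End OneTensor.

Lemma ffun0P (J : finType) (f : {ffun J -> K^o}) : f = 0 <-> forall t, f t = 0.
Proof. by split=> [-> t|h]; [rewrite ffunE | apply/ffunP => t; rewrite h ffunE]. Qed.

Lemma alt_vanish C : m = 3%N -> C \in weyl g -> van (Posz 0, 2%N) C.
Proof.
move=> m3 CW; apply: (alt0_three m_gt2 m3).
exact: (@pr_mods K m m_gt2 0 2 _ (riemF frameP CW)).
Qed.

Lemma n6 : (n == 6%N) = (m == 3%N).
Proof. by rewrite n_eq -[6%N]/(3.*2)%N -!muln2 eqn_pmul2r. Qed.

Lemma allpair2 (A B : Type) (Q : A * B -> Prop) :
  (forall t, Q t) <-> forall a b, Q (a, b).
Proof. by split=> [h a b|h [a b]]. Qed.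
Lemma allpair3 (A B D : Type) (Q : A * B * D -> Prop) :
  (forall t, Q t) <-> forall a b d, Q (a, b, d).
Proof. by split=> [h a b d|h [[a b] d]]. Qed.
Lemma allpair4 (A B D E : Type) (Q : A * B * D * E -> Prop) :
  (forall t, Q t) <-> forall a b d e, Q (a, b, d, e).
Proof. by split=> [h a b d e|h [[[a b] d] e]]. Qed.

Lemma mem_cap_ker (E : vectType K) (f : {linear T -> E}) C (Q : Prop) :
  (C \in weyl g -> (f C = 0 <-> Q)) ->
  C \in (weyl g :&: lker (linfun f))%VS <-> C \in weyl g /\ Q.
Proof.
move=> h; rewrite memv_cap memv_ker lfunE; split=> [/andP [CW /eqP /h]|[CW /(h CW) ->]].
  by move=> hQ; split=> //; exact: hQ.
by rewrite CW eqxx.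
Qed.

Local Ltac atP h := apply/kP_van; exact: (h (Negz 1, 0%N)).
Local Ltac atQ CW h :=
  apply/(kQ_van CW); split; [exact: (h (Negz 0, 0%N)) | exact: (h (Negz 0, 1%N))].

Lemma mem_ker_Pi (k : int) (j : nat) C : k <= 1 -> j \in indices n k ->
  C \in ker_Pi g gp gm xi k j <-> C \in weyl g /\ forall u, u \in under k j -> van u C.
Proof.
pose G (k' : int) (j' : nat) := C \in ker_Pi g gp gm xi k' j' <->
  C \in weyl g /\ forall u, u \in under k' j' -> van u C.
have ker03 : G (Posz 0) 3%N.
  apply: mem_cap_ker => CW; apply: (iff_trans (ffun0P _)); apply: (iff_trans (allpair4 _)).
  apply: (iff_trans (ker_0_3 m_gt2 n_eq frameP cliffP xi_e xi_neq0 CW)).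
  split=> [[/(kP_van C) ? /(kQlam_van CW) ? /hasSP ?]|h].
    by do 3!(apply/in_consP; split=> //); apply/in_nilP.
  by split; [atP h | (apply/(kQlam_van CW); exact: (h (Negz 0, 1%N))) | (apply/hasSP; exact: (h (Posz 0, 3%N)))].
have ker00 : G (Posz 0) 0%N.
  apply: mem_cap_ker => CW; apply: (iff_trans (ffun0P _)); apply: (iff_trans (allpair2 _)).
  apply: (iff_trans (ker_0_0 frameP cliffP xi_e xi_neq0 CW)).
  rewrite -zzF; split=> [[/(kP_van C) ? /(kz_van CW) ? /(zzP m_gt2) ?]|h].
    by do 3!(apply/in_consP; split=> //); apply/in_nilP.
  by split; [atP h | (apply/(kz_van CW); exact: (h (Negz 0, 0%N))) | (apply/(zzP m_gt2); exact: (h (Posz 0, 0%N)))].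
have ker01 : G (Posz 0) 1%N.
  apply: mem_cap_ker => CW; apply: (iff_trans (ffun0P _)); apply: (iff_trans (allpair3 _)).
  apply: (iff_trans (ker_0_1 m_gt2 n_eq frameP cliffP xi_e xi_neq0 CW)).
  split=> [[/(kP_van C) ? /(kQ_van CW) [? ?] /(hasZ_van C) ?]|h].
    by do 4!(apply/in_consP; split=> //); apply/in_nilP.
  split; [atP h | | (apply/hasZ_van; exact: (h (Posz 0, 1%N)))].
  by atQ CW h.
have ker02 : m != 3%N -> G (Posz 0) 2%N.
  move=> m3; apply: mem_cap_ker => CW; apply: (iff_trans (ffun0P _)); apply: (iff_trans (allpair4 _)).
  apply: (iff_trans (ker_0_2 m_gt2 n_eq frameP cliffP xi_e xi_neq0 CW m3)).
  split=> [[/(kP_van C) ? /(kQ_van CW) [? ?] /hasLP ?]|h].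
    by do 4!(apply/in_consP; split=> //); apply/in_nilP.
  split; [atP h | | (apply/hasLP; exact: (h (Posz 0, 2%N)))].
  by atQ CW h.
case: k => [[|[|k]]|[|[|k]]] // _; rewrite /indices ?n6.
- case: ifP => m3; rewrite !inE; first by case/or3P => /eqP ->.
  by case/or4P => /eqP -> //; apply: ker02; rewrite m3.
- rewrite !inE => /orP [] /eqP ->; apply: mem_cap_ker => CW; apply: (iff_trans (ffun0P _)).
    apply: (iff_trans (allpair3 _)); apply: (iff_trans (ker_1_0 frameP cliffP xi_e xi_neq0 CW)).
    exact: ker_1_0_van.
  apply: (iff_trans (allpair4 _)).
  apply: (iff_trans (ker_1_1 m_gt2 n_eq frameP cliffP xi_e xi_neq0 CW)).
  split=> [[/(kP_van C) ? /(kQ_van CW) [? ?] [/hasSP ? /hasLP ? /(hasZP m_gt2) ?] /(kF1_van CW) ?]|h].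
    by do 7!(apply/in_consP; split=> //); apply/in_nilP.
  split; [atP h | | split | (apply/(kF1_van CW); exact: (h (Posz 1, 1%N)))].
  - by atQ CW h.
  - by apply/hasSP; exact: (h (Posz 0, 3%N)).
  - (apply/hasLP; exact: (h (Posz 0, 2%N))).
  - (apply/(hasZP m_gt2); exact: (h (Posz 0, 1%N))).
- rewrite !inE => /orP [] /eqP ->; apply: mem_cap_ker => CW; apply: (iff_trans (ffun0P _)).
    apply: (iff_trans (allpair3 _)); apply: (iff_trans (ker_m1_0 frameP cliffP xi_e xi_neq0 CW)).
    split=> [[/(kP_van C) ? /(kz_van CW) ?]|h].
      by do 2!(apply/in_consP; split=> //); apply/in_nilP.
    by split; [atP h | (apply/(kz_van CW); exact: (h (Negz 0, 0%N)))].
  apply: (iff_trans (allpair4 _)); apply: (iff_trans (ker_m1_1 m_gt2 n_eq frameP cliffP xi_e xi_neq0 CW)).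
  split=> [[/(kP_van C) ? /(kQlam_van CW) ?]|h].
    by do 2!(apply/in_consP; split=> //); apply/in_nilP.
  by split; [atP h | (apply/(kQlam_van CW); exact: (h (Negz 0, 1%N)))].
- rewrite !inE => /eqP ->; apply: mem_cap_ker => CW; apply: (iff_trans (ffun0P _)).
  apply: (iff_trans (allpair4 _)); apply: (iff_trans (ker_m2_0 frameP cliffP xi_e xi_neq0 C)).
  split=> [/(kP_van C) ?|h]; last atP h.
  by apply/in_consP; split=> //; apply/in_nilP.
Qed.

End Filtration.

(** * The ten pieces of the space of Weyl tensors *)

Section Pieces.
Variables (K : numClosedFieldType) (m n : nat) (g : 'M[K]_n)
  (fr : bool -> 'I_m -> 'rV[K]_n).
Hypotheses (m_gt2 : (2 < m)%N) (frameP : frame g fr).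
Local Notation T := (tensor4 K n).
Local Notation van := (van fr).
Local Notation rk := (rk fr).
Implicit Types (u v : int * nat) (C : T).

Definition labels : seq (int * nat) :=
  [:: (Negz 1, 0); (Negz 0, 0); (Negz 0, 1); (Posz 0, 0); (Posz 0, 1); (Posz 0, 2);
      (Posz 0, 3); (Posz 1, 0); (Posz 1, 1); (Posz 2, 0)]%N.

Definition levQ u := (lev u.1).1.
Definition levb u := (lev u.1).2.

Lemma labelsP (Q : int * nat -> Prop) :
  Q (Negz 1, 0%N) -> Q (Negz 0, 0%N) -> Q (Negz 0, 1%N) -> Q (Posz 0, 0%N) ->
  Q (Posz 0, 1%N) -> Q (Posz 0, 2%N) -> Q (Posz 0, 3%N) -> Q (Posz 1, 0%N) ->
  Q (Posz 1, 1%N) -> Q (Posz 2, 0%N) -> forall u, u \in labels -> Q u.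
Proof.
move=> q0 q1 q2 q3 q4 q5 q6 q7 q8 q9; rewrite /labels.
do 10![apply/in_consP; split; first by []]; exact/in_nilP.
Qed.

Lemma lab_ok u : u \in labels -> okb (levQ u) (levb u).
Proof. by move: u; apply: labelsP. Qed.
Lemma lab_valid u : u \in labels -> valid (levQ u) u.2.
Proof. by move: u; apply: labelsP. Qed.
Lemma lab_le2 u : u \in labels -> (levQ u <= 2)%N.
Proof. by move: u; apply: labelsP. Qed.
Lemma lev_inj u v : u \in labels -> v \in labels -> (levQ u, levb u) = (levQ v, levb v) ->
  u.1 = v.1.
Proof. by move=> ul; move: v; apply: labelsP; move: u ul; apply: labelsP. Qed.

(** The g_0-submodule that represents the label [u], with [cmp u] as the projection onto it; it is
    simple, or zero for the label (0, 2) when m = 3. *)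
Definition Pt u : {vspace T} := part frameP (levQ u) (levb u) u.2.
Definition cmp u C : T := mk g fr (levQ u) (levb u) (pr (levQ u) u.2 (rk u.1 C)).

Lemma rk_linear (k : int) : linear (rk k).
Proof. exact: rdC_linear. Qed.

Lemma van_lin u : lin_closed (van u).
Proof.
split=> [|x C D]; rewrite /van.
  by rewrite -(lin_ofE (rk_linear u.1)) linear0 pr_0.
by rewrite rk_linear pr_linear => -> ->; rewrite scaler0 addr0.
Qed.

Lemma rk_lvl u C : C \in weyl g -> lvl (levQ u) (rk u.1 C).
Proof. exact: rdC_lvl. Qed.

Lemma cmp_mem u C : u \in labels -> C \in weyl g -> cmp u C \in Pt u.
Proof.
move=> ul CW; have M := pr_mods m_gt2 u.2 (rk_lvl u CW).
apply/(mem_part frameP _ _ (lab_ok ul)); rewrite rdC_mk ?lab_le2 //; last exact: mods_lvl M.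
by split=> //; apply: mk_weyl => //; exact: mods_lvl M.
Qed.

Lemma Pt_weyl u C : u \in labels -> C \in Pt u -> C \in weyl g.
Proof. by move=> /lab_ok o /(mem_part frameP _ _ o) []. Qed.

Lemma Pt_fix u C : u \in labels -> C \in Pt u -> cmp u C = C.
Proof.
move=> ul /(mem_part frameP _ _ (lab_ok ul)) [CW M E].
by rewrite /cmp (pr_fix m_gt2 (lab_valid ul) M) -E.
Qed.

Lemma mk0 Q b : mk g fr Q b 0 = 0.
Proof. by rewrite -(lin_ofE (mk_linear frameP Q b)) linear0. Qed.

Lemma van_cmp u C : u \in labels -> C \in weyl g -> van u C <-> cmp u C = 0.
Proof.
move=> ul CW; have M := mods_lvl (pr_mods m_gt2 u.2 (rk_lvl u CW)).
split=> [h|h]; first by rewrite /cmp /levQ h mk0.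
have := rdC_mk frameP (levb u) (lab_le2 ul) M; rewrite -/(cmp u C) h.
by rewrite /van -/(levQ u) => <-; rewrite -(lin_ofE (rdC_linear fr _ _)) linear0.
Qed.

Lemma Pt_van u v C : u \in labels -> v \in labels -> v != u -> C \in Pt u -> van v C.
Proof.
move=> ul vl vu /(mem_part frameP _ _ (lab_ok ul)) [CW M E].
have [e|ne] := eqVneq (levQ u, levb u) (levQ v, levb v); last first.
  rewrite /van /rk E -/(levQ v) -/(levb v) (rdC_mk0 frameP _ (lab_ok ul) (lab_ok vl) ne).
  exact: pr_0.
have e1 := lev_inj ul vl e; case: e => eQ eb.
have M' : mods (levQ v) u.2 (rk v.1 C) by rewrite -eQ /rk -e1.
apply: (pr_mods0 m_gt2 (lab_valid vl) M'); apply: contra vu => /eqP e2.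
by rewrite [v]surjective_pairing [u]surjective_pairing e1 e2.
Qed.

Lemma Pt_van0 u C : u \in labels -> C \in Pt u -> van u C -> C = 0.
Proof.
by move=> ul CP; rewrite (van_cmp ul (Pt_weyl ul CP)) (Pt_fix ul CP).
Qed.

Lemma cmp_sum C : C \in weyl g -> C = \sum_(u <- labels) cmp u C.
Proof.
move=> CW; have E (k : int) : mk g fr (lev k).1 (lev k).2 (rdC fr (lev k).1 (lev k).2 C)
    = \sum_(s <- inds (lev k).1) cmp (k, s) C.
  rewrite {1}(pr_sum (rdC_lvl frameP (lev k).1 (lev k).2 CW)).
  by rewrite -(lin_ofE (mk_linear frameP _ _)) linear_sum; apply: eq_bigr => s _; exact: lin_ofE.
have G1 (f : nat * bool -> T) : \sum_(u <- grades) f u =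
    f (2, true)%N + (f (1, true)%N + (f (0, true)%N + (f (1, false)%N + f (2, false)%N))).
  by rewrite /grades !big_cons big_nil addr0.
have G2 (f : int * nat -> T) : \sum_(s <- inds 2) f (Negz 1, s) + (\sum_(s <- inds 1) f (Negz 0, s)
    + (\sum_(s <- inds 0) f (Posz 0, s) + (\sum_(s <- inds 1) f (Posz 1, s)
    + \sum_(s <- inds 2) f (Posz 2, s)))) = \sum_(u <- labels) f u.
  by rewrite /labels /inds !big_cons !big_nil !addr0 !addrA.
rewrite -G2 {1}(weyl_sum frameP CW) G1; congr (_ + (_ + (_ + (_ + _)))).
- exact: (E (Negz 1)).
- exact: (E (Negz 0)).
- exact: (E (Posz 0)).
- exact: (E (Posz 1)).
- exact: (E (Posz 2)).
Qed.

(* The Weyl tensors without components labelled in [S].                            *)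
Definition vanS (S : pred (int * nat)) : {vspace T} :=
  vsof (fun C => C \in weyl g /\ forall u, u \in labels -> S u -> van u C).

Lemma vanSP S C : C \in vanS S <-> C \in weyl g /\ forall u, u \in labels -> S u -> van u C.
Proof.
apply: vsofP; split=> [|x D E [DW hD] [EW hE]].
  by split=> [|u _ _]; [exact: mem0v | case: (van_lin u)].
split=> [|u ul uS]; first by rewrite memvD ?memvZ.
by have [_ h] := van_lin u; apply: h; [exact: hD | exact: hE].
Qed.

Lemma vanS_weyl S : (vanS S <= weyl g)%VS.
Proof. by apply/subvP => C /vanSP []. Qed.

Lemma vanS_sub (S S' : pred (int * nat)) : (forall u, u \in labels -> S' u -> S u) ->
  (vanS S <= vanS S')%VS.
Proof.
move=> h; apply/subvP => C /vanSP [CW hC]; apply/vanSP; split=> // u ul /(h _ ul).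
exact: hC.
Qed.

Lemma Pt_vanS u S : u \in labels -> ~~ S u -> (Pt u <= vanS S)%VS.
Proof.
move=> ul Su; apply/subvP => C CP; apply/vanSP; split=> [|v vl Sv]; first exact: Pt_weyl CP.
by apply: Pt_van CP => //; apply: contraNneq Su => <-.
Qed.

Lemma vanS_sum S C : C \in vanS S -> C = \sum_(u <- labels | ~~ S u) cmp u C.
Proof.
move=> /vanSP [CW hC]; rewrite {1}(cmp_sum CW) (bigID S) /= big1_seq ?add0r // => u.
by case/andP => Su ul; apply/(van_cmp ul CW); exact: hC.
Qed.

Lemma vanS_subP S (X : {vspace T}) :
  (forall u, u \in labels -> ~~ S u -> (Pt u <= X)%VS) -> (vanS S <= X)%VS.
Proof.
move=> h; apply/subvP => C CS; have [CW _] := proj1 (vanSP S C) CS.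
rewrite (vanS_sum CS) big_seq_cond; apply: memv_suml => u /andP [ul Su].
exact: (subvP (h u ul Su)) (cmp_mem ul CW).
Qed.

Lemma cmp_lin u (k : K) C D : cmp u (k *: C + D) = k *: cmp u C + cmp u D.
Proof. by rewrite /cmp rk_linear pr_linear mk_linear. Qed.

End Pieces.

(** * The filtration and its direct sum decompositions *)

Section FiltrationTerms.
Variables (K : numClosedFieldType) (m n N : nat) (g : 'M[K]_n)
  (fr : bool -> 'I_m -> 'rV[K]_n) (gp gm : 'I_n -> 'M[K]_N) (xi : 'rV[K]_N).
Hypotheses (m_gt2 : (2 < m)%N) (n_eq : n = m.*2) (frameP : frame g fr)
  (cliffP : clifford_relations g gp gm).
Local Notation I := 'I_m.
Local Notation P := (bool * I)%type.
Local Notation T := (tensor4 K n).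
Local Notation Gp := (Gp fr gp).
Hypotheses (xi_e : forall i, xi *m Gp (true, i) = 0) (xi_neq0 : xi != 0).
Implicit Types (p q : P) (r s : I) (A B D F : 'I_N).

Local Notation van := (van fr).
Local Notation vanS := (vanS g fr).
Local Notation ker := (ker_Pi g gp gm xi).
Local Notation Cf := (weyl_filtration g gp gm xi).
Local Notation Cc := (weyl_component g gp gm xi).
Implicit Types (C : T) (u v : int * nat).

Definition degs : seq int := [:: Negz 1; Negz 0; Posz 0; Posz 1; Posz 2].

Lemma degsP (k : int) : -2 <= k <= 2 -> k \in degs.
Proof. by case: k => [[|[|[|k]]]|[|[|k]]]. Qed.

Lemma degs_ind (Q : int -> Prop) : Q (Negz 1) -> Q (Negz 0) -> Q (Posz 0) -> Q (Posz 1) ->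
  Q (Posz 2) -> forall k : int, k \in degs -> Q k.
Proof.
move=> q0 q1 q2 q3 q4 x; rewrite !inE.
by do 4![case/orP => [/eqP -> //|]]; move/eqP ->.
Qed.

(** [indices] with the test on n replaced by a boolean, so that statements about all labels can be
    checked by evaluation in both cases. *)
Definition idx (b : bool) (k : int) : seq nat := match k with
  | Negz 1 => [:: 0]
  | Negz 0 => [:: 0; 1]
  | Posz 0 => if b then [:: 0; 1; 3] else [:: 0; 1; 2; 3]
  | Posz 1 => [:: 0; 1]
  | Posz 2 => [:: 0]
  | _ => [::]
  end%N.

Lemma indicesE (k : int) : indices n k = idx (m == 3%N) k.
Proof. by case: k => [[|[|[|k]]]|[|[|k]]] //=; rewrite (n6 n_eq). Qed.

Lemma under_sub b (k : int) (j : nat) : k \in degs -> j \in idx b k ->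
  all (fun u => (u \in labels) && ((u.1 < k) || (u == (k, j)))) (under k j).
Proof.
move=> kd; have : all (fun j : nat => all (fun u => (u \in labels) && ((u.1 < k) || (u == (k, j))))
    (under k j)) (idx b k) by move: k kd; apply: degs_ind => //; case: b.
by move=> /allP h /h.
Qed.

(** The second alternative is the case m = 3, where no map of degree at most 0 tests the label (0,
    2); its module is zero then. *)
Lemma under_cover b (k : int) u : k \in degs -> k <= 1 -> u \in labels -> u.1 <= k ->
  has (fun j : nat => u \in under k j) (idx b k) || b && (u == (Posz 0, 2%N)).
Proof.
by move: k; apply: degs_ind => // _; move: u; apply: labelsP; case: b.
Qed.

Lemma lab_of_idx (k : int) (j : nat) : k \in degs -> j \in indices n k -> (k, j) \in labels.
Proof.
move=> kd; rewrite indicesE; have : all (fun j : nat => (k, j) \in labels) (idx (m == 3%N) k).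
  by move: k kd; apply: degs_ind => //=; case: ifP.
by move=> /allP h /h.
Qed.

Lemma vspace_eqP (U V : {vspace T}) : (forall x, x \in U <-> x \in V) -> U = V.
Proof. by move=> h; apply/vspaceP => x; apply/idP/idP => /h. Qed.

Lemma memv_bigcap (s : seq nat) (S : pred nat) (U : nat -> {vspace T}) C :
  C \in (\bigcap_(k <- s | S k) U k)%VS <-> forall k, k \in s -> S k -> C \in U k.
Proof.
elim: s => [|a s IH]; first by rewrite big_nil memvf.
rewrite big_cons; case: ifP => Sa; rewrite ?memv_cap; split.
- move=> /andP [Ca /IH h] k; rewrite inE => /orP [/eqP -> //|]; exact: h.
- by move=> h; rewrite h ?inE ?eqxx //; apply/IH => k ks; apply: h; rewrite inE ks orbT.
- move=> /IH h k; rewrite inE => /orP [/eqP ->|]; [by rewrite Sa | exact: h].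
- by move=> h; apply/IH => k ks; apply: h; rewrite inE ks orbT.
Qed.

Lemma subv_bigsum (s : seq nat) (S : pred nat) (U : nat -> {vspace T}) X :
  (forall j, j \in s -> S j -> (U j <= X)%VS) -> (\sum_(j <- s | S j) U j <= X)%VS.
Proof.
move=> h; rewrite big_seq_cond.
apply: (big_ind (fun V => (V <= X)%VS)) => [|V W hV hW|j /andP [js Sj]]; first exact: sub0v.
  by rewrite subv_add hV.
exact: h.
Qed.

Lemma subv_bigsup (s : seq nat) (S : pred nat) (U : nat -> {vspace T}) j :
  j \in s -> S j -> (U j <= \sum_(j <- s | S j) U j)%VS.
Proof. by move=> js Sj; rewrite (big_rem j js) /= Sj addvSl. Qed.

Lemma mem_kerS (k : int) (j : nat) C : k <= 1 -> j \in indices n k ->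
  C \in ker k j <-> C \in weyl g /\ forall u, u \in under k j -> van u C.
Proof. exact: mem_ker_Pi. Qed.

Lemma ker_vanS (k : int) (j : nat) : k \in degs -> k <= 1 -> j \in indices n k ->
  ker k j = vanS (mem (under k j)).
Proof.
move=> kd k1 ji; apply: vspace_eqP => C; rewrite mem_kerS // vanSP.
have := under_sub kd (_ : j \in idx (m == 3%N) k); rewrite -indicesE => /(_ ji) /allP sub.
split=> -[CW h]; split=> // u; first by move=> _ us; exact: h.
by move=> us; apply: h => //; case/andP: (sub u us).
Qed.

Lemma van_three C : m = 3%N -> C \in weyl g -> van (Posz 0, 2%N) C.
Proof. exact: alt_vanish. Qed.

(** Every label of degree less than k lies below some map of degree k - 1, and conversely these maps
    test no label of degree k or more. *)
Lemma filt_vanS (k : int) : -2 <= k <= 3 -> Cf k = vanS (fun u => u.1 < k).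
Proof.
move=> kr; have [k3|k3] := boolP (3 <= k).
  have -> : k = 3 by apply/eqP; rewrite eq_le k3 andbT; case/andP: kr.
  rewrite /weyl_filtration lexx; apply/esym/eqP; rewrite -subv0.
  by apply: (@vanS_subP _ _ _ _ _ m_gt2 frameP) => u; move: u; apply: labelsP.
rewrite /weyl_filtration (negPf k3); apply: vspace_eqP => C.
rewrite memv_cap vanSP.
(* There are no indices in degree -3, so the bottom term carries no condition. *)
have [k2|k2] := eqVneq k (-2).
  rewrite k2 big_nil memvf andbT; split=> [CW|[] //]; split=> // u.
  by move: u; apply: labelsP.
have kd : k - 1 \in degs.
  by apply: degsP; move: kr k3 k2; clear; lia.
have k1 : k - 1 <= 1 by move: kr k3 k2; clear; lia.
split.
  move=> /andP [CW /(memv_bigcap _ xpredT) h]; split=> // u ul uk.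
  have uk1 : u.1 <= k - 1 by move: uk; clear; lia.
  have := @under_cover (m == 3%N) _ _ kd k1 ul uk1.
  case/orP => [/hasP [j jk uj]|/andP [/eqP m3 /eqP ->]]; last exact: van_three.
  rewrite -indicesE in jk; have := h j jk isT.
  by move=> /(mem_kerS _ k1 jk) [_ hu]; exact: hu.
move=> [CW h]; rewrite CW; apply/(memv_bigcap _ xpredT) => j jk _.
apply/(mem_kerS _ k1 jk); split=> // u uj.
have := under_sub kd (_ : j \in idx (m == 3%N) (k - 1)); rewrite -indicesE => /(_ jk) /allP sub.
have /andP [ul] := sub u uj; move=> E; apply: h => //.
by case/orP: E => [|/eqP -> /=]; clear; lia.
Qed.

Lemma comp_vanS (k : int) (j : nat) : -2 <= k <= 2 -> j \in indices n k ->
  Cc k j = vanS (fun u => (u.1 < k) || (u.1 == k) && (u.2 != j)).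
Proof.
move=> kr jk; apply: vspace_eqP => C; rewrite /weyl_component memv_cap vanSP.
have kr' : -2 <= k <= 3 by move: kr; clear; lia.
rewrite filt_vanS //.
(* In degree 2 the only index is j = 0 and the intersection over the other indices is empty. *)
have [k1|k1] := boolP (k <= 1); last first.
  have k2 : k = Posz 2 by move: kr k1; clear; lia.
  have j0 : j = 0%N by move: jk; rewrite k2 inE => /eqP.
  rewrite k2 j0 big_cons big_nil /= memvf andbT vanSP; split=> -[CW h]; split=> // u ul.
    by move: u ul (h u ul); apply: labelsP => //= h'; rewrite ?orbT ?orbF; exact: h'.
  by move=> u2; apply: h => //; rewrite u2.
have kd := degsP kr.
have sub i : i \in indices n k -> forall u, u \in under k i ->
    u \in labels /\ (u.1 < k \/ u = (k, i)).
  rewrite indicesE => ik u ui; have /allP := under_sub kd ik.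
  by move=> /(_ u ui) /andP [ul /orP [?|/eqP ?]]; split=> //; [left | right].
split.
  move=> /andP [/vanSP [CW h] /memv_bigcap h2]; split=> // u ul /orP [|/andP [/eqP uk uj]].
    exact: h.
  have := @under_cover (m == 3%N) _ _ kd k1 ul; rewrite uk lexx => /(_ isT).
  case/orP => [/hasP [i ik ui]|/andP [/eqP m3 /eqP ->]]; last exact: van_three.
  rewrite -indicesE in ik.
  have [_ [lt|ue]] := sub i ik u ui; first by rewrite uk ltxx in lt.
  have ij : i != j by apply: contraNneq uj => <-; rewrite ue.
  by have := h2 i ik ij; move=> /(mem_kerS _ k1 ik) [_ hu]; exact: hu.
move=> [CW h]; apply/andP; split.
  by apply/vanSP; split=> // u ul uk; apply: h => //; rewrite uk.
apply/memv_bigcap => i ik ij; apply/(mem_kerS _ k1 ik); split=> // u ui.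
have [ul e] := sub i ik u ui; apply: h => //; case: e => [->//|->].
by rewrite /= eqxx ij orbT.
Qed.

Lemma filt_weyl : Cf (-2) = weyl g.
Proof.
rewrite filt_vanS //; apply/eqP; rewrite eqEsubv vanS_weyl; apply/subvP => C CW.
by apply/vanSP; split=> // u; move: u; apply: labelsP.
Qed.

Lemma filt_le (k : int) : -2 <= k <= 2 -> (Cf (k + 1)%R <= Cf k)%VS.
Proof.
move=> kr; rewrite !filt_vanS; try by move: kr; clear; lia.
by apply: vanS_sub => u _ uk; move: uk; clear; lia.
Qed.

Lemma filt_le_comp (k : int) j : -2 <= k <= 2 -> j \in indices n k -> (Cf (k + 1)%R <= Cc k j)%VS.
Proof.
move=> kr jk; rewrite comp_vanS // filt_vanS; last by move: kr; clear; lia.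
by apply: vanS_sub => u _ /orP [|/andP [/eqP ->]]; clear; lia.
Qed.

Lemma lab_indices u : u \in labels -> u.2 \notin indices n u.1 -> m = 3%N /\ u = (Posz 0, 2%N).
Proof.
rewrite indicesE; case: eqP => [m3|_]; move: u; apply: labelsP => //.
Qed.

Lemma Pt_three : m = 3%N -> Pt frameP (Posz 0, 2%N) = 0%VS.
Proof.
move=> m3; apply: vs0P => C CP; rewrite memv0; apply/eqP.
apply: (Pt_van0 m_gt2 _ CP) => //; apply: van_three => //; exact: Pt_weyl CP.
Qed.

Lemma Pt_comp u : u \in labels -> u.2 \in indices n u.1 -> (Pt frameP u <= Cc u.1 u.2)%VS.
Proof.
move=> ul ui; rewrite comp_vanS //; last by move: u ul {ui}; apply: labelsP.
by apply: (Pt_vanS m_gt2) => //; rewrite /= ltxx !eqxx.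
Qed.

Lemma filt_sum (k : int) : -2 <= k <= 2 -> Cf k = (\sum_(j <- indices n k) Cc k j)%VS.
Proof.
move=> kr; have kr' : -2 <= k <= 3 by move: kr; clear; lia.
have J0 : 0%N \in indices n k.
  by rewrite indicesE; move: k {kr kr'} (degsP kr); apply: degs_ind => //=; case: ifP.
apply/eqP; rewrite eqEsubv; apply/andP; split; last first.
  apply: subv_bigsum => j jk _; rewrite comp_vanS // filt_vanS //.
  by apply: vanS_sub => u _ ->.
rewrite filt_vanS //; apply: (@vanS_subP _ _ _ _ _ m_gt2 frameP) => u ul uk.
have [u1|u1] := eqVneq u.1 k; last first.
  apply: subv_trans (subv_bigsup _ J0 isT); apply: subv_trans (filt_le_comp kr J0).
  rewrite filt_vanS; last by move: kr; clear; lia.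
  by apply: (Pt_vanS m_gt2) => //; move: uk u1; clear; lia.
have [ui|ui] := boolP (u.2 \in indices n u.1); last first.
  have [m3 ->] := lab_indices ul ui; rewrite Pt_three //; exact: sub0v.
rewrite u1 in ui; apply: subv_trans (subv_bigsup _ ui isT).
by have := Pt_comp ul; rewrite u1; apply.
Qed.

(** A tensor in the intersection lacks the component (k, j) because of the sum, and the other
    components of degree k because of the first factor. *)
Lemma filt_direct (k : int) j : -2 <= k <= 2 -> j \in indices n k ->
  (Cc k j :&: \sum_(l <- indices n k | l != j) Cc k l <= Cf (k + 1)%R)%VS.
Proof.
move=> kr jk; apply/subvP => C; rewrite memv_cap => /andP [Cj Cs].
have : C \in vanS (pred1 (k, j)).
  apply: (subvP _ _ Cs); apply: subv_bigsum => l lk lj.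
  rewrite comp_vanS //; apply: vanS_sub => u _ /eqP ->.
  by rewrite /= eqxx ltxx eq_sym lj.
move: Cj; rewrite comp_vanS // => /vanSP [CW h1] /vanSP [_ h2].
rewrite filt_vanS; last by move: kr; clear; lia.
apply/vanSP; split=> // u ul uk; have [->|ne] := eqVneq u (k, j).
  by apply: h2; rewrite //= ?eqxx //; exact: lab_of_idx (degsP kr) jk.
apply: h1 => //; have [u1|u1] := eqVneq u.1 k.
  by apply/orP; right; rewrite andTb; apply: contraNneq ne => <-; rewrite -u1 -surjective_pairing.
by rewrite andFb orbF; move: uk u1; clear; lia.
Qed.

End FiltrationTerms.

Section BilinearSpans.
Variables (K : fieldType) (E F G : vectType K).

Lemma mem_bspan (f : E -> F -> G) (A : {vspace E}) (B : {vspace F}) a b :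
    (forall b, linear (f^~ b)) -> (forall a, linear (f a)) ->
  a \in A -> b \in B -> f a b \in bspan f A B.
Proof. by move=> l r; move: a b; apply/(bspan_subP _ _ _ l r)/subvv. Qed.

End BilinearSpans.

(** * Rotations of the frame and the Lie algebra so(V) *)

Section Rotations.
Variables (K : numClosedFieldType) (m n : nat) (g : 'M[K]_n)
  (fr : bool -> 'I_m -> 'rV[K]_n).
Hypothesis frameP : frame g fr.
Local Notation I := 'I_m.
Local Notation P := (bool * I)%type.
Local Notation T := (tensor4 K n).
Local Notation Sv := (Sv fr).
Local Notation frm := (frm fr).
Local Notation rot := (rot g fr).
Local Notation dp := (dp K).
Implicit Types (C : T) (p q r s x y : P) (phi psi : 'M[K]_n) (u v : 'rV[K]_n).

Lemma tens_vec_linl v : linear (fun u => tens_vec g u v).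
Proof.
by move=> k x y; rewrite /tens_vec mulmxDl linearD /= mulmxDl -scalemxAl linearZ /= -scalemxAl.
Qed.

Lemma tens_vec_linr u : linear (tens_vec g u).
Proof. by move=> k x y; rewrite /tens_vec mulmxDl mulmxDr -scalemxAl -scalemxAr. Qed.

Lemma wedge_linl v : linear (fun u => wedge g u v).
Proof.
move=> k x y; rewrite /wedge tens_vec_linl tens_vec_linr scalerA mulrC -scalerA -scalerDr.
by congr (_ *: _); rewrite scalerBr opprD addrACA.
Qed.

Lemma wedge_linr u : linear (wedge g u).
Proof.
move=> k x y; rewrite /wedge tens_vec_linl tens_vec_linr scalerA mulrC -scalerA -scalerDr.
by congr (_ *: _); rewrite scalerBr opprD addrACA.
Qed.

Lemma wedgeC u v : wedge g v u = - wedge g u v.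
Proof. by rewrite /wedge -scalerN opprB. Qed.

Lemma wedgeZl (x : K) u v : wedge g (x *: u) v = x *: wedge g u v.
Proof.
rewrite /wedge /tens_vec -!scalemxAl linearZ /= -scalemxAl -scalemxAr -scalerBr.
by rewrite scalerA mulrC -scalerA.
Qed.

Lemma rot_wedge p q : wedge g (frm p) (frm q) = 2^-1 *: rot (st p) q.
Proof. by rewrite /rot stK scalerA mulVf ?scale1r // (num_neq0 K 1). Qed.

Lemma rotC p q : rot p q = - rot (st q) (st p).
Proof. by rewrite /rot stK wedgeC scalerN. Qed.

Lemma wedge_span (A B : {vspace 'rV[K]_n}) (s t : bool) (X : {vspace 'M[K]_n}) :
  (forall u, u \in A -> exists c, u = \sum_i c i *: frm (s, i)) ->
  (forall u, u \in B -> exists c, u = \sum_i c i *: frm (t, i)) ->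
  (forall i j, rot (~~ s, i) (t, j) \in X) -> (bspan (wedge g) A B <= X)%VS.
Proof.
move=> hA hB h; apply/(bspan_subP _ _ _ wedge_linl wedge_linr) => u v /hA [c ->] /hB [d ->].
rewrite (_ : wedge g _ _ = \sum_i c i *: wedge g (frm (s, i)) (\sum_j d j *: frm (t, j))).
  apply: memv_suml => i _; apply: memvZ.
  rewrite (_ : wedge g _ _ = \sum_j d j *: wedge g (frm (s, i)) (frm (t, j))).
    by apply: memv_suml => j _; rewrite rot_wedge; do 2!apply: memvZ; exact: h.
  by rewrite -(lin_ofE (wedge_linr _)) linear_sum; apply: eq_bigr => j _; rewrite linearZ /= lin_ofE.
rewrite -(lin_ofE (wedge_linl _)) linear_sum; apply: eq_bigr => j _.
by rewrite linearZ /= lin_ofE.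
Qed.

Lemma endo_linear : linear (endo g).
Proof. by move=> k x y; rewrite /endo mulmxDl -scalemxAl. Qed.

Lemma act4_linl C : linear (fun phi => act4 g phi C).
Proof.
move=> k x y; apply/ffunP => -[[[a b] c] d]; rewrite !ffunE /GRing.scale /=.
rewrite mulr_sumr -big_split; apply: eq_bigr => e _; rewrite endo_linear !mxE /=; ring.
Qed.

Lemma act4_linr phi : linear (act4 g phi).
Proof. by move=> k x y; rewrite linearP. Qed.

Lemma stableE h (X : {vspace T}) :
  stable g h X <-> forall phi C, phi \in h -> C \in X -> act4 g phi C \in X.
Proof.
split=> [st_ phi C ph CX|st_ phi ph].
  by apply: (subvP (st_ phi ph)); rewrite -[act4 g phi C]lfunE memv_img.
by apply/subvP => _ /memv_imgP [C CX ->]; rewrite lfunE; exact: st_.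
Qed.

(** Stability under a subalgebra becomes an inclusion of subspaces, to be checked on spanning
    rotations. *)
Definition stab (X : {vspace T}) : {vspace 'M[K]_n} :=
  vsof (fun phi => forall C, C \in X -> act4 g phi C \in X).

Lemma stabP (X : {vspace T}) phi : phi \in stab X <-> forall C, C \in X -> act4 g phi C \in X.
Proof.
apply: vsofP; split=> [C CX|k x y hx hy C CX].
  by rewrite -(lin_ofE (act4_linl C)) linear0 mem0v.
by rewrite act4_linl memvD ?memvZ ?hx ?hy.
Qed.

Lemma stable_stab h (X : {vspace T}) : stable g h X <-> (h <= stab X)%VS.
Proof.
rewrite stableE; split=> [st_|/subvP sh phi C ph]; last exact: (proj1 (stabP X phi) (sh _ ph) C).
by apply/subvP => phi ph; apply/stabP => C; exact: st_.
Qed.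

Definition fm phi p q : K := Sv p (fun a => Sv q (phi a)).

Lemma rotE p q (a b : 'I_n) : rot p q a b =
  cf g fr p a * cf g fr (st q) b - cf g fr (st q) a * cf g fr p b.
Proof.
rewrite /rot /wedge scalerA mulfV ?(num_neq0 K 1) // scale1r /tens_vec.
have t u v : ((u *m g)^T *m (v *m g)) a b = (u *m g) 0 a * (v *m g) 0 b.
  by rewrite [LHS]mxE big_ord1 [X in X * _]mxE.
by rewrite mxE [X in _ + X]mxE !t /cf stK.
Qed.

(** The factor 1/2 compensates for [rot p (st q)] being skew in p and q, so that each pair is
    counted twice. *)
Lemma so_form_expand phi : phi \in so_form K n ->
  phi = \sum_p \sum_q (fm phi p q / 2) *: rot p (st q).
Proof.
rewrite memv_ker lfunE /= => /eqP s; have sk a b : phi b a = - phi a b.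
  have := congr1 (fun M : 'M_n => M a b) s; rewrite /form_sym !mxE => e.
  by apply/eqP; rewrite -addr_eq0 addrC e.
have E a b : phi a b = \sum_p \sum_q cf g fr p a * cf g fr q b * fm phi p q.
  rewrite -{1}(Sc_Sv frameP b (phi a)) /Sc.
  under eq_bigr => q _ do rewrite -(Sc_Sv frameP a (fun a => Sv q (phi a))) /Sc mulr_sumr.
  rewrite exchange_big; apply: eq_bigr => p _; apply: eq_bigr => q _.
  by rewrite /fm; ring.
apply/matrixP => a b; rewrite summxE.
under eq_bigr => p _ do rewrite summxE.
under eq_bigr => p _ do under eq_bigr => q _ do rewrite mxE rotE stK.
transitivity ((phi a b - phi b a) / 2); first by rewrite sk; field.
rewrite !E -sumrB mulr_suml; apply: eq_bigr => p _; rewrite -sumrB mulr_suml.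
by apply: eq_bigr => q _; ring.
Qed.

Lemma fm_rot p q x y : fm (rot p q) x y = dp x p * dp y (st q) - dp x (st q) * dp y p.
Proof.
have S z w : \sum_a vf fr z a * cf g fr w a = dp z w by exact: vf_cf.
rewrite /fm; transitivity (Sv x (fun a => cf g fr p a * dp y (st q) - cf g fr (st q) a * dp y p)).
  apply: eq_Sv => a; rewrite -!S !mulr_sumr -sumrB; apply: eq_bigr => b _.
  by rewrite rotE; ring.
rewrite -!S !mulr_suml -sumrB; apply: eq_bigr => a _; ring.
Qed.

Lemma rot_so p q : rot p q \in so_form K n.
Proof.
rewrite memv_ker lfunE /= /form_sym; apply/eqP/matrixP => a b.
by rewrite mxE [X in _ + X]mxE !rotE [RHS]mxE; ring.
Qed.

Lemma so_tr phi : phi \in so_form K n -> phi^T = - phi.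
Proof.
by rewrite memv_ker lfunE /= => s; apply/eqP; rewrite -addr_eq0 addrC.
Qed.

Lemma frm_endo_row p q x :
  frm x *m endo g (rot p q) = dp x p *: frm q - dp x (st q) *: frm (st p).
Proof.
apply/rowP => b; rewrite [RHS]mxE [X in _ + X]mxE [X in X - _]mxE [X in _ - X]mxE.
by rewrite -[RHS](frm_endo frameP) [LHS]mxE.
Qed.

(** [lie] acts on lowered indices; after raising them, the skewness of [phi] changes the sign of the
    endomorphism. *)
Lemma lie_wedge phi u v : phi \in so_form K n ->
  lie g phi (wedge g u v) = - (wedge g (u *m endo g phi) v + wedge g u (v *m endo g phi)).
Proof.
move=> /so_tr ph; have [gT gU _ _] := frameP.
have X w : w *m endo g phi *m g = w *m phi by rewrite /endo !mulmxA mulmxKV.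
have Y w : endo g phi *m (w *m g)^T = phi *m w^T.
  by rewrite trmx_mul gT /endo -mulmxA mulKmx.
have L w z : endo g phi *m tens_vec g w z = - tens_vec g (w *m endo g phi) z.
  by rewrite /tens_vec mulmxA Y X trmx_mul ph !mulNmx opprK.
have R w z : tens_vec g w z *m (endo g phi)^T = - tens_vec g w (z *m endo g phi).
  rewrite /tens_vec -mulmxA X -mulmxN; congr (_ *m _).
  by rewrite -[LHS]trmxK trmx_mul trmxK Y trmx_mul trmxK ph mulmxN.
rewrite /lie /wedge -!scalemxAr -!scalemxAl mulmxBr mulmxBl !L !R -!scalerDr -scalerN.
by congr (_ *: _); rewrite !opprD !opprK addrACA [RHS]addrACA; congr (_ + _); rewrite addrC.
Qed.

Lemma lie_rot p q r s : lie g (rot p q) (rot r s) =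
  dp (st r) (st q) *: rot p s - dp (st r) p *: rot (st q) s
  - dp s p *: rot r q + dp s (st q) *: rot r (st p).
Proof.
have -> : lie g (rot p q) (rot r s) = 2 *: lie g (rot p q) (wedge g (frm (st r)) (frm s)).
  by rewrite -linearZ.
rewrite lie_wedge ?rot_so // !frm_endo_row.
have Wl (x y : K) (z w t : 'rV[K]_n) : wedge g (x *: z - y *: w) t = x *: wedge g z t - y *: wedge g w t.
  by rewrite -scaleNr wedge_linl wedgeZl scaleNr.
have Wr (x y : K) (z w t : 'rV[K]_n) : wedge g t (x *: z - y *: w) = x *: wedge g t z - y *: wedge g t w.
  by rewrite (wedgeC (x *: z - y *: w)) (wedgeC z) (wedgeC w) Wl !scalerN opprB opprK addrC.
rewrite Wl Wr scalerN !scalerDr !scalerN ![2 *: (_ *: _)]scalerA ![2 * _]mulrC -!scalerA.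
rewrite /rot !stK !opprD !opprK addrA; by rewrite [- _ + _]addrC.
Qed.

Section Slots.
Variable J : finType.
Definition sl (X : 'M[K]_n) (h : 'I_n -> K) a : K := \sum_e X a e * h e.

Lemma sl_comm X Y (h : 'I_n -> 'I_n -> K) a b :
  sl X (fun e => sl Y (h e) b) a = sl Y (fun f => sl X (h^~ f) a) b.
Proof.
rewrite /sl; under eq_bigr => e _ do rewrite mulr_sumr.
rewrite exchange_big; apply: eq_bigr => f _; rewrite mulr_sumr.
by apply: eq_bigr => e _; rewrite mulrCA.
Qed.

Lemma sl_mul X Y h a : sl X (sl Y h) a = sl (X *m Y) h a.
Proof.
rewrite /sl; under eq_bigr => e _ do rewrite mulr_sumr.
rewrite exchange_big; apply: eq_bigr => f _; rewrite mxE mulr_suml.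
by apply: eq_bigr => e _; rewrite mulrA.
Qed.

Lemma slD X h h' a : sl X (fun e => h e + h' e) a = sl X h a + sl X h' a.
Proof. by rewrite /sl -big_split; apply: eq_bigr => e _; rewrite mulrDr. Qed.

Lemma slB X Y h a : sl (X - Y) h a = sl X h a - sl Y h a.
Proof. by rewrite /sl -sumrB; apply: eq_bigr => e _; rewrite !mxE mulrBl. Qed.

End Slots.

Lemma act4E phi C a b c d : act4 g phi C (a, b, c, d) =
  sl (endo g phi) (fun e => C (e, b, c, d)) a + sl (endo g phi) (fun e => C (a, e, c, d)) b
  + sl (endo g phi) (fun e => C (a, b, e, d)) c + sl (endo g phi) (fun e => C (a, b, c, e)) d.
Proof. by rewrite ffunE /sl -!big_split. Qed.

Lemma endo_lie phi psi : phi \in so_form K n ->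
  endo g (lie g phi psi) = endo g phi *m endo g psi - endo g psi *m endo g phi.
Proof.
move=> /so_tr ph; have [gT gU _ _] := frameP.
have giT : (invmx g)^T = invmx g by rewrite trmx_inv gT.
rewrite /lie {1}/endo mulmxDl; congr (_ + _); first by rewrite /endo !mulmxA.
by rewrite {1}/endo trmx_mul giT ph /endo !mulmxN !mulNmx !mulmxA.
Qed.

(** Actions in different slots commute, so the commutator keeps only terms within one slot, and
    there [endo_lie] applies. *)
Lemma act4_lie phi psi C : phi \in so_form K n ->
  act4 g (lie g phi psi) C = act4 g phi (act4 g psi C) - act4 g psi (act4 g phi C).
Proof.
move=> ph; apply/ffunP => -[[[a b] c] d]; rewrite [RHS]ffunE [X in _ + X]ffunE.
rewrite !act4E (endo_lie _ ph).
set X := endo g phi; set Y := endo g psi; rewrite !slB.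
have D Z W (x y z t : 'I_n) :
  [/\ sl Z (fun e => act4 g W C (e, y, z, t)) x = sl (Z *m endo g W) (fun e => C (e, y, z, t)) x
       + sl Z (fun e => sl (endo g W) (fun f => C (e, f, z, t)) y) x
       + sl Z (fun e => sl (endo g W) (fun f => C (e, y, f, t)) z) x
       + sl Z (fun e => sl (endo g W) (fun f => C (e, y, z, f)) t) x,
      sl Z (fun e => act4 g W C (x, e, z, t)) y = sl Z (fun e => sl (endo g W) (fun f => C (f, e, z, t)) x) y
       + sl (Z *m endo g W) (fun e => C (x, e, z, t)) y
       + sl Z (fun e => sl (endo g W) (fun f => C (x, e, f, t)) z) y
       + sl Z (fun e => sl (endo g W) (fun f => C (x, e, z, f)) t) y,
      sl Z (fun e => act4 g W C (x, y, e, t)) z = sl Z (fun e => sl (endo g W) (fun f => C (f, y, e, t)) x) z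
       + sl Z (fun e => sl (endo g W) (fun f => C (x, f, e, t)) y) z
       + sl (Z *m endo g W) (fun e => C (x, y, e, t)) z
       + sl Z (fun e => sl (endo g W) (fun f => C (x, y, e, f)) t) z
    & sl Z (fun e => act4 g W C (x, y, z, e)) t = sl Z (fun e => sl (endo g W) (fun f => C (f, y, z, e)) x) t
       + sl Z (fun e => sl (endo g W) (fun f => C (x, f, z, e)) y) t
       + sl Z (fun e => sl (endo g W) (fun f => C (x, y, f, e)) z) t
       + sl (Z *m endo g W) (fun e => C (x, y, z, e)) t].
  by split; rewrite -sl_mul -!slD; apply: eq_bigr => e _; rewrite act4E.
have [-> -> -> ->] := D X psi a b c d; have [-> -> -> ->] := D Y phi a b c d.
rewrite -/X -/Y !(sl_comm Y X); ring.
Qed.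

End Rotations.

(** * Submodules for p and irreducible quotients *)

Section Modules.
Variables (K : numClosedFieldType) (m n N : nat) (g : 'M[K]_n)
  (fr : bool -> 'I_m -> 'rV[K]_n) (gp gm : 'I_n -> 'M[K]_N) (xi : 'rV[K]_N).
Hypotheses (m_gt2 : (2 < m)%N) (n_eq : n = m.*2) (frameP : frame g fr)
  (cliffP : clifford_relations g gp gm).
Local Notation I := 'I_m.
Local Notation P := (bool * I)%type.
Local Notation T := (tensor4 K n).
Local Notation Sv := (Sv fr).
Local Notation cm := (cm fr).
Local Notation Gp := (Gp fr gp).
Hypotheses (xi_e : forall i, xi *m Gp (true, i) = 0) (xi_neq0 : xi != 0).
Implicit Types (p q : P) (r s : I) (A B D F : 'I_N).
Local Notation e_ := (pair true).
Local Notation f_ := (pair false).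
Local Notation EE := (EE fr gp xi).

Local Notation EE_ind := (EE_ind frameP cliffP xi_e xi_neq0).
Local Notation EE_0 := (EE_0 frameP cliffP xi_e xi_neq0).
Local Notation van := (van fr).
Local Notation rk := (rk fr).
Local Notation vanS := (vanS g fr).
Local Notation Pt := (Pt frameP).
Local Notation frm := (frm fr).
Local Notation rot := (rot g fr).
Local Notation act4 := (act4 g).
Variable Vm : {vspace 'rV[K]_n}.
Local Notation Vp := (ker_xi gp xi).
Hypotheses (e_in : forall i, frm (true, i) \in Vp) (f_in : forall i, frm (false, i) \in Vm)
  (nullp : totally_null g Vp) (nullm : totally_null g Vm).
Implicit Types (C : T) (u v : int * nat) (phi psi : 'M[K]_n).
Local Notation g0 := (g_zero g Vp Vm).
Local Notation gpos := (g_pos g Vp).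
Local Notation gneg := (g_neg g Vm).
Local Notation p_ := (p_alg g gp xi).

Lemma frm_in p : frm p \in V_half Vp Vm p.1.
Proof. by case: p => -[] i; [exact: e_in | exact: f_in]. Qed.

Lemma V_null (b : bool) : totally_null g (V_half Vp Vm b).
Proof. by case: b. Qed.

(** A totally null half is orthogonal to its own frame vectors, and these pairings are the
    coordinates on the other half. *)
Lemma V_expand (b : bool) w : w \in V_half Vp Vm b -> exists c, w = \sum_i c i *: frm (b, i).
Proof.
move=> wV; have [_ _ _ cpl] := frameP.
exists (fun i => (w *m g *m (frm (st (b, i)))^T) 0 0).
have S (F : P -> 'rV[K]_n) : \sum_p F p = \sum_i F (b, i) + \sum_i F (~~ b, i).
  rewrite (_ : \sum_p F p = \sum_c \sum_i F (c, i)).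
    by rewrite big_bool; case: b {wV} => //; rewrite addrC.
  by rewrite pair_bigA; apply: eq_bigr => -[].
rewrite {1}(cpl w) S [X in _ + X]big1 ?addr0 // => i _.
by rewrite /st /= negbK (@V_null b w) ?mxE ?scale0r //; exact: (frm_in (b, i)).
Qed.

Lemma rot0_in a b : rot (true, a) (true, b) \in g0.
Proof. by rewrite memvZ // mem_bspan ?f_in ?e_in //; [exact: wedge_linl | exact: wedge_linr]. Qed.
Lemma rotp_in a b : rot (false, a) (true, b) \in gpos.
Proof. by rewrite memvZ // mem_bspan ?f_in ?e_in //; [exact: wedge_linl | exact: wedge_linr]. Qed.
Lemma rotm_in a b : rot (true, a) (false, b) \in gneg.
Proof. by rewrite memvZ // mem_bspan ?f_in ?e_in //; [exact: wedge_linl | exact: wedge_linr]. Qed.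

Lemma g0_sub (X : {vspace 'M[K]_n}) : (forall a b, rot (true, a) (true, b) \in X) -> (g0 <= X)%VS.
Proof. exact: wedge_span (@V_expand false) (@V_expand true). Qed.
Lemma gpos_sub (X : {vspace 'M[K]_n}) : (forall a b, rot (false, a) (true, b) \in X) -> (gpos <= X)%VS.
Proof. exact: wedge_span (@V_expand true) (@V_expand true). Qed.
Lemma gneg_sub (X : {vspace 'M[K]_n}) : (forall a b, rot (true, a) (false, b) \in X) -> (gneg <= X)%VS.
Proof. exact: wedge_span (@V_expand false) (@V_expand false). Qed.

(** By [contr1] and the independence of the [eta]; thus membership in p leaves only the components
    of types g_0 and g_1. *)
Lemma form_on_xiE phi : form_on_xi g gp xi phi = 0 <-> forall i j, fm fr phi (e_ i) (e_ j) = 0.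
Proof.
have E A B : form_on_xi g gp xi phi A B = EE A B (fun i j => fm fr phi (e_ i) (e_ j)).
  transitivity (L1 g gp xi A (fun a => L1 g gp xi B (phi a))).
    rewrite /form_on_xi -mulmxA [LHS]mxE; apply: eq_bigr => a _; rewrite [X in X * _]mxE; congr (_ * _).
    by rewrite [LHS]mxE; apply: eq_bigr => b _; rewrite mulrC.
  rewrite (L1E frameP xi_e); apply: eq_bigr => i _.
  rewrite Sv_L1 (L1E frameP xi_e) mulr_sumr; apply: eq_bigr => j _.
  by rewrite mulrA /fm SvC.
split=> [h|h].
  by apply: (proj1 (EE_ind _)) => A B; rewrite -E h mxE.
by apply/matrixP => A B; rewrite E mxE; apply: EE_0.
Qed.

Lemma p_sub : (p_ <= g0 + gpos)%VS.
Proof.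
apply/subvP => phi; rewrite memv_cap => /andP [ps]; rewrite memv_ker lfunE => /eqP h0.
have h := proj1 (form_on_xiE phi) h0.
rewrite (so_form_expand frameP ps); apply: memv_suml => -[s i] _; apply: memv_suml => -[t j] _.
case: s t => -[] //.
- by rewrite h mul0r scale0r mem0v.
- by apply: memvZ; exact: (subvP (addvSl _ _) _ (rot0_in i j)).
- by apply: memvZ; rewrite rotC /st /= memvN; exact: (subvP (addvSl _ _) _ (rot0_in j i)).
- by apply: memvZ; exact: (subvP (addvSr _ _) _ (rotp_in i j)).
Qed.

Lemma zero_p : (g0 <= p_)%VS.
Proof.
apply: g0_sub => a b; rewrite memv_cap rot_so memv_ker lfunE /=.
apply/eqP/form_on_xiE => i j; rewrite (fm_rot frameP) /st /= !dpE /=; ring.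
Qed.

Lemma stable_zero (X : {vspace T}) : stable g g0 X <-> Ninvar g fr X.
Proof.
split=> [/stableE h [a b] C CX|h]; first by apply: h => //; exact: rot0_in.
by apply/stable_stab; apply: g0_sub => a b; apply/stabP => C CX; exact: (h (a, b)).
Qed.

Lemma stable_p (X : {vspace T}) : Ninvar g fr X ->
  (forall a b C, C \in X -> act4 (rot (f_ a) (e_ b)) C \in X) -> stable g p_ X.
Proof.
move=> h0 hp; apply/stable_stab; apply: subv_trans p_sub _; rewrite subv_add.
apply/andP; split; first exact/stable_stab/stable_zero.
by apply: gpos_sub => a b; apply/stabP => C CX; exact: hp.
Qed.

Lemma stable_pN (X : {vspace T}) : stable g p_ X -> Ninvar g fr X.
Proof.
by move=> /stable_stab h; apply/stable_zero/stable_stab; exact: subv_trans zero_p h.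
Qed.

Lemma deg_lev (k : int) : k \in degs -> Posz (deg_of (lev k).1 (lev k).2) = k + 2.
Proof. by move: k; apply: degs_ind. Qed.

Lemma okb_lev (k : int) : k \in degs -> okb (lev k).1 (lev k).2.
Proof. by move: k; apply: degs_ind. Qed.

Lemma lab_degs u : u \in labels -> u.1 \in degs.
Proof. by move: u; apply: labelsP. Qed.

Lemma lev_surj Q b : okb Q b -> exists2 k, k \in degs & lev k = (Q, b).
Proof.
case: Q => [|[|[|Q]]]; case: b => // _; [exists 0 | exists (Negz 0) | exists (Posz 1)
 | exists (Negz 1) | exists (Posz 2)]; by [].
Qed.

Lemma rk_eq0 (k : int) C : k \in degs -> C \in weyl g ->
  rk k C = 0 <-> forall p q (r s : P), Posz (deg p q r s) = k + 2 -> cm C p q r s = 0.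
Proof.
move=> kd CW; rewrite /rk (weyl_grade_eq0 frameP CW (okb_lev kd)) -(deg_lev kd).
by split=> h p q r s; [move=> [] | move=> e]; apply: h => //; rewrite e.
Qed.

Lemma rk_van (k : int) C : k \in degs -> C \in weyl g ->
  rk k C = 0 <-> forall u, u \in labels -> u.1 = k -> van u C.
Proof.
move=> kd CW; split=> [h u _ uk|h]; first by rewrite /van uk h pr_0.
have := pr_sum (rdC_lvl frameP (lev k).1 (lev k).2 CW); rewrite -/(rk k C) => ->.
rewrite big1_seq // => s /andP [_ si]; apply: (h (k, s)) => //.
have : all (fun s : nat => (k, s) \in labels) (inds (lev k).1).
  by move: k kd {h si}; apply: degs_ind.
by move=> /allP; apply.
Qed.

Lemma rop0 p q (h : P -> K) x : (x = p -> h q = 0) -> (x = st q -> h (st p) = 0) ->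
  rop p q h x = 0.
Proof.
rewrite /rop /dp; case: eqP => [-> /(_ erefl) ->|_ _]; case: eqP => [-> /(_ erefl) ->|_ _];
  by rewrite ?mulr0 ?mul0r subrr.
Qed.

(** A component of the image is built from components of the tensor with one f-argument replaced by
    an e-argument: g_1 raises the degree by exactly 1. *)
Lemma gpos_rk a b (k : int) C : k \in degs -> C \in weyl g ->
  (forall p q (r s : P), Posz (deg p q r s).+1 = k + 2 -> cm C p q r s = 0) ->
  rk k (act4 (rot (f_ a) (e_ b)) C) = 0.
Proof.
move=> kd CW h; apply/(rk_eq0 kd); first exact: weyl_rot.
move=> p q r s e; rewrite (cm_rot frameP) !rop0 ?addr0 // => E; apply: h; rewrite -e;
  by rewrite E /deg /st /=; congr Posz; rewrite ?add0n ?add1n ?addSn ?addnS.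
Qed.

Lemma Pt_cm u C p q (r s : P) : u \in labels -> C \in Pt u -> Posz (deg p q r s) != u.1 + 2 ->
  cm C p q r s = 0.
Proof.
move=> ul /(mem_part frameP _ _ (lab_ok ul)) [_ _ ->] ne; rewrite (cm_mk frameP).
apply: emb_deg; first exact: lab_le2.
by apply: contraNneq ne => ->; rewrite -(deg_lev (lab_degs ul)).
Qed.

Lemma gpos_Pt a b u C : u \in labels -> C \in Pt u ->
  act4 (rot (f_ a) (e_ b)) C \in vanS (fun v => v.1 != u.1 + 1).
Proof.
move=> ul CP; have CW := Pt_weyl ul CP; have W := weyl_rot frameP (f_ a) (e_ b) CW.
apply/vanSP; split=> // v vl ne; have kd := lab_degs vl.
apply: (proj1 (rk_van kd W)) => //; apply: gpos_rk => // p q r s e; apply: (Pt_cm ul CP).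
apply: contraNneq ne => e'; apply/eqP; move: e e'; clear; lia.
Qed.

Lemma Pt_Ninvar u : u \in labels -> Ninvar g fr (Pt u).
Proof. by move=> /lab_ok o; exact: part_invar. Qed.

Lemma vanS_p S : (forall u v, u \in labels -> v \in labels -> ~~ S u -> v.1 = u.1 + 1 -> ~~ S v) ->
  stable g p_ (vanS S).
Proof.
move=> up; apply: stable_p => [[a b] C CS|a b C CS].
  have [CW _] := proj1 (vanSP g fr S C) CS.
  rewrite (vanS_sum m_gt2 frameP CS) /Oab linear_sum big_seq_cond.
  apply: memv_suml => u /andP [ul Su].
  apply: (subvP (@Pt_vanS _ _ _ _ _ m_gt2 frameP _ _ ul Su)).
  exact: (Pt_Ninvar ul (a, b) (cmp_mem m_gt2 frameP ul CW)).
have [CW _] := proj1 (vanSP g fr S C) CS.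
rewrite (vanS_sum m_gt2 frameP CS) linear_sum big_seq_cond; apply: memv_suml => u /andP [ul Su].
have /subvP h : (vanS (fun v => v.1 != (u.1 + 1)%R) <= vanS S)%VS.
  by apply: vanS_sub => v vl Sv; apply/eqP => e; case/negP: (up u v ul vl Su e).
by apply: h; exact: (gpos_Pt a b ul (cmp_mem m_gt2 frameP ul CW)).
Qed.

(** Chosen so that [vanS (below u)] is the [weyl_component] labelled [u]. *)
Definition below u : pred (int * nat) := fun v => (v.1 < u.1) || (v.1 == u.1) && (v.2 != u.2).

Lemma below_ne u v : ~~ below u v -> v = u \/ u.1 < v.1.
Proof.
rewrite /below negb_or negb_and negbK -leNgt le_eqVlt => /andP [/orP [/eqP e|]]; last by right.
by rewrite e eqxx /= => /eqP e2; left; rewrite [v]surjective_pairing -e e2 -surjective_pairing.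
Qed.

Lemma below_self u : ~~ below u u. Proof. by rewrite /below ltxx !eqxx. Qed.

(** Modulo the smaller term only the piece [Pt u] remains, so an intermediate module is governed by
    its intersection with this piece, which is invariant inside a simple g_0-module. *)
Lemma vanS_quo_irreducible u : u \in labels -> Pt u <> 0%VS ->
  quo_irreducible g p_ (vanS (below u)) (vanS (fun v => (v.1 < u.1 + 1)%R)).
Proof.
move=> ul P0.
have sub : (vanS (fun v => (v.1 < u.1 + 1)%R) <= vanS (below u))%VS.
  by apply: vanS_sub => v _ /orP [|/andP [/eqP ->]]; clear; lia.
split=> //.
- apply: vanS_p => v w vl wl /below_ne [->|lt] e; rewrite /below e negb_or negb_and.
    by apply/andP; split; [|apply/orP; left]; clear; lia.
  by apply/andP; split; [|apply/orP; left]; move: lt; clear; lia.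
- by apply: vanS_p => v w vl wl; rewrite -!leNgt => le ->; move: le; clear; lia.
- move=> e; apply: P0; apply: vs0P => C CP.
  have : C \in vanS (fun v => (v.1 < u.1 + 1)%R).
    by rewrite e; exact: (subvP (@Pt_vanS _ _ _ _ _ m_gt2 frameP _ _ ul (below_self u)) _ CP).
  move=> /vanSP [_ h]; rewrite memv0; apply/eqP; apply: (Pt_van0 m_gt2 ul CP).
  by apply: h => //; clear; lia.
move=> X /stable_pN NX WX XU.
have CX C : C \in X -> exists2 D, D \in vanS (fun v => (v.1 < u.1 + 1)%R) & C = cmp g fr u C + D.
  move=> CX; have CU := subvP XU _ CX; have [CW _] := proj1 (vanSP g fr _ C) CU.
  exists (C - cmp g fr u C); last by rewrite addrC subrK.
  rewrite [X in X - _](vanS_sum m_gt2 frameP CU) (big_rem u ul) below_self addrAC subrr add0r.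
  rewrite big_seq_cond; apply: memv_suml => v /andP [vr bv].
  have vl : v \in labels := mem_rem vr.
  have W1 := cmp_mem m_gt2 frameP vl CW.
  apply: (fun S nS => subvP (@Pt_vanS _ _ _ _ _ m_gt2 frameP v S vl nS) _ W1).
  have : v != u by move: vr; rewrite mem_rem_uniq // inE => /andP [].
  by case: (below_ne bv) => [->|lt _]; [rewrite eqxx | move: lt; clear; lia].
have iY : invar (Oab g fr) (X :&: Pt u)%VS by apply: invar_cap => //; exact: Pt_Ninvar.
have [Y0|Y1] := part_simple m_gt2 (frameP := frameP) (lab_ok ul) (lab_valid ul) (capvSr X (Pt u)) iY.
  left; apply/eqP; rewrite eqEsubv WX andbT; apply/subvP => C CXX.
  have [D DW e] := CX C CXX.
  have CW : C \in weyl g by exact: subvP (vanS_weyl g fr _) _ (subvP XU _ CXX).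
  have : cmp g fr u C \in (X :&: Pt u)%VS.
    rewrite memv_cap (cmp_mem m_gt2 frameP ul CW) andbT.
    have -> : cmp g fr u C = C - D by rewrite [X in X - _]e addrK.
    by rewrite rpredB //; exact: (subvP WX).
  by rewrite Y0 memv0 => /eqP e0; rewrite e e0 add0r.
right; apply/eqP; rewrite eqEsubv XU; apply: (@vanS_subP _ _ _ _ _ m_gt2 frameP) => v vl bv.
have [->|lt] := below_ne bv.
  by rewrite -[X in (X <= _)%VS]Y1 capvSl.
apply: subv_trans (@Pt_vanS _ _ _ _ _ m_gt2 frameP v _ vl _) WX; move: lt; clear; lia.
Qed.

End Modules.

(** * The pieces as g_0-modules and their uniqueness *)

Section Modules.
Variables (K : numClosedFieldType) (m n N : nat) (g : 'M[K]_n)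
  (fr : bool -> 'I_m -> 'rV[K]_n) (gp gm : 'I_n -> 'M[K]_N) (xi : 'rV[K]_N).
Hypotheses (m_gt2 : (2 < m)%N) (n_eq : n = m.*2) (frameP : frame g fr)
  (cliffP : clifford_relations g gp gm).
Local Notation I := 'I_m.
Local Notation P := (bool * I)%type.
Local Notation T := (tensor4 K n).
Local Notation Sv := (Sv fr).
Local Notation cm := (cm fr).
Local Notation Gp := (Gp fr gp).
Hypotheses (xi_e : forall i, xi *m Gp (true, i) = 0) (xi_neq0 : xi != 0).
Implicit Types (p q : P) (r s : I) (A B D F : 'I_N).

Local Notation van := (van fr).
Local Notation rk := (rk fr).
Local Notation vanS := (vanS g fr).
Local Notation Pt := (Pt frameP).
Local Notation frm := (frm fr).
Local Notation act4 := (act4 g).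
Variable Vm : {vspace 'rV[K]_n}.
Local Notation Vp := (ker_xi gp xi).
Hypotheses (e_in : forall i, frm (true, i) \in Vp) (f_in : forall i, frm (false, i) \in Vm)
  (nullp : totally_null g Vp) (nullm : totally_null g Vm).
Implicit Types (C : T) (u v : int * nat) (phi psi : 'M[K]_n).
Local Notation g0 := (g_zero g Vp Vm).

Lemma Pt_act u phi C : u \in labels -> phi \in g0 -> C \in Pt u -> act4 phi C \in Pt u.
Proof.
move=> ul pg CP; have h : Ninvar g fr (Pt u) := Pt_Ninvar ul.
by move/(stable_zero frameP e_in f_in nullp nullm)/stableE: h; apply.
Qed.

Lemma cmp_other u v C : u \in labels -> v \in labels -> C \in Pt v ->
  cmp g fr u C = if u == v then C else 0.
Proof.
move=> ul vl CP; have CW := Pt_weyl vl CP; case: eqVneq => [->|ne]; first exact: Pt_fix.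
by apply/(van_cmp m_gt2 frameP ul CW); exact: Pt_van CP.
Qed.

Definition cmpL u : 'End(T) := lin_of (cmp_lin (fr := fr) frameP u).

Lemma cmp_bigsum u (s : seq (int * nat)) (F : int * nat -> T) :
  cmp g fr u (\sum_(i <- s) F i) = \sum_(i <- s) cmp g fr u (F i).
Proof.
rewrite -(lin_ofE (cmp_lin (fr := fr) frameP u)) linear_sum.
by apply: eq_bigr => i _; exact: lin_ofE.
Qed.

Lemma cmp_act u phi C : u \in labels -> phi \in g0 -> C \in weyl g ->
  cmp g fr u (act4 phi C) = act4 phi (cmp g fr u C).
Proof.
move=> ul pg CW; rewrite {1}(cmp_sum frameP CW).
rewrite linear_sum cmp_bigsum (big_rem u ul).
have E v : v \in labels -> cmp g fr u (act4 phi (cmp g fr v C))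
    = if u == v then act4 phi (cmp g fr v C) else 0.
  by move=> vl; apply: cmp_other => //; apply: Pt_act => //; exact: cmp_mem.
rewrite E // eqxx big_seq big1 => [|v vr]; first exact: addr0.
rewrite E ?(mem_rem vr) //.
by move: vr; rewrite mem_rem_uniq // inE eq_sym => /andP [/negbTE ->].
Qed.

Lemma above_below u : u \in labels ->
  (vanS (fun v => (v.1 < u.1 + 1)%R) <= vanS (below u))%VS.
Proof. by move=> ul; apply: vanS_sub => v _ /orP [|/andP [/eqP ->]]; clear; lia. Qed.

Lemma cmp_img u : u \in labels -> (cmpL u @: vanS (below u))%VS = Pt u.
Proof.
move=> ul; apply/eqP; rewrite eqEsubv; apply/andP; split; apply/subvP => C.
  case/memv_imgP => D DU ->; rewrite lin_ofE; apply: cmp_mem => //.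
  exact: (subvP (vanS_weyl g fr _) _ DU).
move=> CP; apply/memv_imgP; exists C; last by rewrite lin_ofE Pt_fix.
exact: (subvP (@Pt_vanS _ _ _ _ _ m_gt2 frameP _ _ ul (below_self u))).
Qed.

Lemma cmp_ker u : u \in labels ->
  (vanS (below u) :&: lker (cmpL u))%VS = vanS (fun v => (v.1 < u.1 + 1)%R).
Proof.
move=> ul; apply/vspace_eqP => C; rewrite memv_cap memv_ker lin_ofE; split.
  case/andP => /vanSP [CW h] /eqP c0; apply/vanSP; split=> // v vl lt.
  have [b|b] := boolP (below u v); first exact: h.
  case: (below_ne b) => [->|gt]; first exact/(van_cmp m_gt2 frameP ul CW).
  by move: lt gt; clear; lia.
move=> CS; apply/andP; split; first exact: (subvP (above_below ul)).
have [CW h] := proj1 (vanSP g fr _ C) CS; apply/eqP/(van_cmp m_gt2 frameP ul CW); apply: h => //.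
by clear; lia.
Qed.

Lemma dim_quo u : u \in labels -> \dim (vanS (below u))
  = (\dim (vanS (fun v => (v.1 < u.1 + 1)%R)) + \dim (Pt u))%N.
Proof. by move=> ul; rewrite -(limg_ker_dim (cmpL u)) cmp_img // cmp_ker. Qed.

Lemma quo_iso_Pt u : u \in labels ->
  quo_isomorphic g g0 (vanS (below u)) (vanS (fun v => (v.1 < u.1 + 1)%R)) (Pt u).
Proof.
move=> ul; exists (cmpL u); split; [exact: cmp_img | exact: cmp_ker | move=> phi C pg CU].
by rewrite !lin_ofE cmp_act //; exact: (subvP (vanS_weyl g fr _) _ CU).
Qed.

Lemma irred_Pt u : u \in labels -> Pt u <> 0%VS -> irreducible g g0 (Pt u).
Proof.
move=> ul P0; split=> //; first exact: sub0v.
- by apply/(stable_zero frameP e_in f_in nullp nullm); exact: Pt_Ninvar.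
- by move=> phi pg; rewrite limg0 sub0v.
- by move=> e; apply: P0.
move=> X /(stable_zero frameP e_in f_in nullp nullm) iX _ XP.
exact: (part_simple m_gt2 (lab_ok ul) (lab_valid ul) XP iX).
Qed.

Lemma dimPt u : u \in labels -> \dim (Pt u) = \dim (vsof (@mods K m (levQ u) u.2)).
Proof. by move=> /lab_ok o; exact: dim_part. Qed.

(** Among the labels only (0, 2) has second entry 2, so only this one is excluded, for m = 3. *)
Definition present u := (u.2 == 2)%N ==> (m != 3)%N.

Lemma Pt_dims u : u \in labels -> (match u.1, u.2 with
  | Posz 2, _ | Negz 1, _ => 12 * \dim (Pt u) + m ^ 2 = m ^ 4
  | Posz 1, 0 | Negz 0, 0 => 2 * \dim (Pt u) + m = m ^ 2
  | Posz 1, _ | Negz 0, _ => 3 * \dim (Pt u) + 4 * m ^ 2 = m ^ 4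
  | _, 0 => \dim (Pt u) = 1
  | _, 1 => \dim (Pt u) + 1 = m ^ 2
  | _, 2 => 4 * \dim (Pt u) + 2 * m ^ 3 + 3 * m ^ 2 = m ^ 4
  | _, _ => 4 * \dim (Pt u) + 3 * m ^ 2 = m ^ 4 + 2 * m ^ 3
  end)%N.
Proof.
move=> ul; rewrite (dimPt ul); move: u ul; apply: labelsP; rewrite /levQ /=;
 first [exact: dim_curv | exact: dim_lam | exact: dim_hook | exact: dim_triv0 | exact: dim_sl0
       | exact: dim_alt0 | exact: dim_sym0].
Qed.

Lemma Pt_neq0 u : u \in labels -> present u -> Pt u <> 0%VS.
Proof.
move=> ul pu e; have := Pt_dims ul; rewrite e dimv0; move: pu m_gt2; clear -ul.
have sq (a : nat) : (a ^ 2 = a * a)%N by rewrite expnS expn1.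
have cu (a : nat) : (a ^ 3 = a * a * a)%N by rewrite !expnS expn0 muln1 mulnA.
have qu (a : nat) : (a ^ 4 = a * a * a * a)%N by rewrite !expnS expn0 muln1 !mulnA.
by move: u ul; apply: labelsP; rewrite /present /= ?sq ?cu ?qu; nia.
Qed.

(** The dimension formulas of two different modules of one degree are incompatible for m > 2;
    comparing dimensions replaces a comparison of highest weights. *)
Lemma dim_Pt_inj u v : u \in labels -> v \in labels -> present u -> present v -> u.1 = v.1 ->
  \dim (Pt u) = \dim (Pt v) -> u = v.
Proof.
move=> ul vl pu pv e1 ed; have := Pt_dims vl; rewrite -ed; have := Pt_dims ul.
move: (\dim (Pt u)) => d; move: pu pv e1 m_gt2; clear -ul vl.
have sq (a : nat) : (a ^ 2 = a * a)%N by rewrite expnS expn1.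
have cu (a : nat) : (a ^ 3 = a * a * a)%N by rewrite !expnS expn0 muln1 mulnA.
have qu (a : nat) : (a ^ 4 = a * a * a * a)%N by rewrite !expnS expn0 muln1 !mulnA.
move: v vl; apply: labelsP; move: u ul; apply: labelsP;
 rewrite /present /= ?sq ?cu ?qu //; nia.
Qed.

(* Tensors of degree k, read off their components.                                *)
Definition homog (k : int) : {vspace T} :=
  vsof (fun C => forall p q (r s : P), Posz (deg p q r s) != k + 2 -> cm C p q r s = 0).

Lemma homogP k C : C \in homog k <->
  forall p q (r s : P), Posz (deg p q r s) != k + 2 -> cm C p q r s = 0.
Proof.
apply: vsofP; split=> [*|x D E hD hE p q r s ne]; first exact: cm0.
by rewrite cm_lin hD // hE // mulr0 addr0.
Qed.

Lemma cm_tens phi psi p q (r s : P) :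
  cm (tens_form phi psi) p q r s = fm fr phi p q * fm fr psi r s.
Proof.
transitivity (Sv p (fun a => Sv q (fun b => fm fr psi r s * phi a b))).
  apply: eq_Sv => a; apply: eq_Sv => b; transitivity (Sv r (fun c => phi a b * Sv s (psi c))).
    by apply: eq_Sv => c; rewrite -SvZ; apply: eq_Sv => d; rewrite ffunE.
  by rewrite SvZ mulrC.
transitivity (Sv p (fun a => fm fr psi r s * Sv q (phi a))); last by rewrite SvZ mulrC.
by apply: eq_Sv => a; rewrite SvZ.
Qed.

Lemma tens_vecE (u v : 'rV[K]_n) a b : tens_vec g u v a b = (u *m g) 0 a * (v *m g) 0 b.
Proof. by rewrite /tens_vec mxE big_ord1 [X in X * _]mxE. Qed.

Lemma fm_tens (u v : 'rV[K]_n) p q :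
  fm fr (tens_vec g u v) p q = (u *m g *m (frm p)^T) 0 0 * (v *m g *m (frm q)^T) 0 0.
Proof.
have E (w : 'rV[K]_n) x : (w *m g *m (frm x)^T) 0 0 = Sv x (fun a => (w *m g) 0 a).
  by rewrite [LHS]mxE; apply: eq_bigr => a _; rewrite [X in _ * X]mxE mulrC.
rewrite /fm !E; transitivity (Sv p (fun a => Sv q (fun b => (v *m g) 0 b) * (u *m g) 0 a)).
  by apply: eq_Sv => a; rewrite mulrC -SvZ; apply: eq_Sv => b; rewrite tens_vecE.
by rewrite SvZ mulrC.
Qed.

Lemma tens_form_linl psi : linear (fun phi => tens_form phi psi).
Proof.
move=> k x y; apply/ffunP => -[[[a b] c] d]; rewrite !ffunE [X in X * _]mxE [X in X + _]mxE.
by rewrite mulrDl -mulrA.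
Qed.

Lemma tens_form_linr phi : linear (tens_form phi : 'M[K]_n -> T).
Proof.
move=> k x y; apply/ffunP => -[[[a b] c] d]; rewrite !ffunE [X in _ * X]mxE [X in _ * (X + _)]mxE.
by rewrite mulrDr mulrCA.
Qed.

(** Contains u_a v_b for u and v in the halves [s] and [t]: by nullity such a form vanishes on a
    frame vector of the same half. *)
Definition half_forms (s t : bool) : {vspace 'M[K]_n} :=
  vsof (fun phi => forall p q, (p.1 == s) || (q.1 == t) -> fm fr phi p q = 0).

Lemma half_formsP (s t : bool) phi : phi \in half_forms s t <->
  forall p q, (p.1 == s) || (q.1 == t) -> fm fr phi p q = 0.
Proof.
apply: vsofP; split=> [p q _|x D E hD hE p q st_].
  by rewrite /fm /Sv big1 // => a _; rewrite big1 ?mulr0 // => b _; rewrite mxE mulr0.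
transitivity (x * fm fr D p q + fm fr E p q); last by rewrite hD // hE // mulr0 addr0.
rewrite /fm -SvZ -SvD; apply: eq_Sv => a; rewrite -SvZ -SvD; apply: eq_Sv => b.
by rewrite !mxE.
Qed.

Lemma tens_vec_half (s t : bool) : (bspan (tens_vec g) (V_half Vp Vm s) (V_half Vp Vm t) <= half_forms s t)%VS.
Proof.
apply/(bspan_subP _ _ _ (tens_vec_linl g) (tens_vec_linr g)) => u v us vt.
apply/half_formsP => p q; rewrite fm_tens => /orP [] /eqP e.
  have fp : frm p \in V_half Vp Vm s by rewrite -e; exact: frm_in.
  have -> : u *m g *m (frm p)^T = 0 by apply: (V_null nullp nullm); [exact: us | exact: fp].
  by rewrite mxE mul0r.
have fq : frm q \in V_half Vp Vm t by rewrite -e; exact: frm_in.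
have -> : v *m g *m (frm q)^T = 0 by apply: (V_null nullp nullm); [exact: vt | exact: fq].
by rewrite [X in _ * X]mxE mulr0.
Qed.

Lemma homog_weyl k : k \in degs -> (weyl g :&: homog k)%VS = vanS (fun v => v.1 != k).
Proof.
move=> kd; apply/vspace_eqP => C; rewrite memv_cap; split.
  case/andP => CW /homogP h; apply/vanSP; split=> // v vl ne.
  apply: (proj1 (rk_van frameP (lab_degs vl) CW)) => //.
  apply/(rk_eq0 frameP (lab_degs vl) CW) => p q r s e; apply: h; rewrite e.
  by apply: contraNneq ne => e'; apply/eqP; move: e'; clear; lia.
move=> CS; have [CW _] := proj1 (vanSP g fr _ C) CS; rewrite CW.
rewrite (vanS_sum m_gt2 frameP CS) big_seq_cond; apply: memv_suml => u /andP [ul /negbNE /eqP uk].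
apply/homogP => p q r s ne; apply: (Pt_cm (frameP := frameP) ul); last by rewrite uk.
exact: cmp_mem.
Qed.

Lemma tens_expand C : C = \sum_(x : P * P * P * P)
  let: (p, q, r, s) := x in cm C p q r s *: tens_form
    (tens_vec g (frm (st p)) (frm (st q))) (tens_vec g (frm (st r)) (frm (st s))).
Proof.
apply/(cmP frameP) => p q r s; rewrite (cm_sum fr).
have E x y z t : cm (let: (p, q, r, s) := (x, y, z, t) in cm C p q r s *: tens_form
    (tens_vec g (frm (st p)) (frm (st q))) (tens_vec g (frm (st r)) (frm (st s)))) p q r s
    = cm C x y z t * (dp K x p * dp K y q * (dp K z r * dp K t s)).
  have [_ _ d _] := frameP.
  by rewrite cmZ cm_tens !fm_tens !d !dp_st !stK.
rewrite (bigD1 (p, q, r, s)) // E !dpp !mulr1 big1 => [|[[[x y] z] t]]; rewrite ?E.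
  by rewrite /= addr0.
have [->|n1] := eqVneq x p; last by rewrite /dp (negbTE n1) !mul0r mulr0.
have [->|n2] := eqVneq y q; last by rewrite /dp (negbTE n2) mulr0 mul0r mulr0.
have [->|n3] := eqVneq z r; last by rewrite /dp (negbTE n3) mul0r !mulr0.
have [->|n4] := eqVneq t s; last by rewrite /dp (negbTE n4) !mulr0.
by rewrite eqxx.
Qed.

(** A slot filled by a vector of V_{1/2} is visible only to f-arguments, so the degree of a tensor
    product is the number of f-arguments minus 2. *)
Lemma weyl_gradedE k : k \in degs -> weyl_graded g Vp Vm k = vanS (fun v => v.1 != k).
Proof.
move=> kd; rewrite -homog_weyl // /weyl_graded; congr (_ :&: _)%VS.
apply/eqP; rewrite eqEsubv; apply/andP; split.
  apply/subv_sumP => -[[[s1 s2] s3] s4] /eqP e.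
  apply/(bspan_subP _ _ _ tens_form_linl tens_form_linr) => phi psi.
  move=> /(subvP (tens_vec_half s1 s2)) /half_formsP h1.
  move=> /(subvP (tens_vec_half s3 s4)) /half_formsP h2.
  apply/homogP => p q r s ne; rewrite cm_tens.
  have [/h1 -> |n1] := boolP ((p.1 == s1) || (q.1 == s2)); first by rewrite mul0r.
  have [/h2 -> |n2] := boolP ((r.1 == s3) || (s.1 == s4)); first by rewrite mulr0.
  case/negP: ne; apply/eqP; rewrite /deg; move: n1 n2 e; clear.
  by case: p.1; case: q.1; case: r.1; case: s.1; case: s1; case: s2; case: s3; case: s4 => //= _ _ <-.
apply/subvP => C /homogP h; rewrite (tens_expand C); apply: memv_suml => -[[[p q] r] s] _.
have [e|ne] := eqVneq (Posz (deg p q r s)) (k + 2); last by rewrite h // scale0r mem0v.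
apply: memvZ; apply: (subvP (sumv_sup ((st p).1, (st q).1, (st r).1, (st s).1) _ _)).
- by rewrite /= /deg in e *; rewrite e addrK.
- exact: subvv.
by rewrite !mem_bspan ?frm_in //; [exact: tens_form_linl | exact: tens_form_linr | | | |];
 first [exact: tens_vec_linl | exact: tens_vec_linr].
Qed.

Lemma lab_dich u (X : {vspace T}) : u \in labels -> Ninvar g fr X ->
  (X <= vanS (fun v => v.1 != u.1))%VS -> (Pt u <= X)%VS \/ forall C, C \in X -> van u C.
Proof.
move=> ul iX XS.
have XE (D : T) : D \in X -> D = mk g fr (levQ u) (levb u) (rdC fr (levQ u) (levb u) D).
  move=> DX; have DS := subvP XS _ DX; have [DW hD] := proj1 (vanSP g fr _ D) DS.
  have lD := rdC_lvl frameP (levQ u) (levb u) DW.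
  apply: (weyl_ext frameP DW (mk_weyl frameP (levb u) lD)) => Q b o.
  have [e|ne] := eqVneq (levQ u, levb u) (Q, b).
    by case: e => <- <-; rewrite rdC_mk ?lab_le2.
  rewrite (rdC_mk0 frameP _ (lab_ok ul) o ne); have [k kd ek] := lev_surj o.
  have nk : k != u.1 by apply: contraNneq ne => e; rewrite /levQ /levb -e ek.
  have := proj2 (rk_van frameP kd DW); rewrite /rk ek; apply=> w wl wk.
  by apply: hD => //; rewrite wk.
have [h|h] := part_dichotomy m_gt2 frameP (lab_ok ul) (lab_valid ul) iX
  (subv_trans XS (vanS_weyl g fr _)) XE; [by left | right => C CX].
exact: h.
Qed.

(** By the dichotomy a simple submodule of one degree is some piece [Pt v]; the isomorphism gives it
    the dimension of [Pt u], and dimensions determine the label. *)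
Lemma breve_Pt u : u \in labels -> present u -> forall X,
  ([/\ (X <= weyl_graded g Vp Vm u.1)%VS, irreducible g g0 X
    & quo_isomorphic g g0 (vanS (below u)) (vanS (fun v => (v.1 < u.1 + 1)%R)) X]) <-> X = Pt u.
Proof.
move=> ul pu X; rewrite weyl_gradedE ?lab_degs //; split=> [[XS [_ iX _ X0 Xs] [f [fU fk _]]]|->].
  have iX' := proj1 (stable_zero frameP e_in f_in nullp nullm X) iX.
  have dX : \dim X = \dim (Pt u).
    by apply/eqP; rewrite -(eqn_add2l (\dim (vanS (fun v => (v.1 < u.1 + 1)%R)))) -dim_quo // -fk -fU limg_ker_dim.
  have [C CX C0] : exists2 C, C \in X & C != 0.
    by exists (vpick X); rewrite ?memv_pick // vpick0; apply/eqP => e; apply: X0.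
  have CS := subvP XS _ CX; have [CW _] := proj1 (vanSP g fr _ C) CS.
  have [v vl [v1 cv]] : exists2 v, v \in labels & v.1 = u.1 /\ cmp g fr v C != 0.
    have /hasP [v vl /andP [/eqP e ne]] : has (fun v => (v.1 == u.1) && (cmp g fr v C != 0)) labels.
      apply/hasPn => h; case/negP: C0; apply/eqP; rewrite (vanS_sum m_gt2 frameP CS).
      rewrite big1_seq // => v /andP [/negbNE e vl]; have := h v vl; rewrite e /= negbK.
      by move/eqP.
    by exists v.
  have XS' : (X <= vanS (fun x => x.1 != v.1))%VS by rewrite v1.
  have [PX|N0] := lab_dich vl iX' XS'; last first.
    by case/negP: cv; apply/eqP/(van_cmp m_gt2 frameP vl CW); exact: N0.
  have Pv0 : Pt v <> 0%VS.
    move=> e; case/negP: cv; have := cmp_mem m_gt2 frameP vl CW.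
    by rewrite e memv0.
  have PvX : Pt v = X.
    have iP : stable g g0 (Pt v).
      by apply/(stable_zero frameP e_in f_in nullp nullm); exact: Pt_Ninvar.
    by case: (Xs _ iP (sub0v _) PX).
  have pv : present v.
    apply/implyP => /eqP v2; apply/eqP => m3; apply: Pv0.
    have ev : v = (Posz 0, 2%N) by move: vl v2; clear; move: v; apply: labelsP.
    by rewrite ev; exact: Pt_three.
  by rewrite -PvX; congr (Pt _); apply: dim_Pt_inj => //; rewrite PvX.
split; last exact: quo_iso_Pt.
  by apply: Pt_vanS => //; rewrite eqxx.
exact: irred_Pt (Pt_neq0 ul pu).
Qed.

End Modules.

(** * The action of g_1 between neighbouring degrees *)

Section Raising.
Variables (K : numClosedFieldType) (m : nat).
Local Notation I := 'I_m.
Local Notation A := (tensor4 K m).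
Local Notation M := (m%:R : K).
Local Notation dl := (dl K).
Hypothesis m_gt2 : (2 < m)%N.
Implicit Types (F G : A) (a b i j k l : I).

Let hM : M != 0. Proof. by rewrite pnatr_eq0; case: m m_gt2. Qed.
Let hM1 : M + 1 != 0. Proof. by rewrite natr1 pnatr_eq0. Qed.
Let hM2 : M - 2 != 0.
Proof. by rewrite -natrB ?pnatr_eq0 ?subn_eq0 -?ltnNge // ltnW. Qed.
Let hMp2 : M + 2 != 0. Proof. by rewrite -natrD pnatr_eq0 addn2. Qed.
Let hMm1 : M - 1 != 0.
Proof. by rewrite -[1]/(1%:R) -natrB ?pnatr_eq0 ?subn_eq0 -?ltnNge; [ | exact: ltnW (ltnW m_gt2) .. ]; exact: ltnW m_gt2. Qed.

(* The action of f_a /\ e_b of V_{1/2} /\ V_{1/2} from degree [k - 1] to degree [k]. *)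
Definition raise (k : int) a b F : A := match k with
  | Negz 0 => mkA (fun i j k l => dl l a * ev F i j k b - dl l b * ev F i j k a)
  | Posz 0 => mkA (fun i j k l => dl k a * ev F i b j l - dl k b * ev F i a j l
      + dl l a * ev F j b i k - dl l b * ev F j a i k)
  | Posz 1 => mkA (fun i j k l => - dl i a * ev F b l j k + dl i b * ev F a l j k
      + dl j a * ev F b l i k - dl j b * ev F a l i k
      + dl k a * (ev F b l i j - ev F l b i j) - dl k b * (ev F a l i j - ev F l a i j))
  | _ => mkA (fun i j k l => - dl i a * ev F k l j b + dl i b * ev F k l j a
      + dl j a * ev F k l i b - dl j b * ev F k l i a
      - dl k a * ev F i j l b + dl k b * ev F i j l a
      + dl l a * ev F i j k b - dl l b * ev F i j k a)
  end.

Definition wd a b i j : K := dl a i * dl b j - dl a j * dl b i.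

(** Decomposable elements of the simple modules, of the shape of highest weight vectors; with
    [iota0] and [iota1] of simple matrices they serve as test elements. *)
Definition curvW a b : A := mkA (fun i j k l => wd a b i j * wd a b k l).
Definition hookW a b c : A := mkA (fun i j k l => wd a b i j * (dl a k * dl c l)).
Definition symW a c : A := mkA (fun i j k l => dl a i * dl c k * (dl a j * dl c l)).
Definition altW a b c d : A := mkA (fun i j k l => wd a b i j * wd c d k l).

Lemma curvW_in a b : mods 2 0 (curvW a b).
Proof. by split=> i j k *; rewrite !ev_mkA /wd; ring. Qed.

Lemma hookW_in a b c : a != c -> b != c -> mods 1 1 (hookW a b c).
Proof.
move=> /(dln K) ac /(dln K) bc; split; last first.
  move=> i j; rewrite /z1; under eq_bigr => k _ do rewrite ev_mkA.
  by rewrite -mulr_sumr sum_dl (dlC K c) ac mulr0.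
have T i j : t1 (hookW a b c) i j = 0.
  rewrite /t1; under eq_bigr => k _ do rewrite ev_mkA.
  transitivity (\sum_k (dl b i * dl a j * (dl a k * dl c k) - dl a i * dl a j * (dl b k * dl c k))).
    by apply: eq_bigr => k _; rewrite /wd; ring.
  by rewrite sumrB -!mulr_sumr !sum_dl !(dlC K c) ac bc !mulr0 subr0.
split=> [i j k l|i j k l|i j]; last by rewrite !T addr0.
  by rewrite !ev_mkA /wd; ring.
by rewrite !ev_mkA /wd; ring.
Qed.

Lemma symW_in a c : a != c -> mods 0 3 (symW a c).
Proof.
move=> /(dln K) ac.
have Z j l : z0 (symW a c) j l = 0.
  rewrite /z0; under eq_bigr => i _ do rewrite ev_mkA.
  by rewrite -mulr_suml sum_dl (dlC K) ac mul0r.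
split; last by split=> // i j k l; rewrite !ev_mkA; ring.
split=> [i j k l|j l]; first by rewrite !ev_mkA; ring.
rewrite Z big1 ?mulr0 // => k _; rewrite ev_mkA.
by have [<-|/(dln K) ->] := eqVneq a k; rewrite ?(dlC K c) ?ac; ring.
Qed.

Lemma altW_in a b c d : [/\ a != c, a != d, b != c & b != d] -> mods 0 2 (altW a b c d).
Proof.
case=> /(dln K) ac /(dln K) ad /(dln K) bc /(dln K) bd.
have D (f h : I -> K) : (forall i, f i * h i = 0) -> \sum_i f i * h i = 0.
  by move=> h0; rewrite big1.
have O i j l k : wd a b i j * wd c d i l = 0.
  rewrite /wd; have [e|/(dln K) na] := eqVneq a i.
    by rewrite -e !(dlC K c a) !(dlC K d a) ac ad; ring.
  have [e|/(dln K) nb] := eqVneq b i; last by rewrite na nb; ring.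
  by rewrite -e !(dlC K c b) !(dlC K d b) bc bd; ring.
have wC x y i j : wd x y j i = - wd x y i j by rewrite /wd; ring.
have Z j l : z0 (altW a b c d) j l = 0.
  by rewrite /z0 big1 // => i _; rewrite ev_mkA; exact: O.
split; last by split=> // i j k l; rewrite !ev_mkA (wC c) mulrN.
split=> [i j k l|j l]; first by rewrite !ev_mkA (wC a b i j) (wC c d k l) mulrNN.
by rewrite Z big1 ?mulr0 // => k _; rewrite ev_mkA (wC a b k j) mulNr O ?oppr0.
Qed.

Lemma sl0_iota0 a c : a != c -> mods 0 1 (iota0 (fun i j => dl a i * dl c j)).
Proof.
move=> /(dln K) ac; split; [exact: riem0_iota0 | split; [exact: hasS_iota0 | exact: hasL_iota0 |]].
by rewrite zz_iota0 // /tr2 sum_dl (dlC K) ac.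
Qed.

Lemma triv0_iota0 : mods 0 0 (iota0 (fun i j => dl i j)).
Proof.
split; [exact: riem0_iota0 | split; [exact: hasS_iota0 | exact: hasL_iota0 |]] => i j.
rewrite z0_iota0 // zz_iota0 // /tr2; under eq_bigr => k _ do rewrite dlii.
by rewrite sum_const mulr1 mulVf ?mul1r.
Qed.

Lemma lam_iota1W a b : mods 1 0 (iota1 (wd a b)).
Proof. by apply: lam_iota1 => // i j; rewrite /wd; ring. Qed.

(** At a coordinate whose contravariant index differs from all others the subtracted trace term is
    zero, so the projection need not be computed. The next criteria use coordinates or traces chosen
    in the same spirit. *)
Lemma neq_pr1 G i j k l : i != l -> j != l -> k != l -> ev G i j k l != 0 -> pr 1 1 G != 0.
Proof.
move=> /(dln K) il /(dln K) jl /(dln K) kl; apply: contraNneq => e.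
have : ev (pr 1 1 G) i j k l = 0 by rewrite e ev0.
by rewrite /pr evD evN evZ ev_mkA il jl kl !mulr0 !addr0 subr0 mulr0 oppr0 addr0 => /eqP.
Qed.

Lemma neq_pr0 G i j k : i != k -> j != k -> z1 G i j != 0 -> pr 1 0 G != 0.
Proof.
move=> /(dln K) ik /(dln K) jk; apply: contraNneq => e.
have : ev (pr 1 0 G) i j k k = 0 by rewrite e ev0.
rewrite /pr evZ ev_mkA ik jk dlii !mulr0 addr0 subr0 mulr1 => /eqP.
by rewrite mulf_eq0 invr_eq0 !mulf_eq0 (negPf hM1) pnatr_eq0.
Qed.

Lemma neq_prS G i j k l : [/\ i != k, i != l, j != k & j != l] ->
  ev G i j k l + ev G i j l k != 0 -> pr 0 3 G != 0.
Proof.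
case=> /(dln K) ik /(dln K) il /(dln K) jk /(dln K) jl; apply: contraNneq => e.
have : ev (pr 0 3 G) i j k l = 0 by rewrite e ev0.
rewrite /pr ev_mkA /symB /iotaS ik il jk jl !(mulr0, mul0r, addr0, subr0) => /eqP.
by rewrite mulf_eq0 invr_eq0 pnatr_eq0 orbF.
Qed.

Lemma neq_prL G i j k l : [/\ i != k, i != l, j != k & j != l] ->
  ev G i j k l - ev G i j l k != 0 -> pr 0 2 G != 0.
Proof.
case=> /(dln K) ik /(dln K) il /(dln K) jk /(dln K) jl; apply: contraNneq => e.
have : ev (pr 0 2 G) i j k l = 0 by rewrite e ev0.
rewrite /pr ev_mkA /altB /iotaL ik il jk jl !(mulr0, mul0r, addr0, subr0) => /eqP.
by rewrite mulf_eq0 invr_eq0 pnatr_eq0 orbF.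
Qed.

Lemma neq_prZ G j l : j != l -> z0 G j l != 0 -> pr 0 1 G != 0.
Proof.
move=> /(dln K) jl; apply: contraNneq => e.
have : z0 (pr 0 1 G) j l = 0 by rewrite e z0_0.
by rewrite /pr z0_iota0 // /trace_part jl mulr0 subr0 => /eqP.
Qed.

Lemma z1_raiseN a b F i j : z1 (raise (Negz 0) a b F) i j = ev F i j a b - ev F i j b a.
Proof.
rewrite /z1; under eq_bigr => k _ do rewrite ev_mkA.
by rewrite sumrB !sum_dlC.
Qed.

Lemma z0_raise0 a b F j l : z0 (raise (Posz 0) a b F) j l =
  ev F a b j l - ev F b a j l + dl l a * z1 F j b - dl l b * z1 F j a.
Proof.
rewrite /z0; under eq_bigr => i _ do rewrite ev_mkA.
by rewrite sumrB big_split sumrB /= !sum_dlC -!mulr_sumr.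
Qed.

Lemma zz_raise0 a b F : sk12 F -> zz (raise (Posz 0) a b F) = 4 * z1 F a b.
Proof.
move=> s12; rewrite /zz; under eq_bigr => j _ do rewrite z0_raise0.
rewrite sumrB big_split sumrB /= !sum_dlC.
have -> : \sum_i ev F b a i i = - z1 F a b by rewrite /z1 -sumrN; apply: eq_bigr => i _; rewrite s12.
have -> : z1 F b a = - z1 F a b by rewrite (z1_skew b a s12).
by rewrite -/(z1 F a b); ring.
Qed.

Lemma z1_raise1 a b F i j : riem0 F -> z1 (raise (Posz 1) a b F) i j =
  - dl i a * z0 F b j + dl i b * z0 F a j + dl j a * z0 F b i - dl j b * z0 F a i
  + 2 * (ev F b a i j - ev F a b i j).
Proof.
move=> [s _]; have Z x y : z0 F x y = \sum_k ev F x k y k by apply: eq_bigr => k _; rewrite s.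
rewrite /z1; under eq_bigr => k _ do rewrite ev_mkA.
by rewrite !big_split /= !sumrN -!mulr_sumr !sum_dlC -!Z; ring.
Qed.

Ltac dls := rewrite ?dlii;
  repeat match goal with
  | h : is_true (?x != ?y) |- context [dl ?x ?y] => rewrite (dln K h)
  | h : is_true (?x != ?y) |- context [dl ?y ?x] => rewrite (dlC K y x) (dln K h)
  end.

(* A component on which g_1 acts from degree [k - 1] to degree [k]: the component *)
(* [r] of the target is reached from the component [s].                           *)
Definition hit (k : int) (Q r Q' s : nat) : Prop :=
  exists a b F, mods Q' s F /\ pr Q r (raise k a b F) != 0.

Variables (e0 e1 w : I).
Hypotheses (n01 : e0 != e1) (n0w : e0 != w) (n1w : e1 != w).
Let n10 : e1 != e0. Proof. by rewrite eq_sym. Qed.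
Let nw0 : w != e0. Proof. by rewrite eq_sym. Qed.
Let nw1 : w != e1. Proof. by rewrite eq_sym. Qed.
Let h2 : (2 : K) != 0. Proof. by rewrite pnatr_eq0. Qed.
Let h4 : (4 : K) != 0. Proof. by rewrite pnatr_eq0. Qed.
Let h3 : (3 : K) != 0. Proof. by rewrite pnatr_eq0. Qed.

Lemma hit_m1_1 : hit (Negz 0) 1 1 2 0.
Proof.
exists w, e1, (curvW e0 e1); split; first exact: curvW_in.
apply: (@neq_pr1 _ e0 e1 e0 w) => //; rewrite !ev_mkA /wd; dls.
by rewrite (_ : _ - _ = 1) ?oner_neq0 //; ring.
Qed.

Lemma hit_m1_0 : hit (Negz 0) 1 0 2 0.
Proof.
exists e0, e1, (curvW e0 e1); split; first exact: curvW_in.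
apply: (@neq_pr0 _ e0 e1 w) => //; rewrite z1_raiseN !ev_mkA /wd; dls.
by rewrite (_ : _ - _ = 2) ?h2 //; ring.
Qed.

Lemma hit_0_31 : hit (Posz 0) 0 3 1 1.
Proof.
exists w, e1, (hookW e0 e1 w); split; first exact: hookW_in.
apply: (@neq_prS _ e0 e0 w w); first by split.
rewrite !ev_mkA /wd; dls; by rewrite (_ : _ + _ = 4) ?h4 //; ring.
Qed.

Lemma hit_0_11 : hit (Posz 0) 0 1 1 1.
Proof.
exists e0, e1, (hookW e0 e1 w); split; first exact: hookW_in.
apply: (@neq_prZ _ e0 w) => //; have [_ Z] := hookW_in n0w n1w.
rewrite z0_raise0 !Z !ev_mkA /wd; dls; by rewrite (_ : _ - _ = 2) ?h2 //; ring.
Qed.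

Lemma hit_0_10 : hit (Posz 0) 0 1 1 0.
Proof.
exists w, e1, (iota1 (wd e0 e1)); split; first exact: lam_iota1W.
apply: (@neq_prZ _ e0 w) => //.
have sk i j : wd e0 e1 i j = - wd e0 e1 j i by rewrite /wd; ring.
rewrite z0_raise0 !z1_iota1 // !ev_mkA /wd; dls.
rewrite (_ : _ - _ = 2 * (M + 2)); last by ring.
by rewrite mulf_neq0.
Qed.

Lemma hit_0_00 : hit (Posz 0) 0 0 1 0.
Proof.
exists e0, e1, (iota1 (wd e0 e1)); split; first exact: lam_iota1W.
have sk i j : wd e0 e1 i j = - wd e0 e1 j i by rewrite /wd; ring.
apply/eqP => /(zzP m_gt2); rewrite zz_raise0 ?z1_iota1 // /wd; last by case: (hookish_iota1 sk).
dls; apply/eqP; rewrite (_ : _ * _ = 4 * (2 * (M + 1))); last by ring.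
by rewrite !mulf_neq0.
Qed.

Lemma hit_1_13 : hit (Posz 1) 1 1 0 3.
Proof.
exists e1, e0, (symW e0 w); split; first exact: symW_in.
apply: (@neq_pr1 _ e1 w w e0) => //; rewrite !ev_mkA; dls.
by rewrite (_ : _ - _ = -1) ?oppr_eq0 ?oner_neq0 //; ring.
Qed.

Lemma hit_1_11 : hit (Posz 1) 1 1 0 1.
Proof.
exists e1, w, (iota0 (fun i j => dl e0 i * dl w j)); split; first exact: sl0_iota0.
apply: (@neq_pr1 _ e1 w w e0) => //; rewrite !ev_mkA /iotaS /iotaL /tr2 !sum_dl; dls.
rewrite (_ : _ - _ = - (3 * (cS K m + cL K m))); last by ring.
rewrite oppr_eq0 mulf_neq0 // /cS /cL.
rewrite (_ : _ + _ = (4 * M - 4) / (4 * (M + 2) * (M - 2))); last by field; rewrite hMp2 hM2.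
by rewrite mulf_neq0 ?invr_eq0 ?mulf_neq0 // -[X in _ - X]mulr1 -mulrBr mulf_neq0.
Qed.

Lemma hit_1_01 : hit (Posz 1) 1 0 0 1.
Proof.
exists e1, e0, (iota0 (fun i j => dl e0 i * dl w j)); split; first exact: sl0_iota0.
apply: (@neq_pr0 _ e1 w e0) => //; rewrite z1_raise1; last exact: riem0_iota0.
rewrite !z0_iota0 // !ev_mkA /iotaS /iotaL /tr2 !sum_dl; dls.
rewrite (_ : _ + _ = - (1 + 4 * cL K m)); last by ring.
rewrite oppr_eq0 /cL (_ : _ + _ = (M - 1) / (M - 2)); last by field; rewrite hM2.
by rewrite mulf_neq0 ?invr_eq0.
Qed.

Lemma hit_1_00 : hit (Posz 1) 1 0 0 0.
Proof.
exists e0, e1, (iota0 (fun i j => dl i j)); split; first exact: triv0_iota0.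
apply: (@neq_pr0 _ e0 e1 w) => //; rewrite z1_raise1; last exact: riem0_iota0.
have T : tr2 (fun i j => dl i j) = M :> K.
  by rewrite /tr2; under eq_bigr => i _ do rewrite dlii; rewrite sum_const mulr1.
rewrite !z0_iota0 // !ev_mkA /iotaS /iotaL T /cS /cL; dls.
rewrite (_ : _ + _ = - ((2 * M - 1) / (M - 1))); last by field; rewrite hMp2 hM2 hM1 hMm1.
rewrite oppr_eq0 mulf_neq0 ?invr_eq0 //.
have e : M = m.-1%:R + 1 by rewrite natr1 prednK //; exact: ltn_trans m_gt2.
have -> : 2 * M - 1 = (m + m.-1)%:R by rewrite natrD mulr_natl mulr2n {2}e addrA addrK.
by rewrite pnatr_eq0 addn_eq0; case: m m_gt2.
Qed.

Lemma hit_2_1 : hit (Posz 2) 2 0 1 1.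
Proof.
exists e1, w, (hookW e0 e1 w); split; first exact: hookW_in.
apply/eqP => /(proj2 (evP _ _)) h; have := h e0 e1 e0 e1.
rewrite ev0 !ev_mkA /wd; dls; apply/eqP; by rewrite (_ : _ - _ = 2) ?h2 //; ring.
Qed.

Lemma hit_2_0 : hit (Posz 2) 2 0 1 0.
Proof.
exists e0, e1, (iota1 (wd e0 e1)); split; first exact: lam_iota1W.
apply/eqP => /(proj2 (evP _ _)) h; have := h e0 e1 e0 e1.
rewrite ev0 !ev_mkA /wd; dls; apply/eqP; rewrite (_ : _ - _ = - (3 * 4)); last by ring.
by rewrite oppr_eq0 mulf_neq0.
Qed.

Variable v : I.
Hypotheses (n0v : e0 != v) (n1v : e1 != v) (nvw : v != w).
Let nv0 : v != e0. Proof. by rewrite eq_sym. Qed.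
Let nv1 : v != e1. Proof. by rewrite eq_sym. Qed.
Let nwv : w != v. Proof. by rewrite eq_sym. Qed.

Lemma hit_0_21 : hit (Posz 0) 0 2 1 1.
Proof.
exists v, e0, (hookW e0 e1 w); split; first exact: hookW_in.
apply: (@neq_prL _ e0 e1 v w); first by split.
rewrite !ev_mkA /wd; dls; by rewrite (_ : _ - _ = 1) ?oner_neq0 //; ring.
Qed.

Lemma hit_0_20 : hit (Posz 0) 0 2 1 0.
Proof.
exists v, w, (iota1 (wd e0 e1)); split; first exact: lam_iota1W.
apply: (@neq_prL _ e0 e1 v w); first by split.
rewrite !ev_mkA /wd; dls; by rewrite (_ : _ - _ = 4) ?h4 //; ring.
Qed.

Lemma hit_1_12 : hit (Posz 1) 1 1 0 2.
Proof.
exists v, e0, (altW e0 e1 w v); split; first exact: altW_in.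
apply: (@neq_pr1 _ v w v e1) => //; rewrite !ev_mkA /wd; dls.
by rewrite (_ : _ - _ = - 3) ?oppr_eq0 ?h3 //; ring.
Qed.

Lemma hit_1_02 : hit (Posz 1) 1 0 0 2.
Proof.
exists e0, e1, (altW e0 e1 w v); split; first exact: altW_in.
have [R [_ Z]] : alt0 (altW e0 e1 w v) by exact: altW_in.
apply: (@neq_pr0 _ w v e0) => //; rewrite z1_raise1 // !Z !ev_mkA /wd; dls.
by rewrite (_ : _ + _ = - 4) ?oppr_eq0 ?h4 //; ring.
Qed.

End Raising.

(** * The vanishing entries of the raising action *)

Section RaisingVanish.
Variables (K : numClosedFieldType) (m : nat).
Local Notation I := 'I_m.
Local Notation A := (tensor4 K m).
Local Notation M := (m%:R : K).
Local Notation dl := (dl K).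
Hypothesis m_gt2 : (2 < m)%N.
Implicit Types (F G : A) (a b i j k l : I).

Let hM : M != 0. Proof. by rewrite pnatr_eq0; case: m m_gt2. Qed.
Let hM1 : M + 1 != 0. Proof. by rewrite natr1 pnatr_eq0. Qed.
Let hM2 : M - 2 != 0.
Proof. by rewrite -natrB ?pnatr_eq0 ?subn_eq0 -?ltnNge // ltnW. Qed.
Let hMp2 : M + 2 != 0. Proof. by rewrite -natrD pnatr_eq0 addn2. Qed.
Let hMm1 : M - 1 != 0.
Proof. by rewrite -[1]/(1%:R) -natrB ?pnatr_eq0 ?subn_eq0 -?ltnNge; [ | exact: ltnW (ltnW m_gt2) .. ]; exact: ltnW m_gt2. Qed.

(** Pairs of modules in neighbouring degrees without an arrow have to be excluded as well, for the
    equivalence with inclusions of kernels. Here the total trace of the image is 4 [z1], zero on a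
    trace-free hook. *)
Lemma miss_0_01 a b F : mods 1 1 F -> pr 0 0 (raise (Posz 0) a b F) = 0.
Proof.
by case=> -[s _ _] Z; apply/(zzP m_gt2); rewrite zz_raise0 // Z mulr0.
Qed.

(** The tensor product of a two-vector and a two-form contains no trace-free part symmetric in both
    pairs. In coordinates it is one identity in deltas and entries of the skew array, generalised
    before it is checked. *)
Lemma miss_0_30 a b F : mods 1 0 F -> pr 0 3 (raise (Posz 0) a b F) = 0.
Proof.
case=> -[s _ _] E; have sk := fun i j => z1_skew i j s.
apply/hasSP => i j k l; rewrite /symB !ev_mkA /iotaS zz_raise0 // !z0_raise0.
rewrite !E !ev_mkA; move: (z1 F) sk => T sk.
have Z i' : T i' i' = 0.
  by apply: (@cancel0 _ 2); rewrite ?pnatr_eq0 //; rewrite mulr_natl mulr2n {1}sk addNr.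
rewrite (sk b a) !(dlC K _ a) !(dlC K _ b) /cS.
have [-> -> ->] : [/\ T b i = - T i b, T b j = - T j b & T j i = - T i j] by split; exact: sk.
have [-> ->] : T a i = - T i a /\ T a j = - T j a by split; exact: sk.
move: (T i b) (T j b) (T i a) (T j a) (T a b) (T i j) => x1 x2 x3 x4 x5 x6.
move: (dl i l) (dl i k) (dl j l) (dl j k) (dl a i) (dl a j) (dl a k) (dl a l) (dl b i) (dl b j)
 (dl b k) (dl b l) (dl i j) (dl k l) => d1 d2 d3 d4 d5 d6 d7 d8 d9 d10 d11 d12 d13 d14.
by field; rewrite hMp2 hM1.
Qed.

Lemma miss_1_03 a b F : mods 0 3 F -> pr 1 0 (raise (Posz 1) a b F) = 0.
Proof.
case=> R [y Z]; have Z1 i j : z1 (raise (Posz 1) a b F) i j = 0.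
  by case: (R) => s _; rewrite z1_raise1 // !Z (s b a j i) (y b a i j); ring.
by apply/evP => i j k l; rewrite ev0 /pr evZ ev_mkA !Z1; ring.
Qed.

(** The image of a line under g_1 is at most a copy of g_1, which contains no hook; in coordinates
    the scalar array is written with explicit deltas. *)
Lemma miss_1_10 a b F : mods 0 0 F -> pr 1 1 (raise (Posz 1) a b F) = 0.
Proof.
case=> R [hS hL hZ].
have E : F = iota0 (z0 F) by apply: iota0E.
have [x ZE] : exists x, forall j l, z0 F j l = x * dl j l by exists (M^-1 * zz F) => *; exact: hZ.
have tE : tr2 (z0 F) = x * M.
  rewrite /tr2; under eq_bigr => i _ do rewrite ZE dlii mulr1.
  by rewrite sum_constr.
have C i j k l : ev F i j k l = x * (cS K m * (2 - M / (M + 1)) * (dl i k * dl j l + dl i l * dl j k)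
    + cL K m * (2 - M / (M - 1)) * (dl i k * dl j l - dl i l * dl j k)).
  rewrite {1}E ev_mkA /iotaS /iotaL !ZE tE; field; by rewrite hM1 hMm1.
have cSE : cS K m * (2 - M / (M + 1)) = 3 / (4 * (M + 1)) by rewrite /cS; field; rewrite hMp2 hM1.
have cLE : cL K m * (2 - M / (M - 1)) = (4 * (M - 1))^-1 by rewrite /cL; field; rewrite hM2 hMm1.
apply/evP => i j k l; rewrite ev0 /pr evD evN evZ !ev_mkA !z1_raise1 // !ZE !C cSE cLE.
rewrite ?(dlC K l j) ?(dlC K l i) ?(dlC K l k) ?(dlC K j i) ?(dlC K k i) ?(dlC K k j).
rewrite !(dlC K _ a) !(dlC K _ b).
by field; rewrite hM1 hMm1.
Qed.

End RaisingVanish.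

(** * Inclusions as non-zero entries *)

Section Modules.
Variables (K : numClosedFieldType) (m n N : nat) (g : 'M[K]_n)
  (fr : bool -> 'I_m -> 'rV[K]_n) (gp gm : 'I_n -> 'M[K]_N) (xi : 'rV[K]_N).
Hypotheses (m_gt2 : (2 < m)%N) (n_eq : n = m.*2) (frameP : frame g fr)
  (cliffP : clifford_relations g gp gm).
Local Notation I := 'I_m.
Local Notation P := (bool * I)%type.
Local Notation T := (tensor4 K n).
Local Notation Gp := (Gp fr gp).
Hypotheses (xi_e : forall i, xi *m Gp (true, i) = 0) (xi_neq0 : xi != 0).
Implicit Types (p q : P) (r s : I) (A B D F : 'I_N).
Local Notation e_ := (pair true).
Local Notation f_ := (pair false).
Local Notation dl := (dl K).

Local Notation van := (van fr).
Local Notation rk := (rk fr).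
Local Notation vanS := (vanS g fr).
Local Notation Pt := (Pt frameP).
Local Notation frm := (frm fr).
Local Notation rot := (rot g fr).
Local Notation act4 := (act4 g).
Variable Vm : {vspace 'rV[K]_n}.
Local Notation Vp := (ker_xi gp xi).
Hypotheses (e_in : forall i, frm (true, i) \in Vp) (f_in : forall i, frm (false, i) \in Vm)
  (nullp : totally_null g Vp) (nullm : totally_null g Vm).
Implicit Types (C : T) (u v : int * nat) (phi psi : 'M[K]_n).
Local Notation gpos := (g_pos g Vp).

Lemma gpos_gen (X : {vspace T}) C : (forall a b, act4 (rot (f_ a) (e_ b)) C \in X) ->
  forall psi, psi \in gpos -> act4 psi C \in X.
Proof.
move=> h; have /subvP s : (gpos <= lin_of (act4_linl g C) @^-1: X)%VS.
  by apply: (gpos_sub frameP e_in f_in nullp nullm) => a b; rewrite -memv_preim lin_ofE.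
by move=> psi /s; rewrite -memv_preim lin_ofE.
Qed.

Lemma lie_zero_pos a b psi : psi \in gpos -> lie g (rot (e_ a) (e_ b)) psi \in gpos.
Proof.
have /subvP s : (gpos <= linfun (lie g (rot (e_ a) (e_ b))) @^-1: gpos)%VS.
  apply: (gpos_sub frameP e_in f_in nullp nullm) => c d; rewrite -memv_preim lfunE /=.
  have R x y : rot (f_ x) (e_ y) \in gpos by exact: rotp_in.
  rewrite (lie_rot frameP) /st /= !dpE /= !mul0r !scale0r sub0r addr0.
  apply: memvB; first rewrite memvN; apply: memvZ; exact: R.
by move=> /s; rewrite -memv_preim lfunE.
Qed.

(** The commutator of g_0 with g_1 lies in g_1, so the Leibniz rule for [act4] applies. *)
Lemma Ninvar_pos (Y : {vspace T}) : Ninvar g fr Y -> Ninvar g fr (bspan act4 gpos Y).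
Proof.
move=> iY [a b] C; rewrite /Oab /=; set phi := rot _ _.
have so : phi \in so_form K n by exact: rot_so.
have /subvP s : (bspan act4 gpos Y <= linfun (act4 phi) @^-1: bspan act4 gpos Y)%VS.
  apply/(bspan_subP _ _ _ (act4_linl g) (act4_linr g)) => psi D pg DY.
  rewrite -memv_preim lfunE /=.
  have -> : act4 phi (act4 psi D) = act4 (lie g phi psi) D + act4 psi (act4 phi D).
    by rewrite (act4_lie frameP) // subrK.
  apply: memvD; apply: mem_bspan; rewrite ?lie_zero_pos //;
   first [exact: act4_linl | exact: act4_linr | exact: (iY (a, b))].
by move=> /s; rewrite -memv_preim lfunE.
Qed.

Definition hits u w := exists a b C, C \in Pt w /\ ~ van u (act4 (rot (f_ a) (e_ b)) C).

(** The span g_1 [Pt w] is g_0-invariant and lies in the degree of [u]; by the dichotomy it contains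
    [Pt u] unless its projection on that piece is zero. *)
Lemma hits_inclusion u w : u \in labels -> w \in labels -> u.1 = w.1 + 1 -> present m u ->
  (Pt u <= bspan act4 gpos (Pt w))%VS <-> hits u w.
Proof.
move=> ul wl e pu; pose Z := bspan act4 gpos (Pt w).
have iZ : Ninvar g fr Z by apply: Ninvar_pos; exact: Pt_Ninvar.
have ZS : (Z <= vanS (fun v => v.1 != u.1))%VS.
  apply/(bspan_subP _ _ _ (act4_linl g) (act4_linr g)) => psi D pg DP.
  by apply: gpos_gen pg => a b; rewrite e; exact: gpos_Pt.
split=> [h|[a [b [C [CP nv]]]]]; last first.
  have [//|h] := lab_dich m_gt2 frameP ul iZ ZS; case: nv; apply: h.
  apply: mem_bspan CP; [exact: act4_linl | exact: act4_linr | exact: rotp_in].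
have N0 : Pt u <> 0%VS by exact: Pt_neq0.
have [//|nh] := pselect (hits u w); case: N0.
have /subvP s : (Z <= vanS (fun v => v == u))%VS.
  apply/(bspan_subP _ _ _ (act4_linl g) (act4_linr g)) => psi D pg DP.
  apply: gpos_gen pg => a b; apply/vanSP; split=> [|v _ /eqP ->].
    by apply: weyl_rot => //; exact: Pt_weyl wl DP.
  by have [//|nv] := pselect (van u (act4 (rot (f_ a) (e_ b)) D)); case: nh; exists a, b, D.
apply: vs0P => C CP; rewrite memv0; apply/eqP.
apply: (Pt_van0 m_gt2 ul CP); have /vanSP [_ hv] := s _ (subvP h _ CP).
exact: hv.
Qed.

Lemma rk_raise a b (k : int) (F : tensor4 K m) : k \in degs -> k - 1 \in degs ->
  rk k (act4 (rot (f_ a) (e_ b)) (mk g fr (lev (k - 1)).1 (lev (k - 1)).2 F)) = raise k a b F.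
Proof.
have dE (s s' : bool) (x y : I) : dp K (s, x) (s', y) = (s == s')%:R * dl x y.
  by rewrite /dp /dl xpair_eqE -natrM mulnb.
move: k; apply: degs_ind => //= _; rewrite /rk /rdC /rd /=; apply/evP => i j k l;
 rewrite !ev_mkA (cm_rot frameP) /rop !(cm_mk frameP) /emb /st /= !dE /=; ring.
Qed.

Lemma hitsE u w : u \in labels -> w \in labels -> u.1 = w.1 + 1 ->
  hits u w <-> hit K m u.1 (levQ u) u.2 (levQ w) w.2.
Proof.
move=> ul wl e; have e' : w.1 = u.1 - 1 by rewrite e addrK.
have kd := lab_degs ul; have kd' : u.1 - 1 \in degs by rewrite -e'; exact: lab_degs.
split=> [[a [b [C [CP nv]]]]|[a [b [F [MF nz]]]]].
  have [_ MF E] := proj1 (mem_part frameP _ _ (lab_ok wl)) CP.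
  exists a, b, (rdC fr (levQ w) (levb w) C); split=> //; apply/eqP => z; apply: nv.
  by rewrite /van E /levQ /levb e' rk_raise // -e'.
exists a, b, (mk g fr (levQ w) (levb w) F); have l2 := lab_le2 wl; have lF := mods_lvl MF; split.
  apply/(mem_part frameP _ _ (lab_ok wl)); rewrite rdC_mk //; split=> //; exact: mk_weyl.
rewrite /van /levQ /levb e' rk_raise //; exact/eqP.
Qed.

(** No map Pi belongs to degree 2, so its two arrows are put in by hand; otherwise an arrow is the
    order of labels between neighbouring degrees. *)
Definition arrowed u w := (u.1 == 2) || (w \in under u.1 u.2).

Local Ltac by_hit H xy xz yz :=
  first [by eapply H; [exact: m_gt2 | exact: xy | exact: xz | exact: yz]
       | by eapply H; [exact: xy | exact: xz | exact: yz]
       | by eapply H; [exact: m_gt2 | exact: xy] | by eapply H; exact: xy].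

(** A finite table of sixteen non-zero and four zero entries; the four arrows at the label (0, 2)
    use a fourth index and thus m > 3. *)
Lemma hits_arrow u w : u \in labels -> w \in labels -> u.1 = w.1 + 1 ->
  present m u -> present m w -> hits u w <-> arrowed u w.
Proof.
move=> ul wl e pu pw; rewrite hitsE //.
have [x [y [z [xy xz yz]]]] := ex_three m_gt2.
have four : m != 3%N -> exists e0 e1 w v : I,
  [/\ e0 != e1, e0 != w & e1 != w] /\ [/\ e0 != v, e1 != v & v != w].
  by move=> m3; apply: ex_four; move: m3 m_gt2; clear; lia.
suff : if arrowed u w then hit K m u.1 (levQ u) u.2 (levQ w) w.2
    else ~ hit K m u.1 (levQ u) u.2 (levQ w) w.2 by case: ifP.
have miss (k : int) (Q r Q' s : nat) : (forall (a b : I) (F : tensor4 K m), mods Q' s F -> pr Q r (raise k a b F) = 0) ->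
    ~ @hit K m k Q r Q' s.
  by move=> h [a [b [F [MF /eqP]]]]; apply; exact: h.
move: w wl e pw; apply: labelsP; move: u ul pu; apply: labelsP => //= pu e pw;
 rewrite /levQ /arrowed /=; first
 [ by_hit (@hit_m1_1 K m) xy xz yz
 | by_hit (@hit_m1_0 K m) xy xz yz
 | by_hit (@hit_0_31 K m) xy xz yz
 | by_hit (@hit_0_11 K m) xy xz yz
 | by_hit (@hit_0_10 K m) xy xz yz
 | by_hit (@hit_0_00 K m) xy xz yz
 | by_hit (@hit_1_13 K m) xy xz yz
 | by_hit (@hit_1_11 K m) xy xz yz
 | by_hit (@hit_1_01 K m) xy xz yz
 | by_hit (@hit_1_00 K m) xy xz yz
 | by_hit (@hit_2_1 K m) xy xz yz
 | by_hit (@hit_2_0 K m) xy xz yz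
 | by apply: miss => ? ? ?; apply: miss_0_01 | by apply: miss => ? ? ?; apply: miss_0_30
 | by apply: miss => ? ? ?; apply: miss_1_10 | by apply: miss => ? ? ?; apply: miss_1_03
 | have [e0 [e1 [x' [v [[? ? ?] [? ? ?]]]]]] := four pu; first
   [ by apply: (@hit_0_21 K m e0 e1 x' _ _ _ v) | by apply: (@hit_0_20 K m m_gt2 e0 e1 x' _ _ _ v)
   | by apply: (@hit_0_20 K m m_gt2 e0 e1 x' _ v) ]
 | have [e0 [e1 [x' [v [[? ? ?] [? ? ?]]]]]] := four pw; first
   [ by apply: (@hit_1_12 K m e0 e1 x' _ _ _ v) | by apply: (@hit_1_02 K m e0 e1 x' _ _ _ v) ]
 | idtac ].
Qed.

End Modules.

(** * A Borel subalgebra of g_0 *)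

Section Modules.
Variables (K : numClosedFieldType) (m n N : nat) (g : 'M[K]_n)
  (fr : bool -> 'I_m -> 'rV[K]_n) (gp gm : 'I_n -> 'M[K]_N) (xi : 'rV[K]_N).
Hypotheses (m_gt2 : (2 < m)%N) (n_eq : n = m.*2) (frameP : frame g fr)
  (cliffP : clifford_relations g gp gm).
Local Notation I := 'I_m.
Local Notation P := (bool * I)%type.
Local Notation T := (tensor4 K n).
Local Notation Sv := (Sv fr).
Local Notation Gp := (Gp fr gp).
Hypotheses (xi_e : forall i, xi *m Gp (true, i) = 0) (xi_neq0 : xi != 0).
Implicit Types (p q : P) (r s : I) (A B D F : 'I_N).
Local Notation e_ := (pair true).
Local Notation f_ := (pair false).
Local Notation dl := (dl K).

Local Notation frm := (frm fr).
Local Notation rot := (rot g fr).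
Variable Vm : {vspace 'rV[K]_n}.
Local Notation Vp := (ker_xi gp xi).
Hypotheses (e_in : forall i, frm (true, i) \in Vp) (f_in : forall i, frm (false, i) \in Vm)
  (nullp : totally_null g Vp) (nullm : totally_null g Vm).
Implicit Types (C : T) (u v : int * nat) (phi psi : 'M[K]_n).
Local Notation g0 := (g_zero g Vp Vm).

Local Notation O_ a b := (rot (e_ a) (e_ b)).

Lemma lie_linl psi : linear (fun phi => lie g phi psi).
Proof.
move=> k x y; rewrite /lie endo_linear linearD linearZ /= mulmxDl mulmxDr.
by rewrite -scalemxAl -scalemxAr scalerDr addrACA.
Qed.

Lemma lie_linr phi : linear (lie g phi).
Proof. exact: lie_linear. Qed.

Lemma lie_OO a b c d : lie g (O_ a b) (O_ c d) = dl b c *: O_ a d - dl a d *: O_ c b.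
Proof.
rewrite (lie_rot frameP) /st /= !dpE /= !mul0r !mul1r !scale0r subr0 addr0.
by rewrite (dlC K c b) (dlC K d a).
Qed.

Lemma lie_HO c a b : lie g (O_ c c) (O_ a b) = (dl c a - dl c b) *: O_ a b.
Proof.
rewrite lie_OO scalerBl; congr (_ - _).
  by have [->|/(dln K) ->] := eqVneq c a; rewrite ?scale0r.
by have [->|/(dln K) ->] := eqVneq c b; rewrite ?scale0r.
Qed.

Lemma lie_HH x a b c d : lie g (O_ a a) (lie g (O_ b b) (x *: O_ c d))
  = (x * (dl b c - dl b d) * (dl a c - dl a d)) *: O_ c d.
Proof.
have Z phi (k : K) psi : lie g phi (k *: psi) = k *: lie g phi psi by exact: linearZ.
by rewrite Z lie_HO scalerA Z lie_HO scalerA.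
Qed.

Lemma fm_lin k phi psi p q : fm fr (k *: phi + psi) p q = k * fm fr phi p q + fm fr psi p q.
Proof.
rewrite /fm -SvZ -SvD; apply: eq_Sv => a; rewrite -SvZ -SvD; apply: eq_Sv => b.
by rewrite !mxE.
Qed.

Lemma fm_O a b c d : fm fr (O_ a b) (e_ c) (f_ d) = dl c a * dl d b.
Proof. by rewrite (fm_rot frameP) /st /= !dpE /=; ring. Qed.

Lemma O_neq0 a b : O_ a b != 0.
Proof.
apply/eqP => e; have := fm_O a b a b; rewrite e !dlii mulr1 /fm /Sv big1 => [/esym/eqP|c _].
  by rewrite oner_eq0.
by rewrite big1 ?mulr0 // => d _; rewrite mxE mulr0.
Qed.

Lemma g0_expand phi : phi \in g0 ->
  phi = \sum_(x : I * I) fm fr phi (e_ x.1) (f_ x.2) *: O_ x.1 x.2.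
Proof.
pose Q psi := psi = \sum_(x : I * I) fm fr psi (e_ x.1) (f_ x.2) *: O_ x.1 x.2.
have cQ : lin_closed Q.
  split=> [|k x y hx hy]; rewrite /Q.
    rewrite big1 // => z _; rewrite /fm /Sv big1 ?scale0r // => c _.
    by rewrite big1 ?mulr0 // => d _; rewrite mxE mulr0.
  rewrite {1}hx {1}hy scaler_sumr -big_split; apply: eq_bigr => z _ /=.
  by rewrite fm_lin scalerDl scalerA.
have /subvP s : (g0 <= vsof Q)%VS; last by move=> /s /(vsofP _ cQ).
apply: (g0_sub frameP e_in f_in nullp nullm) => a b; apply/(vsofP _ cQ); rewrite /Q.
rewrite (bigD1 (a, b)) //= fm_O !dlii mulr1 scale1r big1 ?addr0 // => -[c d] ne.
rewrite fm_O /=; have [e|/(dln K) ->] := eqVneq c a; last by rewrite mul0r scale0r.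
have [e'|/(dln K) ->] := eqVneq d b; last by rewrite mulr0 scale0r.
by rewrite e e' eqxx in ne.
Qed.

(** Matrices whose entries lie at least [k] places above the diagonal; [tri 0] is the Borel
    subalgebra. *)
Definition tri (k : nat) : {vspace 'M[K]_n} :=
  <<[seq O_ x.1 x.2 | x <- enum (fun x : I * I => (x.1 + k <= x.2)%N)]>>%VS.

Lemma O_tri k (a b : I) : (a + k <= b)%N -> O_ a b \in tri k.
Proof. by move=> h; apply/memv_span/mapP; exists (a, b); rewrite ?mem_enum. Qed.

Lemma tri_sub k (X : {vspace 'M[K]_n}) : (forall a b : I, (a + k <= b)%N -> O_ a b \in X) -> (tri k <= X)%VS.
Proof. by move=> h; apply/span_subvP => y /mapP [[a b]]; rewrite mem_enum => k' ->; exact: h. Qed.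

Lemma tri_lie k l (X : {vspace 'M[K]_n}) :
  (forall a b c d : I, (a + k <= b)%N -> (c + l <= d)%N -> lie g (O_ a b) (O_ c d) \in X) ->
  (bspan (lie g) (tri k) (tri l) <= X)%VS.
Proof.
move=> h; apply/(bspan_subP _ _ _ lie_linl lie_linr) => phi psi pk pl.
have /subvP s : (tri k <= lin_of (lie_linl psi) @^-1: X)%VS; last first.
  by have := s _ pk; rewrite -memv_preim lin_ofE.
apply: tri_sub => a b ab; rewrite -memv_preim lin_ofE.
have /subvP s : (tri l <= linfun (lie g (O_ a b)) @^-1: X)%VS; last first.
  by have := s _ pl; rewrite -memv_preim lfunE.
by apply: tri_sub => c d cd; rewrite -memv_preim lfunE; exact: h.
Qed.

Lemma tri_le k l : (l <= k)%N -> (tri k <= tri l)%VS.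
Proof. by move=> lk; apply: tri_sub => a b h; apply: O_tri; lia. Qed.

Lemma tri_lieD k l : (bspan (lie g) (tri k) (tri l) <= tri (k + l))%VS.
Proof.
apply: tri_lie => a b c d ab cd; rewrite lie_OO; apply: memvB.
  have [e|/(dln K) ->] := eqVneq b c; last by rewrite scale0r mem0v.
  by apply/memvZ/O_tri; rewrite -e in cd; lia.
have [e|/(dln K) ->] := eqVneq a d; last by rewrite scale0r mem0v.
by apply/memvZ/O_tri; rewrite -e in cd; lia.
Qed.

Lemma tri_lie0 : (bspan (lie g) (tri 0) (tri 0) <= tri 1)%VS.
Proof.
apply: tri_lie => a b c d ab cd; rewrite lie_OO.
have [e|nbc] := eqVneq b c; have [e'|nad] := eqVneq a d.
- have e1 : a = b by apply: val_inj => /=; move: ab cd; rewrite -e -e' !addn0; lia.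
  by rewrite -e -e' e1 subrr mem0v.
- rewrite (dln K nad) scale0r subr0; apply/memvZ/O_tri; rewrite -e in cd.
  by move/eqP/val_eqP: nad => /= nad; lia.
- rewrite (dln K nbc) scale0r sub0r memvN; apply/memvZ/O_tri; rewrite -e' in cd.
  by move/eqP/val_eqP: nbc => /= nbc; lia.
- by rewrite (dln K nbc) (dln K nad) !scale0r subr0 mem0v.
Qed.

(** Derived algebras move the entries away from the diagonal, hence solvability. A strictly larger
    subalgebra of g_0 has an element with an entry below the diagonal; it then contains a copy of
    sl_2, which survives in every derived algebra. *)
Lemma borel_tri : borel g g0 (tri 0).
Proof.
have tg : (tri 0 <= g0)%VS by apply: tri_sub => a b _; exact: rot0_in.
split=> //; first exact: (tri_lieD 0 0).
  exists m; apply/eqP; rewrite -subv0.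
  have T k : (iter k (fun U => bspan (lie g) U U) (tri 0) <= tri k)%VS.
    elim: k => [|k IHk]; first exact: subvv.
    apply: (@subv_trans _ _ (bspan (lie g) (tri k) (tri k))).
      apply/(bspan_subP _ _ _ lie_linl lie_linr) => x y /(subvP IHk) xk /(subvP IHk) yk.
      by apply: mem_bspan => //; [exact: lie_linl | exact: lie_linr].
    case: (k) => [|j]; first exact: tri_lie0.
    by apply: subv_trans (tri_lieD _ _) (tri_le _); lia.
  apply: subv_trans (T m) _; apply: tri_sub => a b h; have := ltn_ord b; lia.
move=> b' bg' sb' [k sk] bb; apply/eqP; rewrite eqEsubv bb andbT.
have lie_in (x y : 'M[K]_n) : x \in b' -> y \in b' -> lie g x y \in b'.
  move=> xb yb; apply: (subvP sb'); apply: mem_bspan => //; [exact: lie_linl | exact: lie_linr].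
apply/subvP => phi pb; rewrite (g0_expand (subvP bg' _ pb)); apply: memv_suml => -[a b] _ /=.
have [ab|ba] := leqP a b; first by apply/memvZ/O_tri; rewrite addn0.
have [->|x0] := eqVneq (fm fr phi (e_ a) (f_ b)) 0; first by rewrite scale0r mem0v.
have nab : a != b by apply/eqP => e; move: ba; rewrite e ltnn.
have nba : b != a by rewrite eq_sym.
have inb (c d : I) : (c <= d)%N -> O_ c d \in b' by move=> h; apply/(subvP bb)/O_tri; rewrite addn0.
have Oba : O_ b a \in b' by apply: inb; exact: ltnW.
(* Brackets with the diagonal units at a and b remove all entries but (a, b) and (b, a), and the
   unit of the latter, above the diagonal, is already in [b']. *)
have Oab' : O_ a b \in b'.
  have := lie_in _ _ (inb a a (leqnn _)) (lie_in _ _ (inb b b (leqnn _)) pb).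
  have -> : lie g (O_ a a) (lie g (O_ b b) phi)
      = - (fm fr phi (e_ a) (f_ b) *: O_ a b + fm fr phi (e_ b) (f_ a) *: O_ b a).
    rewrite {1}(g0_expand (subvP bg' _ pb)) !linear_sum (bigD1 (a, b)) //= (bigD1 (b, a)) /=; last first.
      by apply/eqP => -[e _]; move: ba; rewrite e ltnn.
    rewrite !lie_HH !dlii !(dln K nab) !(dln K nba) big1.
      rewrite opprD -!scaleNr; congr (_ + _); first by congr (_ *: _); ring.
      by rewrite [LHS]addr0; congr (_ *: _); ring.
    move=> [c d] /andP [n1 n2] /=; rewrite lie_HH.
    suff -> : fm fr phi (e_ c) (f_ d) * (dl b c - dl b d) * (dl a c - dl a d) = 0 by rewrite scale0r.
    have [ac|/(dln K) ac] := eqVneq a c; have [ad|/(dln K) ad] := eqVneq a d.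
    - by rewrite -ac -ad !subrr !mulr0.
    - have nbd : b != d by apply: contraNneq n1 => ->; rewrite -ac.
      by rewrite -ac (dln K nba) (dln K nbd) subrr mulr0 mul0r.
    - have nbc : b != c by apply: contraNneq n2 => ->; rewrite -ad.
      by rewrite -ad (dln K nba) (dln K nbc) subrr mulr0 mul0r.
    - by rewrite ac ad subrr mulr0.
  rewrite memvN addrC => h.
  have -> : O_ a b = (fm fr phi (e_ a) (f_ b))^-1 *: (fm fr phi (e_ a) (f_ b) *: O_ a b).
    by rewrite scalerA mulVf ?scale1r.
  by apply: memvZ; rewrite -[X in X \in _](addKr (fm fr phi (e_ b) (f_ a) *: O_ b a)) memvD // memvN memvZ.
have L1 : lie g (O_ a b) (O_ b a) = O_ a a - O_ b b by rewrite lie_OO !dlii !scale1r.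
have L2 : lie g (O_ a a - O_ b b) (O_ a b) = 2 *: O_ a b.
  rewrite -(lin_ofE (lie_linl (O_ a b))) linearB /= !lin_ofE !lie_HO !dlii (dln K nab) (dln K nba).
  by rewrite -scalerBl; congr (_ *: _); ring.
have L3 : lie g (O_ a a - O_ b b) (O_ b a) = - 2 *: O_ b a.
  rewrite -(lin_ofE (lie_linl (O_ b a))) linearB /= !lin_ofE !lie_HO !dlii (dln K nab) (dln K nba).
  by rewrite -scalerBl; congr (_ *: _); ring.
have half (x : 'M[K]_n) (D : {vspace 'M[K]_n}) (c : K) : c != 0 -> c *: x \in D -> x \in D.
  by move=> c0 /(memvZ c^-1); rewrite scalerA mulVf ?scale1r.
(* The three elements of the sl_2-triple are multiples of brackets of one another. *)
have [h _ _] : [/\ O_ a b \in iter k (fun U => bspan (lie g) U U) b',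
    O_ b a \in iter k (fun U => bspan (lie g) U U) b'
  & O_ a a - O_ b b \in iter k (fun U => bspan (lie g) U U) b'].
  elim: k {sk} => [|k [h1 h2 h3]]; first by split=> //; rewrite -L1; exact: lie_in.
  have B (x y : 'M[K]_n) : x \in iter k (fun U => bspan (lie g) U U) b' ->
      y \in iter k (fun U => bspan (lie g) U U) b' ->
      lie g x y \in iter k.+1 (fun U => bspan (lie g) U U) b'.
    by move=> xb yb; rewrite iterS; apply: mem_bspan => //; [exact: lie_linl | exact: lie_linr].
  split; last by rewrite -L1; exact: B.
    by apply: (half _ _ 2); [rewrite pnatr_eq0 | rewrite -L2; exact: B].
  by apply: (half _ _ (- 2)); [rewrite oppr_eq0 pnatr_eq0 | rewrite -L3; exact: B].
by move: h; rewrite sk memv0 (negPf (O_neq0 a b)).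
Qed.

End Modules.

(** * Cartan products from equivariant maps *)

Section Modules.
Variables (K : numClosedFieldType) (m n N : nat) (g : 'M[K]_n)
  (fr : bool -> 'I_m -> 'rV[K]_n) (gp gm : 'I_n -> 'M[K]_N) (xi : 'rV[K]_N).
Hypotheses (m_gt2 : (2 < m)%N) (n_eq : n = m.*2) (frameP : frame g fr)
  (cliffP : clifford_relations g gp gm).
Local Notation I := 'I_m.
Local Notation P := (bool * I)%type.
Local Notation T := (tensor4 K n).
Local Notation cm := (cm fr).
Local Notation Gp := (Gp fr gp).
Hypotheses (xi_e : forall i, xi *m Gp (true, i) = 0) (xi_neq0 : xi != 0).
Implicit Types (p q : P) (r s : I) (A B D F : 'I_N).
Local Notation e_ := (pair true).
Local Notation f_ := (pair false).
Local Notation dl := (dl K).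

Local Notation vanS := (vanS g fr).
Local Notation Pt := (Pt frameP).
Local Notation frm := (frm fr).
Local Notation rot := (rot g fr).
Local Notation act4 := (act4 g).
Variable Vm : {vspace 'rV[K]_n}.
Local Notation Vp := (ker_xi gp xi).
Hypotheses (e_in : forall i, frm (true, i) \in Vp) (f_in : forall i, frm (false, i) \in Vm)
  (nullp : totally_null g Vp) (nullm : totally_null g Vm).
Implicit Types (C : T) (u v : int * nat) (phi psi : 'M[K]_n).
Local Notation g0 := (g_zero g Vp Vm).

Local Notation O_ a b := (rot (e_ a) (e_ b)).

Lemma act_tens phi x y : act4 phi (tens_form x y) =
  tens_form (lie g phi x) y + tens_form x (lie g phi y).
Proof.
apply/ffunP => -[[[a b] c] d]; rewrite !ffunE /lie [X in _ = X * _ + _]mxE [X in _ = _ + _ * X]mxE.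
rewrite ![((_ *m _) : 'M_n) _ _]mxE !mulrDl !mulrDr !mulr_suml !mulr_sumr -!big_split.
apply: eq_bigr => e _; rewrite !ffunE ![(_^T) _ _]mxE /=; ring.
Qed.

Lemma hw_tri phi : phi != 0 ->
  (forall a b : I, (a <= b)%N -> lie g (O_ a b) phi \in <[phi]>%VS) ->
  highest_weight_vector g (tri g fr 0) phi.
Proof.
move=> nz h; split=> // beta.
have /subvP s : (tri g fr 0 <= lin_of (lie_linl g phi) @^-1: <[phi]>)%VS.
  by apply: tri_sub => a b; rewrite addn0 => ab; rewrite -memv_preim lin_ofE; exact: h.
by move=> /s; rewrite -memv_preim lin_ofE.
Qed.

Definition lie_stable (A : {vspace 'M[K]_n}) : Prop :=
  forall a b x, x \in A -> lie g (O_ a b) x \in A.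

(** The stable subspace [A] leaves room for a module [M1] of which only a stable part is known
    explicitly, as for [z_zero]. *)
Definition hwv (M1 A : {vspace 'M[K]_n}) phi : Prop :=
  [/\ (A <= M1)%VS, lie_stable A, phi \in A & highest_weight_vector g (tri g fr 0) phi].

(** An equivariant map that is non-zero on a simple piece is injective there, so the image is again
    simple; containing the product of two highest weight vectors, it is the Cartan product. It lies
    in the tensor product because its part inside is invariant and non-zero. *)
Lemma cartan_of u (f : 'End(T)) (M1 M2 A B : {vspace 'M[K]_n}) c phi psi C0 :
  u \in labels -> present m u ->
  (forall a b C, f (act4 (O_ a b) C) = act4 (O_ a b) (f C)) ->
  hwv M1 A phi -> hwv M2 B psi -> c != 0 -> C0 \in Pt u -> f C0 = c *: tens_form phi psi ->
  exists N, cartan_product g g0 M1 M2 N /\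
    quo_isomorphic g g0 (vanS (below u)) (vanS (fun v => (v.1 < u.1 + 1)%R)) N.
Proof.
move=> ul pu fE [AM sA phA hA] [BM sB psB hB] c0 CP fC.
have fE' phi' C : phi' \in g0 -> f (act4 phi' C) = act4 phi' (f C).
  have cQ : lin_closed (fun phi' => f (act4 phi' C) = act4 phi' (f C)).
    split=> [|k x y hx hy]; last by rewrite !act4_linl linearD linearZ /= hx hy.
    by rewrite -(lin_ofE (act4_linl g C)) -(lin_ofE (act4_linl g (f C))) !linear0.
  have /subvP s : (g0 <= vsof (fun phi' => f (act4 phi' C) = act4 phi' (f C)))%VS.
    by apply: (g0_sub frameP e_in f_in nullp nullm) => a b; apply/(vsofP _ cQ).
  by move=> /s /(vsofP _ cQ).
have tz : tens_form phi psi != 0.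
  have [/matrix0Pn [a [b ab]] _] := hA; have [/matrix0Pn [c' [d cd]] _] := hB.
  apply/eqP => /ffunP /(_ (a, b, c', d)); rewrite !ffunE => /eqP.
  by rewrite mulf_eq0 (negPf ab) (negPf cd).
have fC0 : f C0 != 0 by rewrite fC scaler_eq0 negb_or c0.
have simp (Y : {vspace T}) : (Y <= Pt u)%VS -> Ninvar g fr Y -> Y = 0%VS \/ Y = Pt u.
  by move=> YP iY; exact: (part_simple m_gt2 (lab_ok ul) (lab_valid ul) YP iY).
have iP : Ninvar g fr (Pt u) := Pt_Ninvar ul.
have inj C : C \in Pt u -> f C = 0 -> C = 0.
  have [|Y0|Y1] := simp (Pt u :&: lker f)%VS (capvSl _ _).
  - move=> [a b] D; rewrite !memv_cap => /andP [DP]; rewrite !memv_ker => /eqP fD.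
    apply/andP; split; first exact: (iP (a, b)).
    by rewrite /Oab fE fD linear0.
  - move=> CP' fC'; apply/eqP; rewrite -memv0 -Y0 memv_cap CP' memv_ker fC'; exact: eqxx.
  by move: CP; rewrite -Y1 memv_cap memv_ker (negPf fC0) andbF.
exists (f @: Pt u)%VS; split; last first.
  exists (f \o cmpL frameP u)%VF; split.
  - by rewrite limg_comp cmp_img.
  - rewrite -(cmp_ker m_gt2 frameP ul); apply/vspace_eqP => C; rewrite !memv_cap !memv_ker comp_lfunE lin_ofE.
    split=> /andP [CU /eqP e]; rewrite CU.
      apply/eqP; apply: inj e; apply: cmp_mem => //.
      exact: (subvP (vanS_weyl g fr _) _ CU).
    by rewrite e linear0 eqxx.
  move=> phi' C pg CU; rewrite !comp_lfunE !lin_ofE.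
  rewrite (cmp_act m_gt2 frameP e_in f_in nullp nullm ul pg) ?fE' //.
  exact: (subvP (vanS_weyl g fr _) _ CU).
split.
- have /subvP s : (Pt u <= f @^-1: bspan (@tens_form K n) A B)%VS.
    have [|Y0|Y1] := simp (Pt u :&: f @^-1: bspan (@tens_form K n) A B)%VS (capvSl _ _).
    + move=> [a b] D; rewrite !memv_cap -!memv_preim => /andP [DP fD].
      apply/andP; split; first exact: (iP (a, b)).
      rewrite /Oab fE /=.
      have /subvP s : (bspan (@tens_form K n) A B <= linfun (act4 (O_ a b)) @^-1: bspan (@tens_form K n) A B)%VS.
        apply/(bspan_subP _ _ _ (@tens_form_linl K n) (@tens_form_linr K n)) => x y xA yB.
        rewrite -memv_preim lfunE /= act_tens; apply: memvD; apply: mem_bspan => //;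
          first [exact: tens_form_linl | exact: tens_form_linr | exact: sA | exact: sB].
      by move: (s _ fD); rewrite -memv_preim lfunE.
    + have : C0 \in (Pt u :&: f @^-1: bspan (@tens_form K n) A B)%VS.
        rewrite memv_cap CP -memv_preim fC memvZ //; apply: mem_bspan => //;
          [exact: tens_form_linl | exact: tens_form_linr].
      by rewrite Y0 memv0 => /eqP e; move: fC0; rewrite e linear0 eqxx.
    by rewrite -{1}Y1 capvSr.
  apply/subvP => _ /memv_imgP [C CP' ->]; have := s _ CP'; rewrite -memv_preim; apply: subvP.
  apply/(bspan_subP _ _ _ (@tens_form_linl K n) (@tens_form_linr K n)) => x y xA yB.
  apply: mem_bspan; [exact: tens_form_linl | exact: tens_form_linr | exact: (subvP AM)
    | exact: (subvP BM)].
- split; first exact: sub0v.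
  + apply/stableE => phi' _ pg /memv_imgP [C CP' ->]; rewrite -fE' // memv_img //.
    by apply: (Pt_act e_in f_in nullp nullm).
  + by move=> phi' _; rewrite limg0 sub0v.
  + by move=> e; move: fC0; rewrite -memv0 e memv_img.
  move=> X /(stable_zero frameP e_in f_in nullp nullm) iX _ XN.
  have [|Y0|Y1] := simp (Pt u :&: f @^-1: X)%VS (capvSl _ _).
  + move=> [a b] D; rewrite !memv_cap -!memv_preim => /andP [DP fD].
    apply/andP; split; first exact: (iP (a, b)).
    by rewrite /Oab fE; exact: (iX (a, b)).
  + left; apply: vs0P => x xX.
    have /memv_imgP [C CP' e] := subvP XN _ xX.
    have : C \in (Pt u :&: f @^-1: X)%VS by rewrite memv_cap CP' -memv_preim -e.
    by rewrite Y0 !memv0 => /eqP e'; rewrite e e' linear0.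
  right; apply/eqP; rewrite eqEsubv XN; apply/subvP => _ /memv_imgP [C CP' ->].
  by rewrite memv_preim; apply: (subvP _ _ CP'); rewrite -{1}Y1 capvSr.
exists (tri g fr 0), phi, psi; split.
- exact: borel_tri.
- by split=> //; exact: (subvP AM).
- by split=> //; exact: (subvP BM).
have -> : tens_form phi psi = f (c^-1 *: C0) by rewrite linearZ /= fC scalerA mulVf ?scale1r.
by rewrite memv_img // memvZ.
Qed.

(** Keeping only the components with prescribed types of arguments commutes with g_0, which
    preserves types; it carries a piece into the tensor product of two graded parts of so(V). *)
Definition mask (M4 : bool -> bool -> bool -> bool -> bool) C : T :=
  mkT g fr (fun p q (r s : P) => (M4 p.1 q.1 r.1 s.1)%:R * cm C p q r s).

Lemma mask_linear M4 : linear (mask M4).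
Proof. by move=> k C C'; apply/(cmP frameP) => p q r s; rewrite cm_lin !(cm_mkT frameP) cm_lin; ring. Qed.

Let dE (s s' : bool) (x y : I) : dp K (s, x) (s', y) = (s == s')%:R * dl x y.
Proof. by rewrite /dp /dl xpair_eqE -natrM mulnb. Qed.

Lemma mask_act M4 a b C : mask M4 (act4 (O_ a b) C) = act4 (O_ a b) (mask M4 C).
Proof.
apply/(cmP frameP) => -[s1 i] [s2 j] [s3 k] [s4 l].
rewrite (cm_mkT frameP) !(cm_rot frameP) /rop !(cm_mkT frameP) /st /=.
by case: s1; case: s2; case: s3; case: s4; rewrite !dE /=; ring.
Qed.

(** Twice the degree of a frame vector; [zf] gives the components of the corresponding generator of
    z_0, as [fm_z] confirms. *)
Definition sg (p : P) : K := if p.1 then 1 else -1.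
Definition zf p q : K := sg p * dp K p (st q).
Definition cc C p q : K := \sum_t sg t * cm C p q t (st t).

(* The contraction of the last two indices with the generator of z_0, tensored with it. *)
Definition conT C : T := mkT g fr (fun p q (r s : P) => cc C p q * zf r s).

Lemma cc_lin k C (D : T) p q : cc (k *: C + D) p q = k * cc C p q + cc D p q.
Proof.
rewrite /cc mulr_sumr -big_split; apply: eq_bigr => t _; rewrite cm_lin /=; ring.
Qed.

Lemma conT_linear : linear conT.
Proof. by move=> k C C'; apply/(cmP frameP) => p q r s; rewrite cm_lin !(cm_mkT frameP) cc_lin; ring. Qed.

(** The contraction with the generator of z_0 is g_0-invariant. *)
Lemma rop_contract a b (h : P -> P -> K) :
  \sum_t sg t * (rop (e_ a) (e_ b) (fun x => h x (st t)) t + rop (e_ a) (e_ b) (h t) (st t)) = 0.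
Proof.
transitivity (\sum_t (dp K t (e_ a) * (sg t * h (e_ b) (st t)) - dp K t (f_ b) * (sg t * h (f_ a) (st t))
   + (dp K t (f_ a) * (sg t * h t (e_ b)) - dp K t (e_ b) * (sg t * h t (f_ a))))).
  by apply: eq_bigr => t _; rewrite /rop !dp_st /st /=; ring.
by rewrite big_split !sumrB /= !sum_dpC /sg /st /=; ring.
Qed.

Lemma conT_act a b C : conT (act4 (O_ a b) C) = act4 (O_ a b) (conT C).
Proof.
apply/(cmP frameP) => p q r s; rewrite (cm_mkT frameP) !(cm_rot frameP).
have E x1 x2 x3 x4 : cm (conT C) x1 x2 x3 x4 = cc C x1 x2 * zf x3 x4 by exact: cm_mkT.
have Ecc : cc (act4 (O_ a b) C) p q = rop (e_ a) (e_ b) (fun x => cc C x q) p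
    + rop (e_ a) (e_ b) (fun x => cc C p x) q.
  rewrite -[RHS]addr0 -(rop_contract a b (cm C p q)) /cc /rop !mulr_sumr -!sumrB -!big_split.
  by apply: eq_bigr => t _; rewrite (cm_rot frameP) /rop /=; ring.
have Z : rop (e_ a) (e_ b) (fun x => zf x s) r + rop (e_ a) (e_ b) (fun x => zf r x) s = 0.
  move: r s => [s1 i] [s2 j]; rewrite /rop /zf /sg /st /=.
  case: s1; case: s2; rewrite !dE /= ?(dlC K j) ?(dlC K b i) ?(dlC K a i); ring.
transitivity ((rop (e_ a) (e_ b) (fun x => cc C x q) p + rop (e_ a) (e_ b) (fun x => cc C p x) q) * zf r s
  + cc C p q * (rop (e_ a) (e_ b) (fun x => zf x s) r + rop (e_ a) (e_ b) (fun x => zf r x) s)).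
  by rewrite Z mulr0 addr0 Ecc.
by rewrite /rop !E; ring.
Qed.

End Modules.

(** * Highest weight vectors and the required Cartan products *)

Section Modules.
Variables (K : numClosedFieldType) (m n N : nat) (g : 'M[K]_n)
  (fr : bool -> 'I_m -> 'rV[K]_n) (gp gm : 'I_n -> 'M[K]_N) (xi : 'rV[K]_N).
Hypotheses (m_gt2 : (2 < m)%N) (n_eq : n = m.*2) (frameP : frame g fr)
  (cliffP : clifford_relations g gp gm).
Local Notation I := 'I_m.
Local Notation P := (bool * I)%type.
Local Notation T := (tensor4 K n).
Local Notation M := (m%:R : K).
Local Notation Sv := (Sv fr).
Local Notation Gp := (Gp fr gp).
Hypotheses (xi_e : forall i, xi *m Gp (true, i) = 0) (xi_neq0 : xi != 0).
Implicit Types (p q : P) (r s : I) (A B D F : 'I_N).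
Local Notation e_ := (pair true).
Local Notation f_ := (pair false).
Local Notation dl := (dl K).

Local Notation vanS := (vanS g fr).
Local Notation Pt := (Pt frameP).
Local Notation frm := (frm fr).
Local Notation rot := (rot g fr).
Local Notation act4 := (act4 g).
Variable Vm : {vspace 'rV[K]_n}.
Local Notation Vp := (ker_xi gp xi).
Hypotheses (e_in : forall i, frm (true, i) \in Vp) (f_in : forall i, frm (false, i) \in Vm)
  (nullp : totally_null g Vp) (nullm : totally_null g Vm).
Implicit Types (C : T) (u v : int * nat) (phi psi : 'M[K]_n).
Local Notation g0 := (g_zero g Vp Vm).
Local Notation gpos := (g_pos g Vp).
Local Notation gneg := (g_neg g Vm).

Local Notation O_ a b := (rot (e_ a) (e_ b)).
Local Notation mk := (mk g fr).
Local Notation z0_ := (z_zero g Vp Vm).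
Local Notation sl_ := (sl_zero g Vp Vm).
Local Notation hwv := (hwv g fr).
Local Notation cc := (cc fr).
Let lt0 : (0 < m)%N. Proof. by lia. Qed.
Let lt1 : (1 < m)%N. Proof. by lia. Qed.
Let ltv : (m.-2 < m)%N. Proof. by lia. Qed.
Let ltw : (m.-1 < m)%N. Proof. by lia. Qed.
(** The first two and the last two indices; for m = 3 the second and the last but one coincide. *)
Let i0 : I := Ordinal lt0.
Let i1 : I := Ordinal lt1.
Let iv : I := Ordinal ltv.
Let iw : I := Ordinal ltw.
Let v0 : i0 = 0%N :> nat. Proof. by []. Qed.
Let v1 : i1 = 1%N :> nat. Proof. by []. Qed.
Let vv : iv = m.-2 :> nat. Proof. by []. Qed.
Let vw : iw = m.-1 :> nat. Proof. by []. Qed.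

Lemma fm_neq0 phi p q : fm fr phi p q != 0 -> phi != 0.
Proof.
apply: contraNneq => ->; rewrite /fm /Sv big1 // => c _.
by rewrite big1 ?mulr0 // => d _; rewrite mxE mulr0.
Qed.

Let n01 : i0 != i1. Proof. by rewrite -val_eqE /=. Qed.
Let nvw : iv != iw. Proof. by rewrite -val_eqE /=; lia. Qed.
Let n0w : i0 != iw. Proof. by rewrite -val_eqE /=; lia. Qed.
Let n0v : i0 != iv. Proof. by rewrite -val_eqE /=; lia. Qed.
Let n1w : i1 != iw. Proof. by rewrite -val_eqE /=; lia. Qed.

Lemma rot_st p : rot (st p) p = 0.
Proof. by rewrite /rot stK /wedge subrr !scaler0. Qed.

Lemma lie_Opos a b c d : lie g (O_ a b) (rot (f_ c) (e_ d))
  = - (dl c a *: rot (f_ b) (e_ d)) - dl d a *: rot (f_ c) (e_ b).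
Proof. by rewrite (lie_rot frameP) /st /= !dpE /= !mul0r !mul1r !scale0r sub0r addr0. Qed.

Lemma lie_Oneg a b c d : lie g (O_ a b) (rot (e_ c) (f_ d))
  = dl c b *: rot (e_ a) (f_ d) + dl d b *: rot (e_ c) (f_ a).
Proof. by rewrite (lie_rot frameP) /st /= !dpE /= !mul0r !mul1r !scale0r !subr0. Qed.

(** Under [lie] the upper triangular units move e-vectors towards the last index and f-vectors
    towards the first, so the highest vector of g_1 uses the last two indices and that of g_{-1} the
    first two. *)
Lemma hwv_pos : hwv gpos gpos (rot (f_ iv) (e_ iw)).
Proof.
split=> //; [move=> a b x; exact: lie_zero_pos | exact: rotp_in | apply: hw_tri].
- apply: (@fm_neq0 _ (f_ iv) (f_ iw)); rewrite (fm_rot frameP) /st /= !dpE /= !dlii (dln K nvw).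
  by rewrite !mul1r mul0r subr0 oner_neq0.
move=> a b ab; rewrite lie_Opos; apply: memvB; rewrite ?memvN.
  have [e|/(dln K) ->] := eqVneq iv a; last by rewrite scale0r mem0v.
  have [->|nb] := eqVneq b iv; first by apply/memvZ/memv_line.
  have -> : b = iw.
    by apply: ord_inj; move: nb ab (ltn_ord b); rewrite -val_eqE /= -e ?vv ?vw; clear; lia.
  by rewrite -[f_ iw]/(st (e_ iw)) rot_st scaler0 mem0v.
have [e|/(dln K) ->] := eqVneq iw a; last by rewrite scale0r mem0v.
have -> : b = iw by apply: ord_inj; move: ab (ltn_ord b); rewrite -e vw; clear; lia.
exact/memvZ/memv_line.
Qed.

Lemma lie_zero_neg : lie_stable g fr gneg.
Proof.
move=> a b psi; have /subvP s : (gneg <= linfun (lie g (O_ a b)) @^-1: gneg)%VS.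
  apply: (gneg_sub frameP e_in f_in nullp nullm) => c d; rewrite -memv_preim lfunE /= lie_Oneg.
  by apply: memvD; apply: memvZ; exact: rotm_in.
by move=> /s; rewrite -memv_preim lfunE.
Qed.

Lemma hwv_neg : hwv gneg gneg (rot (e_ i0) (f_ i1)).
Proof.
split=> //; [exact: lie_zero_neg | exact: rotm_in | apply: hw_tri].
- apply: (@fm_neq0 _ (e_ i0) (e_ i1)); rewrite (fm_rot frameP) /st /= !dpE /= !dlii (dln K n01).
  by rewrite !mul1r mul0r subr0 oner_neq0.
move=> a b ab; rewrite lie_Oneg; apply: memvD.
  have [e|/(dln K) ->] := eqVneq i0 b; last by rewrite scale0r mem0v.
  have -> : a = i0 by apply: ord_inj; move: ab; rewrite -e v0; clear; lia.
  exact/memvZ/memv_line.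
have [e|/(dln K) ->] := eqVneq i1 b; last by rewrite scale0r mem0v.
have [->|na] := eqVneq a i1; first exact/memvZ/memv_line.
have -> : a = i0.
  by apply: ord_inj; move: na ab; rewrite -val_eqE /= -e ?v0 ?v1; clear; lia.
by rewrite -[e_ i0]/(st (f_ i0)) rot_st scaler0 mem0v.
Qed.

Lemma sl_sub : (sl_ <= g0)%VS.
Proof.
apply/(bspan_subP _ _ _ (lie_linl g) (lie_linr g)) => x y xg yg.
have /subvP s : (g0 <= lin_of (lie_linl g y) @^-1: g0)%VS; last first.
  by have := s _ xg; rewrite -memv_preim lin_ofE.
apply: (g0_sub frameP e_in f_in nullp nullm) => a b; rewrite -memv_preim lin_ofE.
have /subvP s : (g0 <= linfun (lie g (O_ a b)) @^-1: g0)%VS; last first.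
  by have := s _ yg; rewrite -memv_preim lfunE.
apply: (g0_sub frameP e_in f_in nullp nullm) => c d; rewrite -memv_preim lfunE /= (lie_OO frameP).
by apply: memvB; apply: memvZ; exact: rot0_in.
Qed.

Lemma hwv_sl : hwv sl_ sl_ (O_ i0 iw).
Proof.
have lin : forall x y, x \in g0 -> y \in g0 -> lie g x y \in sl_.
  by move=> x y xg yg; apply: mem_bspan; [exact: lie_linl | exact: lie_linr | |].
split=> //.
- by move=> a b x xs; apply: lin; [exact: rot0_in | exact: (subvP sl_sub)].
- have -> : O_ i0 iw = lie g (O_ i0 i0) (O_ i0 iw).
    by rewrite (lie_HO frameP) dlii (dln K n0w) subr0 scale1r.
  by apply: lin; exact: rot0_in.
apply: hw_tri => [|a b ab]; [exact: O_neq0 | rewrite (lie_OO frameP); apply: memvB].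
  have [e|/(dln K) ->] := eqVneq b i0; last by rewrite scale0r mem0v.
  have -> : a = i0 by apply: ord_inj; move: ab; rewrite e v0; clear; lia.
  exact/memvZ/memv_line.
have [e|/(dln K) ->] := eqVneq a iw; last by rewrite scale0r mem0v.
have -> : b = iw by apply: ord_inj; move: ab (ltn_ord b); rewrite e vw; clear; lia.
exact/memvZ/memv_line.
Qed.

Definition zz_form : 'M[K]_n := \sum_i O_ i i.

Lemma lie_Oz a b : lie g (O_ a b) zz_form = 0.
Proof.
rewrite linear_sum /=; under eq_bigr => i _ do rewrite (lie_OO frameP).
rewrite sumrB (bigD1 b) //= dlii scale1r big1 ?addr0; last first.
  by move=> i; rewrite eq_sym => /(dln K) ->; rewrite scale0r.
rewrite (bigD1 a) //= dlii scale1r big1 ?addr0 ?subrr // => i.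
by rewrite eq_sym => /(dln K) ->; rewrite scale0r.
Qed.

Lemma fm_z (r' s' : P) : fm fr zz_form r' s' = zf K r' s'.
Proof.
have -> : fm fr zz_form r' s' = \sum_i fm fr (O_ i i) r' s'.
  rewrite /zz_form; elim/big_rec2: _ => [|i x y _ e]; first by rewrite /fm /Sv big1 // => c _;
    rewrite big1 ?mulr0 // => d _; rewrite mxE mulr0.
  by rewrite -[O_ i i]scale1r fm_lin mul1r e scale1r.
move: r' s' => [s1 i] [s2 j]; under eq_bigr => k _ do rewrite (fm_rot frameP) /st /= !dpE.
rewrite /zf /sg /st /= dpE; case: s1; case: s2; rewrite /= ?mul1r ?mul0r;
 under eq_bigr => k _ do rewrite ?mul0r ?mul1r ?subr0 ?sub0r ?mulr0 ?subr0; rewrite ?sumrN ?big1_eq ?oppr0 ?mulr0 //.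
- by rewrite (eq_bigr (fun k => dl i k * dl j k)) // sum_dl dlC.
- by rewrite sum_dl dlC mulN1r.
Qed.

Lemma sub_bigcap (s : seq 'M[K]_n) (U : 'M[K]_n -> {vspace 'M[K]_n}) x :
  (forall y, y \in s -> x \in U y) -> x \in (\bigcap_(y <- s) U y)%VS.
Proof.
elim: s => [|y s IHs] h; first by rewrite big_nil memvf.
rewrite big_cons memv_cap h ?mem_head //; apply: IHs => z zs; apply: h.
by rewrite inE zs orbT.
Qed.

Lemma hwv_z : hwv z0_ <[zz_form]>%VS zz_form.
Proof.
have zg : zz_form \in g0 by apply: memv_suml => i _; exact: rot0_in.
split; last 1 first.
- apply: hw_tri => [|a b _]; [| by rewrite lie_Oz mem0v].
  by apply: (@fm_neq0 _ (e_ i0) (f_ i0)); rewrite fm_z /zf /sg /st /= dpE dlii !mul1r oner_neq0.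
- rewrite -memvE memv_cap zg; apply: sub_bigcap => phi pg'; have pg := vbasis_mem pg'.
  rewrite memv_ker lfunE /=.
  have /subvP s : (g0 <= lker (lin_of (lie_linl g zz_form)))%VS.
    by apply: (g0_sub frameP e_in f_in nullp nullm) => a b; rewrite memv_ker lin_ofE lie_Oz.
  by have := s _ pg; rewrite memv_ker lin_ofE.
- move=> a b _ /vlineP [k ->].
  have -> : lie g (O_ a b) (k *: zz_form) = k *: lie g (O_ a b) zz_form by exact: linearZ.
  by rewrite lie_Oz scaler0 mem0v.
- exact: memv_line.
Qed.

Lemma mk_Pt u (F : tensor4 K m) : u \in labels -> mods (levQ u) u.2 F -> mk (levQ u) (levb u) F \in Pt u.
Proof.
move=> ul MF; have l2 := lab_le2 ul; have lF := mods_lvl MF.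
by apply/(mem_part frameP _ _ (lab_ok ul)); rewrite rdC_mk //; split=> //; exact: mk_weyl.
Qed.

Lemma cc_mk1 b (F : tensor4 K m) p q : cc (mk 1 b F) p q =
  if (p.1 == b) && (q.1 == b) then (if b then 2 else - 2) * z1 F p.2 q.2 else 0.
Proof.
move: p q => [s1 i] [s2 j]; rewrite /cc (sum_P _ true) /z1 mulr_sumr -big_split /=.
case: b; case: s1; case: s2 => /=; first [rewrite big1 // => k _ | apply: eq_bigr => k _];
 rewrite !(cm_mk frameP) /emb /st /sg /=; ring.
Qed.

Lemma cc_mk0 (F : tensor4 K m) p q : riem0 F -> cc (mk 0 true F) p q =
  if p.1 == q.1 then 0 else 2 * sg K p * (if p.1 then z0 F p.2 q.2 else z0 F q.2 p.2).
Proof.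
move=> [s _]; have Z x y : z0 F x y = \sum_k ev F x k y k by apply: eq_bigr => k _; rewrite s.
move: p q => [s1 i] [s2 j]; rewrite /cc (sum_P _ true) !Z -big_split /=.
case: s1; case: s2 => /=; rewrite ?mulr_sumr; first [rewrite big1 // => k _ | apply: eq_bigr => k _];
 rewrite !(cm_mk frameP) /emb /st /sg /= ?(s k); ring.
Qed.

Definition cart u (M1 M2 : {vspace 'M[K]_n}) : Prop := exists N, cartan_product g g0 M1 M2 N /\
    quo_isomorphic g g0 (vanS (below u)) (vanS (fun v => (v.1 < u.1 + 1)%R)) N.

Lemma cart_mask u (M4 : bool -> bool -> bool -> bool -> bool) (M1 M2 A B : {vspace 'M[K]_n}) c phi psi (F : tensor4 K m) :
  u \in labels -> present m u -> hwv M1 A phi -> hwv M2 B psi -> c != 0 ->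
  mods (levQ u) u.2 F ->
  (forall p q (r s : P), (M4 p.1 q.1 r.1 s.1)%:R * emb (levQ u) (levb u) F p q r s
    = c * (fm fr phi p q * fm fr psi r s)) -> cart u M1 M2.
Proof.
move=> ul pu hA hB c0 MF E.
have fE a b C : lin_of (mask_linear frameP M4) (act4 (O_ a b) C)
    = act4 (O_ a b) (lin_of (mask_linear frameP M4) C) by rewrite !lin_ofE (mask_act frameP).
have fC : lin_of (mask_linear frameP M4) (mk (levQ u) (levb u) F) = c *: tens_form phi psi.
  apply/(cmP frameP) => p q r s.
  by rewrite lin_ofE (cm_mkT frameP) cmZ cm_tens (cm_mk frameP).
exact: (cartan_of m_gt2 n_eq xi_neq0 e_in f_in nullp nullm ul pu fE hA hB c0 (mk_Pt ul MF) fC).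
Qed.

(** A factor z_0 cannot be singled out by types of arguments; instead the last pair is contracted
    with its generator, which leaves the factor in [M1]. *)
Lemma cart_con u (M1 A : {vspace 'M[K]_n}) c phi (F : tensor4 K m) :
  u \in labels -> present m u -> hwv M1 A phi -> c != 0 ->
  mods (levQ u) u.2 F ->
  (forall p q, cc (mk (levQ u) (levb u) F) p q = c * fm fr phi p q) -> cart u M1 z0_.
Proof.
move=> ul pu hA c0 MF E.
apply: (cartan_of (f := lin_of (conT_linear frameP)) m_gt2 n_eq (frameP := frameP) xi_neq0 e_in f_in nullp nullm
  ul pu _ hA hwv_z c0 (mk_Pt ul MF)).
  by move=> a b C; rewrite !lin_ofE (conT_act frameP).
apply/(cmP frameP) => p q r s.
by rewrite lin_ofE (cm_mkT frameP) cmZ cm_tens fm_z E mulrA.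
Qed.

Ltac comps F := move=> [[] i] [[] j] [[] k] [[] l]; rewrite !(fm_rot frameP) /emb /st /=
  !dpE /= /F ?ev_mkA /wd
   ?(dlC K i0) ?(dlC K i1) ?(dlC K iv) ?(dlC K iw); ring.

Lemma cart_2 : cart (Posz 2, 0%N) gpos gpos.
Proof.
apply: (@cart_mask _ (fun _ _ _ _ => true) _ _ _ _ 1 _ _ (curvW K iv iw) _ _ hwv_pos hwv_pos) => //.
- exact: oner_neq0.
- exact: curvW_in.
comps curvW.
Qed.

Lemma cart_m2 : cart (Negz 1, 0%N) gneg gneg.
Proof.
apply: (@cart_mask _ (fun _ _ _ _ => true) _ _ _ _ 1 _ _ (curvW K i0 i1) _ _ hwv_neg hwv_neg) => //.
- exact: oner_neq0.
- exact: curvW_in.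
comps curvW.
Qed.

Lemma cart_1_1 : cart (Posz 1, 1%N) gpos sl_.
Proof.
apply: (@cart_mask _ (fun s1 s2 s3 s4 : bool => ~~ s1 && ~~ s2 && (s3 != s4)) _ _ _ _ 1 _ _
  (hookW K iw iv i0) _ _ hwv_pos hwv_sl) => //.
- exact: oner_neq0.
- by apply: hookW_in; rewrite eq_sym.
comps hookW.
Qed.

Lemma cart_m1_1 : cart (Negz 0, 1%N) gneg sl_.
Proof.
apply: (@cart_mask _ (fun s1 s2 s3 s4 : bool => s1 && s2 && (s3 != s4)) _ _ _ _ 1 _ _
  (hookW K i0 i1 iw) _ _ hwv_neg hwv_sl) => //.
- exact: oner_neq0.
- exact: hookW_in.
comps hookW.
Qed.

Lemma cart_0_3 : cart (Posz 0, 3%N) sl_ sl_.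
Proof.
apply: (@cart_mask _ (fun s1 s2 s3 s4 : bool => (s1 != s2) && (s3 != s4)) _ _ _ _ 1 _ _
  (symW K i0 iw) _ _ hwv_sl hwv_sl) => //.
- exact: oner_neq0.
- exact: symW_in.
comps symW.
Qed.

Lemma cart_0_2 : (3 < m)%N -> cart (Posz 0, 2%N) gpos gneg.
Proof.
move=> m3; have n1v : i1 != iv by rewrite -val_eqE /=; lia.
(* The factor 2 arises since on f, f, e, e the degree 0 embedding skew-symmetrises an array that is
   already skew. *)
apply: (@cart_mask _ (fun s1 s2 s3 s4 : bool => [&& ~~ s1, ~~ s2, s3 & s4]) _ _ _ _ 2 _ _
  (altW K i0 i1 iv iw) _ _ hwv_pos hwv_neg) => //.
- by rewrite /present /=; apply/eqP => e; rewrite e in m3.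
- by rewrite pnatr_eq0.
- exact: altW_in.
comps altW.
Qed.

Let mp : M + 1 != 0. Proof. by rewrite natr1 pnatr_eq0. Qed.

Ltac wdsk := by move=> *; rewrite /wd; ring.

Lemma cart_1_0 : cart (Posz 1, 0%N) gpos z0_.
Proof.
(* The contraction is - 2 times [z1], and [z1] of [iota1 T] is 2 (M + 1) T. *)
apply: (@cart_con _ _ _ (- (4 * (M + 1))) _ (iota1 (wd K iv iw)) _ _ hwv_pos) => //.
- by rewrite oppr_eq0 mulf_neq0 ?pnatr_eq0.
- exact: lam_iota1W.
move=> [s1 i] [s2 j]; rewrite cc_mk1 z1_iota1; last wdsk.
rewrite (fm_rot frameP) /st /=; case: s1; case: s2; rewrite /= !dpE /= /wd ?(dlC K iv) ?(dlC K iw); ring.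
Qed.

Lemma cart_m1_0 : cart (Negz 0, 0%N) gneg z0_.
Proof.
apply: (@cart_con _ _ _ (4 * (M + 1)) _ (iota1 (wd K i0 i1)) _ _ hwv_neg) => //.
- by rewrite mulf_neq0 ?pnatr_eq0.
- exact: lam_iota1W.
move=> [s1 i] [s2 j]; rewrite cc_mk1 z1_iota1; last wdsk.
rewrite (fm_rot frameP) /st /=; case: s1; case: s2; rewrite /= !dpE /= /wd ?(dlC K i0) ?(dlC K i1); ring.
Qed.

Lemma cart_0_1 : cart (Posz 0, 1%N) sl_ z0_.
Proof.
apply: (@cart_con _ _ _ 2 _ (iota0 (fun i j => dl i0 i * dl iw j)) _ _ hwv_sl) => //.
- by rewrite pnatr_eq0.
- exact: sl0_iota0.
move=> [s1 i] [s2 j]; rewrite cc_mk0; last exact: riem0_iota0.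
rewrite !z0_iota0 // (fm_rot frameP) /st /sg /=; case: s1; case: s2;
 rewrite /= !dpE /= ?(dlC K i0) ?(dlC K iw); ring.
Qed.

Lemma cart_0_0 : cart (Posz 0, 0%N) z0_ z0_.
Proof.
apply: (@cart_con _ _ _ 2 _ (iota0 (fun i j => dl i j)) _ _ hwv_z) => //.
- by rewrite pnatr_eq0.
- exact: triv0_iota0.
move=> [s1 i] [s2 j]; rewrite cc_mk0; last exact: riem0_iota0.
rewrite !z0_iota0 // fm_z /zf /st /sg /=; case: s1; case: s2;
 rewrite /= !dpE /= ?(dlC K j i); ring.
Qed.

End Modules.

(** * Existence of an adapted frame *)

Section FrameExistence.
Variables (K : numClosedFieldType) (m n : nat) (g : 'M[K]_n) (Vp Vm : {vspace 'rV[K]_n}).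
Hypotheses (gT : g^T = g) (gU : g \in unitmx) (n_eq : n = m.*2).
Hypotheses (nullp : totally_null g Vp) (nullm : totally_null g Vm) (dimp : \dim Vp = m).
Hypotheses (cap0 : (Vp :&: Vm = 0)%VS) (add1 : (Vp + Vm = fullv)%VS).
Implicit Types (u v w x : 'rV[K]_n).

Definition bil u v : K := (u *m g *m v^T) 0 0.

Lemma bilC u v : bil u v = bil v u.
Proof.
rewrite /bil -[u *m g *m v^T]trmxK [in LHS]mxE !trmx_mul !trmxK gT mulmxA.
by [].
Qed.

Lemma bil_linr u : is_linform (bil u).
Proof.
by move=> k x y; rewrite /bil linearD linearZ /= mulmxDr -scalemxAr [LHS]mxE [X in X + _]mxE.
Qed.

Lemma bil0r u : bil u 0 = 0. Proof. by rewrite /bil trmx0 mulmx0 mxE. Qed.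
Lemma bilDr u x y : bil u (x + y) = bil u x + bil u y.
Proof. by rewrite -[x]scale1r bil_linr mul1r scale1r. Qed.
Lemma bilZr u k x : bil u (k *: x) = k * bil u x.
Proof. by rewrite -[k *: x]addr0 bil_linr bil0r addr0. Qed.
Lemma bil_sumr u (I : finType) (F : I -> 'rV[K]_n) : bil u (\sum_i F i) = \sum_i bil u (F i).
Proof. by elim/big_rec2: _ => [|i x y _ e]; rewrite ?bil0r // bilDr e. Qed.

Lemma bil_null (V : {vspace 'rV[K]_n}) u v : totally_null g V -> u \in V -> v \in V -> bil u v = 0.
Proof. by move=> h uV vV; rewrite /bil h // mxE. Qed.

Lemma bil_nondeg u : (forall v, bil u v = 0) -> u = 0.
Proof.
move=> h; have : u *m g = 0.
  apply/rowP => a; rewrite [RHS]mxE; have := h (delta_mx 0 a); rewrite /bil trmx_delta.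
  rewrite mxE (bigD1 a) //= [delta_mx _ _ _ _]mxE !eqxx mulr1 big1 ?addr0 // => b /negPf ne.
  by rewrite [delta_mx _ _ _ _]mxE ne mulr0.
by move/(congr1 (mulmx^~ (invmx g))); rewrite mulmxK // mul0mx.
Qed.

(** The f_i are the basis of V_{-1/2} dual to a basis e_i of V_{1/2}. A vector of V_{-1/2}
    orthogonal to all e_i is orthogonal to both halves, hence 0; the dimensions agree, so the
    pairing is perfect. *)
Lemma frame_exists : exists fr : bool -> 'I_m -> 'rV[K]_n,
  frame g fr /\ forall i, fr true i \in Vp /\ fr false i \in Vm.
Proof.
have dimm : \dim Vm = m.
  have := dimv_disjoint_sum cap0; rewrite add1 dimvf dimp /dim /= mul1n => e0.
  by apply: (@addnI m); rewrite -e0 addnn -n_eq.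
pose e (i : 'I_m) := (vbasis Vp)`_i.
have eV i : e i \in Vp by apply: vbasis_mem; rewrite mem_nth // size_tuple dimp.
have eE u : u \in Vp -> exists c, u = \sum_i c i *: e i.
  move=> uV; exists (fun i => coord (vbasis Vp) (cast_ord (esym dimp) i) u).
  rewrite {1}(coord_vbasis uV) (reindex (cast_ord (esym dimp))) //=.
  by exists (cast_ord dimp) => i _; apply: ord_inj.
have lin : linear (fun u : 'rV[K]_n => \row_j bil (e j) u).
  by move=> k x y; apply/rowP => j; rewrite !mxE bil_linr.
pose L := lin_of lin.
have inj u : u \in Vm -> (forall j, bil (e j) u = 0) -> u = 0.
  move=> um h; apply: bil_nondeg => v; have : v \in (Vp + Vm)%VS by rewrite add1 memvf.
  case/memv_addP => x /eE [c ->] [y ym ->]; rewrite bilDr bil_sumr big1 => [|i _].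
    by rewrite add0r (bil_null nullm).
  by rewrite bilZr bilC h mulr0.
have Lf : (L @: Vm)%VS = fullv.
  apply/eqP; rewrite eqEdim subvf /= limg_dim_eq ?dimm ?dimvf /dim /= ?mul1n //.
  apply: vs0P => u; rewrite memv_cap memv_ker lin_ofE => /andP [um /eqP h].
  by rewrite memv0; apply/eqP/inj => // j; have := congr1 (fun M : 'rV_m => M 0 j) h; rewrite !mxE.
have ex i : exists f, f \in Vm /\ forall j, bil (e j) f = (j == i)%:R.
  have : delta_mx 0 i \in (L @: Vm)%VS by rewrite Lf memvf.
  case/memv_imgP => f fm; rewrite lin_ofE => h; exists f; split=> // j.
  by have := congr1 (fun M : 'rV_m => M 0 j) h; rewrite !mxE eqxx.
have [f fP] := choice ex; pose fr (b : bool) := if b then e else f.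
have dual p q : bil (frm fr p) (frm fr q) = dp K p (st q).
  move: p q => [[] i] [[] j]; rewrite /frm /fr /dp /st /= ?xpair_eqE /=.
  - by rewrite (bil_null nullp).
  - by rewrite (proj2 (fP j)).
  - by rewrite bilC (proj2 (fP i)) eq_sym.
  - by rewrite (bil_null nullm) // ?(proj1 (fP _)).
exists fr; split; last by move=> i; split=> //; case: (fP i).
(* The error [d] of the expansion is orthogonal to the whole frame; its two halves vanish one after
   the other. *)
split=> // v; apply: subr0_eq; set d := _ - _.
have dz q : bil d (frm fr q) = 0.
  rewrite bilC /d bilDr -scaleN1r bilZr bil_sumr (bigD1 (st q)) //= bilZr dual stK dpp mulr1.
  rewrite big1 ?addr0 => [|p ne]; first by rewrite mulN1r -[(v *m g *m _) 0 0]/(bil v (frm fr q)) (bilC v) subrr.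
  by rewrite bilZr dual -dp_st dpC /dp; move/negPf: ne => ->; rewrite mulr0.
have : d \in (Vp + Vm)%VS by rewrite add1 memvf.
case/memv_addP => x xp [y ym E]; have y0 : y = 0.
  apply: inj => // j; have := dz (true, j); rewrite E bilC bilDr /frm /=.
  by rewrite (bil_null nullp) // add0r.
move: E; rewrite y0 addr0 => E; have [c xE] := eE x xp.
rewrite E xE big1 // => j _; have := dz (false, j).
rewrite E xE bilC bil_sumr (bigD1 j) //= bilZr bilC (dual (true, j)) /st /= dpp mulr1.
rewrite big1 ?addr0 => [->|i ne]; first by rewrite scale0r.
by rewrite bilZr bilC (dual (true, i) (false, j)) /st /= /dp xpair_eqE /= (negPf ne) mulr0.
Qed.

End FrameExistence.

(** * The statement in terms of labels *)

Section Modules.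
Variables (K : numClosedFieldType) (m n N : nat) (g : 'M[K]_n)
  (fr : bool -> 'I_m -> 'rV[K]_n) (gp gm : 'I_n -> 'M[K]_N) (xi : 'rV[K]_N).
Hypotheses (m_gt2 : (2 < m)%N) (n_eq : n = m.*2) (frameP : frame g fr)
  (cliffP : clifford_relations g gp gm).
Local Notation I := 'I_m.
Local Notation P := (bool * I)%type.
Local Notation T := (tensor4 K n).
Local Notation Gp := (Gp fr gp).
Hypotheses (xi_e : forall i, xi *m Gp (true, i) = 0) (xi_neq0 : xi != 0).
Implicit Types (p q : P) (r s : I) (A B D F : 'I_N).

Local Notation vanS := (vanS g fr).
Local Notation Pt := (Pt frameP).
Local Notation frm := (frm fr).
Variable Vm : {vspace 'rV[K]_n}.
Local Notation Vp := (ker_xi gp xi).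
Hypotheses (e_in : forall i, frm (true, i) \in Vp) (f_in : forall i, frm (false, i) \in Vm)
  (nullp : totally_null g Vp) (nullm : totally_null g Vm).
Implicit Types (C : T) (u v : int * nat) (phi psi : 'M[K]_n).
Local Notation p_ := (p_alg g gp xi).

Lemma component_typeP (k : int) (j : nat) (M1 M2 : {vspace 'M[K]_n}) (d : rat) :
  -2 <= k <= 2 -> (k, j) \in labels -> j \in indices n k -> present m (k, j) ->
  cart g fr gp xi Vm (k, j) M1 M2 -> (\dim (Pt (k, j)))%:R = d ->
  component_type g gp gm xi Vm k j M1 M2 d.
Proof.
move=> kr ul jk pu cu dE; have kr' : -2 <= k + 1 <= 3 by move: kr; clear; lia.
have Ec := comp_vanS m_gt2 n_eq frameP cliffP xi_e xi_neq0 kr jk.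
have Ef := filt_vanS m_gt2 n_eq frameP cliffP xi_e xi_neq0 kr'.
split.
- rewrite Ec Ef; have P0 : Pt (k, j) <> 0%VS by exact: Pt_neq0.
  have Q : quo_irreducible g p_ (vanS (below (k, j))) (vanS (fun v => (v.1 < (k, j).1 + 1)%R)).
    exact: (vanS_quo_irreducible m_gt2 cliffP xi_e xi_neq0 e_in f_in nullp nullm ul P0).
  exact: Q.
- by rewrite Ec Ef.
by rewrite /quo_dim Ec Ef (dim_quo m_gt2 frameP ul) natrD addrAC subrr add0r.
Qed.

Lemma breve_inclusionP (k : int) (j l : nat) : k \in degs -> k - 1 \in degs ->
  j \in indices n k -> l \in indices n (k - 1) ->
  present m (k, j) -> present m (k - 1, l) ->
  breve_inclusion g gp gm xi Vm k j l <-> arrowed (k, j) (k - 1, l).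
Proof.
move=> kd kd' jk lk pu pw.
have ul := lab_of_idx n_eq kd jk; have wl := lab_of_idx n_eq kd' lk.
have rg (i : int) : i \in degs -> -2 <= i <= 2 by move: i; apply: degs_ind.
have B (i : int) (s : nat) X : i \in degs -> s \in indices n i -> present m (i, s) ->
    weyl_breve g gp gm xi Vm i s X <-> X = Pt (i, s).
  move=> id si ps; have il := lab_of_idx n_eq id si.
  have ir := rg _ id; have ir' : -2 <= i + 1 <= 3 by move: ir; clear; lia.
  have Ec := comp_vanS m_gt2 n_eq frameP cliffP xi_e xi_neq0 ir si.
  have Ef := filt_vanS m_gt2 n_eq frameP cliffP xi_e xi_neq0 ir'.
  by rewrite /weyl_breve Ec Ef; exact: (breve_Pt m_gt2 frameP e_in f_in nullp nullm il ps).
rewrite -(hits_arrow m_gt2 frameP ul wl _ pu pw) ?subrK //.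
rewrite -(hits_inclusion m_gt2 frameP e_in f_in nullp nullm ul wl _ pu) ?subrK //.
split=> [h|h X Y /B -> // /B -> //]; by apply: h; apply/B.
Qed.

(** If (k - 1, l) is not among the labels below (k, j), its piece lies in the first kernel but not
    in the second. Otherwise the labels below it are below (k, j) too. *)
Lemma ker_inclusionP (k : int) (j l : nat) : k \in degs -> k - 1 \in degs -> k <= 1 ->
  j \in indices n k -> l \in indices n (k - 1) ->
  present m (k, j) -> present m (k - 1, l) ->
  (ker_Pi g gp gm xi k j <= ker_Pi g gp gm xi (k - 1) l)%VS <-> arrowed (k, j) (k - 1, l).
Proof.
move=> kd kd' k1 jk lk pu pw.
have ul := lab_of_idx n_eq kd jk; have wl := lab_of_idx n_eq kd' lk.
have k1' : k - 1 <= 1 by move: k1; clear; lia.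
rewrite (ker_vanS m_gt2 n_eq frameP cliffP xi_e xi_neq0 kd k1 jk).
rewrite (ker_vanS m_gt2 n_eq frameP cliffP xi_e xi_neq0 kd' k1' lk).
(* Transitivity of the order of labels, verified by evaluation over all of them. *)
have tr : (k - 1, l) \in under k j -> {subset under (k - 1) l <= under k j}.
  have : all (fun u : int * nat => all (fun v : int * nat => (v \in under u.1 u.2) ==>
    (v.1 == u.1 - 1) ==> all (mem (under u.1 u.2)) (under v.1 v.2)) labels) labels by [].
  move=> /allP /(_ _ ul) /allP /(_ _ wl) /= /implyP h /h; rewrite eqxx /= => /allP; exact.
have self : (k - 1, l) \in under (k - 1) l.
  have : all (fun u : int * nat => (u.1 <= 1) ==> (u \in under u.1 u.2)) labels by [].
  by move=> /allP /(_ _ wl) /implyP /(_ k1').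
rewrite /arrowed /= (_ : (k == 2) = false) /=; last by apply/eqP => e; move: k1; rewrite e.
split=> [h|h]; last by apply: vanS_sub => u _; exact: tr.
apply: contraT => nin; case: (Pt_neq0 (frameP := frameP) m_gt2 wl pw).
apply: vs0P => C CP; rewrite memv0; apply/eqP.
apply: (Pt_van0 m_gt2 wl CP).
have CS : C \in vanS (mem (under k j)).
  exact: (subvP (@Pt_vanS _ _ _ _ _ m_gt2 frameP _ (mem (under k j)) wl nin) _ CP).
by have /vanSP [_ hv] := subvP h _ CS; exact: hv.
Qed.

End Modules.

From mathcomp Require Import complex reals.

Section WeylModules.
Variables (R : realType) (m : nat) (g : 'M[R[i]]_(m.*2)).
Variables (gp gm : 'I_(m.*2) -> 'M[R[i]]_(2 ^ m.-1)%N) (xi : 'rV[R[i]]_(2 ^ m.-1)%N).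
Local Notation Vp := (ker_xi gp xi).

Lemma ker_xiP v : v \in Vp <-> xi *m (\sum_a v 0 a *: gp a) = 0.
Proof.
have E : v *m xi_low gp xi = xi *m (\sum_a v 0 a *: gp a).
  rewrite mulmx_sumr; apply/rowP => A; rewrite [LHS]mxE summxE; apply: eq_bigr => a _.
  by rewrite -scalemxAr [in LHS]mxE [in RHS]mxE.
by rewrite memv_ker lfunE /= E; split=> /eqP.
Qed.

(* Clifford's relation applied to xi for two elements of the kernel gives g(u, v) xi = 0. *)
Lemma ker_xi_null : clifford_relations g gp gm -> xi != 0 -> totally_null g Vp.
Proof.
move=> cl x0 u v /ker_xiP uk /ker_xiP vk.
pose Gu := \sum_a u 0 a *: gp a; pose Gv := \sum_b v 0 b *: gp b.
pose Hu := \sum_a u 0 a *: gm a; pose Hv := \sum_b v 0 b *: gm b.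
have E : 2^-1 *: (Gu *m Hv + Gv *m Hu) = - ((u *m g *m v^T) 0 0)%:M.
  have -> : Gv *m Hu = \sum_a \sum_b (u 0 a * v 0 b) *: (gp b *m gm a).
    rewrite mulmx_sumr; apply: eq_bigr => a _; rewrite mulmx_suml; apply: eq_bigr => b _.
    by rewrite -scalemxAr -scalemxAl scalerA.
  have -> : Gu *m Hv = \sum_a \sum_b (u 0 a * v 0 b) *: (gp a *m gm b).
    rewrite mulmx_suml; apply: eq_bigr => a _; rewrite mulmx_sumr; apply: eq_bigr => b _.
    by rewrite -scalemxAr -scalemxAl !scalerA mulrC.
  have -> : (u *m g *m v^T) 0 0 = \sum_a \sum_b u 0 a * v 0 b * g a b.
    rewrite exchange_big [LHS]mxE; apply: eq_bigr => b _; rewrite [X in X * _]mxE [X in _ * X]mxE mulr_suml.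
    by apply: eq_bigr => a _; ring.
  rewrite raddf_sum -sumrN -big_split scaler_sumr; apply: eq_bigr => a _ /=.
  rewrite raddf_sum -sumrN -big_split scaler_sumr; apply: eq_bigr => b _ /=.
  rewrite -scalerDr scalerA mulrC -scalerA (proj1 (cl a b)) scalerN.
  by rewrite scale_scalar_mx.
have : xi *m - ((u *m g *m v^T) 0 0)%:M = 0.
  by rewrite -E -scalemxAr mulmxDr !mulmxA uk vk !mul0mx addr0 scaler0.
rewrite mulmxN mul_mx_scalar => /eqP; rewrite oppr_eq0 scaler_eq0 (negPf x0) orbF => /eqP e.
by apply/matrixP => a b; rewrite !ord1 e mxE.
Qed.

End WeylModules.

(** The dimensions are known as subtraction-free identities between natural numbers; in [rat] these
    are linear in the dimension. *)
Ltac summand T frameP m_gt2 M k j c :=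
  apply: (T k j _ _ _ isT isT _ c); first (by apply/implyP => // _; apply/eqP);
  move/(congr1 (fun x : nat => x%:R : rat)): (Pt_dims m_gt2 frameP (u := (k, j)) isT);
  rewrite /= ?natrD ?natrM ?natrX -/M; move: (\dim _)%:R => d; lra.

Theorem proposition4p3 (R : realType) (m : nat)
    (g : 'M[R[i]]_(m.*2))
    (gp gm : 'I_(m.*2) -> 'M[R[i]]_(2 ^ m.-1)%N)
    (xi : 'rV[R[i]]_(2 ^ m.-1)%N)
    (Vm : {vspace 'rV[R[i]]_(m.*2)}) :
  let Vp := ker_xi gp xi in
  let p := p_alg g gp xi in
  let gpos := g_pos g Vp in
  let gneg := g_neg g Vm in
  let z0 := z_zero g Vp Vm in
  let sl0 := sl_zero g Vp Vm in
  let Cf := weyl_filtration g gp gm xi in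
  let Cc := weyl_component g gp gm xi in
  let J := indices m.*2 in
  let has_type := component_type g gp gm xi Vm in
  let M : rat := m%:R in
  (2 < m)%N ->
  g^T = g -> g \in unitmx ->
  clifford_relations g gp gm ->
  pure_spinor gp xi ->
  totally_null g Vm -> (Vp :&: Vm = 0)%VS -> (Vp + Vm = fullv)%VS ->
  [/\ (* the filtration *)
      [/\ Cf (-2) = weyl g, Cf 3 = 0%VS,
          forall k : int, -2 <= k <= 2 -> (Cf (k + 1)%R <= Cf k)%VS
        & forall k : int, -2 <= k <= 3 -> stable g p (Cf k)],
      (* Cf k / Cf (k + 1) is the direct sum of the Cc k j / Cf (k + 1) *)
      forall k : int, -2 <= k <= 2 ->
        Cf k = (\sum_(j <- J k) Cc k j)%VS /\
        forall j, j \in J k ->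
          (Cf (k + 1)%R <= Cc k j)%VS /\
          (Cc k j :&: \sum_(l <- J k | l != j) Cc k l <= Cf (k + 1)%R)%VS,
      (* the summands *)
      [/\ has_type 2 0%N gpos gpos (M ^+ 2 * (M ^+ 2 - 1) / 12)
            /\ has_type (-2) 0%N gneg gneg (M ^+ 2 * (M ^+ 2 - 1) / 12),
          has_type 1 0%N gpos z0 (M * (M - 1) / 2)
            /\ has_type (-1) 0%N gneg z0 (M * (M - 1) / 2),
          has_type 1 1%N gpos sl0 (M ^+ 2 * (M ^+ 2 - 4) / 3)
            /\ has_type (-1) 1%N gneg sl0 (M ^+ 2 * (M ^+ 2 - 4) / 3),
          has_type 0 0%N z0 z0 1 /\ has_type 0 1%N sl0 z0 (M ^+ 2 - 1)
        & (m <> 3%N ->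
             has_type 0 2%N gpos gneg (M ^+ 2 * (M + 1) * (M - 3) / 4))
            /\ has_type 0 3%N sl0 sl0 (M ^+ 2 * (M - 1) * (M + 3) / 4)],
      (* the arrows *)
      forall (k : int) (j l : nat), (k, j, l) \in arrows m.*2 ->
        breve_inclusion g gp gm xi Vm k j l
    & forall (k : int) (j l : nat), k <= 1 -> j \in J k -> l \in J (k - 1) ->
        breve_inclusion g gp gm xi Vm k j l <->
        (ker_Pi g gp gm xi k j <= ker_Pi g gp gm xi (k - 1) l)%VS].
Proof.
move=> Vp p gpos gneg z0 sl0 Cf Cc J has_type M m_gt2 gT gU cl [xi0 dimVp] nullm cap0 add1.
have nullp : totally_null g Vp by exact: ker_xi_null.
have dimp : \dim Vp = m by apply: double_inj.
have [fr [frameP frV]] := frame_exists gT gU erefl nullp nullm dimp cap0 add1.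
have e_in i : frm fr (true, i) \in Vp by exact: (proj1 (frV i)).
have f_in i : frm fr (false, i) \in Vm by exact: (proj2 (frV i)).
have xi_e i : xi *m Gp fr gp (true, i) = 0 by apply/ker_xiP; exact: e_in.
have rg (k : int) : k \in degs -> -2 <= k <= 2 by move: k; apply: degs_ind.
split.
- split; [exact: (filt_weyl m_gt2 erefl frameP cl xi_e xi0) | by [] | |].
    by move=> k kr; exact: (filt_le m_gt2 erefl frameP cl xi_e xi0).
  move=> k kr; rewrite /Cf (filt_vanS m_gt2 erefl frameP cl xi_e xi0 kr).
  apply: (vanS_p m_gt2 frameP cl xi_e xi0 e_in f_in nullp nullm) => u v ul vl; rewrite -!leNgt => le ->.
  by move: le; clear; lia.
- move=> k kr; split; first exact: (filt_sum m_gt2 erefl frameP cl xi_e xi0 kr).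
  move=> j jk; split; first exact: (filt_le_comp m_gt2 erefl frameP cl xi_e xi0 kr jk).
  exact: (filt_direct m_gt2 erefl frameP cl xi_e xi0 kr jk).
- have T (k : int) j (M1 M2 : {vspace 'M[R[i]]_(m.*2)}) (d : rat) : k \in degs -> (k, j) \in labels ->
      present m (k, j) -> cart g fr gp xi Vm (k, j) M1 M2 ->
      (\dim (Pt frameP (k, j)))%:R = d -> has_type k j M1 M2 d.
    move=> kd ul pk ck dk.
    have jk : j \in indices m.*2 k.
      apply: contraT => /(lab_indices erefl ul) [m3 [_ e]].
      by move: pk; rewrite /present /= e m3.
    have h := component_typeP m_gt2 erefl (frameP := frameP) cl xi_e xi0 e_in f_in nullp nullm (rg _ kd) ul jk pk ck dk.
    exact h.
  split.
  + by split; [ summand T frameP m_gt2 M (Posz 2) 0%N (cart_2 m_gt2 erefl frameP xi0 e_in f_in nullp nullm)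
     | summand T frameP m_gt2 M (Negz 1) 0%N (cart_m2 m_gt2 erefl frameP xi0 e_in f_in nullp nullm)].
  + by split; [ summand T frameP m_gt2 M (Posz 1) 0%N (cart_1_0 m_gt2 erefl frameP xi0 e_in f_in nullp nullm)
     | summand T frameP m_gt2 M (Negz 0) 0%N (cart_m1_0 m_gt2 erefl frameP xi0 e_in f_in nullp nullm)].
  + by split; [ summand T frameP m_gt2 M (Posz 1) 1%N (cart_1_1 m_gt2 erefl frameP xi0 e_in f_in nullp nullm)
     | summand T frameP m_gt2 M (Negz 0) 1%N (cart_m1_1 m_gt2 erefl frameP xi0 e_in f_in nullp nullm)].
  + by split; [ summand T frameP m_gt2 M (Posz 0) 0%N (cart_0_0 m_gt2 erefl frameP xi0 e_in f_in nullp nullm)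
     | summand T frameP m_gt2 M (Posz 0) 1%N (cart_0_1 m_gt2 erefl frameP xi0 e_in f_in nullp nullm)].
  + split=> [m3|]; last by summand T frameP m_gt2 M (Posz 0) 3%N (cart_0_3 m_gt2 erefl frameP xi0 e_in f_in nullp nullm).
    (* The highest weight vectors of g_1 and g_{-1} must use four different indices here. *)
    have m4 : (3 < m)%N by move/eqP: m3 => m3; lia.
    by summand T frameP m_gt2 M (Posz 0) 2%N (cart_0_2 m_gt2 erefl frameP xi0 e_in f_in nullp nullm m4).
- move=> k j l; rewrite mem_filter => /andP [/andP [jk lk] ka].
  have lvl2 : [&& k \in degs, k - 1 \in degs & arrowed (k, j) (k - 1, l)].
    by move: ka {jk lk}; rewrite !inE; repeat case/orP; move=> /eqP [-> -> ->].
  have /and3P [kd kd' ar] := lvl2.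
  (* For m = 3, that is n = 6, the index 2 is missing from [indices]. *)
  have pr (i : int) (s : nat) : i \in degs -> s \in J i -> present m (i, s).
    move=> id si; apply/implyP => /eqP /= s2; apply/eqP => m3.
    by move: i id si; rewrite s2 /J /indices m3; apply: degs_ind.
  by apply/(breve_inclusionP m_gt2 erefl frameP cl xi_e xi0 e_in f_in nullp nullm kd kd' jk lk) => //; apply: pr.
move=> k j l k1 jk lk.
have dg (i : int) (s : nat) : s \in J i -> i \in degs by case: i => [[|[|[|i]]]|[|[|i]]].
have pr (i : int) (s : nat) : s \in J i -> present m (i, s).
  move=> si; apply/implyP => /eqP /= s2; apply/eqP => m3.
  by move: i si (dg i s si); rewrite s2 /J /indices m3 => i si id; move: i id si; apply: degs_ind.
rewrite (breve_inclusionP m_gt2 erefl frameP cl xi_e xi0 e_in f_in nullp nullm) ?(dg _ _ jk) ?(dg _ _ lk) ?pr //.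
by rewrite (ker_inclusionP m_gt2 erefl frameP cl xi_e xi0) ?(dg _ _ jk) ?(dg _ _ lk) ?pr.
Qed.
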